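(* Let $M$ be a smooth compact surface and let $f\in\mathcal{F}(M)$ be such that its Kronrod–Reeb graph $\Gamma_f$ contains a special vertex $v$. Let $V=p_f^{-1}(v)$ be the corresponding special component, let $G_v^{loc}$ be the local stabilizer of $v$, and let $\phi:\mathcal{S}_V(f)\to G_v^{loc}$ be the homomorphism $\phi(h)=\rho(h)|_{\mathrm{st}(v)}$. Let $H$ be a subgroup of $G_v^{loc}$, and suppose that the subgroup $\mathcal{H}=\phi^{-1}(H)$ of $\mathcal{S}_V(f)$ satisfies the following condition: (C) if $h\in\mathcal{H}$ and $E$ is a $2$-dimensional element of the partition $\Xi$ of $M$ with $h(E)=E$, then $h(e)=e$ for all other $e\in\Xi$, and $h$ preserves the orientation of each element of $\Xi$. Then there exists a section $s:H\to\mathcal{H}$ of $\phi$, i.e. a group homomorphism $s:H\to\mathcal{H}$ such that $\phi\circ s=\mathrm{id}_H$.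
   Context: $M$ is a smooth compact surface (possibly with boundary), and $\mathcal{D}(M)$ is its group of $C^\infty$ diffeomorphisms. Class $\mathcal{F}(M)$: the set of $f\in C^\infty(M,\mathbb{R})$ such that (B) $f$ is constant on each connected component of $\partial M$ and all critical points of $f$ lie in the interior of $M$; (P) for each critical point $x$ of $f$ the germ of $f$ at $x$ is smoothly equivalent to a homogeneous polynomial $f_x:\mathbb{R}^2\to\mathbb{R}$ without multiple linear factors (in suitable smooth local coordinates centred at $x$, $f=f(x)+f_x$). Homogeneous polynomials here are considered over $\mathbb{R}$: $f_x=\prod_i L_i\cdot\prod_j Q_j^{q_j}$ with $L_i$ pairwise non-proportional linear forms and $Q_j$ pairwise non-proportional irreducible quadratic forms. Stabilizer: $\mathcal{S}(f)=\{h\in\mathcal{D}(M): f\circ h=f\}$. Kronrod–Reeb graph: $\Gamma_f$ is the quotient of $M$ obtained by collapsing each connected component of each level set $f^{-1}(t)$ to a point, and $p_f:M\to\Gamma_f$ is the projection. It is a $1$-dimensional CW complex whose vertices correspond to the critical components of level sets, i.e. connected components of level sets containing at least one critical point of $f$. Each $h\in\mathcal{S}(f)$ permutes the connected components of level sets, hence induces an automorphism $\rho(h)$ of $\Gamma_f$ with $p_f\circ h=\rho(h)\circ p_f$; this gives a homomorphism $\rho:\mathcal{S}(f)\to\mathrm{Aut}(\Gamma_f)$. Put $G=\rho(\mathcal{S}(f))$, which is a finite group. For a vertex $v$ of $\Gamma_f$: $G_v=\{g\in G: g(v)=v\}$; a star $\mathrm{st}(v)$ is a connected closed $G_v$-invariant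 neighbourhood of $v$ in $\Gamma_f$ containing no other vertices of $\Gamma_f$; the local stabilizer is $G_v^{loc}=\{g|_{\mathrm{st}(v)}: g\in G_v\}\subset\mathrm{Aut}(\mathrm{st}(v))$, and $r:G_v\to G_v^{loc}$ is the restriction map. Let $V=p_f^{-1}(v)$. The vertex $v$ and the component $V$ are called special if there is a bijection between the connected components of $\mathrm{st}(v)\setminus v$ and those of $M\setminus V$. For a special component $V$, the partition $\Xi$ of $M$ has as $0$-dimensional elements the vertices of $V$ (the critical points of $f$ in $V$), as $1$-dimensional elements the edges of $V$ (the connected components of $V$ minus its vertices), and as $2$-dimensional elements the connected components of $M\setminus V$. $\mathcal{S}_V(f)=\{h\in\mathcal{S}(f): h(V)=V\}$, and $\phi=r\circ\rho:\mathcal{S}_V(f)\to G_v\to G_v^{loc}$. *)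

(* Defs.v *)
From HB Require Import structures.
From mathcomp Require Import all_boot all_order all_algebra generic_quotient.
From mathcomp Require Import all_classical all_reals all_analysis.
Set Implicit Arguments.
Unset Strict Implicit.
Unset Printing Implicit Defensive.
Import Order.TTheory GRing.Theory Num.Theory.
Import numFieldNormedType.Exports.
Local Open Scope classical_set_scope.
Local Open Scope ring_scope.
Local Open Scope quotient_scope.

(** * Smooth maps between normed spaces *)

Fixpoint iter_derive (R : realType) (V W : normedModType R) (vs : seq V)
    (g : V -> W) : V -> W :=
  if vs is v :: vs' then iter_derive vs' (fun x => 'D_v g x) else g.

Definition smooth_at (R : realType) (V W : normedModType R) (p : V)
    (g : V -> W) : Prop :=
  \forall q \near p, forall vs : seq V,
    (forall v, derivable (iter_derive vs g) q v) /\
    {for q, continuous (iter_derive vs g)}.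

(** * Smooth surfaces, possibly with boundary *)

Definition half_plane (R : realType) : set 'rV[R]_2 :=
  [set p | 0 <= p ord0 ord0].

(* [cmap] is total, but only its values on the open set [cdom] matter. *)
Record chart (R : realType) (M : Type) :=
  Chart { cdom : set M ; cmap : M -> 'rV[R]_2 }.

(* The last clause says that [cmap c] is an open map from [cdom c] to the half
   plane; so [cmap c] is a homeomorphism from [cdom c] onto a relatively open
   subset of the half plane. *)
Definition is_chart (R : realType) (M : topologicalType) (c : chart R M) :=
  [/\ open (cdom c),
      forall x, cdom c x -> {for x, continuous (cmap c)},
      forall x y, cdom c x -> cdom c y -> cmap c x = cmap c y -> x = y &
      forall U, open U -> U `<=` cdom c ->
        exists2 O, open O & cmap c @` U = O `&` @half_plane R].

(* [g] is smooth on a full neighbourhood in the plane of [cmap c x] and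
   expresses [u] near [x] in the chart [c]; when [x] is a boundary point this
   is the usual requirement of a smooth local extension across the boundary. *)
Definition local_rep (R : realType) (M : topologicalType)
    (W : normedModType R) (c : chart R M) (x : M) (u : M -> W)
    (g : 'rV[R]_2 -> W) : Prop :=
  smooth_at (cmap c x) g /\ \forall y \near x, u y = g (cmap c y).

Definition compatible (R : realType) (M : topologicalType) (c d : chart R M) :=
  forall x, cdom c x -> cdom d x ->
    (exists g, local_rep c x (cmap d) g) /\
    (exists g, local_rep d x (cmap c) g).

Record smooth_structure (R : realType) (M : topologicalType)
    (A : set (chart R M)) : Prop := SmoothStructure {
  atlas_chart : forall c, A c -> is_chart c ;
  atlas_cover : forall x, exists2 c, A c & cdom c x ;
  atlas_compatible : forall c d, A c -> A d -> compatible c d ;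
  atlas_maximal : forall c, is_chart c ->
    (forall d, A d -> compatible c d) -> A c }.

(* Second countability is automatic for a compact locally Euclidean space. *)
Record compact_surface (R : realType) := CompactSurface {
  carrier :> topologicalType ;
  atlas : set (chart R carrier) ;
  surface_smooth : smooth_structure atlas ;
  surface_hausdorff : hausdorff_space carrier ;
  surface_compact : compact [set: carrier] }.

Definition boundary (R : realType) (M : compact_surface R) : set M :=
  [set x | exists c : chart R M,
     [/\ atlas c, cdom c x & cmap c x ord0 ord0 = 0]].

Definition smooth_fun (R : realType) (M : compact_surface R) (f : M -> R) :=
  forall (c : chart R M) x, atlas c -> cdom c x ->
    exists g : 'rV[R]_2 -> R, local_rep c x f g.

Definition smooth_map (R : realType) (M : compact_surface R) (h : M -> M) :=
  continuous h /\
  forall (c d : chart R M) x, atlas c -> atlas d -> cdom c x -> cdom d (h x) ->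
    exists g, local_rep c x (cmap d \o h) g.

Definition diffeo (R : realType) (M : compact_surface R) (h : M -> M) :=
  smooth_map h /\
  exists k, [/\ smooth_map k, cancel h k & cancel k h].

(* The differential of [g] at [cmap c x] does not depend on [g], also when [x]
   is a boundary point. *)
Definition critical (R : realType) (M : compact_surface R) (f : M -> R) :
    set M :=
  [set x | forall (c : chart R M) (g : 'rV[R]_2 -> R),
     atlas c -> cdom c x -> local_rep c x f g ->
     forall v, 'D_v g (cmap c x) = 0].

(** * The class F(M) *)

Definition components (T : topologicalType) (A : set T) : set (set T) :=
  [set C | exists2 x, A x & C = connected_component A x].

(* Homogeneous polynomials of degree [n] as functions on the plane. *)
Definition homogeneous (R : realType) (n : nat) (P : 'rV[R]_2 -> R) :=
  exists a : nat -> R, forall p,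
    P p = \sum_(i < n.+1) a i * p ord0 ord0 ^+ i * p ord0 ord_max ^+ (n - i).

Definition linear_form (R : realType) (a b : R) (p : 'rV[R]_2) : R :=
  a * p ord0 ord0 + b * p ord0 ord_max.

(* This excludes [P = 0], which is divisible by every square. *)
Definition no_multiple_linear_factor (R : realType) (P : 'rV[R]_2 -> R) :=
  forall (a b : R) (m : nat) (Q : 'rV[R]_2 -> R), homogeneous m Q ->
    (forall p, P p = linear_form a b p ^+ 2 * Q p) -> a = 0 /\ b = 0.

Record classF (R : realType) (M : compact_surface R) (f : M -> R) : Prop :=
  ClassF {
  classF_smooth : smooth_fun f ;
  classF_boundary : forall C, components (@boundary R M) C ->
    forall x y, C x -> C y -> f x = f y ;
  classF_interior : critical f `<=` ~` @boundary R M ;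
  classF_germ : forall x, critical f x ->
    exists (c : chart R M) (n : nat) (P : 'rV[R]_2 -> R),
      [/\ atlas c, cdom c x, homogeneous n P, no_multiple_linear_factor P &
          \forall y \near x, f y = f x + P (cmap c y - cmap c x)] }.

(** * The Kronrod-Reeb graph *)

Section reeb.
Context (M : topologicalType) (T : Type) (f : M -> T).

Definition level_component (x : M) : set M :=
  connected_component (f @^-1` [set f x]) x.

Definition reeb_rel : rel M := fun x y => `[< level_component x y >].

Lemma level_componentf x y : level_component x y -> f y = f x.
Proof. by move/connected_component_sub. Qed.

Lemma reeb_rel_refl : reflexive reeb_rel.
Proof. by move=> x; apply/asboolP; exact: connected_component_refl. Qed.

Lemma reeb_rel_sym : symmetric reeb_rel.
Proof.
move=> x y; apply/asboolP/asboolP => xy;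
  by have := connected_component_sym xy;
     rewrite /level_component (level_componentf xy).
Qed.

Lemma reeb_rel_trans : transitive reeb_rel.
Proof.
move=> y x z /asboolP xy /asboolP yz; apply/asboolP.
apply: (connected_component_trans xy).
by move: yz; rewrite /level_component (level_componentf xy).
Qed.

Canonical reeb_equiv : equiv_rel M :=
  EquivRel reeb_rel reeb_rel_refl reeb_rel_sym reeb_rel_trans.

Definition reeb : topologicalType := quotient_topology {eq_quot reeb_equiv}.

Definition reeb_proj (x : M) : reeb := \pi_{eq_quot reeb_equiv} x.

Definition reeb_repr (v : reeb) : M := repr (v : {eq_quot reeb_equiv}).

Lemma reeb_projP x y : reeb_proj x = reeb_proj y <-> level_component x y.
Proof.
by split=> [/eqmodP/asboolP//|xy]; apply/eqmodP/asboolP.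
Qed.

Lemma reeb_reprK v : reeb_proj (reeb_repr v) = v.
Proof. exact: reprK. Qed.

Definition rho (h : M -> M) : reeb -> reeb := reeb_proj \o h \o reeb_repr.

Lemma rhoE (h : M -> M) : continuous h -> f \o h = f ->
  reeb_proj \o h = rho h \o reeb_proj.
Proof.
move=> hc fh; apply/funext => x; rewrite /rho /=; apply/esym/reeb_projP.
set z := reeb_repr _.
have /reeb_projP [C [Cz Csub Cc] Cx] : reeb_proj z = reeb_proj x
  by exact: reeb_reprK.
have E w : f (h w) = f w by rewrite -[in RHS]fh.
exists (h @` C); last by exists x.
split; first by exists z.
- by move=> _ [w Cw <-]; rewrite /= !E; exact: Csub.
- by apply: connected_continuous_connected => //; exact: continuous_subspaceT.
Qed.

End reeb.

(** * Stabilizers *)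

Section stabilizers.
Context (R : realType) (M : compact_surface R) (f : M -> R).

Definition stabilizer : set (M -> M) := [set h | diffeo h /\ f \o h = f].

Definition reeb_group : set (reeb f -> reeb f) := rho (f := f) @` stabilizer.

Definition vertex : set (reeb f) := reeb_proj f @` critical f.

Definition reeb_stab (v : reeb f) : set (reeb f -> reeb f) :=
  [set g | reeb_group g /\ g v = v].

Record star (v : reeb f) (st : set (reeb f)) : Prop := Star {
  star_nbhs : nbhs v st ;
  star_closed : closed st ;
  star_connected : connected st ;
  star_invariant : forall g, reeb_stab v g -> g @` st = st ;
  star_vertex : forall w, vertex w -> st w -> w = v }.

(* The restriction of [g] to a self-map of [st], for [g] leaving [st]
   invariant; the default value of [insubd] is then never used. *)
Definition restr (st : set (reeb f)) (g : reeb f -> reeb f) : st -> st :=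
  fun x => insubd x (g (val x)).

Definition local_stab (v : reeb f) (st : set (reeb f)) : set (st -> st) :=
  @restr st @` reeb_stab v.

Definition component (v : reeb f) : set M := reeb_proj f @^-1` [set v].

Definition special (v : reeb f) (st : set (reeb f)) : Prop :=
  (components (st `\ v) #= components (~` component v))%card.

Definition stabilizer_comp (v : reeb f) : set (M -> M) :=
  [set h | stabilizer h /\ h @` component v = component v].

Definition phi (st : set (reeb f)) (h : M -> M) : st -> st :=
  restr (rho (f := f) h).

Definition phi_preimage (v : reeb f) (st : set (reeb f))
    (H : set (st -> st)) : set (M -> M) :=
  [set h | stabilizer_comp v h /\ H (phi h)].

Definition Xi0 (v : reeb f) : set (set M) :=
  [set [set x] | x in component v `&` critical f].

Definition Xi1 (v : reeb f) : set (set M) :=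
  components (component v `\` critical f).

Definition Xi2 (v : reeb f) : set (set M) := components (~` component v).

Definition Xi (v : reeb f) : set (set M) := Xi0 v `|` Xi1 v `|` Xi2 v.

End stabilizers.

Arguments vertex {R M f} _.
Arguments star {R M f} v st.
Arguments local_stab {R M f} v st _.
Arguments special {R M f} v st.
Arguments phi {R M f} st h _.
Arguments phi_preimage {R M f} v {st} H _.

Definition subgroup_of (X : Type) (G H : set (X -> X)) : Prop :=
  [/\ H `<=` G, H id, forall a b, H a -> H b -> H (a \o b) &
      forall a, H a -> exists b, [/\ H b, cancel a b & cancel b a]].

(** * Preservation of orientation *)

(* Every edge is an open arc: a critical component is connected, contains a
   critical point and does not meet the boundary, so it has no closed curve
   among its edges. *)
Definition preserves_orientation1 (R : realType) (M : compact_surface R)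
    (h : M -> M) (e : set M) : Prop :=
  forall gamma : R -> M, continuous gamma -> injective gamma ->
    range gamma = e ->
    forall s t s' t', h (gamma s) = gamma s' -> h (gamma t) = gamma t' ->
      s < t -> s' < t'.

(* [o c x] tells whether the chart [c] is positively oriented at [x]. *)
Definition orientation (R : realType) (M : compact_surface R) (E : set M)
    (o : chart R M -> M -> bool) : Prop :=
  (forall (c : chart R M) x, atlas c -> E x -> cdom c x ->
     \forall y \near x, o c y = o c x) /\
  (forall (c d : chart R M) x (g : 'rV[R]_2 -> 'rV[R]_2),
     atlas c -> atlas d -> E x -> cdom c x -> cdom d x ->
     local_rep c x (cmap d) g ->
     (0 < \det ('J g (cmap c x))) = (o c x == o d x)).

(* For [E] open and [h @` E = E]. A nonorientable [E] has no orientation, so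
   the condition then holds for every [h], as it must at least for [id]. *)
Definition preserves_orientation2 (R : realType) (M : compact_surface R)
    (h : M -> M) (E : set M) : Prop :=
  forall o, orientation E o ->
  forall (c d : chart R M) x (g : 'rV[R]_2 -> 'rV[R]_2),
    atlas c -> atlas d -> E x -> cdom c x -> cdom d (h x) ->
    local_rep c x (cmap d \o h) g ->
    (0 < \det ('J g (cmap c x))) = (o c x == o d (h x)).

(* Orientations of the points of [Xi0] are preserved trivially. *)
Definition conditionC (R : realType) (M : compact_surface R) (f : M -> R)
    (v : reeb f) (Hs : set (M -> M)) : Prop :=
  forall h E, Hs h -> Xi2 v E -> h @` E = E ->
    [/\ forall e, Xi v e -> h @` e = e,
        forall e, Xi1 v e -> preserves_orientation1 h e &
        forall e, Xi2 v e -> preserves_orientation2 h e].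

(* Main.v *)
(** Condition (C) forces every element of [phi_preimage v H] that fixes an edge
    or a face, or that acts trivially on the star, to fix all edges with their
    orientation and all vertices.  So these maps form the kernel T of [phi], and
    H acts freely on the edges and on the faces.  Lifts h_a of the elements a of
    H are corrected by elements of T until h_(ab) = h_a h_b near V.

    At a vertex, f is a homogeneous polynomial P in suitable coordinates, and the
    differential of an element of T scales every ray of P = 0 by a positive
    factor.  The Alexander trick, together with hyperbolic rotations when P is a
    saddle, extends its germ to a map that preserves f and is supported near the
    vertex.  Hence the h_a can be taken linear near the vertices, with linear
    parts so rigid that an element of T among such maps is the identity there.
    Along an edge an element of T has the form (t, s) |-> (kappa(t, s), s) in a
    flow box, with kappa increasing in t, and interpolating with the identity
    cuts it off away from the edge; in this way the h_a are matched along
    representatives of the orbits of edges.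

    Finally s(b) is h_(ba) h_a^-1 on the face h_a(E), where E represents its
    orbit, and h_b on V; it coincides with h_b near V, so it is smooth. *)
Require Import Defs.
From HB Require Import structures.
From mathcomp Require Import all_boot all_order all_algebra.
From mathcomp Require Import all_classical all_reals all_analysis.
From mathcomp Require Import ring lra.
Set Implicit Arguments.
Unset Strict Implicit.
Unset Printing Implicit Defensive.
Import Order.TTheory GRing.Theory Num.Theory.
Import numFieldNormedType.Exports.
Local Open Scope classical_set_scope.
Local Open Scope ring_scope.
(** * Smooth maps of the plane *)

(** Every correction must preserve [f] on the whole surface and act trivially on the star, so only
    maps adapted to [f] can be cut off: conjugates by homotheties at a vertex, shears along level
    lines at an edge. Shrinking the homothety deforms a germ to its differential, so the trick needs
    the differential to be the identity. In degree at least 3 positive scaling of the zero rays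
    already forces this. A saddle leaves the one-parameter group diag(t, 1/t): it is cut off
    separately, and it would also destroy the uniqueness of linear lifts, which is why an auxiliary
    quadratic form is carried along.

    That fixing all edges gives triviality on the star rests on two facts: near V each point is then
    sent to its own level component, and level components are upper semicontinuous, so that this
    spreads along the connected star.

    The relation h_(ab) = h_a h_b holds only on a neighbourhood that depends on a and b. A common
    one exists because H is finite: acting freely, it embeds into the finite set of edges. Without
    edges the kernel is everything and H is trivial. *)

Section Plane.
Context {R : realType}.
Local Notation pt := 'rV[R]_2.
Implicit Types (p q v w z : pt) (g : pt -> R) (r e k : R).

Definition cX p : R := p ord0 ord0.
Definition cY p : R := p ord0 ord_max.
Definition mk (x y : R) : pt := \row_j (if j == ord0 then x else y).
Definition e0 : pt := mk 1 0.
Definition e1 : pt := mk 0 1.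

Lemma cX_mk x y : cX (mk x y) = x. Proof. by rewrite /cX mxE. Qed.
Lemma cY_mk x y : cY (mk x y) = y. Proof. by rewrite /cY mxE. Qed.
Lemma cXD p q : cX (p + q) = cX p + cX q. Proof. by rewrite /cX mxE. Qed.
Lemma cYD p q : cY (p + q) = cY p + cY q. Proof. by rewrite /cY mxE. Qed.
Lemma cXN p : cX (- p) = - cX p. Proof. by rewrite /cX mxE. Qed.
Lemma cYN p : cY (- p) = - cY p. Proof. by rewrite /cY mxE. Qed.
Lemma cXZ a p : cX (a *: p) = a * cX p. Proof. by rewrite /cX mxE. Qed.
Lemma cYZ a p : cY (a *: p) = a * cY p. Proof. by rewrite /cY mxE. Qed.
Lemma cX0 : cX 0 = 0. Proof. by rewrite /cX mxE. Qed.
Lemma cY0 : cY 0 = 0. Proof. by rewrite /cY mxE. Qed.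
Definition cE := (cX_mk, cY_mk, cXD, cYD, cXN, cYN, cXZ, cYZ, cX0, cY0).

Lemma ptP p q : cX p = cX q -> cY p = cY q -> p = q.
Proof.
move=> hX hY; apply/rowP => j; case: (unliftP ord0 j) => [k ->|->]; last exact: hX.
have -> : lift ord0 k = ord_max by apply: val_inj; rewrite /= (ord1 k).
exact: hY.
Qed.

Lemma mkK p : mk (cX p) (cY p) = p. Proof. by apply: ptP; rewrite cE. Qed.

(** The norm on row vectors is the maximum of the coordinates, so the balls used throughout are open
    squares. *)
Lemma norm_leP p r : reflect (`|cX p| <= r /\ `|cY p| <= r) (`|p| <= r).
Proof.
have -> : `|p| = \big[Num.max/0]_ij `|p ij.1 ij.2| by exact: mx_normrE.
apply: (iffP idP).
  move=> h; split; apply: le_trans h.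
    exact: (le_bigmax _ (fun ij : 'I_1 * 'I_2 => `|p ij.1 ij.2|) (ord0, ord0)).
  exact: (le_bigmax _ (fun ij : 'I_1 * 'I_2 => `|p ij.1 ij.2|) (ord0, ord_max)).
move=> [hX hY]; apply/bigmax_leP; split; first exact: le_trans hX.
move=> [i j] _ /=; rewrite (ord1 i); case: (unliftP ord0 j) => [k ->|-> //].
have -> : lift ord0 k = ord_max by apply: val_inj; rewrite /= (ord1 k).
exact: hY.
Qed.

Lemma cX_le p : `|cX p| <= `|p|. Proof. by have [] := norm_leP p `|p| (lexx _). Qed.
Lemma cY_le p : `|cY p| <= `|p|. Proof. by have [] := norm_leP p `|p| (lexx _). Qed.

Lemma norm_ltP p r : reflect (`|cX p| < r /\ `|cY p| < r) (`|p| < r).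
Proof.
apply: (iffP idP) => [h|[hX hY]].
  by split; apply: le_lt_trans h; [exact: cX_le|exact: cY_le].
apply: (@le_lt_trans _ _ (Num.max `|cX p| `|cY p|)).
  by apply/norm_leP; rewrite !le_max !lexx orbT.
by rewrite gt_max hX hY.
Qed.

Lemma cX_continuous : continuous cX.
Proof. by move=> p; apply: differentiable_continuous; exact: differentiable_coord. Qed.
Lemma cY_continuous : continuous cY.
Proof. by move=> p; apply: differentiable_continuous; exact: differentiable_coord. Qed.

Lemma near_norm p (P : set pt) :
  (\forall q \near p, P q) <-> exists2 r : R, 0 < r & forall q, `|q - p| < r -> P q.
Proof.
split=> [/nbhs_normP[r r0 h]|[r r0 h]].
  by exists r => // q hq; apply: h; rewrite /ball_/= distrC.
by apply/nbhs_normP; exists r => // q; rewrite /ball_/= distrC => /h.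
Qed.

Lemma mk_continuous (T : topologicalType) (a b : T -> R) (x : T) :
  {for x, continuous a} -> {for x, continuous b} ->
  {for x, continuous (fun t => mk (a t) (b t))}.
Proof.
move=> ha hb; apply/cvgrPdist_lt => eps eps0.
near=> t; apply/norm_ltP; rewrite !cE; split.
  by near: t; move/cvgrPdist_lt : ha => /(_ eps eps0).
by near: t; move/cvgrPdist_lt : hb => /(_ eps eps0).
Unshelve. all: by end_near. Qed.

Lemma pt_continuous (T : topologicalType) (F : T -> pt) (x : T) :
  {for x, continuous (cX \o F)} -> {for x, continuous (cY \o F)} ->
  {for x, continuous F}.
Proof.
move=> ha hb; have -> : F = fun t => mk ((cX \o F) t) ((cY \o F) t).
  by apply/funext => t; rewrite /= mkK.
exact: mk_continuous.
Qed.

Lemma line_is_derive (W : normedModType R) (g : pt -> W) q v (s : R) :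
  derivable g (q + s *: v) v ->
  is_derive s (1 : R) (fun t : R => g (q + t *: v)) ('D_v g (q + s *: v)).
Proof.
move=> dg.
have E : (fun h : R => h^-1 *: (((fun t : R => g (q + t *: v)) \o shift s) (h *: 1) - g (q + s *: v)))
  = (fun h : R => h^-1 *: ((g \o shift (q + s *: v)) (h *: v) - g (q + s *: v))).
  apply/funext => h /=; rewrite (_ : h *: (1 : R) = h); last exact: mulr1.
  by rewrite scalerDl [h *: v + (q + _)]addrCA.
by split; rewrite /derivable /derive E.
Qed.

Lemma line_mvt g q v : (forall t, 0 <= t <= 1 -> derivable g (q + t *: v) v) ->
  exists2 t : R, 0 <= t <= 1 & g (q + v) - g q = 'D_v g (q + t *: v).
Proof.
move=> dg; pose phi (t : R) := g (q + t *: v).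
have D (t : R) : 0 <= t <= 1 -> is_derive t (1 : R) phi ('D_v g (q + t *: v)).
  by move=> t01; apply: line_is_derive; exact: dg.
have [||c c01] := @MVT R phi (fun t => 'D_v g (q + t *: v)) 0 1 ltr01.
- by move=> t; rewrite in_itv /= => /andP[t0 t1]; apply: D; rewrite !ltW.
- apply: derivable_within_continuous => t; rewrite in_itv /= => t01.
  by have [] := D _ t01.
rewrite subr0 mulr1 /phi scale1r scale0r addr0 => E.
by exists c => //; move: c01; rewrite in_itv /= => /andP[? ?]; rewrite !ltW.
Qed.

Definition lin2 (a b : R) (h : pt) : R := cX h * a + cY h * b.

Lemma lin2_linear a b : linear (lin2 a b).
Proof. by move=> k u v; rewrite /lin2 !cE /GRing.scale /=; ring. Qed.

HB.instance Definition _ a b :=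
  GRing.isLinear.Build R pt R _ (lin2 a b) (lin2_linear a b).

Lemma lin2_continuous a b : continuous (lin2 a b).
Proof.
move=> p; rewrite (_ : lin2 a b = (cX \* cst a) \+ (cY \* cst b)) //.
apply: (@continuousD _ _ _ (cX \* cst a) (cY \* cst b)); apply: continuousM;
  by [exact: cX_continuous|exact: cY_continuous|exact: cst_continuous].
Qed.

Lemma differentiable_lin2 g p a b :
  (forall e, 0 < e -> \forall h \near (0 : pt), `|g (h + p) - g p - lin2 a b h| <= e * `|h|) ->
  differentiable g p /\ forall v, 'D_v g p = lin2 a b v.
Proof.
move=> H.
have E : g \o shift p = cst (g p) + lin2 a b +o_ (0 : pt) id.
  apply/eqaddoP => e e0; apply: filterS (H e e0) => h.
  have -> // : (g \o shift p - (cst (g p) + lin2 a b)) h = g (h + p) - g p - lin2 a b h.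
  by rewrite -[LHS]/(g (h + p) - (g p + lin2 a b h)) opprD addrA.
have dE := diff_unique (@lin2_continuous a b) E.
have df : differentiable g p.
  by apply/diff_locallyP; rewrite dE; split=> //; exact: lin2_continuous.
by split=> // v; rewrite deriveE // dE.
Qed.

Lemma scale_dir g q v k : derivable g q v ->
  derivable g q (k *: v) /\ 'D_(k *: v) g q = k * 'D_v g q.
Proof.
move=> dg; have := @line_is_derive _ g q v 0; rewrite scale0r addr0 => /(_ dg) [D0 V0].
have dphi := (derivable1_diffP _ _).1 D0.
have Dk := @diff_derivable _ _ _ _ _ k dphi.
have E : 'D_k (fun t : R => g (q + t *: v)) 0 = k * 'D_v g q.
  rewrite deriveE // -V0 deriveE // -[X in 'd _ _ X](mulr1 k).
  by rewrite -[k * 1]/(k *: (1 : R)) linearZ.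
have E' : (fun h : R => h^-1 *: (((fun t : R => g (q + t *: v)) \o shift 0) (h *: k) - g (q + 0 *: v)))
  = (fun h : R => h^-1 *: ((g \o shift q) (h *: (k *: v)) - g q)).
  by apply/funext => h /=; rewrite addr0 scale0r addr0 scalerA [q + _]addrC.
by move: Dk E; rewrite /derivable /derive E'.
Qed.

(** [smooth_at] speaks only of directional derivatives. The increment [g (h + p) - g p] is split
    into a horizontal and a vertical leg, the mean value theorem is applied to each, and continuity
    of the two partial derivatives makes the error o(h). *)
Lemma C1_differentiable g p :
  (\forall q \near p, forall v, derivable g q v) ->
  {for p, continuous ('D_e0 g)} -> {for p, continuous ('D_e1 g)} ->
  differentiable g p /\ forall v, 'D_v g p = lin2 ('D_e0 g p) ('D_e1 g p) v.
Proof.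
move=> dg c0 c1; apply: differentiable_lin2 => e ep.
have e2 : 0 < e / 2 by rewrite divr_gt0.
have /near_norm [r r0 hr] : \forall q \near p, (forall v, derivable g q v) /\
    (`|'D_e0 g q - 'D_e0 g p| < e / 2 /\ `|'D_e1 g q - 'D_e1 g p| < e / 2).
  apply: filterS2 dg _ => [q ? H|]; first by split; [done|exact: H].
  apply: filterS2 (_ : \forall q \near p, `|'D_e0 g q - 'D_e0 g p| < e / 2)
    (_ : \forall q \near p, `|'D_e1 g q - 'D_e1 g p| < e / 2) => //.
    by move/cvgr_distC_lt : c0; apply.
  by move/cvgr_distC_lt : c1; apply.
apply/near_norm; exists r => // h; rewrite subr0 => hh.
have [hx hy] := norm_ltP _ _ hh.
have small (q : pt) : `|cX q| <= `|cX h| -> `|cY q| <= `|cY h| -> `|(q + p) - p| < r.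
  move=> qx qy; rewrite addrK; apply/norm_ltP.
  by split; [exact: le_lt_trans hx|exact: le_lt_trans hy].
have leabs (t a : R) : 0 <= t <= 1 -> `|t * a| <= `|a|.
  by move=> /andP[t0 t1]; rewrite normrM (ger0_norm t0) ler_piMl.
have [t t01 Et] : exists2 t : R, 0 <= t <= 1 &
    g (h + p) - g (mk 0 (cY h) + p) = cX h * 'D_e0 g (mk (t * cX h) (cY h) + p).
  have [t ht|t t01] := @line_mvt g (mk 0 (cY h) + p) (cX h *: e0).
    apply: (scale_dir _ _).1.
    have -> : mk 0 (cY h) + p + t *: (cX h *: e0) = mk (t * cX h) (cY h) + p.
      by apply: ptP; rewrite !cE; ring.
    by apply: (hr _ _).1; apply: small; rewrite cE // leabs.
  have -> : mk 0 (cY h) + p + t *: (cX h *: e0) = mk (t * cX h) (cY h) + p.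
    by apply: ptP; rewrite !cE; ring.
  have -> : mk 0 (cY h) + p + cX h *: e0 = h + p by apply: ptP; rewrite !cE; ring.
  move=> ->; exists t => //; apply: (scale_dir _ _).2.
  by apply: (hr _ _).1; apply: small; rewrite cE // leabs.
have [s s01 Es] : exists2 t : R, 0 <= t <= 1 &
    g (mk 0 (cY h) + p) - g p = cY h * 'D_e1 g (mk 0 (t * cY h) + p).
  have [s hs|s s01] := @line_mvt g p (cY h *: e1).
    apply: (scale_dir _ _).1.
    have -> : p + s *: (cY h *: e1) = mk 0 (s * cY h) + p.
      by apply: ptP; rewrite !cE; ring.
    by apply: (hr _ _).1; apply: small; rewrite cE ?leabs// normr0.
  have -> : p + s *: (cY h *: e1) = mk 0 (s * cY h) + p.
    by apply: ptP; rewrite !cE; ring.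
  have -> : p + cY h *: e1 = mk 0 (cY h) + p by apply: ptP; rewrite !cE; ring.
  move=> ->; exists s => //; apply: (scale_dir _ _).2.
  by apply: (hr _ _).1; apply: small; rewrite cE ?leabs// normr0.
have -> : g (h + p) - g p - lin2 ('D_e0 g p) ('D_e1 g p) h =
   cX h * ('D_e0 g (mk (t * cX h) (cY h) + p) - 'D_e0 g p) +
   cY h * ('D_e1 g (mk 0 (s * cY h) + p) - 'D_e1 g p).
  by rewrite /lin2 !mulrBr -Et -Es; ring.
apply: le_trans (ler_normD _ _) _; rewrite !normrM [e]splitr mulrDl; apply: lerD.
  rewrite mulrC ler_pM // ?cX_le // ltW //.
  by apply: (hr _ _).2.1; apply: small; rewrite cE // leabs.
rewrite mulrC ler_pM // ?cY_le // ltW //.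
by apply: (hr _ _).2.2; apply: small; rewrite cE ?leabs// normr0.
Qed.

End Plane.

(** * Functions of class C^k on open sets *)

Section Smooth.
Context {R : realType}.
Local Notation pt := 'rV[R]_2.
Implicit Types (p q v w z : pt) (g h : pt -> R) (F : pt -> pt) (U : set pt).

Lemma open_near (T : topologicalType) (U : set T) x :
  open U -> U x -> \forall y \near x, U y.
Proof. by move=> oU Ux; apply: open_nbhs_nbhs; split. Qed.

Lemma eq_near_derive (V W : normedModType R) (f g : V -> W) (p v : V) :
  (\forall q \near p, f q = g q) -> 'D_v f p = 'D_v g p.
Proof.
move=> E; have [->|v0] := eqVneq v 0; first by rewrite !derive0.
exact: near_eq_derive.
Qed.

Lemma eq_near_derivable (V W : normedModType R) (f g : V -> W) (p v : V) :
  (\forall q \near p, f q = g q) -> derivable f p v -> derivable g p v.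
Proof.
move=> E; have [->|v0] := eqVneq v 0; first by move=> _; exact: derivable0.
exact: near_eq_derivable.
Qed.

Lemma eq_near_continuous (S T : topologicalType) (f g : S -> T) (p : S) :
  (\forall q \near p, f q = g q) -> {for p, continuous f} -> {for p, continuous g}.
Proof.
move=> E fc; rewrite /prop_for /continuous_at -(nbhs_singleton E).
by apply: cvg_trans fc; apply: near_eq_cvg.
Qed.

Lemma eq_near_differentiable (V W : normedModType R) (f g : V -> W) (p : V) :
  (\forall q \near p, f q = g q) -> differentiable f p -> differentiable g p.
Proof.
move=> E df; have gp := nbhs_singleton E.
have H : g \o shift p = cst (g p) + 'd f p +o_ 0 id.
  apply/eqaddoP => e e0.
  have /eqaddoP/(_ e e0) := diff_locally df.
  apply: filter_app; move: E; rewrite (near_shift 0) /= => E.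
  apply: filterS E => h /=; rewrite subr0 => E.
  by rewrite !fctE /= -E -gp.
have dE := diff_unique (@diff_continuous _ _ _ (nbhs_filter_on p) _ df) H.
by apply/diff_locallyP; rewrite dE; split=> //; exact: diff_continuous.
Qed.

(** Asking for differentiability, and not only for directional derivatives, is what makes the chain
    rule available; by [smooth_atP], [Ck] for all [n] on one open set amounts to [smooth_at]. *)
Fixpoint Ck n U (g : pt -> R) : Prop :=
  if n is m.+1 then (forall p, U p -> differentiable g p) /\ forall v, Ck m U ('D_v g)
  else forall p, U p -> {for p, continuous g}.

Lemma Ck_continuous n U g p : Ck n U g -> U p -> {for p, continuous g}.
Proof.
case: n => [|n]; first exact.
by move=> [dg _] Up; apply: differentiable_continuous; exact: dg.
Qed.

Lemma CkS n U g : Ck n.+1 U g -> Ck n U g.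
Proof.
elim: n g => [|n IH] g Cg; first by move=> p Up; exact: Ck_continuous Cg Up.
by case: Cg => dg Dg; split=> // v; apply: IH.
Qed.

Lemma Ck_eq n U g h : open U -> (forall p, U p -> g p = h p) -> Ck n U g -> Ck n U h.
Proof.
move=> oU; elim: n g h => [|n IH] g h E /=.
  move=> gc p Up; apply: (eq_near_continuous _ (gc p Up)).
  by apply: filterS (open_near oU Up) => q; exact: E.
have near_gh p : U p -> \forall q \near p, g q = h q.
  by move=> Up; apply: filterS (open_near oU Up) => q; exact: E.
case=> dg Dg; split=> [p Up|v].
  exact: (eq_near_differentiable (near_gh p Up) (dg p Up)).
by apply: IH (Dg v) => p Up; apply: eq_near_derive; exact: near_gh.
Qed.

Lemma Ck_sub n U V g : V `<=` U -> Ck n U g -> Ck n V g.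
Proof.
move=> VU; elim: n g => [|n IH] g /=; first by move=> H p /VU; exact: H.
by case=> dg Dg; split=> [p /VU|v]; [exact: dg|exact: IH].
Qed.

Lemma Ck_cst n U (c : R) : Ck n U (cst c).
Proof.
elim: n c => [|n IH] c /=; first by move=> p _; exact: cst_continuous.
split=> [p _|v]; first exact: differentiable_cst.
by rewrite (_ : 'D_v (cst c) = cst 0) //; apply/funext => p; rewrite derive_cst.
Qed.

Lemma Ck_lin2 n U (a b : R) : Ck n U (lin2 a b).
Proof.
have D p : differentiable (lin2 a b) p /\ forall v, 'D_v (lin2 a b) p = lin2 a b v.
  apply: differentiable_lin2 => e e0; apply/near_norm; exists 1 => // h _.
  by rewrite linearD addrK subrr normr0 mulr_ge0 // ltW.
case: n => [|n] /=; first by move=> p _; exact: lin2_continuous.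
split=> [p _|v]; first by case: (D p).
rewrite (_ : 'D_v _ = cst (lin2 a b v)); first exact: Ck_cst.
by apply/funext => p; case: (D p).
Qed.

Lemma CkD n U g h : open U -> Ck n U g -> Ck n U h -> Ck n U (g \+ h).
Proof.
move=> oU; elim: n g h => [|n IH] g h /=.
  by move=> gc hc p Up; apply: continuousD; [exact: gc|exact: hc].
case=> dg Dg [dh Dh]; split=> [p Up|v].
  by apply: differentiableD; [exact: dg|exact: dh].
apply: (@Ck_eq n U ('D_v g \+ 'D_v h)) => // [p Up|]; last exact: IH.
by rewrite deriveD //; apply: diff_derivable; [exact: dg|exact: dh].
Qed.

Lemma CkM n U g h : open U -> Ck n U g -> Ck n U h -> Ck n U (g \* h).
Proof.
move=> oU; elim: n g h => [|n IH] g h /=.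
  by move=> gc hc p Up; apply: continuousM; [exact: gc|exact: hc].
move=> Cg Ch; have Cg' := @CkS n U g Cg; have Ch' := @CkS n U h Ch.
case: Cg => dg Dg; case: Ch => dh Dh; split=> [p Up|v].
  by apply: differentiableM; [exact: dg|exact: dh].
apply: (@Ck_eq n U ((g \* 'D_v h) \+ (h \* 'D_v g))) => // [p Up|].
  by rewrite deriveM //; apply: diff_derivable; [exact: dg|exact: dh].
apply: CkD => //; apply: IH => //; apply: CkS.
Qed.

Lemma CkV n U g : open U -> (forall p, U p -> g p != 0) -> Ck n U g ->
  Ck n U (fun p => (g p)^-1).
Proof.
move=> oU g0; elim: n => [|n IH].
  by move=> gc p Up; apply: continuousV; [exact: g0|exact: gc].
move=> Cg; case: (Cg) => dg Dg; split=> [p Up|v].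
  by apply: differentiableV; [exact: dg|exact: g0].
have Cgi := IH (CkS Cg).
apply: (@Ck_eq n U (cst (-1) \* (((fun p => (g p)^-1) \* (fun p => (g p)^-1)) \* 'D_v g))) => // [p Up|].
  rewrite deriveV; [|exact: g0|by apply: diff_derivable; exact: dg].
  by rewrite /= mulN1r -mulNr expr2 invfM.
apply: CkM => //; first exact: Ck_cst.
apply: CkM => //; [exact: CkM|exact: (Dg v)].
Qed.

Lemma differentiable_coords (F : pt -> pt) p :
  differentiable (cX \o F) p -> differentiable (cY \o F) p ->
  differentiable F p /\
  forall v, 'd F p v = mk ('D_v (cX \o F) p) ('D_v (cY \o F) p).
Proof.
move=> dX dY.
have E : F = (fun z => (cX \o F) z *: (e0 : pt)) + (fun z => (cY \o F) z *: (e1 : pt)).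
  by apply/funext => z; apply: ptP; rewrite !fctE !cE /=; ring.
have d0 := differentiableZl (e0 : pt) dX; have d1 := differentiableZl (e1 : pt) dY.
have dF : differentiable F p by rewrite E; exact: differentiableD.
split=> // v; rewrite -deriveE // derive_mx; last exact: diff_derivable.
by apply: ptP; rewrite !cE /cX /cY !mxE.
Qed.

Lemma derive_comp_pt (g : pt -> R) (F : pt -> pt) p :
  differentiable g (F p) -> differentiable (cX \o F) p -> differentiable (cY \o F) p ->
  differentiable (g \o F) p /\
  forall v, 'D_v (g \o F) p =
    'D_v (cX \o F) p * 'D_e0 g (F p) + 'D_v (cY \o F) p * 'D_e1 g (F p).
Proof.
move=> dg dX dY; have [dF EF] := differentiable_coords dX dY.
have dgF : differentiable (g \o F) p by exact: differentiable_comp.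
split=> // v; rewrite (deriveE v dgF) diff_comp //= EF.
have -> : mk ('D_v (cX \o F) p) ('D_v (cY \o F) p) =
   'D_v (cX \o F) p *: e0 + 'D_v (cY \o F) p *: e1.
  by apply: ptP; rewrite !cE; ring.
by rewrite linearD !linearZ /= !deriveE.
Qed.

Lemma Ck_comp n U W g F : open U ->
  Ck n U (cX \o F) -> Ck n U (cY \o F) -> (forall p, U p -> W (F p)) ->
  Ck n W g -> Ck n U (g \o F).
Proof.
move=> oU + + UW; elim: n g => [|n IH] g.
  move=> cXF cYF gc p Up; apply: continuous_comp; last exact: gc (UW _ Up).
  by apply: pt_continuous; [exact: cXF|exact: cYF].
move=> CX CY [dg Dg]; case: (CX) => dX DX; case: (CY) => dY DY.
have D p : U p -> _ := fun Up => derive_comp_pt (dg _ (UW _ Up)) (dX _ Up) (dY _ Up).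
split=> [p Up|v]; first by case: (D p Up).
apply: (@Ck_eq n U (('D_v (cX \o F) \* ('D_e0 g \o F)) \+ ('D_v (cY \o F) \* ('D_e1 g \o F)))) => //.
  by move=> p Up; rewrite (D p Up).2.
apply: CkD => //; apply: CkM => //.
- exact: (DX v).
- exact: IH (CkS CX) (CkS CY) (Dg e0).
- exact: (DY v).
- exact: IH (CkS CX) (CkS CY) (Dg e1).
Qed.

Fixpoint C1k n (u : R -> R) : Prop :=
  if n is m.+1 then (forall x, derivable u x 1) /\ C1k m (u^`()%classic) else continuous u.

Lemma Ck_comp1 n U (u : R -> R) g : open U -> C1k n u -> Ck n U g -> Ck n U (u \o g).
Proof.
move=> oU; elim: n u => [|n IH] u.
  by move=> uc gc p Up; apply: continuous_comp; [exact: gc|exact: uc].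
move=> Cu; case: (Cu) => du Du Cg; case: (Cg) => dg Dg.
have duD x : differentiable u x by apply/derivable1_diffP.
have dC p : U p -> differentiable (u \o g) p.
  by move=> Up; apply: differentiable_comp => //; exact: dg.
split=> // v.
apply: (@Ck_eq n U ('D_v g \* (u^`()%classic \o g))) => //.
  move=> p Up; rewrite (deriveE v (dC p Up)) diff_comp //=; last exact: dg.
  by rewrite deriv1E // deriveE //; exact: dg.
apply: CkM => //; first exact: (Dg v).
by apply: IH => //; exact: CkS.
Qed.

Lemma smooth_onP (W : normedModType R) (g : pt -> W) p : smooth_at p g ->
  exists U, [/\ open U, U p & forall q, U q -> forall vs,
    (forall v, derivable (iter_derive vs g) q v) /\ {for q, continuous (iter_derive vs g)}].
Proof.
move=> H; exists (interior [set q | forall vs,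
    (forall v, derivable (iter_derive vs g) q v) /\ {for q, continuous (iter_derive vs g)}]).
by split; [exact: open_interior|exact: H|move=> q /interior_subset].
Qed.

(** The neighbourhood in [smooth_at] serves all orders of derivation, so [U] does not depend on [n].
    Continuous partial derivatives give differentiability by [C1_differentiable]. *)
Lemma smooth_atP g p : smooth_at p g <-> exists U, [/\ open U, U p & forall n, Ck n U g].
Proof.
split=> [/smooth_onP[U [oU Up H]]|[U [oU Up H]]].
  exists U; split=> // n; elim: n g H => [|n IH] g H.
    by move=> q Uq; have [] := H q Uq [::].
  split=> [q Uq|v]; last by apply: IH => q Uq vs; exact: (H q Uq (v :: vs)).
  apply: (C1_differentiable _ _ _).1.
  - by apply: filterS (open_near oU Uq) => z Uz; have [] := H z Uz [::].
  - by have [] := H q Uq [:: e0].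
  - by have [] := H q Uq [:: e1].
apply: filterS (open_near oU Up) => q Uq vs.
elim: vs g H => [|v vs IH] g H; last first.
  by apply: (IH ('D_v g)) => n; have [_ /(_ v)] := H n.+1.
split; last exact: H 0%N q Uq.
by move=> v; apply: diff_derivable; have [dg _] := H 1%N; exact: dg.
Qed.

End Smooth.

(** * Closure properties of smooth maps *)

Section SmoothTheory.
Context {R : realType}.
Local Notation pt := 'rV[R]_2.
Implicit Types (p q v w z : pt) (g h : pt -> R) (F G : pt -> pt) (U : set pt).

Lemma iter_derive_eq (W : normedModType R) (f g : pt -> W) U : open U ->
  (forall q, U q -> f q = g q) ->
  forall vs q, U q -> iter_derive vs f q = iter_derive vs g q.
Proof.
move=> oU E vs; elim: vs f g E => [|v vs IH] f g E q Uq; first exact: E.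
apply: (IH ('D_v f) ('D_v g)) => // z Uz; apply: eq_near_derive.
by apply: filterS (open_near oU Uz).
Qed.

Lemma smooth_at_near (W : normedModType R) (g : pt -> W) p :
  smooth_at p g -> \forall q \near p, smooth_at q g.
Proof.
move=> /smooth_onP[U [oU Up H]]; apply: filterS (open_near oU Up) => q Uq.
exact: filterS (open_near oU Uq).
Qed.

Lemma smooth_at_eq (W : normedModType R) (f g : pt -> W) p :
  (\forall q \near p, f q = g q) -> smooth_at p f -> smooth_at p g.
Proof.
move=> E /smooth_onP[U [oU Up H]].
pose V := U `&` interior [set q | f q = g q].
have oV : open V by apply: openI => //; exact: open_interior.
apply: filterS (open_near oV (conj Up E : V p)) => q Vq vs.
have Enear : \forall z \near q, iter_derive vs f z = iter_derive vs g z.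
  apply: filterS (open_near oV Vq) => z Vz.
  by apply: (iter_derive_eq oV) => // z' [_ /interior_subset].
have [d c] := H q Vq.1 vs; split=> [v|]; first exact: eq_near_derivable Enear (d v).
exact: eq_near_continuous Enear c.
Qed.

Lemma smooth_at_continuous (W : normedModType R) (g : pt -> W) p :
  smooth_at p g -> {for p, continuous g}.
Proof. by move=> /nbhs_singleton /(_ [::]) []. Qed.

Lemma smooth_at_derive (W : normedModType R) (g : pt -> W) p v :
  smooth_at p g -> smooth_at p ('D_v g).
Proof. by apply: filterS => q H vs; exact: H (v :: vs). Qed.

Lemma smooth_at_pt F p :
  smooth_at p F <-> smooth_at p (cX \o F) /\ smooth_at p (cY \o F).
Proof.
have cE j : cX \o F = (fun z => F z ord0 ord0) by [].
split=> [/smooth_onP[U [oU Up H]]|[/smooth_atP[U [oU Up HU]] /smooth_atP[V [oV Vp HV]]]].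
  suff K (j : 'I_2) : smooth_at p (fun z => F z ord0 j : R).
    by split; [exact: (K ord0)|exact: (K ord_max)].
  have E vs q : U q ->
     iter_derive vs F q ord0 j = iter_derive vs (fun z => F z ord0 j : R) q.
    elim: vs F H {cE} q => [//|v vs IH] F H q Uq.
    rewrite [LHS](IH ('D_v F)) => [|z Uz ws|//]; last exact: (H z Uz (v :: ws)).
    apply: (iter_derive_eq oU) => // z Uz; rewrite derive_mx ?mxE //.
    by have [d _] := H z Uz [::]; exact: d.
  apply: filterS (open_near oU Up) => q Uq vs.
  have Eq : \forall z \near q, iter_derive vs F z ord0 j =
      iter_derive vs (fun z => F z ord0 j : R) z.
    by apply: filterS (open_near oU Uq) => z; exact: E.
  have [d c] := H q Uq vs; split=> [v|].
    by apply: eq_near_derivable Eq _; exact: (derivable_mxP _ _ _).1 (d v) ord0 j.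
  apply: (eq_near_continuous Eq).
  apply: (@continuous_comp _ _ _ (iter_derive vs F) (fun M : pt => M ord0 j : R)); first exact: c.
  by apply: differentiable_continuous; exact: differentiable_coord.
pose B (F : pt -> pt) := forall n, Ck n (U `&` V) (cX \o F) /\ Ck n (U `&` V) (cY \o F).
have oUV := openI oU oV.
have BF : B F.
  by move=> n; split; [apply: Ck_sub (HU n)|apply: Ck_sub (HV n)] => z [].
have Bd F' q : B F' -> (U `&` V) q -> forall v, derivable F' q v.
  move=> BF' UVq v; apply: diff_derivable; apply: (differentiable_coords _ _).1.
    by have [[d _] _] := BF' 1%N; exact: d.
  by have [_ [d _]] := BF' 1%N; exact: d.
have BD F' v : B F' -> B ('D_v F').
  move=> BF' n; have [[_ /(_ v) CX] [_ /(_ v) CY]] := BF' n.+1.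
  by split; [apply: Ck_eq CX|apply: Ck_eq CY] => // q UVq /=;
    rewrite /cX /cY derive_mx ?mxE //; exact: Bd.
apply: filterS (open_near oUV (conj Up Vp)) => q UVq vs.
elim: vs F BF {HU HV cE} => [|v vs IH] F BF; last by apply: (IH ('D_v F)); exact: BD.
split=> [v|]; first exact: Bd.
by apply: pt_continuous; [exact: (BF 0%N).1|exact: (BF 0%N).2].
Qed.

Lemma smooth_at_diff g p : smooth_at p g -> differentiable g p.
Proof. by move=> /smooth_atP[U [_ Up /(_ 1%N)[d _]]]; exact: d. Qed.

Lemma smooth_deriveE g p v : smooth_at p g ->
  'D_v g p = cX v * 'D_e0 g p + cY v * 'D_e1 g p.
Proof.
move=> sg; apply: (C1_differentiable _ _ _).2.
- by apply: filterS (smooth_at_near sg) => q sq v'; apply: diff_derivable; exact: smooth_at_diff.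
- by apply: smooth_at_continuous; exact: smooth_at_derive.
- by apply: smooth_at_continuous; exact: smooth_at_derive.
Qed.

Lemma smooth_cst p (c : R) : smooth_at p (cst c : pt -> R).
Proof. by apply/smooth_atP; exists setT; split=> // [|n]; [exact: openT|exact: Ck_cst]. Qed.

Lemma smooth_lin2 p (a b : R) : smooth_at p (lin2 a b).
Proof. by apply/smooth_atP; exists setT; split=> // [|n]; [exact: openT|exact: Ck_lin2]. Qed.

Lemma smooth_X p : smooth_at p (@cX R).
Proof.
have -> : @cX R = lin2 1 0 by apply/funext => z; rewrite /lin2 mulr1 mulr0 addr0.
exact: smooth_lin2.
Qed.

Lemma smooth_Y p : smooth_at p (@cY R).
Proof.
have -> : @cY R = lin2 0 1 by apply/funext => z; rewrite /lin2 mulr1 mulr0 add0r.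
exact: smooth_lin2.
Qed.

Lemma smoothD p g h : smooth_at p g -> smooth_at p h -> smooth_at p (g \+ h).
Proof.
move=> /smooth_atP[U [oU Up HU]] /smooth_atP[V [oV Vp HV]]; apply/smooth_atP.
exists (U `&` V); have oUV := openI oU oV; split=> // n.
by apply: CkD => //; [apply: Ck_sub (HU n)|apply: Ck_sub (HV n)] => z [].
Qed.

Lemma smoothM p g h : smooth_at p g -> smooth_at p h -> smooth_at p (g \* h).
Proof.
move=> /smooth_atP[U [oU Up HU]] /smooth_atP[V [oV Vp HV]]; apply/smooth_atP.
exists (U `&` V); have oUV := openI oU oV; split=> // n.
by apply: CkM => //; [apply: Ck_sub (HU n)|apply: Ck_sub (HV n)] => z [].
Qed.

Lemma smoothN p g : smooth_at p g -> smooth_at p (fun z => - g z).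
Proof.
move=> sg; have -> : (fun z => - g z) = cst (-1) \* g by apply/funext => z /=; rewrite mulN1r.
by apply: smoothM => //; exact: smooth_cst.
Qed.

Lemma smoothB p g h : smooth_at p g -> smooth_at p h -> smooth_at p (fun z => g z - h z).
Proof. by move=> sg sh; apply: (smoothD sg (smoothN sh)). Qed.

Lemma smoothV p g : smooth_at p g -> g p != 0 -> smooth_at p (fun z => (g z)^-1).
Proof.
move=> sg gp; have gc := smooth_at_continuous sg.
case/smooth_atP : sg => [U [oU Up HU]]; apply/smooth_atP.
pose V := U `&` interior [set z | g z != 0].
have oV : open V by apply: openI => //; exact: open_interior.
exists V; split=> // [|n].
  by split=> //; move/cvgr_neq0 : gc; apply.
by apply: CkV => // [q [_ /interior_subset]//|]; apply: Ck_sub (HU n) => z [].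
Qed.

Lemma smoothX p g n : smooth_at p g -> smooth_at p (fun z => g z ^+ n).
Proof.
move=> sg; elim: n => [|n IH].
  by have -> : (fun z => g z ^+ 0) = cst 1 by []; exact: smooth_cst.
have -> : (fun z => g z ^+ n.+1) = g \* (fun z => g z ^+ n).
  by apply/funext => z; rewrite exprS.
exact: smoothM.
Qed.

Lemma smooth_sum p n (g : 'I_n -> pt -> R) : (forall i, smooth_at p (g i)) ->
  smooth_at p (fun z => \sum_(i < n) g i z).
Proof.
elim: n g => [|n IH] g sg.
  by rewrite (_ : (fun z => _) = cst 0); [exact: smooth_cst|apply/funext => z; rewrite big_ord0].
rewrite (_ : (fun z => _) =
   (fun z => \sum_(i < n) g (widen_ord (leqnSn n) i) z) \+ g ord_max).
  by apply: smoothD => //; apply: IH.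
by apply/funext => z; rewrite big_ord_recr.
Qed.

Lemma smooth_comp F g p : smooth_at p F -> smooth_at (F p) g -> smooth_at p (g \o F).
Proof.
move=> sF /smooth_atP[W [oW WF HW]]; have cF := smooth_at_continuous sF.
case/smooth_at_pt : sF => /smooth_atP[U [oU Up HU]] /smooth_atP[V [oV Vp HV]].
apply/smooth_atP; pose A := (U `&` V) `&` interior (F @^-1` W).
have oA : open A by apply: openI; [exact: openI|exact: open_interior].
exists A; split=> // [|n].
  by split; [split|apply: (cF W); exact: (open_nbhs_nbhs (conj oW WF))].
apply: (@Ck_comp _ n A W) => //; last by move=> q [_ /interior_subset].
  by apply: Ck_sub (HU n) => z [[]].
by apply: Ck_sub (HV n) => z [[]].
Qed.

Lemma smooth_comp_pt F G p : smooth_at p F -> smooth_at (F p) G -> smooth_at p (G \o F).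
Proof.
move=> sF /smooth_at_pt[sX sY]; apply/smooth_at_pt; split.
  exact: (smooth_comp sF sX).
exact: (smooth_comp sF sY).
Qed.

Lemma smooth_comp1 (u : R -> R) g p : (forall n, C1k n u) -> smooth_at p g ->
  smooth_at p (u \o g).
Proof.
move=> Cu /smooth_atP[U [oU Up HU]]; apply/smooth_atP; exists U; split=> // n.
exact: Ck_comp1.
Qed.

Lemma smooth_mk p g h : smooth_at p g -> smooth_at p h ->
  smooth_at p (fun z => mk (g z) (h z)).
Proof.
move=> sg sh; apply/smooth_at_pt; split.
  by rewrite (_ : cX \o _ = g) //; apply/funext => z; rewrite /= cE.
by rewrite (_ : cY \o _ = h) //; apply/funext => z; rewrite /= cE.
Qed.

Lemma smooth_id p : smooth_at p (id : pt -> pt).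
Proof. by apply/smooth_at_pt; split; [exact: smooth_X|exact: smooth_Y]. Qed.

Lemma smooth_shift p w : smooth_at p (fun z : pt => z + w).
Proof.
apply/smooth_at_pt; split.
  rewrite (_ : cX \o _ = @cX R \+ cst (cX w)); last by apply/funext => z /=; rewrite cE.
  by apply: smoothD; [exact: smooth_X|exact: smooth_cst].
rewrite (_ : cY \o _ = @cY R \+ cst (cY w)); last by apply/funext => z /=; rewrite cE.
by apply: smoothD; [exact: smooth_Y|exact: smooth_cst].
Qed.

Lemma smooth_scale p (k : R) : smooth_at p (fun z : pt => k *: z).
Proof.
apply/smooth_at_pt; split.
  rewrite (_ : cX \o _ = cst k \* @cX R); last by apply/funext => z /=; rewrite cE.
  by apply: smoothM; [exact: smooth_cst|exact: smooth_X].
rewrite (_ : cY \o _ = cst k \* @cY R); last by apply/funext => z /=; rewrite cE.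
by apply: smoothM; [exact: smooth_cst|exact: smooth_Y].
Qed.

End SmoothTheory.

(** * Smooth steps and cut-off functions *)

Section Bump.
Context {R : realType}.
Local Notation pt := 'rV[R]_2.
Implicit Types (p z : pt) (x y : R).

Lemma C1k_lin n (u w : R -> R) (c : R) : C1k n u -> C1k n w ->
  C1k n (fun x => u x + c * w x).
Proof.
elim: n u w => [|n IH] u w /=.
  move=> cu cw x; apply: (@continuousD _ _ _ u (fun x => c * w x)); first exact: cu.
  by apply: (@continuousM _ _ (cst c) w); [exact: cst_continuous|exact: cw].
move=> [du Du] [dw Dw].
have dcw x : derivable (fun x => c * w x) x 1.
  by apply: (@derivableM _ _ (cst c) w) => //; exact: derivable_cst.
split=> [x|]; first exact: (@derivableD _ _ _ u (fun x => c * w x)).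
rewrite (_ : _^`()%classic = (fun x => u^`()%classic x + c * w^`()%classic x)); first exact: IH.
apply/funext => x; rewrite !derive1E (@deriveD _ _ _ u (fun x => c * w x)) //.
by rewrite (@deriveMl _ _ w c).
Qed.

(** The functions x^-k exp(-1/x), extended by 0, are stable under derivation up to linear
    combinations ([flat_derive]); this gives the smoothness of exp(-1/x) by induction. *)
Definition flat k x : R := if 0 < x then x^-1 ^+ k * expR (- x^-1) else 0.

(** From exp(y) >= (y/m)^m with m = k + 2 and y = 1/x. The quadratic bound makes the difference
    quotients of [flat k] at 0 tend to 0. *)
Lemma flat_le k x : exists C : R, forall x, 0 < x -> flat k x <= C * x ^+ 2.
Proof.
exists (k.+2%:R ^+ k.+2) => {}x x0; rewrite /flat x0.
set y := x^-1; have y0 : 0 < y by rewrite invr_gt0.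
have m0 : (0 : R) < k.+2%:R by rewrite ltr0n.
have : (y / k.+2%:R) ^+ k.+2 <= expR y.
  rewrite -[X in expR X](divfK (lt0r_neq0 m0)) expRM_natr.
  have yk : 0 <= y / k.+2%:R by rewrite divr_ge0// ltW.
  rewrite lerXn2r ?nnegrE ?expR_ge0//.
  by apply: le_trans (expR_ge1Dx _); rewrite lerDr.
rewrite expr_div_n ler_pdivrMr ?exprn_gt0// => H.
rewrite expRN ler_pdivrMr ?expR_gt0//.
have -> : y ^+ k = y ^+ k.+2 * x ^+ 2.
  by rewrite -addn2 exprD -mulrA -exprMn mulVf ?gt_eqF// expr1n mulr1.
rewrite [leRHS]mulrAC ler_wpM2r//; first by rewrite exprn_ge0// ltW.
by rewrite mulrC.
Qed.

Lemma flat_derive k x : is_derive x 1 (flat k) (flat k.+2 x - k%:R * flat k.+1 x).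
Proof.
have n1 : (1 : R) != 0 := oner_neq0 R.
have [x0|x0|->] := ltgtP x 0.
- have -> : flat k.+2 x - k%:R * flat k.+1 x = 0.
    by rewrite /flat ltNge ltW// mulr0 subr0.
  apply: (@near_eq_is_derive _ _ _ (cst 0)) => //.
  near=> y; rewrite /flat ifF//; apply/negbTE; rewrite -leNgt ltW//.
  by near: y; exact: lt_nbhsl.
- have D : is_derive x 1 (fun y : R => y^-1 ^+ k * expR (- y^-1))
     (flat k.+2 x - k%:R * flat k.+1 x).
    have xn : x != 0 by rewrite gt_eqF.
    have dV : is_derive x 1 (fun y : R => y^-1) (- x ^- 2).
      have d : derivable (@id R) x 1 by exact: derivable_id.
      split; first by apply: (@derivableV _ _ (@id R)).
      by rewrite (@deriveV _ _ (@id R)) // derive_id /GRing.scale /= mulr1.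
    have dE : is_derive x 1 (fun y : R => expR (- y^-1)) (expR (- x^-1) * x ^- 2).
      apply: (@is_derive_eq _ _ _ _ _ _ _ _ (is_derive1_comp _ _)).
      by rewrite opprK.
    have D' := is_deriveM (is_deriveX k dV) dE.
    have -> : (fun y : R => y^-1 ^+ k * expR (- y^-1)) =
        (fun y : R => y^-1) ^+ k * (fun y : R => expR (- y^-1)).
      by apply/funext => y; rewrite !fctE.
    apply: (is_derive_eq D'); rewrite /flat x0 ?exprfctE ?fctE /GRing.scale /= -exprVn.
    set y := x^-1; set E := expR _; case: (k) => [|j] /=; first by rewrite !mul0r; ring.
    by rewrite !exprS; ring.
  apply: (@near_eq_is_derive _ _ _ (fun y : R => y^-1 ^+ k * expR (- y^-1))) => //.
  near=> y; rewrite /flat ifT//.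
  by near: y; exact: lt_nbhsr.
- have -> : flat k.+2 0 - k%:R * flat k.+1 0 = 0.
    by rewrite /flat ltxx mulr0 subr0.
  have H : (fun h : R => h^-1 *: ((flat k \o shift 0) (h *: (1 : R)) - flat k 0)) @ 0^' --> (0 : R).
    have [C HC] := flat_le k 0.
    have C0 : 0 <= C.
      have := HC 1 ltr01; rewrite expr1n mulr1; apply: le_trans.
      by rewrite /flat ltr01 mulr_ge0 ?expR_ge0// exprn_ge0// invr_ge0.
    apply/cvgrPdist_le => e ep; near=> h.
    rewrite sub0r normrN /= addr0 (_ : h *: 1 = h); last exact: mulr1.
    rewrite {2}/flat ltxx subr0 normrM.
    have hn : h != 0 by near: h; exact: nbhs_dnbhs_neq.
    have [h0|h0] := ltP 0 h; last by rewrite /flat ltNge h0 normr0 mulr0 ltW.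
    rewrite normfV (gtr0_norm h0) ger0_norm; last first.
      by rewrite /flat h0 mulr_ge0 ?expR_ge0// exprn_ge0// invr_ge0 ltW.
    rewrite ler_pdivrMl//; apply: (le_trans (HC _ h0)).
    rewrite expr2 mulrA [leLHS]mulrC ler_wpM2l//; first exact: ltW.
    have hs : h <= e / (C + 1).
      rewrite -(gtr0_norm h0) ltW//; near: h.
      by apply: dnbhs0_lt; rewrite divr_gt0// ltr_wpDl.
    apply: (@le_trans _ _ ((C + 1) * (e / (C + 1)))); last by rewrite mulrCA divff ?mulr1// gt_eqF// ltr_wpDl.
    by apply: ler_pM => //; [exact: ltW|rewrite lerDl].
  by split; [apply/cvg_ex; exists 0|exact: cvg_lim].
Unshelve. all: by end_near. Qed.

Lemma flat_C1k n k : C1k n (flat k).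
Proof.
elim: n k => [|n IH] k.
  move=> x; apply: differentiable_continuous; apply/derivable1_diffP.
  by case: (flat_derive k x).
split=> [x|]; first by case: (flat_derive k x).
rewrite (_ : _^`()%classic = fun x => flat k.+2 x + (- k%:R) * flat k.+1 x).
  exact: C1k_lin.
by apply/funext => x; have [_ E] := flat_derive k x; rewrite derive1E E mulNr.
Qed.

Definition step x : R := flat 0 x / (flat 0 x + flat 0 (1 - x)).

Lemma flat_gt0 x : 0 < x -> 0 < flat 0 x.
Proof. by move=> x0; rewrite /flat x0 expr0 mul1r expR_gt0. Qed.

Lemma flat_ge0 x : 0 <= flat 0 x.
Proof. by have [/flat_gt0/ltW//|x0] := ltP 0 x; rewrite /flat ltNge x0. Qed.

Lemma flat_eq0 x : x <= 0 -> flat 0 x = 0.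
Proof. by move=> x0; rewrite /flat ltNge x0. Qed.

Lemma step_den x : 0 < flat 0 x + flat 0 (1 - x).
Proof.
have [x0|x0] := ltP 0 x; first by rewrite ltr_pwDl ?flat_gt0 ?flat_ge0.
by rewrite ltr_wpDl ?flat_ge0// flat_gt0// subr_gt0 (le_lt_trans x0).
Qed.

Lemma step_le0 x : x <= 0 -> step x = 0.
Proof. by move=> x0; rewrite /step flat_eq0// mul0r. Qed.

Lemma step_ge1 x : 1 <= x -> step x = 1.
Proof.
move=> x1; have := step_den x; rewrite /step [flat 0 (1 - x)]flat_eq0 ?subr_le0// addr0.
by move=> /gt_eqF ?; rewrite divff// gt_eqF// flat_gt0 // (lt_le_trans _ x1).
Qed.

Lemma step01 x : 0 <= step x <= 1.
Proof.
have d := step_den x; rewrite /step divr_ge0 ?flat_ge0 ?(ltW d)//=.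
by rewrite ler_pdivrMr ?step_den// mul1r lerDl flat_ge0.
Qed.

Lemma smooth_step (g : pt -> R) p : smooth_at p g -> smooth_at p (step \o g).
Proof.
move=> sg; have s1 := smooth_comp1 (fun n => flat_C1k n 0) sg.
have s2 := smooth_comp1 (fun n => flat_C1k n 0) (smoothB (smooth_cst p 1) sg).
have den : ((flat 0 \o g) \+ (flat 0 \o (fun z => cst 1 z - g z))) p != 0 by rewrite /= gt_eqF// step_den.
exact: (smoothM s1 (smoothV (smoothD s1 s2) den)).
Qed.

Lemma C1k_expR n : C1k n (@expR R).
Proof.
elim: n => [|n IH]; first exact: continuous_expR.
split=> [x|]; first exact: derivable_expR.
rewrite (_ : _^`()%classic = @expR R) //.
by apply/funext => x; have [_ E] := is_derive_expR x; rewrite derive1E E.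
Qed.

(** The Euclidean radius replaces the norm, which is not smooth. On the square [|p| <= r / 2] its
    square is at most r^2 / 2, which makes the argument of [step] at least 1. *)
Definition cutoff (r : R) p : R := step ((r ^+ 2 - (cX p ^+ 2 + cY p ^+ 2)) / (r ^+ 2 / 2)).

Lemma smooth_cutoff r p : smooth_at p (cutoff r).
Proof.
apply: (@smooth_step (fun z => (r ^+ 2 - (cX z ^+ 2 + cY z ^+ 2)) / (r ^+ 2 / 2))).
apply: (@smoothM _ _ (fun z => r ^+ 2 - (cX z ^+ 2 + cY z ^+ 2)) (cst ((r ^+ 2 / 2)^-1))).
  apply: (@smoothB _ _ (cst (r ^+ 2))); first exact: smooth_cst.
  by apply: smoothD; apply: smoothX; [exact: smooth_X|exact: smooth_Y].
exact: smooth_cst.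
Qed.

Lemma cutoff01 r p : 0 <= cutoff r p <= 1. Proof. exact: step01. Qed.

Lemma cutoff1 (r : R) p : 0 < r -> `|p| <= r / 2 -> cutoff r p = 1.
Proof.
move=> r0 /norm_leP[hX hY]; apply: step_ge1.
rewrite ler_pdivlMr ?divr_gt0 ?exprn_gt0// mul1r lerBrDr -lerBrDl.
have K (x : R) : `|x| <= r / 2 -> x ^+ 2 <= r ^+ 2 / 4.
  move=> h; rewrite -(real_normK (num_real x)).
  have -> : r ^+ 2 / 4 = (r / 2) ^+ 2 by rewrite !expr2; field.
  by rewrite lerXn2r// nnegrE// divr_ge0// ltW.
have -> : r ^+ 2 - r ^+ 2 / 2 = r ^+ 2 / 4 + r ^+ 2 / 4 by field.
by apply: lerD; exact: K.
Qed.

Lemma cutoff0 (r : R) p : 0 < r -> r <= `|p| -> cutoff r p = 0.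
Proof.
move=> r0 h; apply: step_le0; rewrite pmulr_lle0 ?invr_gt0 ?divr_gt0 ?exprn_gt0//.
rewrite subr_le0; have [|[hX|hY]] : (`|p| < r) \/ (r <= `|cX p| \/ r <= `|cY p|).
  have [?|a] := ltP `|cX p| r; last by right; left.
  have [?|a] := ltP `|cY p| r; last by right; right.
  by left; apply/norm_ltP.
- by rewrite ltNge h.
- rewrite -(real_normK (num_real (cX p))) ler_wpDr ?sqr_ge0//.
  by rewrite lerXn2r// nnegrE// ltW.
- rewrite -(real_normK (num_real (cY p))) ler_wpDl ?sqr_ge0//.
  by rewrite lerXn2r// nnegrE// ltW.
Qed.

End Bump.
HB.instance Definition _ (R : realType) (m n : nat) := Complete.on 'M[R]_(m, n).

(** * Inverse functions *)

Section Inverse.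
Context {R : realType}.
Local Notation pt := 'rV[R]_2.
Implicit Types (p q v w z : pt) (g h : pt -> R) (F G : pt -> pt) (U V W : set pt).

Lemma dist_continuous (T : topologicalType) (W : normedModType R) (F : T -> W) (x : T) :
  (forall e : R, 0 < e -> \forall y \near x, `|F x - F y| < e) -> {for x, continuous F}.
Proof. by move=> H; apply/cvgrPdist_lt. Qed.

(** Solving z + eta z = y means finding the fixed point of the contraction z |-> y - eta z. The
    estimate |z - w| <= 2 |(z + eta z) - (w + eta w)| gives both injectivity and the Lipschitz
    constant of the inverse. *)
Lemma lipschitz_bijective (eta : pt -> pt) :
  (forall z w, `|eta z - eta w| <= 2^-1 * `|z - w|) ->
  exists k : pt -> pt, [/\ cancel (fun z => z + eta z) k, cancel k (fun z => z + eta z) &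
    forall z w, `|k z - k w| <= 2 * `|z - w|].
Proof.
move=> L.
have low z w : `|z - w| <= 2 * `|(z + eta z) - (w + eta w)|.
  have := ler_normD ((z + eta z) - (w + eta w)) (- (eta z - eta w)).
  rewrite normrN (_ : _ - _ + - _ = z - w); last by apply: ptP; rewrite !cE; ring.
  by have := L z w; lra.
have surj y : exists z, z + eta z = y.
  pose T : {fun [set: pt] >-> [set: pt]} :=
    mkfun_fun (f := fun z : pt => y - eta z) (A := setT) (B := setT) (fun _ _ => I).
  have [|||z _ Ez] := @banach_fixed_point R _ setT T.
  - exists (2^-1)%:nng; split; first by rewrite /= invf_lt1// ltr1n.
    move=> [z w] _ /=; rewrite opprB addrC addrA subrK -normrN opprB.
    exact: L.
  - exact: closedT.
  - by exists 0.
  by exists z; rewrite {1}Ez /= subrK.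
have [k kP] := choice surj.
exists k; split=> [z|z|z w]; last 2 first.
- exact: kP.
- by apply: le_trans (low _ _) _; rewrite !kP.
have := low (k (z + eta z)) z; rewrite kP subrr normr0 mulr0 normr_le0 subr_eq0.
by move/eqP.
Qed.

Definition jac F p : R :=
  'D_e0 (cX \o F) p * 'D_e1 (cY \o F) p - 'D_e1 (cX \o F) p * 'D_e0 (cY \o F) p.

(** Both points vary, unlike in the definition of the differential: the mean value theorem on the
    segment between them, together with continuity of the gradient at [p]. Local injectivity and all
    Lipschitz estimates rest on this form. *)
Lemma strict_diff g p (e : R) : smooth_at p g -> 0 < e ->
  exists2 r : R, 0 < r & forall z w, `|z - p| < r -> `|w - p| < r ->
    `|g z - g w - lin2 ('D_e0 g p) ('D_e1 g p) (z - w)| <= e * `|z - w|.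
Proof.
move=> sg ep; have e2 : 0 < e / 2 by rewrite divr_gt0.
have c (v : pt) : \forall q \near p, `|'D_v g q - 'D_v g p| < e / 2.
  by move: (smooth_at_continuous (smooth_at_derive v sg)) => /cvgr_distC_lt; apply.
have [r r0 hr] : exists2 r : R, 0 < r & forall q, `|q - p| < r ->
   [/\ smooth_at q g, `|'D_e0 g q - 'D_e0 g p| < e / 2 & `|'D_e1 g q - 'D_e1 g p| < e / 2].
  by apply/near_norm; apply: filterS3 (smooth_at_near sg) (c e0) (c e1) => q *; split.
exists r => // z w hz hw.
have seg (t : R) : 0 <= t <= 1 -> `|w + t *: (z - w) - p| < r.
  move=> /andP[t0 t1].
  have -> : w + t *: (z - w) - p = (1 - t) *: (w - p) + t *: (z - p).
    by apply: ptP; rewrite !cE; ring.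
  apply: le_lt_trans (ler_normD _ _) _; rewrite !normrZ (ger0_norm t0) ger0_norm ?subr_ge0//.
  move: hz hw; move: `|z - p| `|w - p| => A B hA hB.
  have [t12|t12] := leP t 2^-1; nra.
have dg (t : R) : 0 <= t <= 1 -> derivable g (w + t *: (z - w)) (z - w).
  by move=> /seg/hr[s _ _]; apply: diff_derivable; exact: smooth_at_diff.
have [t t01] := line_mvt dg.
rewrite [w + _]addrC subrK => ->; have [s hx hy] := hr _ (seg t t01).
rewrite smooth_deriveE // /lin2 opprD addrACA -!mulrBr.
move: ('D_e0 g (w + t *: (z - w)) - 'D_e0 g p) ('D_e1 g (w + t *: (z - w)) - 'D_e1 g p) hx hy => X Y.
move: (cX (z - w)) (cY (z - w)) `|z - w| (cX_le (z - w)) (cY_le (z - w)) => A B N AN BN hX hY.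
apply: le_trans (ler_normD _ _) _; rewrite !normrM.
rewrite [e]splitr mulrDl; apply: lerD; rewrite mulrC; apply: ler_pM => //; exact: ltW.
Qed.

(** A bound, in the maximum norm, for the inverse of the matrix with rows (a, b) and (c, d). *)
Definition cond (a b c d : R) := (`|a| + `|b| + `|c| + `|d|) / `|a * d - b * c|.

Lemma solve2 (a b c d x y X Y e : R) : a * d - b * c != 0 ->
  `|X - (x * a + y * b)| <= e -> `|Y - (x * c + y * d)| <= e ->
  `|x - (X * (d / (a * d - b * c)) + Y * (- b / (a * d - b * c)))| <= cond a b c d * e /\
  `|y - (X * (- c / (a * d - b * c)) + Y * (a / (a * d - b * c)))| <= cond a b c d * e.
Proof.
rewrite /cond; set J := a * d - b * c => J0 hX hY.
have ep : 0 <= e by apply: le_trans hX.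
have K (u v : R) : `|u| + `|v| <= `|a| + `|b| + `|c| + `|d| ->
   `|(u * (X - (x * a + y * b)) + v * (Y - (x * c + y * d))) / J| <=
   (`|a| + `|b| + `|c| + `|d|) / `|J| * e.
  move=> h; rewrite normrM normfV mulrAC ler_wpM2r ?invr_ge0//.
  apply: le_trans (ler_normD _ _) _; rewrite !normrM.
  apply: (@le_trans _ _ ((`|u| + `|v|) * e)); last by rewrite ler_wpM2r.
  by rewrite mulrDl lerD// ler_wpM2l.
split.
  have -> : x - (X * (d / J) + Y * (- b / J)) =
      ((- d) * (X - (x * a + y * b)) + b * (Y - (x * c + y * d))) / J.
    by rewrite /J; field.
  by apply: K; rewrite normrN; move: (normr_ge0 a) (normr_ge0 c); lra.
have -> : y - (X * (- c / J) + Y * (a / J)) =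
    (c * (X - (x * a + y * b)) + (- a) * (Y - (x * c + y * d))) / J.
  by rewrite /J; field.
by apply: K; rewrite normrN; move: (normr_ge0 b) (normr_ge0 d); lra.
Qed.

Lemma cond_ge0 (a b c d : R) : 0 <= cond a b c d.
Proof. by rewrite divr_ge0// !addr_ge0. Qed.

(** The second condition on [m] gives C m <= 1/2, so the last term in the bound on [x] is absorbed
    and x <= 2 C y. *)
Lemma small_bound (m C x y e : R) : x <= C * y + C * (m * x) ->
  m * (2 * (C * C) + 1) <= e -> m * (2 * (C + 1)) <= 1 -> 0 < m -> 0 <= C ->
  0 <= x -> 0 <= y -> C * (m * x) <= e * y.
Proof.
move=> uh m1 m2 mp C0 x0 y0.
have h1 : x <= 2 * C * y by nra.
have h2 : C * (m * x) <= m * (2 * (C * C)) * y.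
  rewrite (_ : C * (m * x) = (m * C) * x); last by ring.
  rewrite (_ : m * (2 * (C * C)) * y = (m * C) * (2 * C * y)); last by ring.
  by rewrite ler_wpM2l// mulr_ge0// ltW.
by apply: le_trans h2 _; rewrite ler_wpM2r//; lra.
Qed.

(** A merely continuous right inverse is differentiable: the strict estimate for [F] at [G w] is
    inverted by Cramer's rule, and continuity of [G] keeps the points within the range of that
    estimate. *)
Lemma inverse_diff F G w : smooth_at (G w) F -> jac F (G w) != 0 ->
  (\forall w' \near w, F (G w') = w') -> {for w, continuous G} ->
  (differentiable (cX \o G) w /\ forall v, 'D_v (cX \o G) w =
     lin2 ('D_e1 (cY \o F) (G w) / jac F (G w)) (- 'D_e1 (cX \o F) (G w) / jac F (G w)) v) /\
  (differentiable (cY \o G) w /\ forall v, 'D_v (cY \o G) w =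
     lin2 (- 'D_e0 (cY \o F) (G w) / jac F (G w)) ('D_e0 (cX \o F) (G w) / jac F (G w)) v).
Proof.
rewrite /jac; set p := G w => /smooth_at_pt[sX sY].
set a := 'D_e0 (cX \o F) p; set b := 'D_e1 (cX \o F) p.
set c := 'D_e0 (cY \o F) p; set d := 'D_e1 (cY \o F) p => J0 FG cG.
have Fp := nbhs_singleton FG; rewrite -/p in Fp.
pose C := cond a b c d; have C0 : 0 <= C := cond_ge0 a b c d.
have key (e : R) : 0 < e -> \forall h \near (0 : pt),
   `|cX (G (h + w)) - cX p - lin2 (d / (a * d - b * c)) (- b / (a * d - b * c)) h| <= e * `|h| /\
   `|cY (G (h + w)) - cY p - lin2 (- c / (a * d - b * c)) (a / (a * d - b * c)) h| <= e * `|h|.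
  move=> ep; pose m := Num.min (e / (2 * (C * C) + 1)) (1 / (2 * (C + 1))).
  have C2 : 0 <= C * C by rewrite mulr_ge0.
  have mp : 0 < m by rewrite lt_min !divr_gt0// ?mulr_gt0// ltr_wpDl// mulr_ge0.
  have m1 : m * (2 * (C * C) + 1) <= e by rewrite -ler_pdivlMr ?ltr_wpDl ?mulr_ge0// ge_min lexx.
  have m2 : m * (2 * (C + 1)) <= 1 by rewrite -ler_pdivlMr ?mulr_gt0 ?ltr_wpDl// ge_min lexx orbT.
  have [r r0 hX] := strict_diff sX mp.
  have [r' r0' hY] := strict_diff sY mp.
  have nG : \forall w' \near w, `|G w' - p| < Num.min r r'.
    by move/cvgr_distC_lt : cG; apply; rewrite lt_min r0 r0'.
  have [s s0 hs] := (near_norm _ _).1 (filterI nG FG).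
  apply/near_norm; exists s => // h; rewrite subr0 => hh.
  have := hs (h + w); rewrite addrK => /(_ hh) [].
  set q := G (h + w); rewrite lt_min => /andP[qr qr'] Fq.
  have := hX q p; rewrite subrr normr0 => /(_ qr r0) {}hX.
  have := hY q p; rewrite subrr normr0 => /(_ qr' r0') {}hY.
  move: hX hY; rewrite /= Fq Fp -cXN -cXD -cYN -cYD addrK /lin2 => hX hY.
  set u := q - p in hX hY.
  have [uX uY] := solve2 J0 hX hY.
  have hh0 : `|cX h - (0 * a + 0 * b)| <= `|h| by rewrite !mul0r addr0 subr0 cX_le.
  have hh1 : `|cY h - (0 * c + 0 * d)| <= `|h| by rewrite !mul0r addr0 subr0 cY_le.
  have [vX vY] := solve2 J0 hh0 hh1; rewrite !sub0r !normrN in vX vY.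
  have uh : `|u| <= C * `|h| + C * (m * `|u|).
    apply/norm_leP; split.
      rewrite -[cX u](subrK (cX h * (d / (a * d - b * c)) + cY h * (- b / (a * d - b * c)))).
      by rewrite addrC; apply: le_trans (ler_normD _ _) _; exact: lerD.
    rewrite -[cY u](subrK (cX h * (- c / (a * d - b * c)) + cY h * (a / (a * d - b * c)))).
    by rewrite addrC; apply: le_trans (ler_normD _ _) _; exact: lerD.
  have fin : C * (m * `|u|) <= e * `|h|.
    by apply: (small_bound uh m1 m2).
  by rewrite -cXN -cYN -cXD -cYD -/u; split; [exact: le_trans uX _|exact: le_trans uY _].
by split; apply: differentiable_lin2 => e ep; apply: filterS (key e ep) => h [].
Qed.

Lemma Ck_of_smooth n W g : (forall p, W p -> smooth_at p g) -> Ck n W g.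
Proof.
elim: n g => [|n IH] g sg; first by move=> p /sg; exact: smooth_at_continuous.
split=> [p /sg|v]; first exact: smooth_at_diff.
by apply: IH => p /sg; exact: smooth_at_derive.
Qed.

Lemma smooth_jac F p : smooth_at p F -> smooth_at p (jac F).
Proof.
move=> /smooth_at_pt[sX sY].
apply: (@smoothB _ _ ('D_e0 (cX \o F) \* 'D_e1 (cY \o F)) ('D_e1 (cX \o F) \* 'D_e0 (cY \o F)));
  by apply: smoothM; exact: smooth_at_derive.
Qed.

(** The partial derivatives of [G] are rational expressions in those of [F] taken at [G]. If [G] is
    of class C^n, so are they, and [G] is of class C^(n+1). *)
Lemma inverse_smooth F G V : open V ->
  (forall w, V w -> [/\ smooth_at (G w) F, jac F (G w) != 0, F (G w) = w &
     {for w, continuous G}]) ->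
  forall w, V w -> smooth_at w G.
Proof.
move=> oV H.
have nearFG w : V w -> \forall w' \near w, F (G w') = w'.
  by move=> Vw; apply: filterS (open_near oV Vw) => z /H[].
have D w (Vw : V w) := let: And4 s j _ c := H w Vw in inverse_diff s j (nearFG w Vw) c.
have sJ p : smooth_at p F -> jac F p != 0 -> smooth_at p (fun z => (jac F z)^-1).
  by move=> sF J0; apply: smoothV => //; exact: smooth_jac.
have C n : Ck n V (cX \o G) /\ Ck n V (cY \o G).
  elim: n => [|n [IX IY]].
    split=> w Vw; have [_ _ _ c] := H w Vw.
      by apply: continuous_comp => //; exact: cX_continuous.
    by apply: continuous_comp => //; exact: cY_continuous.
  have comp (g : pt -> R) : (forall w, V w -> smooth_at (G w) g) -> Ck n V (g \o G).
    move=> sg; apply: (@Ck_comp _ n V [set p | smooth_at p g]) => //.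
    exact: Ck_of_smooth.
  have comp2 (g h : pt -> R) v : (forall w, V w -> smooth_at (G w) g) ->
      (forall w, V w -> smooth_at (G w) h) ->
      Ck n V (fun w => lin2 (g (G w) / jac F (G w)) (h (G w) / jac F (G w)) v).
    move=> sg sh.
    apply: (comp (fun p => lin2 (g p / jac F p) (h p / jac F p) v)) => w Vw.
    have [sF J0 _ _] := H w Vw; have s := sJ _ sF J0.
    apply: (@smoothD _ _ (cst (cX v) \* (g \* (fun z => (jac F z)^-1)))
      (cst (cY v) \* (h \* (fun z => (jac F z)^-1)))).
      by apply: smoothM; [exact: smooth_cst|apply: smoothM; [exact: sg|exact: s]].
    by apply: smoothM; [exact: smooth_cst|apply: smoothM; [exact: sh|exact: s]].
  have sF w : V w -> smooth_at (G w) (cX \o F) /\ smooth_at (G w) (cY \o F).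
    by move=> Vw; apply/smooth_at_pt; have [] := H w Vw.
  split; split=> [w Vw|v].
  - by have [[]] := D w Vw.
  - apply: Ck_eq (comp2 ('D_e1 (cY \o F)) (fun p => - 'D_e1 (cX \o F) p) v _ _) => //.
    + by move=> w Vw; have [[_ ->]] := D w Vw.
    + by move=> w Vw; apply: smooth_at_derive; case: (sF w Vw).
    + by move=> w Vw; apply: smoothN; apply: smooth_at_derive; case: (sF w Vw).
  - by have [_ []] := D w Vw.
  - apply: Ck_eq (comp2 (fun p => - 'D_e0 (cY \o F) p) ('D_e0 (cX \o F)) v _ _) => //.
    + by move=> w Vw; have [_ [_ ->]] := D w Vw.
    + by move=> w Vw; apply: smoothN; apply: smooth_at_derive; case: (sF w Vw).
    + by move=> w Vw; apply: smooth_at_derive; case: (sF w Vw).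
move=> w Vw; apply/smooth_at_pt; split; apply/smooth_atP; exists V; split=> // n.
  by case: (C n).
by case: (C n).
Qed.

Definition clamp (r x : R) : R := Num.max (- r) (Num.min r x).

Lemma clamp_lip (r x y : R) : `|clamp r x - clamp r y| <= `|x - y|.
Proof.
have aux (N : R) : y - x <= N -> x - y <= N -> `|clamp r x - clamp r y| <= N.
  move=> h1 h2; rewrite ler_norml /clamp !maxEle !minEle.
  case: (lerP r x) => ?; case: (lerP r y) => ?; do ? (case: ifPn; rewrite -?ltNge => ?);
    apply/andP; split; lra.
by apply: aux; [rewrite distrC|]; exact: ler_norm.
Qed.

Lemma clamp_id (r x : R) : `|x| <= r -> clamp r x = x.
Proof.
by rewrite ler_norml => /andP[? ?]; rewrite /clamp min_r// max_r.
Qed.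

Lemma clamp_le (r x : R) : 0 <= r -> `|clamp r x| <= r.
Proof.
move=> r0; rewrite /clamp ler_norml le_max lexx /= ge_max ge_min lexx /=.
by rewrite andbT; lra.
Qed.

Definition clamp2 (r : R) z : pt := mk (clamp r (cX z)) (clamp r (cY z)).

Lemma clamp2_lip r z w : `|clamp2 r z - clamp2 r w| <= `|z - w|.
Proof.
apply/norm_leP; rewrite !cE; split; apply: le_trans (clamp_lip _ _ _) _.
  by rewrite -cXN -cXD cX_le.
by rewrite -cYN -cYD cY_le.
Qed.

Lemma clamp2_id r z : `|z| <= r -> clamp2 r z = z.
Proof. by move=> /norm_leP[hX hY]; apply: ptP; rewrite !cE clamp_id. Qed.

Lemma clamp2_le r z : 0 <= r -> `|clamp2 r z| <= r.
Proof. by move=> r0; apply/norm_leP; rewrite !cE !clamp_le. Qed.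

(** Clamping the argument to a small square and composing with the inverse of the differential turns
    [F] into a map z + eta z of the whole plane with [eta] 1/2-Lipschitz. The inverse then exists
    globally, and domains are restricted only at the end. *)
Lemma inverse_function F p : smooth_at p F -> jac F p != 0 ->
  exists r G, [/\ 0 < r, 
    forall z w, `|z - p| < r -> `|w - p| < r -> F z = F w -> z = w,
    {for F p, continuous G}, G (F p) = p &
    \forall w \near F p, F (G w) = w /\ smooth_at w G].
Proof.
move=> sF J0; have /smooth_at_pt[sX sY] := sF.
pose a := 'D_e0 (cX \o F) p; pose b := 'D_e1 (cX \o F) p.
pose c := 'D_e0 (cY \o F) p; pose d := 'D_e1 (cY \o F) p.
have J0' : a * d - b * c != 0 := J0.
set J := a * d - b * c in J0'.
pose C := cond a b c d; have C0 : 0 <= C := cond_ge0 a b c d.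
pose m := 1 / (2 * (C + 1)).
have mp : 0 < m by rewrite divr_gt0// mulr_gt0// ltr_wpDl.
have Cm : C * m <= 2^-1.
  by rewrite /m mul1r invfM mulrCA ler_piMr// ler_pdivrMr ?ltr_wpDl// mul1r lerDl.
have [r1 r10 hX] := strict_diff sX mp.
have [r2 r20 hY] := strict_diff sY mp.
have [r3 r30 h3] : exists2 r : R, 0 < r & forall q, `|q - p| < r -> smooth_at q F /\ jac F q != 0.
  apply/near_norm; apply: filterS2 (smooth_at_near sF) _ => [q sq Jq|]; first by split; [|exact: Jq].
  have /cvgr_neq0 := smooth_at_continuous (smooth_jac sF); exact.
pose r := Num.min (Num.min r1 r2) r3.
have r0 : 0 < r by rewrite !lt_min r10 r20.
(* [B] is the inverse of the differential of [F] at [p], and [cl] retracts the plane onto the closed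
   square of half-width r / 2 around [p]. *)
pose B (u : pt) : pt := mk (cX u * (d / J) + cY u * (- b / J)) (cX u * (- c / J) + cY u * (a / J)).
pose cl z := p + clamp2 (r / 2) (z - p).
have r20' : 0 <= r / 2 by rewrite divr_ge0// ltW.
have cl_in z : `|cl z - p| < r.
  by rewrite /cl addrC addKr; apply: le_lt_trans (clamp2_le _ r20') _; lra.
have cl_id z : `|z - p| <= r / 2 -> cl z = z.
  by move=> h; rewrite /cl clamp2_id// addrC subrK.
pose eta z := B (F (cl z) - F p) - (cl z - p).
have Blip z w : `|z - p| < r -> `|w - p| < r ->
    `|B (F z - F p) - (z - p) - (B (F w - F p) - (w - p))| <= 2^-1 * `|z - w|.
  rewrite /r !lt_min => /andP[/andP[z1 z2] _] /andP[/andP[w1 w2] _].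
  have h1 := hX z w z1 w1; have h2 := hY z w z2 w2.
  have [uX uY] := solve2 J0' h1 h2.
  have le : C * (m * `|z - w|) <= 2^-1 * `|z - w| by rewrite mulrA ler_wpM2r.
  rewrite -normrN; apply/norm_leP; split.
    apply: le_trans le; apply: le_trans uX; rewrite le_eqVlt; apply/orP; left; apply/eqP; congr `|_|.
    by rewrite /B !cE /=; ring.
  apply: le_trans le; apply: le_trans uY; rewrite le_eqVlt; apply/orP; left; apply/eqP; congr `|_|.
  by rewrite /B !cE /=; ring.
have Lip z w : `|eta z - eta w| <= 2^-1 * `|z - w|.
  apply: le_trans (Blip _ _ (cl_in z) (cl_in w)) _; rewrite ler_wpM2l//.
  by rewrite /cl opprD addrACA subrr add0r; apply: le_trans (clamp2_lip _ _ _) _; rewrite opprB addrA subrK.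
have [k [k1 k2 k3]] := lipschitz_bijective Lip.
have Psi z : `|z - p| <= r / 2 -> z + eta z = p + B (F z - F p).
  by move=> h; rewrite /eta cl_id//; apply: ptP; rewrite !cE; ring.
pose G w := k (p + B (w - F p)).
have B0 : B 0 = 0 by apply: ptP; rewrite !cE; ring.
have Gp : G (F p) = p.
  have := Psi p; rewrite subrr normr0 => /(_ r20'); rewrite subrr B0 addr0 => E.
  by rewrite /G subrr B0 addr0 -{2}(k1 p) E.
have Binj u v : B u = B v -> u = v.
  move=> E; have E1 := congr1 (@cX R) E; have E2 := congr1 (@cY R) E.
  rewrite /B !cE in E1 E2.
  have rX (w : pt) : cX w = a * (cX w * (d / J) + cY w * (- b / J)) + b * (cX w * (- c / J) + cY w * (a / J)).
    by rewrite /J; field.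
  have rY (w : pt) : cY w = c * (cX w * (d / J) + cY w * (- b / J)) + d * (cX w * (- c / J) + cY w * (a / J)).
    by rewrite /J; field.
  by apply: ptP; [rewrite (rX u) (rX v) E1 E2|rewrite (rY u) (rY v) E1 E2].
have Blin u v : B u - B v = B (u - v) by apply: ptP; rewrite /B !cE; ring.
have Bn u : `|B u| <= C * `|u|.
  have hh0 : `|cX u - (0 * a + 0 * b)| <= `|u| by rewrite !mul0r addr0 subr0 cX_le.
  have hh1 : `|cY u - (0 * c + 0 * d)| <= `|u| by rewrite !mul0r addr0 subr0 cY_le.
  by have [] := solve2 J0' hh0 hh1; rewrite !sub0r !normrN => ? ?; apply/norm_leP; rewrite !cE.
have Glip u v : `|G u - G v| <= 2 * C * `|u - v|.
  apply: le_trans (k3 _ _) _; rewrite -mulrA ler_wpM2l//.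
  by rewrite opprD addrACA subrr add0r Blin opprB addrA subrK.
have cG (u : pt) : {for u, continuous G}.
  apply: dist_continuous => e ep.
  apply/near_norm; exists (e / (2 * C + 1)).
    by rewrite divr_gt0// ltr_wpDl// mulr_ge0.
  move=> v hv; apply: le_lt_trans (Glip _ _) _; rewrite distrC.
  apply: (@le_lt_trans _ _ ((2 * C + 1) * `|v - u|)); first by rewrite ler_wpM2r// lerDl.
  by rewrite mulrC -ltr_pdivlMr// ltr_wpDl// mulr_ge0.
have near_half : \forall w \near F p, `|G w - p| < r / 2.
  have /cvgr_distC_lt := cG (F p); rewrite Gp; apply; exact: divr_gt0.
have FG w : `|G w - p| < r / 2 -> F (G w) = w.
  move=> h; have := k2 (p + B (w - F p)); rewrite -/(G w) Psi ?ltW// => /addrI/Binj.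
  by move/addIr.
exists r, G; split=> //.
  move=> z w hz hw E; have := Blip z w hz hw; rewrite E.
  move: (B _) => b0; have -> : b0 - (z - p) - (b0 - (w - p)) = - (z - w).
    by apply: ptP; rewrite !cE; ring.
  rewrite normrN.
  move=> h; apply/eqP; rewrite -subr_eq0 -normr_le0; have := normr_ge0 (z - w); lra.
pose V := interior [set w | `|G w - p| < r / 2].
have oV : open V by exact: open_interior.
have VF : V (F p) by exact: near_half.
apply: filterS (open_near oV VF) => w Vw.
have h := interior_subset Vw; split; first exact: FG.
apply: (@inverse_smooth F G V oV) => // {Vw h}w /interior_subset h.
have rr3 : r <= r3 by rewrite /r ge_min lexx orbT.
have [] := h3 (G w); first by move: h; rewrite /=; lra.
by move=> ? ?; split=> //; exact: FG.
Qed.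

Lemma lip_derive_le g p v (L : R) : derivable g p v ->
  (forall z w, `|g z - g w| <= L * `|z - w|) -> `|'D_v g p| <= L * `|v|.
Proof.
move=> dg Lg.
have : 'D_v g p \in [set x : R | `|x| <= L * `|v|].
  apply/mem_set.
  apply: (@closed_cvg _ _ (0^') _ (fun h : R => h^-1 *: ((g \o shift p) (h *: v) - g p)) (fun x : R => `|x| <= L * `|v|)) => //.
    rewrite (_ : (fun x : R => _) = (fun x : R => `|x|) @^-1` [set x : R | x <= L * `|v|]) //.
    by apply: preimage_closed => [? _|]; [exact: norm_continuous|exact: closed_le].
  near=> h; have h0 : h != 0 by near: h; exact: nbhs_dnbhs_neq.
  rewrite normrZ normfV ler_pdivrMl ?normr_gt0//.
  by apply: le_trans (Lg _ _) _; rewrite /= addrK normrZ mulrCA.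
by rewrite inE.
Unshelve. all: by end_near. Qed.

Definition plane_diffeo (K : pt -> pt) :=
  [/\ bijective K, forall p, smooth_at p K & forall p, jac K p != 0].

Lemma plane_diffeo_inv K : plane_diffeo K ->
  exists k, [/\ cancel K k, cancel k K & forall p, smooth_at p k].
Proof.
move=> [[k Kk kK] sK J0]; exists k; split; [exact: Kk|exact: kK|move=> p].
have := inverse_function (sK (k p)) (J0 (k p)); rewrite kK => -[r [G [_ _ _ _ nG]]].
apply: (smooth_at_eq _ (nbhs_singleton nG).2).
by apply: filterS nG => w [E _]; rewrite -{2}E Kk.
Qed.

Lemma derive_lin2 (a b : R) p v : 'D_v (lin2 a b) p = lin2 a b v.
Proof. by rewrite deriveE ?diff_lin //; [exact: lin2_continuous|exact/linear_differentiable/lin2_continuous]. Qed.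

Lemma derive_X p v : 'D_v (@cX R) p = cX v.
Proof.
have -> : @cX R = lin2 1 0 by apply/funext => z; rewrite /lin2 mulr1 mulr0 addr0.
exact: derive_lin2.
Qed.

Lemma derive_Y p v : 'D_v (@cY R) p = cY v.
Proof.
have -> : @cY R = lin2 0 1 by apply/funext => z; rewrite /lin2 mulr1 mulr0 add0r.
exact: derive_lin2.
Qed.

(** The norm dual to the maximum norm is the sum of absolute values; the four vertices of the unit
    square detect it. *)
Lemma norm_sum_le (a b e : R) :
  (forall v : pt, `|v| <= 1 -> `|cX v * a + cY v * b| <= e) -> `|a| + `|b| <= e.
Proof.
move=> H.
have n1 : `|1 : R| <= 1 by rewrite normr1.
have n2 : `|-1 : R| <= 1 by rewrite normrN normr1.
have K (x y : R) : `|x| <= 1 -> `|y| <= 1 -> x * a + y * b <= e.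
  move=> hx hy; apply: le_trans (ler_norm _) _.
  have := H (mk x y); rewrite !cE; apply; apply/norm_leP; by rewrite !cE.
have := K 1 1 n1 n1; have := K 1 (-1) n1 n2; have := K (-1) 1 n2 n1; have := K (-1) (-1) n2 n2.
move=> k1 k2 k3 k4; case: (ger0P a) => ?; case: (ger0P b) => ?; lra.
Qed.

(** The rows of the differential of [eta] have l^1 norm at most 1/2, so in the differential of z +
    eta z the product of the diagonal entries exceeds that of the other two. *)
Lemma near_identity (eta : pt -> pt) : (forall p, smooth_at p eta) ->
  (forall z w, `|eta z - eta w| <= 2^-1 * `|z - w|) -> plane_diffeo (fun z => z + eta z).
Proof.
move=> se L; have [k [k1 k2 _]] := lipschitz_bijective L.
have sp p : smooth_at p (fun z => z + eta z).
  apply/smooth_at_pt; have /smooth_at_pt[sX sY] := se p; split.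
    rewrite (_ : cX \o _ = @cX R \+ (cX \o eta)).
      by apply: smoothD => //; exact: smooth_X.
    by apply/funext => z; rewrite /= cE.
  rewrite (_ : cY \o _ = @cY R \+ (cY \o eta)).
    by apply: smoothD => //; exact: smooth_Y.
  by apply/funext => z; rewrite /= cE.
split=> // [|p]; first by exists k.
have /smooth_at_pt[sX sY] := se p.
have LX v : `|'D_v (cX \o eta) p| <= 2^-1 * `|v|.
  apply: lip_derive_le => [|z w]; first by apply: diff_derivable; exact: smooth_at_diff.
  by rewrite /= -cXN -cXD; apply: le_trans (cX_le _) (L z w).
have LY v : `|'D_v (cY \o eta) p| <= 2^-1 * `|v|.
  apply: lip_derive_le => [|z w]; first by apply: diff_derivable; exact: smooth_at_diff.
  by rewrite /= -cYN -cYD; apply: le_trans (cY_le _) (L z w).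
have dX v : 'D_v (cX \o (fun z => z + eta z)) p = cX v + 'D_v (cX \o eta) p.
  rewrite (_ : cX \o _ = @cX R \+ (cX \o eta)); last by apply/funext => z; rewrite /= cE.
  rewrite deriveD; first by rewrite derive_X.
    by apply: diff_derivable; apply: smooth_at_diff; exact: smooth_X.
  by apply: diff_derivable; exact: smooth_at_diff.
have dY v : 'D_v (cY \o (fun z => z + eta z)) p = cY v + 'D_v (cY \o eta) p.
  rewrite (_ : cY \o _ = @cY R \+ (cY \o eta)); last by apply/funext => z; rewrite /= cE.
  rewrite deriveD; first by rewrite derive_Y.
    by apply: diff_derivable; apply: smooth_at_diff; exact: smooth_Y.
  by apply: diff_derivable; exact: smooth_at_diff.
rewrite /jac !dX !dY !cE.
have h1 := @norm_sum_le ('D_e0 (cX \o eta) p) ('D_e1 (cX \o eta) p) 2^-1.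
have h2 := @norm_sum_le ('D_e0 (cY \o eta) p) ('D_e1 (cY \o eta) p) 2^-1.
have {}h1 : `|'D_e0 (cX \o eta) p| + `|'D_e1 (cX \o eta) p| <= 2^-1.
  apply: h1 => v v1; rewrite -smooth_deriveE//; apply: le_trans (LX v) _.
  by rewrite ler_piMr.
have {}h2 : `|'D_e0 (cY \o eta) p| + `|'D_e1 (cY \o eta) p| <= 2^-1.
  apply: h2 => v v1; rewrite -smooth_deriveE//; apply: le_trans (LY v) _.
  by rewrite ler_piMr.
suff K (a b c d : R) : `|a| + `|b| <= 2^-1 -> `|c| + `|d| <= 2^-1 ->
    (1 + a) * (1 + d) - (0 + b) * (0 + c) != 0 by exact: K h1 h2.
rewrite !add0r => {}h1 {}h2.
have h3 : b * c <= `|b| * `|c| by rewrite -normrM ler_norm.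
have h4 : - a <= `|a| by rewrite -normrN ler_norm.
have h5 : - d <= `|d| by rewrite -normrN ler_norm.
have [A0 B0 C0 D0] : [/\ 0 <= `|a|, 0 <= `|b|, 0 <= `|c| & 0 <= `|d|] by [].
rewrite gt_eqF// subr_gt0; apply: (le_lt_trans h3).
apply: (@le_lt_trans _ _ ((2^-1 - `|a|) * (2^-1 - `|d|))); first by apply: ler_pM => //; lra.
apply: (@lt_le_trans _ _ ((1 - `|a|) * (1 - `|d|))); first by lra.
by apply: ler_pM; lra.
Qed.

End Inverse.
(** * Hadamard's lemma and the Alexander trick *)

Section Hadamard.
Context {R : realType}.
Local Notation pt := 'rV[R]_2.
Local Notation mu := (@lebesgue_measure R).
Implicit Types (p q v w z : pt) (g h F : pt -> R) (r : R).

Lemma ball_compact r : compact [set z : pt | `|z| <= r].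
Proof.
apply: bounded_closed_compact.
  exists r; split; first exact: num_real.
  by move=> x rx z /= zr; apply: le_trans zr _; exact: ltW.
rewrite (_ : [set z | _] = (fun z : pt => `|z|) @^-1` [set x : R | x <= r]) //.
by apply: preimage_closed => [? _|]; [exact: norm_continuous|exact: closed_le].
Qed.

Lemma compact_bounded (T : topologicalType) (A : set T) (u : T -> R) : compact A ->
  (forall x, A x -> {for x, continuous u}) -> exists2 C : R, 0 <= C & forall x, A x -> `|u x| <= C.
Proof.
move=> cA cu.
have : compact ((fun x => `|u x|) @` A).
  apply: continuous_compact => //; apply: continuous_in_subspaceT => x /set_mem Ax.
  by apply: continuous_comp; [exact: cu|exact: norm_continuous].
move=> /compact_bounded [M [Mr hM]]; exists (`|M| + 1); first by rewrite addr_ge0.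
move=> x Ax; rewrite -[ `|u x| ]normr_id; apply: hM; last by exists x.
by rewrite ltr_pwDr// ler_norm.
Qed.

(** The weight [u ^+ k] makes the family stable under derivation: the derivative of [Iint k F] along
    v is [Iint k.+1] of the derivative of [F]. The factors in Hadamard's lemma are instances with k
    = 0. *)
Definition Iint k F z : R := \int[mu]_(u in `[0, 1]) (u ^+ k * F (u *: z)).

Lemma scale_in r z (u : R) : 0 <= u <= 1 -> `|z| < r -> `|u *: z| < r.
Proof.
move=> /andP[u0 u1] zr; rewrite normrZ ger0_norm//.
by apply: le_lt_trans zr; rewrite ler_piMl.
Qed.

Lemma Iint_cont k F z (u : R) : {for u *: z, continuous F} ->
  {for u, continuous (fun u : R => u ^+ k * F (u *: z))}.
Proof.
move=> cF; apply: continuousM; first exact: exprn_continuous.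
apply: (@continuous_comp _ _ _ (fun x : R => x *: z) F); last exact: cF.
exact: scalel_continuous.
Qed.

Lemma Iint_integrable k F z :
  (forall u : R, 0 <= u <= 1 -> {for u *: z, continuous F}) ->
  mu.-integrable `[0, 1] (EFin \o (fun u : R => u ^+ k * F (u *: z))).
Proof.
move=> cF; apply: continuous_compact_integrable; first exact: segment_compact.
apply: continuous_in_subspaceT => u /set_mem /=; rewrite in_itv /= => u01.
by apply: Iint_cont; exact: cF.
Qed.

Lemma mu01 : fine (mu `[0, 1]) = 1.
Proof. by rewrite lebesgue_measure_itv /= lte_fin ltr01 oppr0 adde0. Qed.

Lemma Iint_bound k F z (C : R) :
  (forall u : R, 0 <= u <= 1 -> {for u *: z, continuous F}) ->
  (forall u : R, 0 <= u <= 1 -> `|F (u *: z)| <= C) -> `|Iint k F z| <= C.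
Proof.
move=> cF FC; have iF := Iint_integrable k cF.
have m01 := measurable_itv (`[0, 1]%R : interval R).
apply: le_trans; first exact: (@le_normr_Rintegral _ _ _ mu _ _ (measurable_itv _) iF).
have -> : C = \int[mu]_(u in `[0, 1]) C by rewrite Rintegral_cst// mu01 mulr1.
apply: le_Rintegral => //.
- exact: integrable_norm.
- apply: continuous_compact_integrable; first exact: segment_compact.
  by apply: continuous_subspaceT => x; exact: cst_continuous.
- move=> u /=; rewrite in_itv /= => u01; rewrite normrM.
  have /andP[u0 u1] := u01.
  rewrite (le_trans _ (FC u u01))// ler_piMl// normrX exprn_ile1// ger0_norm//.
Qed.

Lemma Iint_derive r k F z v : (forall q, `|q| < r -> smooth_at q F) -> `|z| < r ->
  derivable (Iint k F) z v /\ 'D_v (Iint k F) z = Iint k.+1 ('D_v F) z.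
Proof.
move=> sF zr; pose r' := (`|z| + r) / 2.
have zr' : `|z| < r' by rewrite /r'; lra.
have r'r : r' < r by rewrite /r'; lra.
have [C C0 hC] : exists2 C : R, 0 <= C & forall q, `|q| <= r' -> `|'D_v F q| <= C.
  apply: (compact_bounded (@ball_compact r')) => q /= qr'.
  apply: smooth_at_continuous; apply: smooth_at_derive; apply: sF.
  exact: le_lt_trans r'r.
(* For |h| < d the point z + h v stays within radius r' < r, where the derivative is bounded by [C]:
   this is the domination needed to differentiate under the integral. *)
pose d := (r' - `|z|) / (`|v| + 1).
have d0 : 0 < d by rewrite divr_gt0 ?subr_gt0// ltr_wpDl.
have near_in (h : R) : `|h| < d -> `|z + h *: v| < r'.
  move=> hd; apply: le_lt_trans (ler_normD _ _) _; rewrite -ltrBrDl normrZ.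
  apply: (@le_lt_trans _ _ (`|h| * (`|v| + 1))); first by rewrite ler_wpM2l// lerDl.
  by rewrite -ltr_pdivlMr// ltr_wpDl.
pose f (h u : R) := u ^+ k * F (u *: (z + h *: v)).
have itv (h : R) : (`]- d, d[%classic h : Prop) -> `|h| < d.
  by rewrite /= in_itv /= ltr_norml.
have m01 := measurable_itv (`[0, 1]%R : interval R).
have df (h u : R) : `|h| < d -> 0 <= u <= 1 ->
    is_derive h (1 : R) (f^~ u) (u ^+ k.+1 * 'D_v F (u *: (z + h *: v))).
  move=> hd u01.
  have sq : smooth_at (u *: (z + h *: v)) F.
    by apply: sF; apply: scale_in => //; apply: lt_trans r'r; exact: near_in.
  have E : u *: (z + h *: v) = u *: z + h *: (u *: v) by rewrite scalerDr !scalerA mulrC.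
  have D := @line_is_derive R R^o F (u *: z) (u *: v) h.
  rewrite -E in D; have {}D := D (diff_derivable (smooth_at_diff sq)).
  have [_ Es] := scale_dir u (diff_derivable (smooth_at_diff sq) : derivable F _ v).
  rewrite Es in D.
  have := is_deriveM (is_derive_cst (u ^+ k) h (1 : R)) D.
  rewrite scaler0 addr0.
  have -> : cst (u ^+ k) * (fun t : R => F (u *: z + t *: (u *: v))) = f^~ u.
    apply/funext => t; rewrite -[LHS]/(u ^+ k * F (u *: z + t *: (u *: v))) /f.
    by rewrite scalerDr !scalerA [t * u]mulrC.
  by move/is_derive_eq; apply; rewrite exprSr -mulrA.
have a0 : `]- d, d[%classic (0 : R) by rewrite /= in_itv /= oppr_lt0 d0.
have int_f (h : R) : `]- d, d[%classic h -> mu.-integrable `[0, 1] (EFin \o f h).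
  move=> /itv hd; apply: Iint_integrable => u u01.
  apply: smooth_at_continuous; apply: sF; apply: scale_in => //.
  by apply: lt_trans r'r; exact: near_in.
have der_f (h u : R) : `]- d, d[%classic h -> `[0, 1]%classic u -> derivable (f^~ u) h 1.
  by move=> /itv hd; rewrite /= in_itv /= => u01; have [] := df h u hd u01.
have int_C : mu.-integrable `[0, 1] (EFin \o cst C).
  apply: continuous_compact_integrable; first exact: segment_compact.
  by apply: continuous_subspaceT => x; exact: cst_continuous.
have pf (h u : R) : `]- d, d[%classic h -> `[0, 1]%classic u ->
    partial1of2 f h u = u ^+ k.+1 * 'D_v F (u *: (z + h *: v)).
  move=> /itv hd; rewrite /= in_itv /= => u01; rewrite partial1of2E.
  by have [_ ->] := df h u hd u01.
have ub (h u : R) : `]- d, d[%classic h -> `[0, 1]%classic u -> `|partial1of2 f h u| <= C.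
  move=> hd u01; rewrite pf// normrM; move: u01; rewrite /= in_itv /= => /andP[u0 u1].
  have h1 : `|'D_v F (u *: (z + h *: v))| <= C.
    by apply: hC; apply: ltW; apply: scale_in; [rewrite u0|exact/near_in/itv].
  by rewrite (le_trans _ h1)// ler_piMl// normrX exprn_ile1// ger0_norm.
have D1 := @derivable_under_integral _ _ _ mu f _ (measurable_itv _) 0 _ _ a0 int_f der_f _ (fun _ => C0) int_C ub.
have D2 := @differentiation_under_integral _ _ _ mu f _ (measurable_itv _) 0 _ _ a0 int_f der_f _ (fun _ => C0) int_C ub.
have EI : (fun h : R => \int[mu]_(u in `[0, 1]) f h u) = (fun h : R => Iint k F (h *: v + z)).
  by apply/funext => h; rewrite /f [h *: v + z]addrC.
rewrite EI in D1 D2.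
have dI : derivable (Iint k F) z v by apply/derivable1P.
split=> //.
have := @line_is_derive R R^o (Iint k F) z v 0; rewrite scale0r addr0 => /(_ dI) [_ <-].
rewrite (_ : (fun t : R => Iint k F (z + t *: v)) = (fun h : R => Iint k F (h *: v + z))).
  rewrite -derive1E D2; apply: eq_Rintegral => u /set_mem u01.
  by rewrite pf// scale0r addr0.
by apply/funext => t; rewrite addrC.
Qed.

(** Directional derivatives alone do not give continuity; with a bound on the gradient, the mean
    value theorem turns them into a Lipschitz estimate. *)
Lemma Iint_continuous r k F z : (forall q, `|q| < r -> smooth_at q F) -> `|z| < r ->
  {for z, continuous (Iint k F)}.
Proof.
move=> sF zr; pose r' := (`|z| + r) / 2.
have zr' : `|z| < r' by rewrite /r'; lra.
have r'r : r' < r by rewrite /r'; lra.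
have sD v q : `|q| <= r' -> smooth_at q ('D_v F).
  by move=> qr'; apply: smooth_at_derive; apply: sF; exact: le_lt_trans r'r.
have B v : exists2 C : R, 0 <= C & forall q, `|q| <= r' -> `|'D_v F q| <= C.
  by apply: (compact_bounded (@ball_compact r')) => q /= /sD-/(_ v)/smooth_at_continuous.
have [C0 C0p hC0] := B e0; have [C1 C1p hC1] := B e1.
have L w : `|w| < r' -> `|Iint k F z - Iint k F w| <= (C0 + C1) * `|z - w|.
  move=> wr'.
  have seg (t : R) : 0 <= t <= 1 -> `|w + t *: (z - w)| < r'.
    move=> /andP[t0 t1]; have -> : w + t *: (z - w) = (1 - t) *: w + t *: z.
      by apply: ptP; rewrite !cE; ring.
    apply: le_lt_trans (ler_normD _ _) _; rewrite !normrZ (ger0_norm t0) ger0_norm ?subr_ge0//.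
    move: zr' wr'; move: `|z| `|w| => A B0 hA hB.
    by have [t12|t12] := leP t 2^-1; nra.
  have seg' t (t01 : 0 <= t <= 1) := lt_trans (seg t t01) r'r.
  have [t t01] := line_mvt (fun t t01 => (Iint_derive k (z - w) sF (seg' t t01)).1).
  rewrite [w + (z - w)]addrC subrK => ->; rewrite (Iint_derive k (z - w) sF (seg' t t01)).2.
  apply: Iint_bound => u u01.
    apply: smooth_at_continuous; apply: sD; apply: ltW; apply: scale_in => //; exact: seg.
  have sr : `|u *: (w + t *: (z - w))| < r' by apply: scale_in => //; exact: seg.
  rewrite smooth_deriveE; last by apply: sF; exact: lt_trans r'r.
  apply: le_trans (ler_normD _ _) _; rewrite !normrM mulrDl; apply: lerD.
    by rewrite mulrC ler_pM// ?cX_le// hC0// ltW.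
  by rewrite mulrC ler_pM// ?cY_le// hC1// ltW.
apply: dist_continuous => e ep.
have r'z : 0 < r' - `|z| by rewrite subr_gt0.
apply/near_norm; exists (Num.min (r' - `|z|) (e / (C0 + C1 + 1))).
  by rewrite lt_min r'z divr_gt0// ltr_wpDl// addr_ge0.
move=> w; rewrite lt_min => /andP[wz we].
have wr' : `|w| < r'.
  by rewrite -(subrK z w); apply: le_lt_trans (ler_normD _ _) _; lra.
apply: le_lt_trans (L w wr') _; rewrite distrC.
apply: (@le_lt_trans _ _ ((C0 + C1 + 1) * `|w - z|)); first by rewrite ler_wpM2r// lerDl.
by rewrite mulrC -ltr_pdivlMr// ltr_wpDl// addr_ge0.
Qed.

Lemma Iint_smooth r k F z : (forall q, `|q| < r -> smooth_at q F) -> `|z| < r ->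
  smooth_at z (Iint k F).
Proof.
move=> sF zr.
have oU : open [set q : pt | `|q| < r].
  rewrite (_ : [set q : pt | _] = (fun z : pt => `|z|) @^-1` [set x : R | x < r]) //.
  by apply: open_comp => [? _|]; [exact: norm_continuous|exact: open_lt].
have E vs : forall k F, (forall q, `|q| < r -> smooth_at q F) -> forall q, `|q| < r ->
    iter_derive vs (Iint k F) q = Iint (size vs + k) (iter_derive vs F) q.
  elim: vs => [//|v vs IH] j G sG q qr /=.
  rewrite addSnnS -IH//; last by move=> ? ?; apply: smooth_at_derive; exact: sG.
  by apply: (iter_derive_eq oU) => // w wr; rewrite (Iint_derive j v sG wr).2.
have sD vs q : `|q| < r -> smooth_at q (iter_derive vs F).
  by elim: vs F sF {E} => [|v vs IH] F sF qr; [exact: sF|apply: IH => // ? ?; apply: smooth_at_derive; exact: sF].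
apply: filterS (open_near oU zr) => q qr vs.
have En : \forall w \near q, Iint (size vs + k) (iter_derive vs F) w = iter_derive vs (Iint k F) w.
  by apply: filterS (open_near oU qr) => w wr; rewrite E.
have sD' w : `|w| < r -> smooth_at w (iter_derive vs F) := @sD vs w.
split=> [v|].
  by apply: (eq_near_derivable En); exact: (Iint_derive _ v sD' qr).1.
by apply: (eq_near_continuous En); exact: Iint_continuous sD' qr.
Qed.

Lemma hadamard g : smooth_at 0 g -> g 0 = 0 -> exists h0 h1 : pt -> R,
  [/\ smooth_at 0 h0, smooth_at 0 h1, h0 0 = 'D_e0 g 0, h1 0 = 'D_e1 g 0 &
   \forall z \near (0 : pt), g z = cX z * h0 z + cY z * h1 z].
Proof.
move=> sg g0.
have [r r0 hr] : exists2 r : R, 0 < r & forall q, `|q| < r -> smooth_at q g.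
  have [r r0 hr] := (near_norm _ _).1 (smooth_at_near sg).
  by exists r => // q qr; apply: hr; rewrite subr0.
have sD v q : `|q| < r -> smooth_at q ('D_v g) by move=> /hr; exact: smooth_at_derive.
have n0 : `|0 : pt| < r by rewrite normr0.
have I0 v : Iint 0 ('D_v g) 0 = 'D_v g 0.
  rewrite /Iint (_ : (fun u : R => _) = cst ('D_v g 0)); last first.
    by apply/funext => u; rewrite scaler0 expr0 mul1r.
  by rewrite Rintegral_cst ?mu01 ?mulr1//; exact: measurable_itv.
exists (Iint 0 ('D_e0 g)), (Iint 0 ('D_e1 g)); split.
- exact: Iint_smooth (sD e0) n0.
- exact: Iint_smooth (sD e1) n0.
- exact: I0.
- exact: I0.
apply/near_norm; exists r => // z; rewrite subr0 => zr.
pose phi (u : R) := g (u *: z).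
have D (u : R) : 0 <= u <= 1 -> is_derive u (1 : R) phi ('D_z g (u *: z)).
  move=> u01; have := @line_is_derive R R^o g 0 z u; rewrite add0r.
  rewrite (_ : (fun t : R => g (0 + t *: z)) = phi); last by apply/funext => t; rewrite add0r.
  by apply; apply: diff_derivable; apply: smooth_at_diff; apply: hr; exact: scale_in.
have cphi (u : R) : 0 <= u <= 1 -> {for u, continuous phi}.
  by move=> /D[d _]; apply: differentiable_continuous; exact/derivable1_diffP.
have c' (v : pt) (u : R) : 0 <= u <= 1 -> {for u *: z, continuous ('D_v g)}.
  by move=> u01; apply: smooth_at_continuous; apply: sD; exact: scale_in.
have F1 := @continuous_FTC2 R (fun u : R => 'D_z g (u *: z)) phi 0 1 ltr01.
have {F1} : (\int[mu]_(x in `[0%R, 1%R]) ('D_z g (x *: z))%:E)%E = ((phi 1)%:E - (phi 0)%:E)%E.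
  apply: F1.
  - apply: continuous_in_subspaceT => u /set_mem /=; rewrite in_itv /= => u01.
    have := @Iint_cont 0 ('D_z g) z u (c' z u u01).
    by rewrite (_ : (fun u : R => _) = (fun u : R => 'D_z g (u *: z))) //; apply/funext => t; rewrite expr0 mul1r.
  - split.
    + by move=> u; rewrite in_itv /= => /andP[u0 u1]; have [] := D u; rewrite ?ltW.
    + by apply: cvg_at_right_filter; apply: cphi; rewrite lexx ler01.
    + by apply: cvg_at_left_filter; apply: cphi; rewrite lexx ler01.
  - by move=> u; rewrite in_itv /= => /andP[u0 u1]; rewrite derive1E; have [|_ ->] := D u; rewrite ?ltW.
rewrite /phi scale1r scale0r g0 -EFinB subr0 => F2.
have -> : g z = \int[mu]_(u in `[0, 1]) 'D_z g (u *: z) by rewrite /Rintegral F2.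
rewrite /Iint -!RintegralZl; try exact: measurable_itv.
- rewrite -RintegralD; try exact: measurable_itv.
  + apply: eq_Rintegral => u /set_mem; rewrite /= in_itv /= => u01.
    by rewrite !expr0 !mul1r (smooth_deriveE z (hr _ (scale_in u01 zr))).
  + rewrite (_ : (fun x => _) = (fun u : R => u ^+ 0 * (fun q => cX z * 'D_e0 g q) (u *: z))).
      apply: (@Iint_integrable 0 (fun q => cX z * 'D_e0 g q) z) => u u01.
      by apply: (@continuousM _ _ (cst (cX z)) ('D_e0 g)); [exact: cst_continuous|exact: c'].
    by apply/funext => u; rewrite mulrCA.
  + rewrite (_ : (fun x => _) = (fun u : R => u ^+ 0 * (fun q => cY z * 'D_e1 g q) (u *: z))).
      apply: (@Iint_integrable 0 (fun q => cY z * 'D_e1 g q) z) => u u01.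
      by apply: (@continuousM _ _ (cst (cY z)) ('D_e1 g)); [exact: cst_continuous|exact: c'].
    by apply/funext => u; rewrite mulrCA.
- by apply: (@Iint_integrable 0 ('D_e1 g)) => u; exact: c'.
- by apply: (@Iint_integrable 0 ('D_e0 g)) => u; exact: c'.
Qed.

End Hadamard.
Opaque smooth_at.

(** * Compactly supported extensions of germs *)

Section Lipschitz.
Context {R : realType}.
Local Notation pt := 'rV[R]_2.
Implicit Types (p q v w z : pt) (g h : pt -> R) (r d : R).

Lemma lip_near g p : smooth_at p g -> exists C r : R, [/\ 0 <= C, 0 < r &
  forall z w, `|z - p| < r -> `|w - p| < r -> `|g z - g w| <= C * `|z - w|].
Proof.
move=> sg; have [r r0 hr] := strict_diff sg ltr01.
exists (`|'D_e0 g p : R| + `|'D_e1 g p : R| + 1), r; split=> [||z w hz hw]; first by rewrite !addr_ge0//.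
  exact: r0.
have := hr z w hz hw; rewrite mul1r => h.
have : `|lin2 ('D_e0 g p) ('D_e1 g p) (z - w)| <= (`|'D_e0 g p : R| + `|'D_e1 g p : R|) * `|z - w|.
  apply: le_trans (ler_normD _ _) _; rewrite !normrM mulrDl.
  by rewrite ![_ * `|z - w|]mulrC lerD// ler_wpM2r// ?cX_le ?cY_le.
move=> h'; rewrite [leRHS]mulrDl mul1r -[g z - g w](subrK (lin2 ('D_e0 g p) ('D_e1 g p) (z - w))).
by apply: le_trans (ler_normD _ _) _; rewrite addrC lerD.
Qed.

Lemma lip_ball g r : (forall p, `|p| <= r -> smooth_at p g) -> exists2 C : R, 0 <= C &
  forall z w, `|z| <= r -> `|w| <= r -> `|g z - g w| <= C * `|z - w|.
Proof.
move=> sg.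
have B v : exists2 C : R, 0 <= C & forall q, `|q| <= r -> `|'D_v g q| <= C.
  have := @compact_bounded R _ _ ('D_v g) (@ball_compact R r); apply => q /= /sg sq.
  by apply: smooth_at_continuous; exact: smooth_at_derive.
have [C0 C0p hC0] := B e0; have [C1 C1p hC1] := B e1.
exists (C0 + C1) => [|z w hz hw]; first exact: addr_ge0.
have seg (t : R) : 0 <= t <= 1 -> `|w + t *: (z - w)| <= r.
  move=> /andP[t0 t1]; have -> : w + t *: (z - w) = (1 - t) *: w + t *: z.
    by apply: ptP; rewrite !cE; ring.
  apply: le_trans (ler_normD _ _) _; rewrite !normrZ (ger0_norm t0) ger0_norm ?subr_ge0//.
  by move: hz hw; move: `|z| `|w| => A B0 hA hB; nra.
have dg (t : R) : 0 <= t <= 1 -> derivable g (w + t *: (z - w)) (z - w).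
  by move=> /seg/sg s; apply: diff_derivable; exact: smooth_at_diff.
have [t t01] := line_mvt dg.
rewrite [w + (z - w)]addrC subrK => ->; have h := seg t t01.
rewrite smooth_deriveE; last exact: sg.
apply: le_trans (ler_normD _ _) _; rewrite !normrM mulrDl; apply: lerD.
  by rewrite mulrC ler_pM// ?cX_le// hC0.
by rewrite mulrC ler_pM// ?cY_le// hC1.
Qed.

Lemma lip_prod (a b : pt -> R) (A B La Lb : R) z w :
  `|a z| <= A -> `|b w| <= B -> `|a z - a w| <= La * `|z - w| ->
  `|b z - b w| <= Lb * `|z - w| -> 0 <= La -> 0 <= Lb ->
  `|a z * b z - a w * b w| <= (A * Lb + B * La) * `|z - w|.
Proof.
move=> hA hB hLa hLb La0 Lb0.
have -> : a z * b z - a w * b w = a z * (b z - b w) + b w * (a z - a w) by ring.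
apply: le_trans (ler_normD _ _) _; rewrite !normrM mulrDl -!mulrA.
by apply: lerD; apply: ler_pM.
Qed.

Lemma le_sum4 (a b c d : R) : 0 <= a -> 0 <= b -> 0 <= c -> 0 <= d ->
  [/\ a <= a + b + c + d, b <= a + b + c + d, c <= a + b + c + d & d <= a + b + c + d].
Proof. by move=> *; split; lra. Qed.

Lemma mk_dist_le (x y x' y' e : R) : `|x - x'| <= e -> `|y - y'| <= e ->
  `|mk x y - mk x' y'| <= e.
Proof. by move=> hx hy; apply/norm_leP; rewrite !cE. Qed.

Lemma clamp2_ge r z : 0 < r -> r <= `|z| -> r <= `|clamp2 r z|.
Proof.
move=> r0 rz; rewrite leNgt; apply/negP => /norm_ltP; rewrite !cE => -[hX hY].
have K (x : R) : `|clamp r x| < r -> `|x| < r.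
  move=> h; rewrite ltNge; apply/negP; rewrite ler_normr.
  move: h; rewrite ltr_norml /clamp => /andP[h1 h2] /orP[] h3.
    by move: h2; rewrite min_l// max_r ?ltxx//; lra.
  by move: h1; rewrite min_r ?max_l ?ltxx//; lra.
by have : `|z| < r; [apply/norm_ltP; split; exact: K|rewrite ltNge rz].
Qed.

Lemma cutoff_scale r p : 0 < r -> cutoff r p = cutoff 1 (r^-1 *: p).
Proof.
move=> r0; rewrite /cutoff !cE; congr (step _).
by field; rewrite gt_eqF.
Qed.

(** [cutoff r] is a rescaling of [cutoff 1], so one [Z] serves all radii. Then the cut-off times a
    function of size [r] with bounded Lipschitz constant is Lipschitz uniformly in [r]. *)
Lemma cutoff_lip : exists2 Z : R, 0 <= Z & forall r z w, 0 < r ->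
  `|cutoff r z - cutoff r w| <= Z / r * `|z - w|.
Proof.
have [Z Z0 hZ] := @lip_ball (cutoff 1) 1 (fun p _ => smooth_cutoff 1 p).
exists Z => [|r z w r0]; first exact: Z0.
rewrite (cutoff_scale z r0) (cutoff_scale w r0).
have C (p : pt) : cutoff 1 p = cutoff 1 (clamp2 1 p).
  have [h|h] := leP `|p| 1; first by rewrite clamp2_id.
  by rewrite !cutoff0// ?clamp2_ge// ltW.
rewrite C [cutoff 1 (r^-1 *: w)]C.
apply: le_trans (hZ _ _ _ _) _; rewrite ?clamp2_le// -mulrA ler_wpM2l//.
apply: le_trans (clamp2_lip _ _ _) _.
by rewrite -scalerBr normrZ gtr0_norm// invr_gt0.
Qed.

(** The identity near 0 and 0 far away, with values in the ball of radius [d] and a Lipschitz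
    constant independent of [d]: composition with it makes a function near 0 global. *)
Definition shrink d z : pt := cutoff d z *: z.

Lemma shrink_clamp d z : 0 < d -> shrink d z = cutoff d z *: clamp2 d z.
Proof.
move=> d0; rewrite /shrink; have [h|h] := leP `|z| d; first by rewrite clamp2_id.
by rewrite cutoff0 ?ltW// !scale0r.
Qed.

Lemma shrink_le d z : 0 < d -> `|shrink d z| <= d /\ `|shrink d z| <= `|z|.
Proof.
move=> d0; have /andP[b0 b1] := cutoff01 d z; split.
  rewrite shrink_clamp// normrZ ger0_norm//.
  by apply: le_trans (clamp2_le z (ltW d0)); rewrite ler_piMl.
by rewrite normrZ ger0_norm// ler_piMl.
Qed.

Lemma shrink_lip : exists2 Z : R, 0 <= Z & forall d z w, 0 < d ->
  `|shrink d z - shrink d w| <= Z * `|z - w|.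
Proof.
have [Z Z0 hZ] := cutoff_lip; exists (1 + Z) => [|d z w d0]; first exact: addr_ge0.
have /andP[b0 b1] := cutoff01 d z.
have Zd : 0 <= Z / d by rewrite divr_ge0// ltW.
have K (a : pt -> R) : (forall z, `|a z| <= d) -> (forall z w, `|a z - a w| <= `|z - w|) ->
    `|cutoff d z * a z - cutoff d w * a w| <= (1 + Z) * `|z - w|.
  move=> ad al.
  apply: le_trans (@lip_prod (cutoff d) a 1 d (Z / d) 1 z w _ _ _ _ _ _) _ => //.
  - by rewrite ger0_norm.
  - exact: hZ.
  - by rewrite mul1r.
  - by rewrite mulr1 mulrCA divff ?mulr1// gt_eqF.
rewrite !shrink_clamp//; apply/norm_leP; rewrite !cE; split;
  [apply: (K (fun p => clamp d (cX p))) => [p|p q]|apply: (K (fun p => clamp d (cY p))) => [p|p q]].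
- by apply: clamp_le; exact: ltW.
- by apply: le_trans (clamp_lip _ _ _) _; rewrite -cXN -cXD cX_le.
- by apply: clamp_le; exact: ltW.
- by apply: le_trans (clamp_lip _ _ _) _; rewrite -cYN -cYD cY_le.
Qed.

Lemma smooth_shrink d z : smooth_at z (shrink d).
Proof.
apply/smooth_at_pt; split.
  rewrite (_ : cX \o _ = cutoff d \* @cX R); last by apply/funext => p; rewrite /= cE.
  by apply: smoothM; [exact: smooth_cutoff|exact: smooth_X].
rewrite (_ : cY \o _ = cutoff d \* @cY R); last by apply/funext => p; rewrite /= cE.
by apply: smoothM; [exact: smooth_cutoff|exact: smooth_Y].
Qed.

(* Alexander trick: [K z = g (t z) / t], where [t] decreases from 1 near the
   origin to 0 far away and the value at [t = 0] is the differential of [g] at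
   the origin; hence [K] preserves every homogeneous function that [g] does. *)
Lemma alexander (g : pt -> pt) (rho delta : R) : smooth_at 0 g -> g 0 = 0 ->
  (forall v, 'D_v (cX \o g) 0 = cX v) -> (forall v, 'D_v (cY \o g) 0 = cY v) ->
  0 < rho -> 0 < delta ->
  exists K : pt -> pt, [/\ plane_diffeo K, \forall z \near (0 : pt), K z = g z,
    forall z, rho <= `|z| -> K z = z &
    forall z, K z = z \/ exists t : R, [/\ 0 < t, `|t *: z| < delta & K z = t^-1 *: g (t *: z)]].
Proof.
move=> sg g0 dX dY rho0 delta0; have /smooth_at_pt[sX sY] := sg.
have H (l : pt -> R) (dl : forall v, 'D_v l 0 = l v) (sl : smooth_at 0 l) (l0 : l 0 = 0)
    (u : pt -> R) (su : smooth_at 0 u) (u0 : u 0 = 0) (du : forall v, 'D_v u 0 = l v) :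
  exists h0 h1 : pt -> R, [/\ smooth_at 0 h0, smooth_at 0 h1, h0 0 = 0, h1 0 = 0 &
    \forall z \near (0 : pt), u z - l z = cX z * h0 z + cY z * h1 z].
  have Dq v : 'D_v (fun z => u z - l z) 0 = 0.
    have E := @deriveB _ _ _ u l (0 : pt) v.
    rewrite [LHS]E ?du ?dl ?subrr//; by apply: diff_derivable; exact: smooth_at_diff.
  have [h0 [h1 [s0 s1 e0 e1 E]]] := hadamard (smoothB su sl) (etrans (congr2 _ u0 (congr1 _ l0)) (subrr 0)).
  by exists h0, h1; split=> //; [rewrite e0 Dq|rewrite e1 Dq].
have gX0 : (cX \o g) 0 = 0 by rewrite /= g0 cX0.
have gY0 : (cY \o g) 0 = 0 by rewrite /= g0 cY0.
have [a0 [a1 [sa0 sa1 a00 a10 Ea]]] := H _ (derive_X 0) (smooth_X 0) cX0 _ sX gX0 dX.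
have [b0 [b1 [sb0 sb1 b00 b10 Eb]]] := H _ (derive_Y 0) (smooth_Y 0) cY0 _ sY gY0 dY.
have Lk (k : pt -> R) : smooth_at 0 k -> k 0 = 0 -> exists C r : R, [/\ 0 <= C, 0 < r &
    forall z, `|z| < r -> smooth_at z k /\ forall w, `|w| < r -> `|k z - k w| <= C * `|z - w|].
  move=> sk k0; have [C [r [C0 r0 h]]] := lip_near sk.
  have [r' r'0 h'] := (near_norm _ _).1 (smooth_at_near sk).
  exists C, (Num.min r r'); split=> //; first by rewrite lt_min r0 r'0.
  move=> z; rewrite lt_min => /andP[zr zr']; split; first by apply: h'; rewrite subr0.
  by move=> w; rewrite lt_min => /andP[wr _]; apply: h; rewrite subr0.
have [C1 [r1 [C10 r10 h1]]] := Lk a0 sa0 a00.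
have [C2 [r2 [C20 r20 h2]]] := Lk a1 sa1 a10.
have [C3 [r3 [C30 r30 h3]]] := Lk b0 sb0 b00.
have [C4 [r4 [C40 r40 h4]]] := Lk b1 sb1 b10.
have [r5 r50 h5] := (near_norm _ _).1 (filterI Ea Eb).
have [Z Z0 hZ] := shrink_lip.
pose C := C1 + C2 + C3 + C4; have C0 : 0 <= C by rewrite !addr_ge0.
pose r := Num.min (Num.min (Num.min r1 r2) (Num.min r3 r4)) (Num.min r5 (Num.min rho delta)).
have r0 : 0 < r by rewrite !lt_min r10 r20 r30 r40 r50 rho0 delta0.
(* A coordinate, at most [d] where the other factor does not vanish, times a [C]-Lipschitz function
   vanishing at 0 has, after shrinking, Lipschitz constant at most d C (Z + 1). The second bound on
   [d] makes this at most 1/4, so that [eta] is 1/2-Lipschitz. *)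
pose d := Num.min (r / 2) (1 / (4 * (C * (Z + 1) + 1))).
have CZ : 0 <= C * (Z + 1) by rewrite mulr_ge0// addr_ge0.
have d0 : 0 < d by rewrite lt_min !divr_gt0// mulr_gt0// ltr_wpDl.
have dr : d < r by apply: (@le_lt_trans _ _ (r / 2)); [rewrite ge_min lexx|lra].
have dC : d * (C * (Z + 1)) <= 4^-1.
  have : d * (4 * (C * (Z + 1) + 1)) <= 1.
    by rewrite -ler_pdivlMr ?mulr_gt0 ?ltr_wpDl// ge_min lexx orbT.
  by lra.
(* With t = [cutoff d z] this is a coordinate of t^-1 g(t z) - z, written through Hadamard's lemma
   without division by t, hence smooth also where t = 0. *)
pose k (c0 c1 : pt -> R) z := cX z * c0 (shrink d z) + cY z * c1 (shrink d z).
pose eta z := mk (k a0 a1 z) (k b0 b1 z).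
have sh z : `|shrink d z| < r by apply: le_lt_trans dr; case: (shrink_le z d0).
have [R1 R2 R3 R4] : [/\ r <= r1, r <= r2, r <= r3 & r <= r4].
  by rewrite /r !ge_min !lexx /= ?orbT.
have [R5 R6 R7] : [/\ r <= r5, r <= rho & r <= delta] by rewrite /r !ge_min !lexx /= ?orbT.
have sk (c0 c1 : pt -> R) z : (forall q, `|q| < r -> smooth_at q c0 /\ smooth_at q c1) -> smooth_at z (k c0 c1).
  move=> sc; have [s0 s1] := sc _ (sh z).
  apply: (@smoothD _ _ (@cX R \* (c0 \o shrink d)) (@cY R \* (c1 \o shrink d))); apply: smoothM.
  - exact: smooth_X.
  - by apply: smooth_comp; [exact: smooth_shrink|].
  - exact: smooth_Y.
  - by apply: smooth_comp; [exact: smooth_shrink|].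
have seta z : smooth_at z eta.
  apply: smooth_mk; apply: sk => q qr; split.
  - by have [] := h1 q (lt_le_trans qr R1).
  - by have [] := h2 q (lt_le_trans qr R2).
  - by have [] := h3 q (lt_le_trans qr R3).
  - by have [] := h4 q (lt_le_trans qr R4).
have n0 : `|0 : pt| < r by rewrite normr0.
have lk (c : pt -> R) (l : pt -> R) Cc z w : c 0 = 0 -> 0 <= Cc ->
   (forall q q', `|q| < r -> `|q'| < r -> `|c q - c q'| <= Cc * `|q - q'|) ->
   (forall q, `|l q| <= `|q|) -> (forall q q', `|l q - l q'| <= `|q - q'|) ->
   (forall q, l (clamp2 d q) = clamp d (l q)) ->
   `|l z * c (shrink d z) - l w * c (shrink d w)| <= (d * (Cc * (Z + 1))) * `|z - w|.
  move=> c0 Cc0 Lc ll ll' lcl.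
  have E q : l q * c (shrink d q) = clamp d (l q) * c (shrink d q).
    have [h|h] := leP `|q| d; first by rewrite clamp_id// (le_trans (ll q)).
    by rewrite {1 2}/shrink cutoff0 ?ltW// scale0r c0 !mulr0.
  rewrite !E; have := @lip_prod (fun q => clamp d (l q)) (fun q => c (shrink d q)) d (Cc * d) 1 (Cc * Z) z w.
  have -> : d * (Cc * Z) + Cc * d * 1 = d * (Cc * (Z + 1)) by ring.
  apply=> //.
  - by apply: clamp_le; exact: ltW.
  - have := Lc (shrink d w) 0 (sh w) n0; rewrite c0 !subr0 => h; apply: le_trans h _.
    by rewrite ler_wpM2l//; case: (shrink_le w d0).
  - by rewrite mul1r; apply: le_trans (clamp_lip _ _ _) _.
  - by apply: le_trans (Lc _ _ (sh z) (sh w)) _; rewrite -mulrA ler_wpM2l// hZ.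
  - exact: mulr_ge0.
have lX (q q' : pt) : `|cX q - cX q'| <= `|q - q'| by rewrite -cXN -cXD cX_le.
have lY (q q' : pt) : `|cY q - cY q'| <= `|q - q'| by rewrite -cYN -cYD cY_le.
have Lk2 (c0 c1 : pt -> R) D0 D1 z w : c0 0 = 0 -> c1 0 = 0 -> 0 <= D0 -> 0 <= D1 ->
   D0 <= C -> D1 <= C ->
   (forall q q', `|q| < r -> `|q'| < r -> `|c0 q - c0 q'| <= D0 * `|q - q'|) ->
   (forall q q', `|q| < r -> `|q'| < r -> `|c1 q - c1 q'| <= D1 * `|q - q'|) ->
   `|k c0 c1 z - k c0 c1 w| <= 2^-1 * `|z - w|.
  move=> c00 c10 D00 D10 D0C D1C l0 l1.
  have e0 := @lk c0 (@cX R) D0 z w c00 D00 l0 (@cX_le R) lX (fun q => cX_mk _ _).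
  have e1 := @lk c1 (@cY R) D1 z w c10 D10 l1 (@cY_le R) lY (fun q => cY_mk _ _).
  rewrite /k opprD addrACA; apply: le_trans (ler_normD _ _) _.
  have q0 : d * (D0 * (Z + 1)) <= 4^-1.
    apply: le_trans dC; rewrite ler_wpM2l//; first exact: ltW.
    by rewrite ler_wpM2r// addr_ge0.
  have q1 : d * (D1 * (Z + 1)) <= 4^-1.
    apply: le_trans dC; rewrite ler_wpM2l//; first exact: ltW.
    by rewrite ler_wpM2r// addr_ge0.
  have n := normr_ge0 (z - w); nra.
have Leta z w : `|eta z - eta w| <= 2^-1 * `|z - w|.
  have [q1 q2 q3 q4] : [/\ C1 <= C, C2 <= C, C3 <= C & C4 <= C].
    exact: le_sum4.
  apply: mk_dist_le.
    apply: (Lk2 a0 a1 C1 C2 z w a00 a10 C10 C20 q1 q2) => q q' qr qr'.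
      by have [_] := h1 q (lt_le_trans qr R1); apply; exact: lt_le_trans R1.
    by have [_] := h2 q (lt_le_trans qr R2); apply; exact: lt_le_trans R2.
  apply: (Lk2 b0 b1 C3 C4 z w b00 b10 C30 C40 q3 q4) => q q' qr qr'.
    by have [_] := h3 q (lt_le_trans qr R3); apply; exact: lt_le_trans R3.
  by have [_] := h4 q (lt_le_trans qr R4); apply; exact: lt_le_trans R4.
have dlt z : 0 < cutoff d z -> `|z| < d.
  by move=> h; rewrite ltNge; apply/negP => dz; rewrite cutoff0 ?ltxx in h.
exists (fun z => z + eta z); split.
- exact: near_identity.
- apply/near_norm; exists (d / 2) => [|z]; first exact: divr_gt0.
  rewrite subr0 => zd; have cz1 : cutoff d z = 1 by apply: cutoff1 => //; exact: ltW.
  have [] := h5 z; first by rewrite subr0; lra.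
  move=> E1 E2; apply: ptP; rewrite !cE /k /shrink cz1 scale1r.
    by rewrite -E1 /= addrC subrK.
  by rewrite -E2 /= addrC subrK.
- move=> z rz; have s0 : shrink d z = 0 by rewrite /shrink cutoff0 ?scale0r//; lra.
  by apply: ptP; rewrite !cE /k s0 ?a00 ?a10 ?b00 ?b10 !mulr0 !addr0.
move=> z; have /andP[] := cutoff01 d z; rewrite le_eqVlt => /predU1P[E _|bp _].
  by left; apply: ptP; rewrite !cE /k /shrink -E scale0r ?a00 ?a10 ?b00 ?b10 ?mulr0 ?addr0.
have zd := dlt z bp; right; exists (cutoff d z); split=> //.
  by apply: lt_le_trans R7; exact: sh.
have [] := h5 (shrink d z); first by rewrite subr0; apply: lt_le_trans R5.
rewrite /= -/(shrink d z) => E1 E2; have bn : cutoff d z != 0 by rewrite gt_eqF.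
apply: (scalerI bn); rewrite scalerA divff// scale1r.
apply: ptP; rewrite !cE.
  rewrite -[RHS](subrK (cX (shrink d z))) E1 /k !cE.
  by ring.
rewrite -[RHS](subrK (cY (shrink d z))) E2 /k !cE.
by ring.
Qed.

Lemma jac_comp (F G : pt -> pt) p : smooth_at p F -> smooth_at (F p) G ->
  jac (G \o F) p = jac G (F p) * jac F p.
Proof.
move=> /smooth_at_pt[fX fY] /smooth_at_pt[gX gY].
have dX := derive_comp_pt (smooth_at_diff gX) (smooth_at_diff fX) (smooth_at_diff fY).
have dY := derive_comp_pt (smooth_at_diff gY) (smooth_at_diff fX) (smooth_at_diff fY).
have EX v : 'D_v (cX \o (G \o F)) p = _ := dX.2 v.
have EY v : 'D_v (cY \o (G \o F)) p = _ := dY.2 v.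
rewrite /jac !EX !EY.
have det (a b c d x y z t : R) : (a * x + c * y) * (b * z + d * t) - (b * x + d * y) * (a * z + c * t) = (x * t - y * z) * (a * d - b * c) by ring.
exact: det.
Qed.

Lemma plane_diffeo_comp (K L : pt -> pt) : plane_diffeo K -> plane_diffeo L ->
  plane_diffeo (K \o L).
Proof.
move=> [bK sK jK] [bL sL jL]; split=> [|p|p]; first exact: bij_comp.
  by apply: smooth_comp_pt; [exact: sL|exact: sK].
by rewrite jac_comp//; rewrite mulf_neq0.
Qed.

Lemma plane_diffeo_id : plane_diffeo (id : pt -> pt).
Proof.
split=> [|p|p]; first by exists id.
  exact: smooth_id.
rewrite /jac (_ : cX \o id = @cX R)// (_ : cY \o id = @cY R)// !derive_X !derive_Y !cE.
by rewrite mulr1 mulr0 subr0 oner_neq0.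
Qed.

Lemma expR_lip (t s : R) : t <= 1 -> s <= 1 -> `|expR t - expR s| <= expR 1 * `|t - s|.
Proof.
have K (x y : R) : x <= 1 -> y <= x -> `|expR x - expR y| <= expR 1 * `|x - y|.
  move=> x1 yx; rewrite !ger0_norm ?subr_ge0 ?ler_expR//.
  have E : expR y = expR x * expR (y - x) by rewrite -expRD addrC subrK.
  have h := expR_ge1Dx (y - x); have e1 : expR x <= expR 1 by rewrite ler_expR.
  rewrite E -{1}[expR x]mulr1 -mulrBr; apply: ler_pM.
  - exact: expR_ge0.
  - by rewrite subr_ge0 -[X in _ <= X]expR0 ler_expR; lra.
  - exact: e1.
  - by lra.
move=> t1 s1; have [h|h] := leP s t; first exact: K.
by rewrite distrC [ `|t - s| ]distrC; apply: K => //; exact: ltW.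
Qed.

(** With a cut-off chi, the map (x, y) |-> (exp(b chi) x, exp(-b chi) y) preserves x y. For small b
    it is close to the identity, hence a diffeomorphism; so b is a small fraction of [a] and the map
    is iterated. *)
Lemma hyperbolic (a rho : R) : 0 < rho -> exists K : pt -> pt,
  [/\ plane_diffeo K, \forall z \near (0 : pt), K z = mk (expR a * cX z) (expR (- a) * cY z),
    forall z, rho <= `|z| -> K z = z & forall z, cX (K z) * cY (K z) = cX z * cY z].
Proof.
move=> r0; have [Z Z0 hZ] := cutoff_lip.
(* The perturbation of the identity has Lipschitz constant |b| exp(1) (Z + 1), and |b| m <= 1 makes
   this at most 1/2. *)
pose m := 2 * (expR 1 * (Z + 1)) + 1.
have e1 : 0 < expR (1 : R) := expR_gt0 1.
have m1 : 1 <= m by rewrite lerDr mulr_ge0// mulr_ge0// ?addr_ge0// ltW.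
pose N := Num.bound (`|a| * m).
have hN : `|a| * m <= N.+1%:R.
  apply: ltW; apply: lt_trans (archi_boundP _) _; rewrite ?ltr_nat//.
  by rewrite mulr_ge0//; lra.
pose b := a / N.+1%:R.
have Np : (0 : R) < N.+1%:R by rewrite ltr0n.
have bm : `|b| * m <= 1 by rewrite /b normrM normfV (gtr0_norm Np) mulrAC ler_pdivrMr// mul1r.
have b1 : `|b| <= 1 by apply: le_trans bm; rewrite ler_peMr.
have bs : `|b| * (expR 1 * (Z + 1)) <= 2^-1.
  have := normr_ge0 b; move: bm; rewrite /m; move: (expR 1 * (Z + 1)) => u; lra.
have Lip (c : R) (l : pt -> R) z w : `|c| = `|b| ->
    (forall q, `|l q| <= `|q|) -> (forall q q', `|l q - l q'| <= `|q - q'|) ->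
    `|l z * (expR (c * cutoff rho z) - 1) - l w * (expR (c * cutoff rho w) - 1)| <= 2^-1 * `|z - w|.
  move=> cb ll ll'.
  have E q : l q * (expR (c * cutoff rho q) - 1) = clamp rho (l q) * (expR (c * cutoff rho q) - 1).
    have [h|h] := leP `|q| rho; first by rewrite clamp_id// (le_trans (ll q)).
    by rewrite cutoff0 ?ltW// mulr0 expR0 subrr !mulr0.
  have cc q : `|c * cutoff rho q| <= `|b|.
    by rewrite normrM cb; have /andP[h0 h1] := cutoff01 rho q; rewrite ger0_norm// ler_piMr.
  have c1 q : c * cutoff rho q <= 1.
    by apply: le_trans (ler_norm _) _; exact: le_trans (cc q) b1.
  rewrite !E; apply: (@le_trans _ _ (`|b| * (expR 1 * (Z + 1)) * `|z - w|)); last by rewrite ler_wpM2r.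
  have := @lip_prod (fun q => clamp rho (l q)) (fun q => expR (c * cutoff rho q) - 1)
     rho (expR 1 * `|b|) 1 (expR 1 * (`|b| * (Z / rho))) z w.
  have -> : rho * (expR 1 * (`|b| * (Z / rho))) + expR 1 * `|b| * 1 = `|b| * (expR 1 * (Z + 1)).
    by field; rewrite gt_eqF.
  apply=> //.
  - by apply: clamp_le; exact: ltW.
  - rewrite -[X in _ - X]expR0; apply: le_trans (expR_lip (c1 w) ler01) _.
    by rewrite subr0 ler_wpM2l ?expR_ge0.
  - by rewrite mul1r; apply: le_trans (clamp_lip _ _ _) _.
  - rewrite opprB addrA subrK; apply: le_trans (expR_lip (c1 z) (c1 w)) _.
    rewrite -mulrBr normrM cb -!mulrA ler_wpM2l ?expR_ge0// ler_wpM2l//.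
    by rewrite mulrA; exact: hZ.
  - by rewrite mulr_ge0 ?expR_ge0// mulr_ge0// divr_ge0// ltW.
pose K0 z := mk (expR (b * cutoff rho z) * cX z) (expR (- b * cutoff rho z) * cY z).
pose eta z := mk (cX z * (expR (b * cutoff rho z) - 1)) (cY z * (expR (- b * cutoff rho z) - 1)).
have K0E : K0 = fun z => z + eta z.
  by apply/funext => z; apply: ptP; rewrite !cE; ring.
have sE (c : R) z : smooth_at z (fun z => expR (c * cutoff rho z) - 1).
  apply: (@smoothB _ _ (expR \o (fun z => c * cutoff rho z)) (cst 1)); last exact: smooth_cst.
  apply: smooth_comp1; first exact: C1k_expR.
  by apply: (@smoothM _ _ (cst c) (cutoff rho)); [exact: smooth_cst|exact: smooth_cutoff].
have dK0 : plane_diffeo K0.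
  rewrite K0E; apply: near_identity => [p|z w].
    apply: smooth_mk.
      by apply: (@smoothM _ _ (@cX R) (fun z => expR (b * cutoff rho z) - 1)); [exact: smooth_X|exact: sE].
    by apply: (@smoothM _ _ (@cY R) (fun z => expR (- b * cutoff rho z) - 1)); [exact: smooth_Y|exact: sE].
  apply: mk_dist_le.
    apply: (Lip b (@cX R)); [exact: erefl|exact: cX_le|].
    by move=> q q'; rewrite -cXN -cXD cX_le.
  apply: (Lip (- b) (@cY R)); [exact: normrN|exact: cY_le|].
  by move=> q q'; rewrite -cYN -cYD cY_le.
have bN : N.+1%:R * b = a by rewrite mulrC divfK// gt_eqF.
clearbody b.
(* Close enough to 0 the first n iterates stay where the cut-off is 1, so the exponents add up. *)
have nE n : \forall z \near (0 : pt), iter n K0 z = mk (expR (n%:R * b) * cX z) (expR (- (n%:R * b)) * cY z).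
  elim: n => [|n IH].
    by apply/near_norm; exists 1 => // z _; rewrite mul0r oppr0 expR0 !mul1r mkK.
  pose L z := mk (expR (n%:R * b) * cX z) (expR (- (n%:R * b)) * cY z).
  have cL : {for 0, continuous L}.
    apply: smooth_at_continuous; apply: smooth_mk.
      by apply: (@smoothM _ _ (cst _) (@cX R)); [exact: smooth_cst|exact: smooth_X].
    by apply: (@smoothM _ _ (cst _) (@cY R)); [exact: smooth_cst|exact: smooth_Y].
  have L0 : L 0 = 0 by apply: ptP; rewrite !cE mulr0.
  have nL : \forall z \near (0 : pt), `|L z| <= rho / 2.
    move/cvgr_dist_le : cL; rewrite L0 => /(_ (rho / 2)) => H.
    by have := H (divr_gt0 r0 (ltr0n _ 2)); apply: filterS => z; rewrite sub0r normrN.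
  apply: filterS2 IH nL => z E h; rewrite iterS E -/(L z) /K0 cutoff1// !mulr1 !cE.
  rewrite !mulrA; congr (mk (_ * _) (_ * _)); rewrite -expRD; congr expR.
    by rewrite -[n.+1]addn1 natrD mulrDl mul1r addrC.
  by rewrite -[n.+1]addn1 natrD mulrDl mul1r opprD addrC.
exists (iter N.+1 K0); split.
- elim: N.+1 => [|n IH]; first exact: plane_diffeo_id.
  by rewrite (_ : iter n.+1 K0 = K0 \o iter n K0) //; exact: plane_diffeo_comp.
- by have := nE N.+1; rewrite bN.
- move=> z hz; elim: N.+1 => [//|n IH]; rewrite iterS IH /K0 cutoff0// !mulr0 expR0 !mul1r.
  exact: mkK.
have KE w : cX (K0 w) * cY (K0 w) = cX w * cY w.
  by rewrite cX_mk cY_mk mulrACA -expRD mulNr subrr expR0 mul1r.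
by move=> z; elim: N.+1 => [//|n IH]; rewrite iterS KE.
Qed.

End Lipschitz.
(** * Homogeneous polynomials and extension of germs *)

Section Homogeneous.
Context {R : realType}.
Local Notation pt := 'rV[R]_2.
Implicit Types (p q u v w z : pt) (P : pt -> R).

Definition dmap (F : pt -> pt) p v : pt := mk ('D_v (cX \o F) p) ('D_v (cY \o F) p).

Lemma dmap_comp (F G : pt -> pt) p v : smooth_at p F -> smooth_at (F p) G ->
  dmap (G \o F) p v = dmap G (F p) (dmap F p v).
Proof.
move=> /smooth_at_pt[fX fY] /smooth_at_pt[gX gY].
have dX := derive_comp_pt (smooth_at_diff gX) (smooth_at_diff fX) (smooth_at_diff fY).
have dY := derive_comp_pt (smooth_at_diff gY) (smooth_at_diff fX) (smooth_at_diff fY).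
rewrite /dmap [X in mk X _](dX.2 v) [X in mk _ X](dY.2 v).
by congr mk; rewrite [RHS]smooth_deriveE// !cE.
Qed.

Lemma gradP (g : pt -> R) p : smooth_at p g ->
  exists a b : R, forall v, 'D_v g p = cX v * a + cY v * b.
Proof. by move=> sg; exists ('D_e0 g p), ('D_e1 g p) => v; exact: smooth_deriveE. Qed.

Lemma norm2_gt0 u : u != 0 -> 0 < cX u * cX u + cY u * cY u.
Proof.
move=> u0; rewrite -!expr2 lt_def addr_ge0 ?sqr_ge0// andbT paddr_eq0 ?sqr_ge0// !sqrf_eq0.
by apply: contra u0 => /andP[/eqP h1 /eqP h2]; apply/eqP; apply: ptP; rewrite ?h1 ?h2 !cE.
Qed.

Lemma dmap_linear (F : pt -> pt) p : smooth_at p F -> linear (dmap F p).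
Proof.
have E (g : pt -> R) (a : R) u v : smooth_at p g -> 'D_(a *: u + v) g p = a * 'D_u g p + 'D_v g p.
  by move=> /gradP[x [y G]]; rewrite !G !cE; ring.
have DX w : cX (dmap F p w) = 'D_w (cX \o F) p by exact: cX_mk.
have DY w : cY (dmap F p w) = 'D_w (cY \o F) p by exact: cY_mk.
move=> /smooth_at_pt[fX fY] a u v.
apply: ptP.
  apply: (etrans (DX _)); apply: (etrans (E _ a u v fX)).
  by apply: esym; apply: (etrans (cXD _ _)); congr (_ + _);
    [apply: (etrans (cXZ _ _)); congr (_ * _)|]; exact: DX.
apply: (etrans (DY _)); apply: (etrans (E _ a u v fY)).
by apply: esym; apply: (etrans (cYD _ _)); congr (_ + _);
    [apply: (etrans (cYZ _ _)); congr (_ * _)|]; exact: DY.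
Qed.

Lemma dmap_near (F G : pt -> pt) p v : (\forall z \near p, F z = G z) -> dmap F p v = dmap G p v.
Proof.
move=> E; rewrite /dmap; congr mk; apply: eq_near_derive; apply: filterS E => z /= -> //.
Qed.

Lemma dmap_id p v : dmap id p v = v.
Proof.
rewrite /dmap (_ : cX \o id = @cX R)// (_ : cY \o id = @cY R)// derive_X derive_Y.
exact: mkK.
Qed.

Lemma linear_lin2 (L : pt -> pt) : linear L ->
  cX \o L = lin2 (cX (L e0)) (cX (L e1)) /\ cY \o L = lin2 (cY (L e0)) (cY (L e1)).
Proof.
move=> lL; have E z : L z = cX z *: L e0 + cY z *: L e1.
  have L0 : L 0 = 0 by have := lL (-1) 0 0; rewrite scaler0 addr0 scaleN1r addNr.
  have := lL (cX z) e0 (cY z *: e1); have := lL (cY z) e1 0; rewrite !addr0 L0 addr0 => -> <-.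
  by congr L; apply: ptP; rewrite !cE; ring.
by split; apply/funext => z /=; rewrite E !cE.
Qed.

Lemma smooth_linear (L : pt -> pt) p : linear L -> smooth_at p L.
Proof.
by move=> /linear_lin2[eX eY]; apply/smooth_at_pt; rewrite eX eY; split; exact: smooth_lin2.
Qed.

Lemma dmap_of_linear (L : pt -> pt) p v : linear L -> dmap L p v = L v.
Proof.
move=> /linear_lin2[eX eY]; rewrite /dmap eX eY !derive_lin2.
by apply: ptP; rewrite !cE -?eX -?eY.
Qed.

Lemma linear0' (L : pt -> pt) : linear L -> L 0 = 0.
Proof. by move=> lL; have := lL (-1) 0 0; rewrite scaler0 addr0 scaleN1r addNr. Qed.

Lemma linearZ' (L : pt -> pt) (a : R) z : linear L -> L (a *: z) = a *: L z.
Proof. by move=> lL; have := lL a z 0; rewrite !addr0 (linear0' lL) addr0. Qed.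

Lemma linearD' (L : pt -> pt) z w : linear L -> L (z + w) = L z + L w.
Proof. by move=> lL; have := lL 1 z w; rewrite !scale1r. Qed.

Lemma linear_comp (L L' : pt -> pt) : linear L -> linear L' -> linear (L \o L').
Proof. by move=> l l' a u v /=; rewrite l' l. Qed.

Lemma hom_scale n P (t : R) z : homogeneous n P -> P (t *: z) = t ^+ n * P z.
Proof.
move=> [a aP]; rewrite !aP mulr_sumr; apply: eq_bigr => i _; rewrite !mxE !exprMn.
have -> : t ^+ n = t ^+ i * t ^+ (n - i) by rewrite -exprD subnKC// -ltnS.
by ring.
Qed.

Lemma hom_smooth n P z : homogeneous n P -> smooth_at z P.
Proof.
move=> [a aP]; have -> : P = fun p => \sum_(i < n.+1) (a i * cX p ^+ i * cY p ^+ (n - i)).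
  by apply/funext => p; rewrite aP.
apply: (@smooth_sum _ z n.+1 (fun (i : 'I_n.+1) p => a i * cX p ^+ i * cY p ^+ (n - i))) => i.
apply: (@smoothM _ z (fun p => a i * cX p ^+ i) (fun p => cY p ^+ (n - i))).
  by apply: (@smoothM _ z (cst (a i)) (fun p => cX p ^+ i)); [exact: smooth_cst|apply: smoothX; exact: smooth_X].
by apply: smoothX; exact: smooth_Y.
Qed.

Lemma hom_derive_scale n P (t : R) z v : homogeneous n.+1 P -> t != 0 ->
  'D_v P (t *: z) = t ^+ n * 'D_v P z.
Proof.
move=> hP t0; have sP q : smooth_at q P := hom_smooth q hP.
have lS : linear (fun z : pt => t *: z).
  by move=> a u w; rewrite scalerDr !scalerA mulrC.
have := @derive_comp_pt _ P (fun z => t *: z) z (smooth_at_diff (sP _)).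
have /smooth_at_pt[sX sY] := smooth_linear z lS.
move=> /(_ (smooth_at_diff sX) (smooth_at_diff sY)) [_ /(_ v)].
have E : P \o (fun z => t *: z) = cst (t ^+ n.+1) \* P.
  by apply/funext => q /=; rewrite (hom_scale _ _ hP).
rewrite E (@deriveM _ _ (cst (t ^+ n.+1)) P); first last.
- by apply: diff_derivable; exact: smooth_at_diff.
- exact: derivable_cst.
have := dmap_of_linear z v lS; rewrite /dmap => Ed.
have -> : 'D_v (cX \o (fun z => t *: z)) z = t * cX v by rewrite -cXZ -Ed cE.
have -> : 'D_v (cY \o (fun z => t *: z)) z = t * cY v by rewrite -cYZ -Ed cE.
rewrite derive_cst scaler0 addr0 -!mulrA -mulrDr -smooth_deriveE// => H.
by apply: (mulfI t0); rewrite -H /= exprS mulrA.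
Qed.

Lemma hom_euler n P u : homogeneous n P -> P u = 0 -> 'D_u P u = 0.
Proof.
move=> hP Pu; have du : derivable P (u + (0 : R) *: u) u.
  by apply: diff_derivable; apply: smooth_at_diff; exact: hom_smooth hP.
have [_] := line_is_derive du; rewrite scale0r addr0 => <-.
rewrite (_ : (fun t : R => P (u + t *: u)) = cst 0) ?derive_cst//.
by apply/funext => t; rewrite -{1}[u]scale1r -scalerDl (hom_scale _ _ hP) Pu mulr0.
Qed.

Lemma hom0 n P : homogeneous n.+1 P -> P 0 = 0.
Proof. by move=> hP; rewrite -(scale0r (0 : pt)) (hom_scale _ _ hP) expr0n mul0r. Qed.

Definition swap z : pt := mk (cY z) (cX z).

Lemma swap_linear : linear swap.
Proof. by move=> a u v; apply: ptP; rewrite !cE. Qed.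

Lemma swapK z : swap (swap z) = z. Proof. by apply: ptP; rewrite !cE. Qed.

Lemma hom_swap n P : homogeneous n P -> homogeneous n (P \o swap).
Proof.
move=> [a aP]; exists (fun i => a (n - i)%N) => p; rewrite /= aP.
rewrite (reindex_inj rev_ord_inj) /=; apply: eq_bigr => i _.
rewrite subSS subKn; last by rewrite -ltnS.
rewrite -!/(cX _) -!/(cY _) -/(cX (swap p)) -/(cY (swap p)) !cE.
by rewrite mulrAC.
Qed.

(** Identities between polynomials are checked off the axis, where dehomogenizing may divide by
    [cY]. *)
Lemma dense_cY (u : pt -> R) z : {for z, continuous u} ->
  (forall w, cY w != 0 -> u w = 0) -> u z = 0.
Proof.
move=> cu H; have [//|/eqP uz] := eqVneq (u z) 0.
have [Yz|Yz] := eqVneq (cY z) 0; last exact: H.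
have /near_norm[r r0 hr] : \forall w \near z, u w != 0.
  by move/cvgr_neq0 : cu; apply; apply/eqP.
have : u (z + mk 0 (r / 2)) != 0.
  apply: hr; rewrite addrAC subrr add0r; apply/norm_ltP; rewrite !cE normr0.
  by split=> //; rewrite ger0_norm; lra.
by rewrite H ?eqxx// !cE Yz add0r; apply/eqP; lra.
Qed.

Lemma double_root (r : {poly R}) (c : R) : root r c -> root r^`() c ->
  exists s, r = s * ('X - c%:P) ^+ 2.
Proof.
move=> /factor_theorem[q ->]; rewrite derivM derivXsubC mulr1 rootE !hornerE subrr mulr0 add0r.
by rewrite -rootE => /factor_theorem[q' ->]; exists q'; rewrite -mulrA -expr2.
Qed.

(** The polynomial p(x) = P(x, 1) has the root c = [cX z / cY z], which is also a root of p'. So (X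
    - c)^2 divides p, and the square of the linear form X - c Y divides [P]. *)
Lemma hom_regularY n P z : homogeneous n P -> no_multiple_linear_factor P ->
  cY z != 0 -> P z = 0 -> 'D_e0 P z = 0 -> False.
Proof.
move=> hP nP Yz Pz Dz; have [a aP] := hP.
pose p : {poly R} := \poly_(i < n.+1) a i.
have pE x : p.[x] = P (mk x 1).
  rewrite horner_poly aP; apply: eq_bigr => i _.
  by rewrite -/(cX _) -/(cY _) !cE expr1n mulr1.
have zE (w : pt) : cY w != 0 -> w = cY w *: mk (cX w / cY w) 1.
  by move=> Yw; apply: ptP; rewrite !cE ?mulr1// mulrC divfK.
have PE w : cY w != 0 -> P w = cY w ^+ n * p.[cX w / cY w].
  by move=> Yw; rewrite {1}(zE w Yw) (hom_scale _ _ hP) pE.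
pose c := cX z / cY z.
have rp : root p c.
  by move: Pz; rewrite PE// => /eqP; rewrite mulf_eq0 expf_eq0 (negbTE Yz) andbF.
have Dp x : 'D_e0 P (mk x 1) = (p^`()).[x].
  have d : derivable P (mk 0 1 + x *: e0) e0.
    by apply: diff_derivable; apply: smooth_at_diff; exact: hom_smooth hP.
  have E y : mk 0 1 + y *: e0 = mk y 1 :> pt by apply: ptP; rewrite !cE; ring.
  have [_] := line_is_derive d; rewrite E => <-.
  rewrite (_ : (fun t : R => _) = horner p); last by apply/funext => t; rewrite E pE.
  by have [_ ->] := is_derive_poly p x.
have rp' : root p^`() c.
  apply/eqP; rewrite -Dp; case: n {aP p pE PE rp Dp} hP => [|n] hP.
    have -> : P = cst (P 0).
      by apply/funext => w; rewrite -[in RHS](scale0r w) (hom_scale _ _ hP) expr0 mul1r.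
    by rewrite derive_cst.
  move: Dz; rewrite {1}(zE z Yz) (hom_derive_scale _ _ hP)// => /eqP.
  by rewrite mulf_eq0 expf_eq0 (negbTE Yz) andbF => /eqP.
have [q pq] := double_root rp rp'.
have q0 : q != 0.
  apply/eqP => q0; have P0 w : P w = 0.
    apply: (dense_cY (smooth_at_continuous (hom_smooth w hP))) => {}w Yw.
    by rewrite PE// pq q0 mul0r horner0 mulr0.
  have [] := nP 1 0 0%N (fun=> 0).
  - by exists (fun=> 0) => w; rewrite big1// => i _; rewrite !mul0r.
  - by move=> w; rewrite P0 mulr0.
  by move=> /eqP; rewrite oner_eq0.
have sp : (size p <= n.+1)%N by exact: size_poly.
have sq : (size q + 2)%N = size p.
  rewrite pq size_Mmonic ?monicXn ?monic_exp ?monicXsubC// size_exp_XsubC.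
  by rewrite addn3 /= addn2.
have [m nm] : exists m, n = m.+2.
  exists (n - 2)%N; move: sp; rewrite -sq; have : (0 < size q)%N by rewrite size_poly_gt0.
  by case: (size q) => // k _; rewrite addn2 !ltnS => h; rewrite -addn2 subnK// (leq_trans _ h).
rewrite nm in hP PE sp aP.
pose Q w := \sum_(i < m.+1) q`_i * cX w ^+ i * cY w ^+ (m - i).
have hQ : homogeneous m Q by exists (fun i => q`_i) => w.
have QE w : cY w != 0 -> Q w = cY w ^+ m * q.[cX w / cY w].
  move=> Yw; rewrite {1}(zE w Yw) (hom_scale _ _ hQ); congr (_ * _).
  have sq' : (size q <= m.+1)%N by move: sp; rewrite -sq addn2.
  rewrite (horner_coef_wide _ sq'); apply: eq_bigr => i _.
  by rewrite !cE expr1n mulr1.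
have [] := nP 1 (- c) m Q hQ.
  move=> w; apply/eqP; rewrite -subr_eq0; apply/eqP.
  apply: (@dense_cY (fun w => P w - linear_form 1 (- c) w ^+ 2 * Q w) w).
    apply: smooth_at_continuous; apply: (@smoothB _ _ P (fun w => linear_form 1 (- c) w ^+ 2 * Q w)).
      exact: hom_smooth hP.
    apply: (@smoothM _ _ (fun w => linear_form 1 (- c) w ^+ 2) Q); last exact: hom_smooth hQ.
    apply: smoothX; rewrite (_ : linear_form _ _ = lin2 1 (- c)); first exact: smooth_lin2.
    by apply/funext => q'; rewrite /linear_form /lin2 mulrC [_ * - c]mulrC.
  move=> {}w Yw; rewrite PE// QE// pq hornerM horner_exp hornerXsubC /linear_form.
  rewrite -[w ord0 ord0]/(cX w) -[w ord0 ord_max]/(cY w) !exprS; clearbody c.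
  by move: q.[_] => k; field.
by move=> /eqP; rewrite oner_eq0.
Qed.

Lemma hom_regular n P z : homogeneous n P -> no_multiple_linear_factor P ->
  z != 0 -> P z = 0 -> exists v, 'D_v P z != 0.
Proof.
move=> hP nP z0 Pz; have [Yz|Yz] := eqVneq (cY z) 0; last first.
  by exists e0; apply/eqP; exact: hom_regularY hP nP Yz Pz.
have Xz : cX z != 0.
  by apply: contra z0 => /eqP Xz; apply/eqP; apply: ptP; rewrite ?Xz ?Yz !cE.
exists e1; apply/eqP => Dz.
have nS : no_multiple_linear_factor (P \o swap).
  move=> a b m Q hQ E; have [|b0 a0 //] := nP b a m (Q \o swap) (hom_swap hQ).
  move=> w; have := E (swap w); rewrite /= swapK => ->; congr (_ ^+ 2 * _).
  by rewrite /linear_form -!/(cX _) -!/(cY _) !cE addrC.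
apply: (@hom_regularY n (P \o swap) (swap z) (hom_swap hP) nS).
- by rewrite !cE.
- by rewrite /= swapK.
have /smooth_at_pt[sX sY] := smooth_linear (swap z) swap_linear.
have [_ ->] := derive_comp_pt (smooth_at_diff (hom_smooth (swap (swap z)) hP)) (smooth_at_diff sX) (smooth_at_diff sY).
have := dmap_of_linear (swap z) e0 swap_linear; rewrite /dmap => Ed.
have -> : 'D_e0 (cX \o swap) (swap z) = 0 by rewrite -(cX_mk ('D_e0 _ _) ('D_e0 (cY \o swap) (swap z))) Ed !cE.
by rewrite mul0r add0r swapK Dz mulr0.
Qed.

Lemma preserved_gradient P (A : pt -> pt) z v : (forall z, smooth_at z P) -> linear A ->
  (forall z, P (A z) = P z) -> 'D_(A v) P (A z) = 'D_v P z.
Proof.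
move=> sP lA PA; have /smooth_at_pt[sX sY] := smooth_linear z lA.
have [_ /(_ v)] := derive_comp_pt (smooth_at_diff (sP (A z))) (smooth_at_diff sX) (smooth_at_diff sY).
have -> : P \o A = P by apply/funext => w /=; rewrite PA.
move=> ->; have [a [b G]] := gradP (sP (A z)); rewrite !G.
by have := dmap_of_linear z v lA; rewrite /dmap => <-; rewrite !cE; ring.
Qed.

Definition independent u w := cX u * cY w - cY u * cX w != 0.

Lemma independent_span u w z : independent u w ->
  z = ((cX z * cY w - cY z * cX w) / (cX u * cY w - cY u * cX w)) *: u +
      ((cX u * cY z - cY u * cX z) / (cX u * cY w - cY u * cX w)) *: w.
Proof. by move=> D; apply: ptP; rewrite !cE; field. Qed.

Lemma dependent_scale u w : u != 0 -> ~~ independent u w -> exists c : R, w = c *: u.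
Proof.
move=> u0; rewrite negbK subr_eq0 => /eqP D.
have [Xu|Xu] := eqVneq (cX u) 0.
  have Yu : cY u != 0 by apply: contra u0 => /eqP Yu; apply/eqP; apply: ptP; rewrite ?Xu ?Yu !cE.
  exists (cY w / cY u); apply: ptP; rewrite !cE; last by rewrite divfK.
  rewrite Xu mulr0; move: D; rewrite Xu mul0r => /esym/eqP.
  by rewrite mulf_eq0 (negbTE Yu) => /eqP.
exists (cX w / cX u); apply: ptP; rewrite !cE; first by rewrite divfK.
by apply: (mulfI Xu); rewrite D; field.
Qed.

Lemma linear_ext u w (A B : pt -> pt) : independent u w -> linear A -> linear B ->
  A u = B u -> A w = B w -> A = B.
Proof.
move=> D lA lB Eu Ew; apply/funext => z; rewrite (independent_span z D).
by rewrite !(linearD' _ _ lA, linearD' _ _ lB) !(linearZ' _ _ lA, linearZ' _ _ lB) Eu Ew.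
Qed.

Lemma exprn_eq1 (x : R) n : 0 < x -> x ^+ n.+1 = 1 -> x = 1.
Proof. by move=> x0 /eqP; rewrite pexpr_eq1 ?ltW//= => /eqP. Qed.

Section Rigid.
Context (n : nat) (P : pt -> R) (hP : homogeneous n.+2 P) (nP : no_multiple_linear_factor P).
Context (A : pt -> pt) (lA : linear A) (PA : forall z, P (A z) = P z).

Let sP z : smooth_at z P. Proof. exact: hom_smooth hP. Qed.

Lemma deriveZv z (c : R) v : 'D_(c *: v) P z = c * 'D_v P z.
Proof. by have [a [b G]] := gradP (sP z); rewrite !G !cE; ring. Qed.

Lemma deriveDv z v w : 'D_(v + w) P z = 'D_v P z + 'D_w P z.
Proof. by have [a [b G]] := gradP (sP z); rewrite !G !cE; ring. Qed.

Lemma zero_gradient u w : u != 0 -> P u = 0 -> independent u w -> 'D_w P u != 0.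
Proof.
move=> u0 Pu D; have [v] := hom_regular hP nP u0 Pu; apply: contra => /eqP Dw.
rewrite (independent_span v D) deriveDv !deriveZv Dw (hom_euler hP Pu).
by rewrite !mulr0 addr0.
Qed.

Lemma gradient_scale u (c : R) v : c != 0 -> 'D_v P (c *: u) = c ^+ n.+1 * 'D_v P u.
Proof. by move=> c0; rewrite (hom_derive_scale _ _ hP). Qed.

(** The gradient of [P] at c u is c^(n+1) times that at [u], and invariance of [P] relates the two
    on [w] and [A w]. The component of [A w] along [u] contributes nothing, by Euler's relation at a
    zero of [P]. *)
Lemma zero_eigen u w (c a b : R) : u != 0 -> P u = 0 -> independent u w ->
  A u = c *: u -> c != 0 -> A w = a *: w + b *: u -> c ^+ n.+1 * a = 1.
Proof.
move=> u0 Pu D Au c0 Aw; have g := zero_gradient u0 Pu D.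
have := preserved_gradient u w sP lA PA.
rewrite Au Aw gradient_scale// deriveDv !deriveZv (hom_euler hP Pu) mulr0 addr0.
by rewrite mulrA -[RHS]mul1r => /(mulIf g).
Qed.

Lemma independent_sym u w : independent u w -> independent w u.
Proof. by rewrite /independent => D; rewrite -oppr_eq0; apply: contra D => /eqP E; apply/eqP; lra. Qed.

(** The relations a^(n+1) b = 1 = b^(n+1) a give a^n = b^n, hence a = b = 1 as soon as n > 0. For n
    = 0 the maps diag(t, 1/t) survive. *)
Lemma rigid_two u w : u != 0 -> w != 0 -> P u = 0 -> P w = 0 -> independent u w ->
  (exists2 a : R, 0 < a & A u = a *: u) -> (exists2 b : R, 0 < b & A w = b *: w) ->
  (0 < n)%N -> A = id.
Proof.
move=> u0 w0 Pu Pw D [a a0 Au] [b b0 Aw] n0.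
have E1 : a ^+ n.+1 * b = 1.
  by apply: (@zero_eigen u w a b 0) => //; [rewrite gt_eqF|rewrite scale0r addr0].
have E2 : b ^+ n.+1 * a = 1.
  by apply: (@zero_eigen w u b a 0) => //; [exact: independent_sym|rewrite gt_eqF|rewrite scale0r addr0].
case: n n0 E1 E2 => // m _ E1 E2.
have ab : a / b = 1.
  apply: (@exprn_eq1 _ m); first exact: divr_gt0.
  rewrite expr_div_n; apply/eqP; rewrite -subr_eq0; apply/eqP.
  have bm : b ^+ m.+1 != 0 by rewrite expf_neq0// gt_eqF.
  have ab0 : a * b != 0 by rewrite mulf_neq0// gt_eqF.
  apply: (mulIf bm); apply: (mulIf ab0); rewrite !mul0r mulrBl divfK// mul1r mulrBl.
  rewrite (_ : a ^+ m.+1 * (a * b) = a ^+ m.+2 * b); last by rewrite [a ^+ m.+2]exprSr mulrA.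
  have -> : b ^+ m.+1 * (a * b) = b ^+ m.+2 * a by rewrite (exprSr b m.+1); ring.
  by rewrite E1 E2 subrr.
have {}ab : a = b by rewrite -[a](divfK (lt0r_neq0 b0)) ab mul1r.
have a1 : a = 1 by apply: (@exprn_eq1 _ m.+2) => //; rewrite exprSr {2}ab.
apply: (linear_ext D lA) => //; first by rewrite Au a1 scale1r.
by rewrite Aw -ab a1 scale1r.
Qed.

(** If the second eigenvalue [a] differs from [c], it has an eigenvector off the zero line, where
    invariance of [P] forces a = 1, and then c = 1. Otherwise a = c = 1 and [A] is a shear along
    [u]: P(w + k b u) does not depend on k, and dividing by (k b)^(n+2) shows that [P] vanishes to
    second order at [u] in the direction [w], against [zero_gradient]. *)
Lemma rigid_one u : u != 0 -> P u = 0 -> (forall w, P w = 0 -> ~~ independent u w) ->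
  (exists2 a : R, 0 < a & A u = a *: u) -> A = id.
Proof.
move=> u0 Pu only [c c0 Au].
have cn0 : c != 0 by rewrite gt_eqF.
have [w D] : exists w, independent u w.
  exists (mk (- cY u) (cX u)); rewrite /independent !cE gt_eqF// mulrN opprK.
  exact: norm2_gt0.
have [a [b Aw]] : exists a b : R, A w = a *: w + b *: u.
  rewrite (independent_span (A w) D); set s := _ / _; set t := _ / _.
  by exists t, s; rewrite addrC.
have E1 := zero_eigen u0 Pu D Au cn0 Aw.
have a0 : 0 < a.
  have := exprn_gt0 n.+1 c0; rewrite ltNge => h; rewrite ltNge; apply/negP => a0.
  by have : c ^+ n.+1 * a <= 0; [rewrite mulr_ge0_le0// ltW// exprn_gt0|rewrite E1 ler10].
have [E|ac] := eqVneq a c; last first.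
  have [s hs] : exists s, A (w + s *: u) = a *: (w + s *: u).
    exists (b / (a - c)); rewrite linearD'// linearZ'// Au Aw.
    have : a - c != 0 by rewrite subr_eq0.
    by move=> h; apply: ptP; rewrite !cE; field.
  have Pw : P (w + s *: u) != 0.
    apply/eqP => /only; rewrite /independent !cE negbK => /eqP h.
    move: D; rewrite /independent => /eqP; apply; rewrite -{}h; ring.
  have a1 : a = 1.
    apply: (@exprn_eq1 _ n.+1) => //; apply: (mulIf Pw).
    by rewrite -(hom_scale _ _ hP) -hs PA mul1r.
  have c1 : c = 1 by apply: (@exprn_eq1 _ n) => //; rewrite -E1 a1 mulr1.
  by move: ac; rewrite a1 c1 eqxx.
have c1 : c = 1 by apply: (@exprn_eq1 _ n.+1) => //; rewrite exprSr -{2}E.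
rewrite E c1 scale1r in Aw; rewrite c1 scale1r in Au.
have [b0|b0] := eqVneq b 0.
  apply: (linear_ext D lA) => //.
  by rewrite Aw b0 scale0r addr0.
have Ak k : P (w + (k%:R * b) *: u) = P w.
  elim: k => [|k IH]; first by rewrite mul0r scale0r addr0.
  rewrite -[RHS]IH -(PA (w + (k%:R * b) *: u)) (linearD' _ _ lA) (linearZ' _ _ lA) Au Aw; congr P.
  by rewrite -addrA -scalerDl -[k.+1]addn1 natrD mulrDl mul1r [_ + b]addrC.
have g := zero_gradient u0 Pu D.
have gp : 0 < `|'D_w P u| by rewrite normr_gt0.
pose e := `|'D_w P u| / (2 * (`|w| + 1)).
have w1 : 0 < 2 * (`|w| + 1) by rewrite mulr_gt0// ltr_wpDl.
have ep : 0 < e by rewrite divr_gt0.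
have [r r0 hr] := strict_diff (sP u) ep.
(* With t = 1 / (k b) and |t| S < 1, the three terms give |t w| < r, |t| <= 1 and |t P(w)| < |D_w
   P(u)| / 2. The expansion at [u] then contradicts P(u + t w) = t^(n+2) P(w). *)
pose S := `|w| / r + 1 + 2 * `|P w| / `|'D_w P u|.
have S1 : 1 <= S.
  rewrite /S -addrA addrCA lerDl addr_ge0// divr_ge0//; first exact: ltW.

pose k := (Num.bound (S / `|b|)).+1.
have bp : 0 < `|b| by rewrite normr_gt0.
have Sk : S < k%:R * `|b|.
  rewrite -ltr_pdivrMr//; apply: lt_le_trans (archi_boundP _) _; last by rewrite ler_nat.
  by rewrite divr_ge0//; lra.
pose t := (k%:R * b)^-1.
have kb0 : k%:R * b != 0 by rewrite mulf_neq0// pnatr_eq0.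
have tn : `|t| * S < 1.
  rewrite /t normfV normrM (ger0_norm (ler0n _ _)) mulrC ltr_pdivrMr ?mul1r//.
  by rewrite mulr_gt0// ltr0n.
have t0 : 0 < `|t| by rewrite normr_gt0 invr_neq0.
have h1 : 0 <= `|w| / r by rewrite divr_ge0// ltW.
have h2 : 0 <= 2 * `|P w| / `|'D_w P u| by rewrite divr_ge0// mulr_ge0.
have t1 : `|t| <= 1 by apply: le_trans (ltW tn); rewrite ler_peMr.
have tw : `|t *: w| < r.
  rewrite normrZ -(divfK (lt0r_neq0 r0) `|w|) mulrA -ltr_pdivlMr// divff ?gt_eqF//.
  apply: le_lt_trans tn; rewrite ler_pM2l//; move: h2; rewrite /S; lra.
have := hr (u + t *: w) u; rewrite subrr normr0 addrAC subrr add0r => /(_ tw r0).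
rewrite Pu subr0.
have -> : P (u + t *: w) = t ^+ n.+2 * P w.
  by rewrite -(Ak k) -(hom_scale _ _ hP) scalerDr scalerA mulVf// scale1r addrC.
have -> : lin2 ('D_e0 P u) ('D_e1 P u) (t *: w) = t * 'D_w P u.
  by have [x [y G]] := gradP (sP u); rewrite !G /lin2 !cE; ring.
rewrite exprS -mulrA -mulrBr normrM normrZ mulrCA ler_pM2l// => h3.
have h4 : `|t| * `|P w| < `|'D_w P u| / 2.
  rewrite -(divfK (lt0r_neq0 gp) `|P w|) mulrA -ltr_pdivlMr// mulrAC divff ?gt_eqF// mul1r.
  have : `|t| * (2 * `|P w| / `|'D_w P u|) < 1.
    by apply: le_lt_trans tn; rewrite ler_pM2l// /S; lra.
  by rewrite -!mulrA mulrCA; lra.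
have h5 : e * `|w| <= `|'D_w P u| / 2.
  by rewrite /e -mulrA ler_pM2l// mulrC ler_pdivrMr//; lra.
have h6 : `|t ^+ n.+1 * P w| <= `|t| * `|P w|.
  rewrite normrM normrX ler_wpM2r// exprS ler_piMr//.
  exact: exprn_ile1.
have h7 := ler_normB (t ^+ n.+1 * P w) (t ^+ n.+1 * P w - 'D_w P u).
by exfalso; move: h7 h6 h5 h4 h3 gp; rewrite subKr; clear; lra.
Qed.

End Rigid.

Lemma plane_diffeo_of (K k : pt -> pt) : cancel K k -> cancel k K ->
  (forall z, smooth_at z K) -> (forall z, smooth_at z k) -> plane_diffeo K.
Proof.
move=> Kk kK sK sk; split=> // [|p]; first by exists k.
have [_ _ /(_ p)] := @plane_diffeo_id R; apply: contra => /eqP J0.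
have -> : id = k \o K by apply/funext => z /=; rewrite Kk.
by rewrite jac_comp// J0 mulr0.
Qed.

Lemma blowup_near (g : pt -> pt) z (r : R) : smooth_at 0 g -> g 0 = 0 -> 0 < r ->
  \forall t \near (0 : R)^', `|t^-1 *: g (t *: z) - dmap g 0 z| < r.
Proof.
move=> sg g0 r0; have /smooth_at_pt[sX sY] := sg.
have H (l : pt -> R) (ls : smooth_at 0 (l \o g)) (l0 : l 0 = 0) (lZ : forall (a : R) w, l (a *: w) = a * l w) :
    \forall t \near (0 : R)^', `|l (t^-1 *: g (t *: z)) - 'D_z (l \o g) 0| < r.
  have d : derivable (l \o g) 0 z by apply: diff_derivable; exact: smooth_at_diff.
  have /cvgr_distC_lt/(_ _ r0) := d; apply: filterS => t.
  by rewrite -/(derive (l \o g) 0 z) /= addr0 g0 l0 subr0 lZ.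
near=> t; apply/norm_ltP; rewrite !cE; split; near: t.
- have := H (@cX R) sX; rewrite cE => /(_ erefl) h; apply: filterS (h _) => [t|a w]; last by rewrite cE.
  by rewrite !cE.
- have := H (@cY R) sY; rewrite cE => /(_ erefl) h; apply: filterS (h _) => [t|a w]; last by rewrite cE.
  by rewrite !cE.
Unshelve. all: by end_near. Qed.

(** By homogeneity P'(t^-1 g(t z)) = P z for small t, and t^-1 g(t z) tends to the differential at
    z. *)
Lemma dmap_preserves n P P' (g : pt -> pt) z : homogeneous n P -> homogeneous n P' ->
  smooth_at 0 g -> g 0 = 0 -> (\forall z \near (0 : pt), P' (g z) = P z) ->
  P' (dmap g 0 z) = P z.
Proof.
move=> hP hP' sg g0 Pg; apply/eqP; rewrite -subr_eq0 -normr_le0 leNgt; apply/negP => ep.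
have /cvgr_distC_lt/(_ _ ep)/near_norm[r r0 hr] := smooth_at_continuous (hom_smooth (dmap g 0 z) hP').
have /near_norm[d d0 hd] := Pg.
have F : ProperFilter (0 : R)^' by exact: Proper_dnbhs_numFieldType.
have [t [[t0 h1] h2]] : exists t : R, (t != 0 /\ `|t *: z| < d) /\ `|t^-1 *: g (t *: z) - dmap g 0 z| < r.
  have h1 : \forall t \near (0 : R)^', t != 0 by exact: nbhs_dnbhs_neq.
  have h2 : \forall t \near (0 : R)^', `|t *: z| < d.
    apply: cvg_within; have z1 : 0 < `|z| + 1 by rewrite ltr_wpDl.
    exists (d / (`|z| + 1)); first exact: divr_gt0.
    move=> t /=; rewrite sub0r normrN ltr_pdivlMr// normrZ => h; apply: le_lt_trans h.
    by rewrite ler_wpM2l// lerDl.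
  have [t [? ?]] := filter_ex (filterI (filterI h1 h2) (blowup_near z sg g0 r0)).
  by exists t.
have := hr _ h2; rewrite (hom_scale _ _ hP') (hd (t *: z)) ?subr0// (hom_scale _ _ hP).
by rewrite mulrA -exprMn mulVf// expr1n mul1r distrC ltxx.
Qed.

Lemma alexander_hom n P (g : pt -> pt) (rho : R) : homogeneous n P -> smooth_at 0 g -> g 0 = 0 ->
  (\forall z \near (0 : pt), P (g z) = P z) -> dmap g 0 = id -> 0 < rho ->
  exists K : pt -> pt, [/\ plane_diffeo K, \forall z \near (0 : pt), K z = g z,
    forall z, rho <= `|z| -> K z = z & forall z, P (K z) = P z].
Proof.
move=> hP sg g0 Pg dg rho0; have /near_norm[d d0 hd] := Pg.
have dX v : 'D_v (cX \o g) 0 = cX v.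
  by have /(congr1 cX) : dmap g 0 v = v; [rewrite dg|rewrite cE].
have dY v : 'D_v (cY \o g) 0 = cY v.
  by have /(congr1 cY) : dmap g 0 v = v; [rewrite dg|rewrite cE].
have [K [h1 h2 h3 h4]] := alexander sg g0 dX dY rho0 d0.
exists K; split=> // z; have [->//|[t [t0 td ->]]] := h4 z.
rewrite (hom_scale _ _ hP) hd ?subr0// (hom_scale _ _ hP) mulrA -exprMn mulVf ?gt_eqF//.
by rewrite expr1n mul1r.
Qed.

Lemma two_lines P u : homogeneous 2 P -> no_multiple_linear_factor P -> u != 0 -> P u = 0 ->
  exists a b c d : R, a * d - b * c != 0 /\ forall z, P z = lin2 a b z * lin2 c d z.
Proof.
move=> [q qP] nP u0 Pu; have N0 := lt0r_neq0 (norm2_gt0 u0).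
have PE z : P z = q 0%N * cY z ^+ 2 + q 1%N * cX z * cY z + q 2%N * cX z ^+ 2.
  rewrite qP 2!big_ord_recr big_ord1 /= -!/(cX _) -!/(cY _) !expr0 !expr1.
  by rewrite !mulr1.
pose u1 := cX u; pose u2 := cY u; pose N := u1 * u1 + u2 * u2.
(* Write z = s u + t u' with u' the quarter turn of [u]. The coefficient of s^2 in [P] is P u = 0,
   those of s t and t^2 are [B] and [W]. Thus P z = t (B s + W t), and B = 0 would make t a double
   factor. *)
pose B := - (2 * q 0%N * u1 * u2) * - 1 + q 1%N * (u1 * u1 - u2 * u2) - 2 * q 2%N * u1 * u2.
pose W := q 0%N * u1 ^+ 2 - q 1%N * u1 * u2 + q 2%N * u2 ^+ 2.
have Pu' : q 0%N * u2 ^+ 2 + q 1%N * u1 * u2 + q 2%N * u1 ^+ 2 = 0 by rewrite -PE.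
have E z : P z = lin2 (- u2 / N) (u1 / N) z * lin2 ((B * u1 - W * u2) / N) ((B * u2 + W * u1) / N) z.
  have -> : P z = P z - ((u1 * cX z + u2 * cY z) / N) ^+ 2 *
      (q 0%N * u2 ^+ 2 + q 1%N * u1 * u2 + q 2%N * u1 ^+ 2) by rewrite Pu' mulr0 subr0.
  rewrite PE /lin2 /B /W; move: N0; rewrite -/u1 -/u2 -/N => N0; rewrite /N.
  by field; exact: N0.
exists (- u2 / N), (u1 / N), ((B * u1 - W * u2) / N), ((B * u2 + W * u1) / N).
split=> //; have -> : - u2 / N * ((B * u2 + W * u1) / N) - u1 / N * ((B * u1 - W * u2) / N) = - B / N.
  by rewrite /N; field; exact: N0.
rewrite mulf_neq0 ?invr_neq0// oppr_eq0; apply/eqP => B0.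
have [] := nP (- u2 / N) (u1 / N) 0%N (fun=> W).
- by exists (fun=> W) => p; rewrite big_ord1 /= !expr0 !mulr1.
- move=> z; rewrite E B0 /lin2 /linear_form -/(cX z) -/(cY z) !mul0r sub0r add0r.
  by field; exact: N0.
move=> /eqP; rewrite mulNr oppr_eq0 mulf_eq0 invr_eq0 (negbTE N0) orbF => /eqP h2.
move=> /eqP; rewrite mulf_eq0 invr_eq0 (negbTE N0) orbF => /eqP h1.
by move/eqP : u0; apply; apply: ptP; rewrite !cE.
Qed.

Lemma lin2_pair (a b c d : R) : a * d - b * c != 0 -> exists C k : pt -> pt,
  [/\ linear C, linear k, cancel C k, cancel k C & forall z, C z = mk (lin2 a b z) (lin2 c d z)].
Proof.
move=> D; pose e := a * d - b * c.
exists (fun z => mk (lin2 a b z) (lin2 c d z)).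
exists (fun z => mk ((d * cX z - b * cY z) / e) ((a * cY z - c * cX z) / e)); split=> //.
- by move=> t u v; apply: ptP; rewrite /lin2 !cE; ring.
- by move=> t u v; apply: ptP; rewrite /lin2 !cE; ring.
- by move=> z; apply: ptP; rewrite /lin2 !cE /e; field.
- by move=> z; apply: ptP; rewrite /lin2 !cE /e; field.
Qed.

(** In the coordinates given by the two linear factors [P] is x y and [A] is diag(t, 1/t), which
    [hyperbolic] cuts off. *)
Lemma saddle_extension P u (A : pt -> pt) (rho : R) : homogeneous 2 P -> no_multiple_linear_factor P ->
  u != 0 -> P u = 0 -> linear A -> (forall z, P (A z) = P z) ->
  (forall u, P u = 0 -> exists2 a : R, 0 < a & A u = a *: u) -> 0 < rho ->
  exists K : pt -> pt, [/\ plane_diffeo K, \forall z \near (0 : pt), K z = A z,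
    forall z, rho <= `|z| -> K z = z & forall z, P (K z) = P z].
Proof.
move=> hP nP u0 Pu lA PA rays rho0; have [a [b [c [d [D PE]]]]] := two_lines hP nP u0 Pu.
have [C [k [lC lk Ck kC CE]]] := lin2_pair D.
have PC z : P z = cX (C z) * cY (C z) by rewrite PE CE !cE.
have zr (w : pt) : cX w * cY w = 0 -> exists2 t : R, 0 < t & C (A (k w)) = t *: w.
  move=> w0; have [|t t0 E] := rays (k w); first by rewrite PC kC.
  by exists t => //; rewrite E linearZ'// kC.
have [t t0 Et] : exists2 t : R, 0 < t & C (A (k e0)) = t *: e0 by apply: zr; rewrite !cE mulr0.
have [s s0 Es] : exists2 t : R, 0 < t & C (A (k e1)) = t *: e1 by apply: zr; rewrite !cE mul0r.
have DE z : C (A (k z)) = mk (t * cX z) (s * cY z).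
  have -> : z = cX z *: e0 + cY z *: e1 by apply: ptP; rewrite !cE; ring.
  rewrite (linearD' _ _ lk) (linearD' _ _ lA) (linearD' _ _ lC).
  rewrite !(linearZ' _ _ lk) !(linearZ' _ _ lA) !(linearZ' _ _ lC) Et Es.
  by apply: ptP; rewrite !cE; ring.
have ts : s = t^-1.
  have := PA (k (mk 1 1)); rewrite !PC DE kC !cE !mulr1 => E.
  by apply: (mulfI (lt0r_neq0 t0)); rewrite E divff ?gt_eqF.
have ck : {for (0 : pt), continuous k} by apply: smooth_at_continuous; exact: smooth_linear.
have /near_norm[rho1 rho10 h] : \forall z \near (0 : pt), `|k z| < rho.
  by have /cvgr_dist_lt/(_ _ rho0) := ck; apply: filterS => z; rewrite linear0'// sub0r normrN.
have [K [pK nK iK PK]] := hyperbolic (ln t) rho10.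
have eE : expR (ln t) = t by rewrite lnK.
have pC : plane_diffeo C by apply: (plane_diffeo_of Ck kC) => z; exact: smooth_linear.
have pk : plane_diffeo k by apply: (plane_diffeo_of kC Ck) => z; exact: smooth_linear.
exists (k \o K \o C); split.
- by apply: plane_diffeo_comp => //; exact: plane_diffeo_comp.
- have cC : {for (0 : pt), continuous C} by apply: smooth_at_continuous; exact: smooth_linear.
  have N : \forall z \near C 0, K z = mk (t * cX z) (s * cY z).
    rewrite linear0'//; apply: filterS nK => z ->.
    by rewrite expRN eE ts.
  have N' : \forall z \near (0 : pt), K (C z) = mk (t * cX (C z)) (s * cY (C z)) := cC _ N.
  by apply: filterS N' => z Kz; rewrite /comp Kz -DE Ck Ck.
- move=> z hz /=; rewrite iK ?Ck// leNgt; apply/negP => lt.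
  by move: hz; rewrite -(Ck z) leNgt h// subr0.
- by move=> z /=; rewrite !PC kC PK.
Qed.

(** In degree at least 3 rigidity makes the differential the identity and the Alexander trick
    applies. In degree 2 the differential is first divided out by its cut-off version [K1]; the
    remaining germ has identity differential. *)
Lemma germ_extension n P u (g : pt -> pt) (rho : R) :
  homogeneous n.+2 P -> no_multiple_linear_factor P -> u != 0 -> P u = 0 ->
  smooth_at 0 g -> g 0 = 0 -> (\forall z \near (0 : pt), P (g z) = P z) ->
  (forall u, P u = 0 -> exists2 a : R, 0 < a & dmap g 0 u = a *: u) -> 0 < rho ->
  exists K : pt -> pt, [/\ plane_diffeo K, \forall z \near (0 : pt), K z = g z,
    forall z, rho <= `|z| -> K z = z & forall z, P (K z) = P z].
Proof.
move=> hP nP u0 Pu sg g0 Pg rays rho0.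
have lA := dmap_linear sg; have PA z := dmap_preserves z hP hP sg g0 Pg.
case: n hP => [|n] hP; last first.
  apply: (alexander_hom hP) => //.
  have [[w [w0 Pw D]]|no] := pselect (exists w, [/\ w != 0, P w = 0 & independent u w]).
    by apply: (rigid_two hP nP lA PA u0 w0 Pu Pw D _ _ (ltn0Sn _)); exact: rays.
  apply: (rigid_one hP nP lA PA u0 Pu _ (rays u Pu)) => w Pw; apply/negP => D; apply: no; exists w.
  by split=> //; apply: contraTneq D => ->; rewrite /independent !cE !mulr0 subr0 eqxx.
have [K1 [pK1 nK1 iK1 PK1]] := saddle_extension hP nP u0 Pu lA PA rays rho0.
have [k [K1k kK1 sk]] := plane_diffeo_inv pK1.
have K10 : K1 0 = 0 by rewrite (nbhs_singleton nK1) linear0'.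
have k0 : k 0 = 0 by rewrite -{1}K10 K1k.
have sK1 z : smooth_at z K1 by case: pK1 => _ h _; exact: h.
have sk0 : smooth_at (g 0) k by exact: sk.
have sg' : smooth_at 0 (k \o g) by exact: smooth_comp_pt sg sk0.
have dg' : dmap (k \o g) 0 = id.
  apply/funext => z; rewrite (dmap_comp z sg sk0) g0.
  have -> : dmap g 0 z = dmap K1 0 z by rewrite (dmap_near z nK1) (dmap_of_linear _ _ lA).
  have sk1 : smooth_at (K1 0) k by exact: sk.
  have := dmap_comp z (sK1 0) sk1; rewrite K10 => <-; rewrite -[RHS](dmap_id 0 z).
  by congr (dmap _ 0 z); apply/funext => w; rewrite /comp K1k.
have kg0 : (k \o g) 0 = 0 by rewrite /= g0.
have Pkg : \forall z \near (0 : pt), P ((k \o g) z) = P z.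
  by apply: filterS Pg => z <-; rewrite -PK1 /= kK1.
have [K2 [pK2 nK2 iK2 PK2]] := alexander_hom hP sg' kg0 Pkg dg' rho0.
exists (K1 \o K2); split.
- exact: plane_diffeo_comp.
- by apply: filterS nK2 => z /= ->; rewrite /= kK1.
- by move=> z hz /=; rewrite iK2// iK1.
- by move=> z /=; rewrite PK1.
Qed.

End Homogeneous.
(** * Disks in a surface *)

Section Manifold.
Context {R : realType} {M : compact_surface R}.
Local Notation pt := 'rV[R]_2.
Implicit Types (c d : chart R M) (x y z : M) (p q : pt).

Lemma jac_left_inverse (F G : pt -> pt) p q : smooth_at p F -> F p = q -> smooth_at q G ->
  (\forall z \near p, G (F z) = z) -> jac F p != 0.
Proof.
move=> sF <- sG E; have [_ _ /(_ p)] := @plane_diffeo_id R.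
have -> : jac id p = jac (G \o F) p.
  have e (l : pt -> R) v : 'D_v (l \o id) p = 'D_v (l \o (G \o F)) p.
    by apply: eq_near_derive; apply: filterS E => z /= ->.
  by rewrite /jac !e.
by rewrite (jac_comp sF sG) mulf_eq0 negb_or => /andP[].
Qed.

Lemma cdom_near c x : atlas c -> cdom c x -> \forall y \near x, cdom c y.
Proof.
by move=> /(atlas_chart (surface_smooth M))[oc _ _ _] cx; apply: open_nbhs_nbhs.
Qed.

Lemma cmap_continuous c x : atlas c -> cdom c x -> {for x, continuous (cmap c)}.
Proof. by move=> /(atlas_chart (surface_smooth M))[_ cc _ _]; exact: cc. Qed.

Lemma cmap_inj c x y : atlas c -> cdom c x -> cdom c y -> cmap c x = cmap c y -> x = y.
Proof. by move=> /(atlas_chart (surface_smooth M))[_ _ ci _]; exact: ci. Qed.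

Lemma cmap_ge0 c x : atlas c -> cdom c x -> 0 <= cX (cmap c x).
Proof.
move=> /(atlas_chart (surface_smooth M))[oc _ _ on] cx; have [W _ E] := on _ oc (fun _ h => h).
by have [_] : (W `&` @half_plane R) (cmap c x) by rewrite -E; exists x.
Qed.

Lemma chart_onto c x (U : set M) : atlas c -> cdom c x -> nbhs x U ->
  exists2 r : R, 0 < r & forall p, `|p - cmap c x| < r -> 0 <= cX p ->
    exists y, [/\ U y, cdom c y & cmap c y = p].
Proof.
move=> Ac cx Ux; have [oc _ _ on] := atlas_chart (surface_smooth M) Ac.
have oU : open (interior U `&` cdom c) by apply: openI => //; exact: open_interior.
have [W oW E] := on _ oU (fun _ h => h.2).
have [Wx _] : (W `&` @half_plane R) (cmap c x) by rewrite -E; exists x.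
have /near_norm[r r0 hr] : \forall p \near cmap c x, W p by apply: open_nbhs_nbhs.
exists r => // p /hr Wp p0; have [y [Uy cy] yp] : (cmap c @` (interior U `&` cdom c)) p by rewrite E.
by exists y; split=> //; exact: interior_subset.
Qed.

Lemma transition c d x : atlas c -> atlas d -> cdom c x -> cdom d x ->
  exists g, local_rep c x (cmap d) g.
Proof. by move=> Ac Ad cx dx; have [] := atlas_compatible (surface_smooth M) Ac Ad cx dx. Qed.

Lemma chart_at x : exists2 c, atlas c & cdom c x.
Proof. exact: atlas_cover (surface_smooth M) x. Qed.

Lemma smooth_comp_at (F : pt -> pt) (g : pt -> R) p q :
  smooth_at p F -> F p = q -> smooth_at q g -> smooth_at p (g \o F).
Proof. by move=> sF <- sg; exact: smooth_comp sF sg. Qed.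

Lemma smooth_comp_pt_at (F G : pt -> pt) p q :
  smooth_at p F -> F p = q -> smooth_at q G -> smooth_at p (G \o F).
Proof. by move=> sF <- sg; exact: smooth_comp_pt sF sg. Qed.

Lemma rep_change_pt c d x (u : M -> pt) g : local_rep c x u g -> atlas c -> atlas d ->
  cdom c x -> cdom d x -> exists g', local_rep d x u g'.
Proof.
move=> [sg ug] Ac Ad cx dx; have [t [st ct]] := transition Ad Ac dx cx.
exists (g \o t); split.
  exact: smooth_comp_pt_at st (esym (nbhs_singleton ct)) sg.
by apply: filterS2 ug ct => y -> /= ->.
Qed.

Lemma rep_comp_pt c x (u : M -> pt) g (t : pt -> pt) : local_rep c x u g -> smooth_at (u x) t ->
  local_rep c x (t \o u) (t \o g).
Proof.
move=> [sg ug] st; split; first exact: smooth_comp_pt_at sg (esym (nbhs_singleton ug)) st.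
by apply: filterS ug => y /= ->.
Qed.

Lemma rep_eq_pt c x (u v : M -> pt) g : local_rep c x u g -> (\forall y \near x, v y = u y) ->
  local_rep c x v g.
Proof. by move=> [sg ug] vu; split; [exact: sg|apply: filterS2 ug vu => y <-]. Qed.

Definition smooth_map_at (h : M -> M) x := exists c d g,
  [/\ atlas c, atlas d, cdom c x, cdom d (h x) & local_rep c x (cmap d \o h) g].

(** One pair of charts at each point suffices, since the transition maps are smooth. *)
Lemma smooth_mapP (h : M -> M) : smooth_map h <-> continuous h /\ forall x, smooth_map_at h x.
Proof.
split=> [[hc H]|[hc H]]; (split; first exact: hc).
  move=> x; have [c Ac cx] := chart_at x; have [d Ad dx] := chart_at (h x).
  by have [g G] := H c d x Ac Ad cx dx; exists c, d, g.
move=> c' d' x Ac' Ad' cx' dx'; have [c [d [g [Ac Ad cx dx [sg hg]]]]] := H x.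
have [t [st dt]] := transition Ad Ad' dx dx'.
have G : local_rep c x (cmap d' \o h) (t \o g).
  apply: rep_eq_pt (rep_comp_pt (conj sg hg) st) _.
  exact: (hc x _ dt).
exact: (rep_change_pt G Ac Ac' cx cx').
Qed.

Lemma smooth_map_local (h : M -> M) :
  (forall x, exists2 h', smooth_map h' & \forall y \near x, h y = h' y) -> smooth_map h.
Proof.
move=> H; apply/smooth_mapP; split=> x; have [h' /smooth_mapP[ch sh] E] := H x.
  apply: cvg_trans (near_eq_cvg _) _; first exact: (filterS (fun y e => esym e) E).
  by rewrite (nbhs_singleton E); exact: ch.
have [c [d [g [Ac Ad cx dx [sg hg]]]]] := sh x; exists c, d, g.
rewrite (nbhs_singleton E); split; [exact: Ac|exact: Ad|exact: cx|exact: dx|].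
by apply: rep_eq_pt (conj sg hg) _; apply: filterS E => y /= ->.
Qed.

Lemma smooth_map_id : smooth_map (@id M).
Proof.
apply/smooth_mapP; split=> x; first exact: cvg_id.
have [c Ac cx] := chart_at x; exists c, c, id; split; [exact: Ac|exact: Ac|exact: cx|exact: cx|].
by split; [exact: smooth_id|exact: nearW].
Qed.

Lemma smooth_map_comp (h k : M -> M) : smooth_map h -> smooth_map k -> smooth_map (h \o k).
Proof.
move=> [ch sh] [ck sk]; apply/smooth_mapP; split=> x.
  by apply: continuous_comp; [exact: ck|exact: ch].
have [c Ac cx] := chart_at x; have [d Ad dx] := chart_at (k x).
have [e Ae ex] := chart_at (h (k x)).
have [g [sg hg]] := sk c d x Ac Ad cx dx; have [g' [sg' hg']] := sh d e (k x) Ad Ae dx ex.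
exists c, e, (g' \o g); split; [exact: Ac|exact: Ae|exact: cx|exact: ex|].
apply: rep_eq_pt (rep_comp_pt (conj sg hg) sg') _.
exact: (ck x _ hg').
Qed.

Lemma diffeo_of (h k : M -> M) : smooth_map h -> smooth_map k -> cancel h k -> cancel k h ->
  diffeo h.
Proof. by move=> sh sk hk kh; split=> //; exists k. Qed.

Lemma diffeo_comp (h k : M -> M) : diffeo h -> diffeo k -> diffeo (h \o k).
Proof.
move=> [sh [h' [sh' hh h'h]]] [sk [k' [sk' kk k'k]]].
apply: (@diffeo_of _ (k' \o h')); [exact: smooth_map_comp..|exact: can_comp|exact: can_comp].
Qed.

(** At a point with positive first coordinate the transition map is a local diffeomorphism of the
    plane, so its values fill a neighbourhood of [cmap d x]. If this point were on the boundary
    line, the chart [d] would take values outside the half plane. *)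
Lemma pos_inner c x : atlas c -> cdom c x -> 0 < cX (cmap c x) -> ~ boundary x.
Proof.
move=> Ac cx c0 [d [Ad dx d0]].
have [t [st dt]] := transition Ac Ad cx dx; have [s [ss cs]] := transition Ad Ac dx cx.
have tx : t (cmap c x) = cmap d x by rewrite -(nbhs_singleton dt).
have [r r0 onto] := chart_onto Ac cx (filterI (filterI dt cs) (cdom_near Ad dx)).
pose r1 := Num.min r (cX (cmap c x)).
have r10 : 0 < r1 by rewrite lt_min r0.
have onto1 p : `|p - cmap c x| < r1 -> exists y, [/\ cdom d y, cmap c y = p, cmap d y = t p & s (t p) = p].
  rewrite lt_min => /andP[h1 h2]; have [|y [[[dy sy] cy] _ yp]] := onto p h1.
    have := cX_le (p - cmap c x); rewrite cXD cXN ler_norml => /andP[h3 _]; lra.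
  by exists y; split=> //; [rewrite dy yp|rewrite -yp -dy].
have J : jac t (cmap c x) != 0.
  apply: jac_left_inverse st tx ss _.
  by apply/near_norm; exists r1 => // p /onto1[y []].
have [r2 [G [r20 _ cG Gt nG]]] := inverse_function st J; rewrite tx in cG Gt nG.
have nG2 : \forall w \near cmap d x, `|G w - cmap c x| < r1.
  by have := cG; move/cvgr_distC_lt => /(_ _ r10); rewrite Gt.
have /near_norm[e e0 he] : \forall w \near cmap d x, (t (G w) = w /\ smooth_at w G) /\ `|G w - cmap c x| < r1.
  exact: filterI nG nG2.
have [|[tG _] /onto1[y [cy yG dy _]]] := he (cmap d x - mk (e / 2) 0).
  rewrite addrAC subrr add0r normrN; apply/norm_ltP; rewrite !cE normr0 ger0_norm ?divr_ge0// ?ltW//.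
  by split=> //; lra.
have := cmap_ge0 Ad cy; rewrite dy tG !cE /cX d0; lra.
Qed.

(** Coordinates [m] on an open part of the interior, together with their inverse [j]. They are only
    compared with the atlas locally and need not be a chart of it, so that one can pass freely to
    coordinates adapted to [f]. *)
Record disk (m : M -> pt) (j : pt -> M) (r : R) : Prop := Disk {
  disk_gt0 : 0 < r;
  disk_open : open (j @` [set p | `|p| < r]);
  disk_inner : forall p, `|p| < r -> ~ boundary (j p);
  disk_mK : forall p, `|p| < r -> m (j p) = p;
  disk_smooth : forall p, `|p| < r -> exists c g,
    [/\ atlas c, cdom c (j p), local_rep c (j p) m g & jac g (cmap c (j p)) != 0] }.

Definition region (j : pt -> M) (r : R) : set M := j @` [set p | `|p| < r].

Lemma inner_pos c x : atlas c -> cdom c x -> ~ boundary x -> 0 < cX (cmap c x).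
Proof.
move=> Ac cx ix; rewrite lt_def cmap_ge0// andbT; apply/eqP => h.
by apply: ix; exists c.
Qed.

Lemma chart_onto_inner c x (U : set M) : atlas c -> cdom c x -> ~ boundary x -> nbhs x U ->
  exists2 r : R, 0 < r & forall p, `|p - cmap c x| < r ->
    exists y, [/\ U y, cdom c y & cmap c y = p].
Proof.
move=> Ac cx ix Ux; have [r r0 onto] := chart_onto Ac cx Ux; have c0 := inner_pos Ac cx ix.
exists (Num.min r (cX (cmap c x))); first by rewrite lt_min r0.
move=> p; rewrite lt_min => /andP[h1 h2]; apply: onto => //.
by have := cX_le (p - cmap c x); rewrite cXD cXN ler_norml => /andP[h3 _]; lra.
Qed.

Section Disk.
Context (m : M -> pt) (j : pt -> M) (r : R) (D : disk m j r).

Lemma region_near y : region j r y -> \forall z \near y, region j r z.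
Proof. by move=> jy; apply: open_nbhs_nbhs; split=> //; exact: disk_open D. Qed.

Lemma disk_region p : `|p| < r -> region j r (j p). Proof. by move=> pr; exists p. Qed.

Lemma disk_jm y : region j r y -> j (m y) = y /\ `|m y| < r.
Proof. by move=> [p pr <-]; rewrite (disk_mK D). Qed.

Lemma disk_rep d p : `|p| < r -> atlas d -> cdom d (j p) -> exists g, local_rep d (j p) m g.
Proof.
move=> pr Ad dp; have [c [g [Ac cp G _]]] := disk_smooth D pr.
exact: (rep_change_pt G Ac Ad cp dp).
Qed.

Lemma disk_m_continuous y : region j r y -> {for y, continuous m}.
Proof.
move=> [p pr <-]; have [c [g [Ac cp [sg mg] _]]] := disk_smooth D pr.
apply: cvg_trans (near_eq_cvg _) _; first exact: (filterS (fun y e => esym e) mg).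
rewrite (nbhs_singleton mg); apply: continuous_comp; first exact: cmap_continuous.
exact: smooth_at_continuous.
Qed.

Lemma disk_near (Q : set pt) p : `|p| < r -> (\forall q \near p, Q q) ->
  \forall y \near j p, region j r y /\ Q (m y).
Proof.
move=> pr Qp; apply: filterI; first exact: region_near (disk_region pr).
by apply: (disk_m_continuous (disk_region pr)); rewrite (disk_mK D).
Qed.

Lemma disk_nbhs (Q : set M) p : `|p| < r -> (\forall q \near p, Q (j q)) -> nbhs (j p) Q.
Proof.
by move=> pr /(disk_near pr); apply: filterS => y [/disk_jm[E _]]; rewrite E.
Qed.

(** Read in a chart, [m] is locally invertible and [j] coincides with the smooth inverse provided by
    the inverse function theorem. *)
Lemma disk_chart p : `|p| < r -> exists c,
  [/\ atlas c, cdom c (j p), smooth_at p (cmap c \o j), jac (cmap c \o j) p != 0 & {for p, continuous j}].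
Proof.
move=> pr; have [c [g [Ac cp [sg mg] J]]] := disk_smooth D pr.
have ip := disk_inner D pr; have [r2 [G [r20 _ cG Gg nG]]] := inverse_function sg J.
have mp : m (j p) = p := disk_mK D pr.
have gp : g (cmap c (j p)) = p by rewrite -(nbhs_singleton mg).
rewrite gp in cG Gg nG.
have key (U : set M) : nbhs (j p) U -> \forall q \near p, [/\ U (j q), cmap c (j q) = G q & smooth_at q G].
  move=> Up; have R1 := region_near (disk_region pr).
  have [e e0 onto] := chart_onto_inner Ac cp ip (filterI (filterI Up mg) R1).
  have nG2 : \forall w \near p, `|G w - cmap c (j p)| < e.
    by have := cG; move/cvgr_distC_lt => /(_ _ e0); rewrite Gg.
  apply: filterS2 nG nG2 => q [gG sG] /onto[y [[[Uy my] Ry] cy yG]].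
  have [jmy _] := disk_jm Ry; have qy : q = m y by rewrite my yG gG.
  by rewrite -qy in jmy; rewrite jmy; split; [exact: Uy|exact: yG|exact: sG].
have sG : smooth_at p G by exact: (nbhs_singleton nG).2.
have E : \forall q \near p, G q = (cmap c \o j) q.
  by apply: filterS (key setT filterT) => q [_ h _] /=; rewrite h.
exists c; split; [exact: Ac|exact: cp| | |].
- exact: smooth_at_eq E sG.
- have scj : smooth_at p (cmap c \o j) by exact: smooth_at_eq E sG.
  apply: jac_left_inverse scj erefl sg _.
  by apply: filterS2 nG E => q [gG _] /= <-.
- by move=> U /key; apply: filterS => q [].
Qed.

Lemma disk_j_continuous p : `|p| < r -> {for p, continuous j}.
Proof. by move=> /disk_chart[c []]. Qed.

Lemma disk_j_smooth d p : `|p| < r -> atlas d -> cdom d (j p) -> smooth_at p (cmap d \o j).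
Proof.
move=> pr Ad dp; have [c [Ac cp sc _ cj]] := disk_chart pr.
have [t [st ct]] := transition Ac Ad cp dp.
apply: (@smooth_at_eq _ _ (t \o (cmap c \o j))); last exact: smooth_comp_pt sc st.
have ct' : \forall q \near p, cmap d (j q) = t (cmap c (j q)) := cj _ ct.
by apply: filterS ct' => q /= ->.
Qed.

Lemma disk_fun_smooth (f : M -> R) p : smooth_fun f -> `|p| < r -> smooth_at p (f \o j).
Proof.
move=> sf pr; have [c [Ac cp sc _ cj]] := disk_chart pr; have [g [sg fg]] := sf c _ Ac cp.
apply: (@smooth_at_eq _ _ (g \o (cmap c \o j))); last exact: smooth_comp sc sg.
have fg' : \forall q \near p, f (j q) = g (cmap c (j q)) := cj _ fg.
by apply: filterS fg' => q /= ->.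
Qed.

Lemma disk_critical (f : M -> R) p : smooth_fun f -> `|p| < r ->
  critical f (j p) <-> forall v, 'D_v (f \o j) p = 0.
Proof.
move=> sf pr; split=> [cr v|D0 c g Ac cp [sg fg] v].
  have [c [Ac cp sc _ cj]] := disk_chart pr; have [g G] := sf c _ Ac cp.
  have [sg fg] := G; have fg' : \forall q \near p, (f \o j) q = (g \o (cmap c \o j)) q := cj _ fg.
  rewrite (eq_near_derive v fg'); have /smooth_at_pt[sX sY] := sc.
  have [_ ->] := derive_comp_pt (smooth_at_diff sg) (smooth_at_diff sX) (smooth_at_diff sY).
  by rewrite /= !(cr c g Ac cp G) !mulr0 addr0.
have [t [st mt]] := disk_rep pr Ac cp; have mp : m (j p) = p := disk_mK D pr.
have tp : t (cmap c (j p)) = p by rewrite -(nbhs_singleton mt).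
have ip := disk_inner D pr.
have [e e0 onto] := chart_onto_inner Ac cp ip (filterI (filterI fg mt) (region_near (disk_region pr))).
have E : \forall q \near cmap c (j p), g q = ((f \o j) \o t) q.
  apply/near_norm; exists e => // q /onto[y [[[fy my] Ry] cy <-]] /=.
  by rewrite -my (disk_jm Ry).1.
rewrite (eq_near_derive v E); have /smooth_at_pt[sX sY] := st.
have sfj : smooth_at (t (cmap c (j p))) (f \o j) by rewrite tp; exact: disk_fun_smooth.
have [_ ->] := derive_comp_pt (smooth_at_diff sfj) (smooth_at_diff sX) (smooth_at_diff sY).
by rewrite tp !D0 !mulr0 addr0.
Qed.

End Disk.

Lemma open_of_near (A : set M) : (forall y, A y -> \forall z \near y, A z) -> open A.
Proof. by move=> H; rewrite openE => y /H. Qed.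

Lemma near_norm_lt p (r : R) : `|p| < r -> \forall q \near p, `|q| < r.
Proof.
move=> pr; apply/near_norm; exists (r - `|p|); first by rewrite subr_gt0.
by move=> q h; have := ler_normD (q - p) p; rewrite subrK; lra.
Qed.

Lemma disk_shrink m j (r r' : R) : disk m j r -> 0 < r' -> r' <= r -> disk m j r'.
Proof.
move=> D r0 rr; have lt p : `|p| < r' -> `|p| < r by move=> h; exact: lt_le_trans h rr.
split=> // [|p /lt|p /lt|p /lt]; [|exact: disk_inner D p|exact: disk_mK D p|exact: disk_smooth D p].
apply: open_of_near => _ [p pr <-].
have N : \forall q \near p, `|q| < r'.
  exact: near_norm_lt.
apply: filterS (disk_near D (lt _ pr) N) => y [Ry my]; exists (m y) => //.
by have [] := disk_jm D Ry.
Qed.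

Lemma disk_at c x : atlas c -> cdom c x -> ~ boundary x ->
  exists j r, disk (fun y => cmap c y - cmap c x) j r /\ j 0 = x.
Proof.
move=> Ac cx ix.
have [r r0 onto] := chart_onto_inner Ac cx ix (cdom_near Ac cx).
pose j p := xget x [set y | cdom c y /\ cmap c y = cmap c x + p].
have jP p : `|p| < r -> cdom c (j p) /\ cmap c (j p) = cmap c x + p.
  move=> pr; have [|y [_ cy yp]] := onto (cmap c x + p); first by rewrite addrAC subrr add0r.
  exact: (@xgetPex _ x [set y | cdom c y /\ cmap c y = cmap c x + p]) (ex_intro _ y (conj cy yp)).
have jE y : cdom c y -> `|cmap c y - cmap c x| < r -> j (cmap c y - cmap c x) = y.
  move=> cy yr; have [cj E] := jP _ yr; apply: (cmap_inj Ac cj cy).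
  by rewrite E addrC subrK.
pose r1 := Num.min r (cX (cmap c x)); have r10 : 0 < r1 by rewrite lt_min r0 inner_pos.
have lt p : `|p| < r1 -> `|p| < r by rewrite lt_min => /andP[].
have ij p : `|p| < r1 -> ~ boundary (j p).
  move=> pr; have [cj E] := jP _ (lt _ pr); apply: (pos_inner Ac cj); rewrite E cXD.
  by have := cX_le p; move: pr; rewrite lt_min ler_norml => /andP[_ h] /andP[h' _]; lra.
exists j, r1; split; last first.
  by rewrite -(subrr (cmap c x)) jE// subrr normr0.
split; [exact: r10| |exact: ij|move=> p /lt/jP[_ ->]; by rewrite addrAC subrr add0r|].
- apply: open_of_near => _ [p pr <-]; have [cj E] := jP _ (lt _ pr).
  have N : \forall q \near cmap c (j p), `|q - cmap c x| < r1.
    rewrite E; have /near_norm[e e0 he] := near_norm_lt pr.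
    apply/near_norm; exists e => // q; rewrite opprD addrA => /he //.
  have N' : \forall y \near j p, `|cmap c y - cmap c x| < r1 := cmap_continuous Ac cj N.
  apply: filterS (filterI (cdom_near Ac cj) N') => y [cy /= yr].
  by exists (cmap c y - cmap c x) => //; apply: jE => //; exact: lt.
- move=> p pr; have [cj E] := jP _ (lt _ pr).
  exists c, (fun q => q - cmap c x); split; [exact: Ac|exact: cj| |].
    by split; [exact: smooth_shift|exact: nearW].
  have H (l : pt -> R) a v : (forall q, l (q + a) = l q + l a) -> smooth_at (cmap c (j p)) l ->
      'D_v (l \o (fun q => q + a)) (cmap c (j p)) = 'D_v l (cmap c (j p)).
    move=> lD sl; have -> : l \o (fun q => q + a) = l \+ cst (l a) by apply/funext => q /=.
    rewrite deriveD; first by rewrite derive_cst addr0.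
      by apply: diff_derivable; exact: smooth_at_diff.
    exact: derivable_cst.
  have HX v := H (@cX R) (- cmap c x) v (fun q => cXD q _) (smooth_X _).
  have HY v := H (@cY R) (- cmap c x) v (fun q => cYD q _) (smooth_Y _).
  rewrite /jac !HX !HY.
  by rewrite !derive_X !derive_Y !cE mulr1 mulr0 subr0 oner_neq0.
Qed.

Lemma disk_change m j (r : R) (F : pt -> pt) : disk m j r -> smooth_at 0 F -> F 0 = 0 ->
  jac F 0 != 0 -> exists G r', [/\ disk (F \o m) (j \o G) r', G 0 = 0,
    (forall p, `|p| < r' -> [/\ F (G p) = p, `|G p| < r & smooth_at p G]) &
    forall y, region (j \o G) r' y -> region j r y].
Proof.
move=> D sF F0 J0; have r0 := disk_gt0 D.
have [r1 [G [r10 inj cG G0 nG]]] := inverse_function sF J0; rewrite F0 in cG G0 nG.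
have J : \forall z \near (0 : pt), jac F z != 0 /\ smooth_at z F.
  apply: filterI; last exact: smooth_at_near.
  by have /cvgr_neq0/(_ J0) := smooth_at_continuous (smooth_jac sF).
have /near_norm[r2 r20 h2] := J.
pose r3 := Num.min r (Num.min r1 r2).
have r30 : 0 < r3 by rewrite !lt_min r0 r10.
have nG2 : \forall w \near (0 : pt), `|G w| < r3.
  by have := cG; move/cvgr_dist_lt => /(_ _ r30); rewrite G0; apply: filterS => w; rewrite sub0r normrN.
have /near_norm[r' r'0 h'] : \forall w \near (0 : pt), (F (G w) = w /\ smooth_at w G) /\ `|G w| < r3.
  exact: filterI nG nG2.
have H w : `|w| < r' -> [/\ F (G w) = w, smooth_at w G, `|G w| < r, `|G w| < r1 & `|G w| < r2].
  move=> wr; have [|[FG sG]] := h' w; first by rewrite subr0.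
  by rewrite !lt_min => /and3P[].
exists G, r'; split; [|exact: G0| |by move=> _ [p /H[_ _ Gr _ _] <-]; exists (G p)].
  split; [exact: r'0| |move=> p /H[_ _ Gr _ _]|move=> p /H[FG _ Gr _ _]|move=> p /H[FG sG Gr _ Gr2]].
  - apply: open_of_near => _ [p pr <-]; have [FG sG Gr Gr1 Gr2] := H _ pr.
    have [_ sFG] : jac F (G p) != 0 /\ smooth_at (G p) F by apply: h2; rewrite subr0.
    have cF : {for G p, continuous F} := smooth_at_continuous sFG.
    have N1 : \forall q \near G p, `|q| < r1.
      exact: near_norm_lt.
    have N2 : \forall q \near G p, `|F q| < r'.
      by apply: (cF [set q | `|q| < r']); apply: near_norm_lt; rewrite FG.
    apply: filterS (disk_near D Gr (filterI N1 N2)) => y [Ry [my1 my2]].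
    exists (F (m y)) => //=; have [E _] := disk_jm D Ry; rewrite -[RHS]E; congr j.
    have [FG' _ _ h _] := H _ my2; apply: inj => //; by rewrite subr0.
  - exact: disk_inner D (G p) Gr.
  - by rewrite /= (disk_mK D).
  - have [J1 sFG] : jac F (G p) != 0 /\ smooth_at (G p) F by apply: h2; rewrite subr0.
    have [c [g [Ac cp G1 Jg]]] := disk_smooth D Gr.
    have E : m (j (G p)) = G p := disk_mK D Gr.
    have sF' : smooth_at (m (j (G p))) F by rewrite E.
    exists c, (F \o g); split; [exact: Ac|exact: cp|exact: rep_comp_pt G1 sF'|].
    have [sg mg] := G1; have gE : g (cmap c (j (G p))) = G p by rewrite -(nbhs_singleton mg).
    have sF2 : smooth_at (g (cmap c (j (G p)))) F by rewrite gE.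
    have := jac_comp sg sF2 => /= ->; by rewrite mulf_neq0 ?gE.
by move=> p /H[].
Qed.

Section Lift.
Context (m : M -> pt) (j : pt -> M) (r : R) (D : disk m j r).

Definition lift (K : pt -> pt) y : M := if `[< region j r y >] then j (K (m y)) else y.

Lemma lift_in K p : `|p| < r -> lift K (j p) = j (K p).
Proof.
by move=> pr; rewrite /lift asboolT; [rewrite (disk_mK D)|exact: disk_region].
Qed.

Lemma lift_out K y : ~ region j r y -> lift K y = y.
Proof. by move=> h; rewrite /lift asboolF. Qed.

(** The image of a compact ball is closed since the surface is Hausdorff. This is what makes an
    extension by the identity smooth on the rim of the disk. *)
Lemma closed_core (r0 : R) : r0 < r -> closed (j @` [set p | `|p| <= r0]).
Proof.
move=> rr; apply: compact_closed; first exact: surface_hausdorff.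
apply: continuous_compact; last exact: ball_compact.
apply: continuous_in_subspaceT => p /set_mem /= pr; apply: (disk_j_continuous D).
exact: le_lt_trans pr rr.
Qed.

Section Supported.
Context (K : pt -> pt) (r0 : R) (K1 : forall z : pt, r0 <= `|z| -> K z = z) (rr : r0 < r).

Lemma lift_fix y : ~ (j @` [set p | `|p| < r0]) y -> lift K y = y.
Proof.
move=> h; have [[p pr E]|ny] := pselect (region j r y); last exact: lift_out.
rewrite -E lift_in// K1// leNgt; apply/negP => lt; by apply: h; exists p.
Qed.

Lemma lift_near_out y : ~ (j @` [set p | `|p| <= r0]) y -> \forall z \near y, lift K z = z.
Proof.
move=> h; have : \forall z \near y, ~ (j @` [set p | `|p| <= r0]) z.
  apply: open_nbhs_nbhs; split=> //; exact: (closed_openC (closed_core rr)).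
apply: filterS => z nz; apply: lift_fix => -[p pr E]; apply: nz; exists p => //=.
exact: ltW.
Qed.

(** If [K p] were outside the support, then K (K p) = K p, and injectivity would give K p = p. *)
Lemma supported_lt p : injective K -> `|p| < r -> `|K p| < r.
Proof.
move=> inj pr; have [h|h] := leP r0 `|K p|; last exact: lt_trans h rr.
by rewrite (inj _ _ (K1 h)).
Qed.

Lemma lift_smooth : plane_diffeo K -> smooth_map (lift K).
Proof.
move=> [bK sK _]; have iK := bij_inj bK.
have cj p : `|p| < r -> \forall z \near j p, lift K z = j (K (m z)).
  move=> pr; apply: filterS (region_near D (disk_region j pr)) => z [q qr <-].
  by rewrite lift_in// (disk_mK D).
apply/smooth_mapP; split=> x; have [[p pr E]|nx] := pselect (region j r x).
- rewrite -E; apply: cvg_trans (near_eq_cvg _) _.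
    exact: (filterS (fun y e => esym e) (cj p pr)).
  rewrite lift_in//; have -> : j (K p) = j (K (m (j p))) by rewrite (disk_mK D).
  apply: (@continuous_comp _ _ _ m (fun q => j (K q))).
    exact: (disk_m_continuous D (disk_region j pr)).
  apply: continuous_comp; first exact: smooth_at_continuous.
  by apply: (disk_j_continuous D); rewrite (disk_mK D)//; exact: supported_lt.
- have N : \forall z \near x, lift K z = z.
    by apply: lift_near_out => -[p pr E]; apply: nx; exists p => //=; exact: le_lt_trans pr rr.
  apply: cvg_trans (near_eq_cvg _) _; first exact: (filterS (fun y e => esym e) N).
  by rewrite (nbhs_singleton N); exact: cvg_id.
- rewrite -E; have [c [_ [Ac cp _ _]]] := disk_smooth D pr.
  have [t G] := disk_rep D pr Ac cp; have [d Ad dp] := chart_at (j (K p)).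
  have Kr := supported_lt iK pr.
  have mp : m (j p) = p := disk_mK D pr.
  exists c, d, ((cmap d \o j \o K) \o t); split; [exact: Ac|exact: Ad|exact: cp|by rewrite lift_in|].
  have s : smooth_at (m (j p)) (cmap d \o j \o K).
    rewrite mp; exact: smooth_comp_pt (sK p) (disk_j_smooth D Kr Ad dp).
  apply: rep_eq_pt (rep_comp_pt G s) _.
  by apply: filterS (cj p pr) => z /= ->.
- have N : \forall z \near x, lift K z = z.
    by apply: lift_near_out => -[p pr E]; apply: nx; exists p => //=; exact: le_lt_trans pr rr.
  have [c Ac cx] := chart_at x; exists c, c, id; rewrite (nbhs_singleton N).
  split; [exact: Ac|exact: Ac|exact: cx|exact: cx|].
  split; [exact: smooth_id|by apply: filterS N => z /= ->].
Qed.

End Supported.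

Lemma liftK K k (r0 : R) : (forall z : pt, r0 <= `|z| -> K z = z) -> r0 < r -> cancel K k ->
  cancel (lift K) (lift k).
Proof.
move=> K1 rr Kk y; have [[p pr <-]|ny] := pselect (region j r y); last by rewrite !lift_out.
by rewrite !lift_in// ?Kk//; apply: (supported_lt K1 rr) => //; exact: can_inj Kk.
Qed.

Lemma lift_diffeo K (r0 : R) : plane_diffeo K -> (forall z : pt, r0 <= `|z| -> K z = z) -> r0 < r ->
  diffeo (lift K).
Proof.
move=> pK K1 rr; have [k [Kk kK sk]] := plane_diffeo_inv pK.
have k1 (z : pt) : r0 <= `|z| -> k z = z by move=> h; rewrite -{1}(K1 z h) Kk.
have pk : plane_diffeo k by apply: plane_diffeo_of kK Kk sk _; case: pK.
apply: (@diffeo_of _ (lift k)); [exact: (lift_smooth K1)|exact: (lift_smooth k1)| |].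
  exact: liftK K1 rr Kk.
exact: liftK k1 rr kK.
Qed.

End Lift.

Section Maps.
Context (m m' : M -> pt) (j j' : pt -> M) (r r' : R) (D : disk m j r) (D' : disk m' j' r').

Lemma disk_map (h : M -> M) p : smooth_map h -> `|p| < r -> region j' r' (h (j p)) ->
  smooth_at p (m' \o h \o j).
Proof.
move=> sh pr [q qr E]; have [c [Ac cp sc _ cj]] := disk_chart D pr.
have [d [g' [Ad dq [sg' mg'] _]]] := disk_smooth D' qr; rewrite E in dq sg' mg'.
have [ch /(_ c d (j p) Ac Ad cp dq)[g [sg hg]]] := sh.
have s1 := smooth_comp_pt_at sg (esym (nbhs_singleton hg)) sg'.
apply: smooth_at_eq (smooth_comp_pt sc s1).
have e1 : \forall z \near p, cmap d (h (j z)) = g (cmap c (j z)) := cj _ hg.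
have chj : {for p, continuous (h \o j)} by apply: continuous_comp cj (ch _).
have e2 : \forall z \near p, m' (h (j z)) = g' (cmap d (h (j z))) := chj _ mg'.
by apply: filterS2 e1 e2 => z /= <- ->.
Qed.

Lemma disk_map_near (h : M -> M) p : continuous h -> `|p| < r -> region j' r' (h (j p)) ->
  \forall z \near p, j' ((m' \o h \o j) z) = h (j z) /\ `|(m' \o h \o j) z| < r'.
Proof.
move=> ch pr Rp; have chj : {for p, continuous (h \o j)}.
  by apply: continuous_comp (disk_j_continuous D pr) (ch _).
have N : \forall z \near p, region j' r' (h (j z)) := chj _ (region_near D' Rp).
by apply: filterS N => z /(disk_jm D').
Qed.

End Maps.

Lemma disk_map_jac m m' j j' (r r' : R) (h : M -> M) p : disk m j r -> disk m' j' r' ->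
  diffeo h -> `|p| < r -> region j' r' (h (j p)) -> jac (m' \o h \o j) p != 0.
Proof.
move=> D D' [sh [k [sk hk kh]]] pr Rp; have [ch _] := sh.
have [E1 E2] := disk_jm D' Rp; have jj : k (j' (m' (h (j p)))) = j p by rewrite E1 hk.
have Rk : region j r (k (j' (m' (h (j p))))) by rewrite jj; exists p.
apply: jac_left_inverse (disk_map D D' sh pr Rp) erefl (disk_map D' D sk E2 Rk) _.
apply: filterS2 (disk_map_near D D' ch pr Rp) (near_norm_lt pr) => z [E3 _] zr.
by rewrite /= in E3 *; rewrite E3 hk (disk_mK D).
Qed.

End Manifold.
(** * Components of level sets *)

Section Reeb.
Context {R : realType} {M : compact_surface R} {f : M -> R} (hf : classF f).
Local Notation pt := 'rV[R]_2.
Implicit Types (c d : chart R M) (x y z : M) (p q : pt).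

(** Induction along a connected set: [P] and its negation are both relatively open. The propagation
    arguments on level components, on the star and on edges all go through it. *)
Lemma connected_near_ind (T : topologicalType) (A : set T) (P : T -> Prop) (x y : T) :
  connected A -> A x -> A y -> P x ->
  (forall a, A a -> \forall b \near a, A b -> (P a <-> P b)) -> P y.
Proof.
move=> cA Ax Ay Px H; have -> // : P y = (A `&` [set a | P a]) y by apply/propext; split=> [|[]].
suff -> : A `&` [set a | P a] = A by [].
apply: cA; first by exists x.
- exists (interior [set a | A a -> P a]); first exact: open_interior.
  apply/seteqP; split=> a [Aa Pa]; split=> //.
    by apply: filterS (H a Aa) => b h Ab; apply/h.
  exact: (interior_subset Pa).
- exists (~` interior [set a | A a -> ~ P a]); first exact: open_closedC (open_interior _).
  apply/seteqP; split=> a [Aa Pa]; split=> //.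
    by move=> /interior_subset /(_ Aa).
  apply: contrapT => nP; apply: Pa; apply: filterS (H a Aa) => b h Ab Pb.
  by apply: nP; apply/h.
Qed.

Lemma classF_continuous : continuous f.
Proof.
move=> x; have [c Ac cx] := chart_at x; have [g [sg fg]] := classF_smooth hf Ac cx.
apply: cvg_trans (near_eq_cvg _) _; first exact: (filterS (fun y e => esym e) fg).
rewrite (nbhs_singleton fg); apply: continuous_comp; first exact: cmap_continuous.
exact: smooth_at_continuous.
Qed.

Notation "x ~~ y" := (level_component f x y) (at level 70).

Lemma lc_sym x y : x ~~ y -> y ~~ x.
Proof. by move=> /asboolP; rewrite -/(reeb_rel f x y) reeb_rel_sym => /asboolP. Qed.

Lemma lc_trans y x z : x ~~ y -> y ~~ z -> x ~~ z.
Proof. by move=> xy yz; apply/asboolP; apply: (@reeb_rel_trans _ _ _ y); apply/asboolP. Qed.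

Lemma lc_refl x : x ~~ x.
Proof. exact: connected_component_refl. Qed.

Lemma lc_f x y : x ~~ y -> f x = f y.
Proof. by move=> /level_componentf. Qed.

Lemma lc_connected x : connected (level_component f x).
Proof. exact: component_connected. Qed.

Lemma lc_closed x : closed (level_component f x).
Proof.
apply: component_closed; apply: preimage_closed; last exact: closed_eq.
by move=> y _; exact: classF_continuous.
Qed.

Lemma lc_max (A : set M) x y : connected A -> A x -> A y -> (forall z, A z -> f z = f x) -> x ~~ y.
Proof. by move=> cA Ax Ay fA; exists A. Qed.

Lemma lc_path (phi : R -> M) (a b : R) : a <= b ->
  (forall t, a <= t <= b -> {for t, continuous phi}) ->
  (forall t, a <= t <= b -> f (phi t) = f (phi a)) -> phi a ~~ phi b.
Proof.
move=> ab cp fp; apply: (@lc_max (phi @` `[a, b])).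
- apply: connected_continuous_connected; first exact: segment_connected.
  by apply: continuous_in_subspaceT => t /set_mem /=; rewrite in_itv; exact: cp.
- by exists a => //=; rewrite in_itv /= lexx.
- by exists b => //=; rewrite in_itv /= lexx ab.
- by move=> ? [t /=]; rewrite in_itv /= => h <-; exact: fp.
Qed.

(* A point near [y] lies on a level component that passes near [y'].  Flow boxes
   give this for nearby points of a regular level, transitivity propagates it. *)
Definition Rel y y' := forall W : set M, nbhs y' W ->
  \forall z \near y, exists2 z', W z' & z' ~~ z.

Lemma Rel_trans y x z : Rel x y -> Rel y z -> Rel x z.
Proof.
move=> xy yz W /yz /xy; apply: filterS => u [w [w' Ww' h] h']; exists w' => //.
exact: lc_trans h h'.
Qed.

Lemma Rel_refl x : Rel x x.
Proof. by move=> W Wx; apply: filterS Wx => z Wz; exists z => //; exact: lc_refl. Qed.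

Lemma Rel_lc x y : Rel x y -> x ~~ y.
Proof.
move=> xy; apply: contrapT => n.
have : nbhs y (~` level_component f x).
  apply: open_nbhs_nbhs; split; last exact: n.
  by apply: closed_openC; exact: lc_closed.
by move=> /xy /nbhs_singleton [z' nz h]; apply: nz; exact: lc_sym.
Qed.

(** The new coordinates are (l, f - f x), where l is whichever of the two old coordinates completes
    the differential of [f]. *)
Lemma regular_disk x : ~ boundary x -> ~ critical f x -> exists m j r,
  [/\ disk m j r, j 0 = x & forall p, `|p| < r -> f (j p) = f x + cY p].
Proof.
move=> ix rx; have [c Ac cx] := chart_at x; have [j [r [D j0]]] := disk_at Ac cx ix.
set m := fun y => _ in D; have r0 := disk_gt0 D; have n0 : `|0 : pt| < r by rewrite normr0.
have sf := disk_fun_smooth D (classF_smooth hf) n0.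
have [v Dv] : exists v, 'D_v (f \o j) 0 != 0.
  apply: contrapT => no; apply: rx; rewrite -j0; apply/(disk_critical D (classF_smooth hf) n0) => v.
  by apply: contrapT => /eqP h; apply: no; exists v.
have H (l : pt -> R) : smooth_at 0 l -> l 0 = 0 ->
    'D_e0 l 0 * 'D_e1 (f \o j) 0 - 'D_e1 l 0 * 'D_e0 (f \o j) 0 != 0 -> exists m j r,
  [/\ disk m j r, j 0 = x & forall p, `|p| < r -> f (j p) = f x + cY p].
  move=> sl l0 J; pose F p := mk (l p) (f (j p) - f x).
  have sF : smooth_at 0 F by apply: smooth_mk => //; apply: (smoothB sf); exact: smooth_cst.
  have EX : cX \o F = l by apply/funext => p /=; rewrite cE.
  have EY : cY \o F = (f \o j) \+ cst (- f x) by apply/funext => p /=; rewrite cE.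
  have JF : jac F 0 != 0.
    rewrite /jac EX EY; have Dd v' : 'D_v' ((f \o j) \+ cst (- f x)) 0 = 'D_v' (f \o j) 0.
      rewrite deriveD; first by rewrite derive_cst addr0.
        by apply: diff_derivable; exact: smooth_at_diff.
      exact: derivable_cst.
    by rewrite !Dd.
  have F0 : F 0 = 0 by rewrite /F l0 j0 subrr; apply: ptP; rewrite !cE.
  have [G [r' [D' G0 FG _]]] := disk_change D sF F0 JF.
  exists (F \o m), (j \o G), r'; split=> //=; first by rewrite G0.
  by move=> p /FG[E _ _]; rewrite -[in cY _]E /F cE addrC subrK.
have [h|h] := eqVneq ('D_e1 (f \o j) 0) 0.
  apply: (H (@cY R)); [exact: smooth_Y|by rewrite cE|].
  rewrite !derive_Y !cE mul0r sub0r mul1r oppr_eq0; apply: contra Dv => /eqP h'.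
  by rewrite smooth_deriveE// h h' !mulr0 addr0.
apply: (H (@cX R)); [exact: smooth_X|by rewrite cE|].
by rewrite !derive_X !cE mul0r subr0 mul1r.
Qed.

(** Weaker than product coordinates, so as to hold also at boundary points, where the level of [x]
    is part of the boundary. *)
Definition flow_box x := exists U : set M, [/\ nbhs x U,
  forall y y', U y -> U y' -> f y = f x -> f y' = f x -> Rel y y' &
  forall y y', U y -> U y' -> f y = f y' -> y ~~ y'].

Lemma disk_level_path (m : M -> pt) (j : pt -> M) (r a : R) p p' : disk m j r ->
  (forall p, `|p| < r -> f (j p) = a + cY p) ->
  `|p| < r -> `|p'| < r -> cY p = cY p' -> j p ~~ j p'.
Proof.
move=> D fj pr pr' pp.
pose phi (t : R) : M := j (p + t *: (p' - p)).
have e0 : phi 0 = j p by rewrite /phi scale0r addr0.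
have e1 : phi 1 = j p' by rewrite /phi scale1r addrC subrK.
have inr t : 0 <= t <= 1 -> `|p + t *: (p' - p)| < r.
  move=> /andP[t0 t1].
  have -> : p + t *: (p' - p) = (1 - t) *: p + t *: p' by apply: ptP; rewrite !cE; ring.
  apply: le_lt_trans (ler_normD _ _) _; rewrite !normrZ (ger0_norm t0) ger0_norm ?subr_ge0//.
  have a1 : `|p| <= Num.max `|p| `|p'| by rewrite le_max lexx.
  have a2 : `|p'| <= Num.max `|p| `|p'| by rewrite le_max lexx orbT.
  have a3 : Num.max `|p| `|p'| < r by rewrite gt_max pr.
  have t1' : 0 <= 1 - t by rewrite subr_ge0.
  by have := ler_wpM2l t0 a2; have := ler_wpM2l t1' a1; lra.
rewrite -e0 -e1; apply: lc_path; first exact: ler01.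
  move=> t ht; apply: continuous_comp; last exact: (disk_j_continuous D (inr t ht)).
  by apply: cvgD; [exact: cvg_cst|apply: cvgZr_tmp; exact: cvg_id].
by move=> t ht; rewrite /phi !fj ?inr ?lexx ?ler01// !cE pp subrr !mulr0.
Qed.

Lemma flow_box_inner x : ~ boundary x -> ~ critical f x -> flow_box x.
Proof.
move=> ix rx; have [m [j [r [D j0 fj]]]] := regular_disk ix rx.
have n0 : `|0 : pt| < r by rewrite normr0; exact: disk_gt0 D.
exists (region j r); split.
- by have R0 := disk_region j n0; rewrite -j0; exact: region_near D _ R0.
- move=> _ _ [p pr <-] [p' pr' <-]; rewrite !fj// => /eqP.
  rewrite -subr_eq0 addrAC subrr add0r => /eqP p0 /eqP; rewrite -subr_eq0 addrAC subrr add0r => /eqP p0' W Wp.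
  have jW : \forall q \near p', W (j q) := disk_j_continuous D pr' Wp.
  have /near_norm[e ep he] := jW.
  have N : \forall q \near p, `|cY q| < e /\ `|mk (cX p') (cY q)| < r.
    have N1 : \forall q \near p, `|q - p| < Num.min e (r - `|p'|).
      by apply/near_norm; exists (Num.min e (r - `|p'|)) => //; rewrite lt_min ep subr_gt0.
    apply: filterS N1 => q; rewrite lt_min => /andP[/norm_ltP[_]]; rewrite !cE p0 subr0 => h1 /norm_ltP[_].
    rewrite !cE p0 subr0 => h2; split=> //; apply/norm_ltP; rewrite !cE.
    have pr2 : `|p'| < r := pr'; have := normr_ge0 p' => h3.
    split; first exact: le_lt_trans (cX_le p') pr2.
    by apply: lt_le_trans h2 _; rewrite gerBl.
  apply: filterS (disk_near D pr N) => z [Rz [h1 h2]]; have [E zr] := disk_jm D Rz.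
  exists (j (mk (cX p') (cY (m z)))).
    by apply: he; apply/norm_ltP; rewrite !cE p0' subrr normr0 subr0.
  apply: lc_sym; rewrite -{1}E; apply: (disk_level_path D fj) => //.
  by rewrite cE.
- move=> _ _ [p pr <-] [p' pr' <-]; rewrite !fj// => /addrI; exact: (disk_level_path D fj).
Qed.

(** It is enough to test directions pointing into the closed half plane, and [e0] and [e1] are such.
    Applied to the difference of two local extensions of [f], this shows that their differentials
    agree at a boundary point. *)
Lemma half_zero (u : pt -> R) p : smooth_at p u -> 0 <= cX p ->
  (\forall q \near p, 0 <= cX q -> u q = 0) -> forall v, 'D_v u p = 0.
Proof.
move=> su p0 nu; have up : u p = 0 := nbhs_singleton nu p0.
have H (v : pt) : 0 <= cX v -> 'D_v u p = 0.
  move=> v0; have [//|a0] := eqVneq ('D_v u p) 0; exfalso.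
  have ap : 0 < `|'D_v u p| by rewrite normr_gt0.
  have v1 : 0 < 2 * (`|v| + 1) by rewrite mulr_gt0// ltr_wpDl.
  have ep : 0 < `|'D_v u p| / (2 * (`|v| + 1)) by exact: divr_gt0.
  have [r r0 hr] := strict_diff su ep; have /near_norm[r' r'0 hr'] := nu.
  pose t : R := Num.min r r' / (2 * (`|v| + 1)).
  have t0 : 0 < t by rewrite divr_gt0// lt_min r0.
  have tv : `|p + t *: v - p| < Num.min r r'.
    rewrite addrAC subrr add0r normrZ ger0_norm ?ltW// /t mulrAC ltr_pdivrMr//.
    by rewrite ltr_pM2l ?lt_min ?r0// -[ltLHS]addr0; have := normr_ge0 v; lra.
  move: tv; rewrite lt_min => /andP[tv1 tv2].
  have := hr _ p tv1; rewrite subrr normr0 => /(_ r0); rewrite up subr0.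
  clearbody t; have up' : u (p + t *: v) = 0 by apply: hr' => //; rewrite !cE addr_ge0// mulr_ge0// ltW.
  rewrite up' sub0r normrN addrAC subrr add0r.
  have -> : lin2 ('D_e0 u p) ('D_e1 u p) (t *: v) = t * 'D_v u p.
    by have [x [y G]] := gradP su; rewrite !G /lin2 !cE; ring.
  rewrite normrM normrZ [`|t|](ger0_norm (ltW t0)).
  have : `|v| / (2 * (`|v| + 1)) < 1 by rewrite ltr_pdivrMr//; have := normr_ge0 v; lra.
  have tD : 0 < t * `|'D_v u p| by exact: mulr_gt0.
  move: tD; move: `|v| `|'D_v u p| => V D tD VI.
  rewrite (_ : _ * (t * V) = t * D * (V / (2 * (V + 1)))); last by move: (_^-1) => I; ring.
  by rewrite -[X in X <= _]mulr1 ler_pM2l// leNgt VI.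
by move=> v; rewrite smooth_deriveE// !H ?cE// !mulr0 addr0.
Qed.

(** The inverse [k] is meaningful only on a half ball, so its continuity is stated along paths that
    stay in the half plane. *)
Lemma chart_inverse c x (U : set M) : atlas c -> cdom c x -> nbhs x U ->
  exists (k : pt -> M) (r : R), [/\ 0 < r,
    forall p, `|p - cmap c x| < r -> 0 <= cX p -> [/\ U (k p), cdom c (k p) & cmap c (k p) = p],
    forall y, cdom c y -> `|cmap c y - cmap c x| < r -> k (cmap c y) = y &
    forall (gam : R -> pt) t, {for t, continuous gam} ->
      (\forall t' \near t, `|gam t' - cmap c x| < r /\ 0 <= cX (gam t')) -> {for t, continuous (k \o gam)}].
Proof.
move=> Ac cx Ux; have [r r0 onto] := chart_onto Ac cx Ux.
pose k p := xget x [set y | [/\ U y, cdom c y & cmap c y = p]].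
have kP p : `|p - cmap c x| < r -> 0 <= cX p -> [/\ U (k p), cdom c (k p) & cmap c (k p) = p].
  move=> h1 h2; exact: (@xgetPex _ x [set y | [/\ U y, cdom c y & cmap c y = p]]) (onto p h1 h2).
have kE y : cdom c y -> `|cmap c y - cmap c x| < r -> k (cmap c y) = y.
  move=> cy yr; have [_ cj E] := kP _ yr (cmap_ge0 Ac cy); exact: (cmap_inj Ac cj cy).
exists k, r; split; [exact: r0|exact: kP|exact: kE|].
move=> gam t cg N W /= Wk; have [h1 h2] := nbhs_singleton N; have [_ ck kk] := kP _ h1 h2.
have [e e0 onto'] := chart_onto Ac ck Wk; rewrite kk in onto'.
have N2 : \forall t' \near t, `|gam t' - gam t| < e by move/cvgr_distC_lt : cg; apply.
apply: filterS2 N N2 => t' [h3 h4] h5 /=; have [y [Wy cy yE]] := onto' _ h5 h4.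
by rewrite -yE kE// yE.
Qed.

(** A segment of the boundary line of the chart is carried to a connected part of the boundary, on
    which [f] is constant. *)
Lemma boundary_const c x g : atlas c -> cdom c x -> cX (cmap c x) = 0 -> local_rep c x f g ->
  \forall p \near cmap c x, cX p = 0 -> g p = f x.
Proof.
move=> Ac cx x0 [sg fg]; have [k [r [r0 kP kE kc]]] := chart_inverse Ac cx fg.
have bx : boundary x by exists c.
apply/near_norm; exists r => // p pr p0; have [fk ck kk] := kP p pr (eq_ind_r (<=%R 0) (lexx 0) p0).
rewrite -[in LHS]kk -fk.
pose gam t := cmap c x + t *: (p - cmap c x).
have g0 t : cX (gam t) = 0 by rewrite !cE p0 x0 subrr mulr0 addr0.
have gr t : 0 <= t <= 1 -> `|gam t - cmap c x| < r.
  move=> /andP[t0 t1]; rewrite addrAC subrr add0r normrZ ger0_norm//.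
  by apply: le_lt_trans pr; rewrite ler_piMl.
have cg t : {for t, continuous gam}.
  by apply: cvgD; [exact: cvg_cst|apply: cvgZr_tmp; exact: cvg_id].
have gN (t : R) : 0 <= t <= 1 -> \forall t' \near t, `|gam t' - cmap c x| < r /\ 0 <= cX (gam t').
  move=> /gr h; have /near_norm[e e0 he] := near_norm_lt h.
  have := cg t; move/cvgr_distC_lt => /(_ _ e0); apply: filterS => t' h'.
  split; last by rewrite g0.
  by apply: he; rewrite opprB addrA subrK.
have bk (t : R) : 0 <= t <= 1 -> boundary (k (gam t)).
  move=> h; have [_ c1 c2] := kP _ (gr t h) (eq_ind_r (<=%R 0) (lexx 0) (g0 t)).
  by exists c; split=> //; rewrite c2 -[LHS]/(cX _).
have E0 : k (gam 0) = x by rewrite /gam scale0r addr0 kE// subrr normr0.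
have E1 : k (gam 1) = k p by rewrite /gam scale1r addrC subrK.
apply: (classF_boundary hf (C := connected_component (@boundary R M) x)).
- by exists x.
- exists ((k \o gam) @` `[0, 1]).
    split; first by exists 0; [rewrite /= in_itv /= lexx ler01|].
      by move=> ? [t /=]; rewrite in_itv => h <-; exact: bk.
    apply: connected_continuous_connected; first exact: segment_connected.
    by apply: continuous_in_subspaceT => t /set_mem /=; rewrite in_itv => h; apply: kc => //; exact: gN.
  by exists 1; [rewrite /= in_itv /= lexx ler01|].
- exact: connected_component_refl.
Qed.

(** The tangential derivative vanishes by [boundary_const]. If the normal one vanished too, [x]
    would be critical, but critical points are interior. *)
Lemma boundary_gradient c x g : atlas c -> cdom c x -> cX (cmap c x) = 0 -> local_rep c x f g ->
  'D_e0 g (cmap c x) != 0.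
Proof.
move=> Ac cx x0 G; have [sg fg] := G; apply/eqP => D0.
have D1 : 'D_e1 g (cmap c x) = 0.
  have d : derivable g (cmap c x + (0 : R) *: e1) e1.
    by rewrite scale0r addr0; apply: diff_derivable; exact: smooth_at_diff.
  have [_] := line_is_derive d; rewrite scale0r addr0 => <-.
  have /near_norm[r r0 hr] := boundary_const Ac cx x0 G.
  rewrite (@eq_near_derive _ R R _ (cst (f x)) 0 1) ?derive_cst//.
  exists r => // t /=; rewrite sub0r normrN => tr.
  apply: hr; last by rewrite !cE x0 mulr0 addr0.
  by rewrite addrAC subrr add0r; apply/norm_ltP; rewrite !cE mulr0 mulr1 normr0.
have D v : 'D_v g (cmap c x) = 0 by rewrite smooth_deriveE// D0 D1 !mulr0 addr0.
have bx : boundary x by exists c.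
apply: (classF_interior hf _ bx) => c' g' Ac' cx' [sg' fg'] v.
have [t [st ct]] := transition Ac' Ac cx' cx.
have tx : t (cmap c' x) = cmap c x by rewrite -(nbhs_singleton ct).
have sgt : smooth_at (cmap c' x) (g \o t) by exact: smooth_comp_at st tx sg.
have Dt w : 'D_w (g \o t) (cmap c' x) = 0.
  have /smooth_at_pt[sX sY] := st; have sg2 : smooth_at (t (cmap c' x)) g by rewrite tx.
  have [_ ->] := derive_comp_pt (smooth_at_diff sg2) (smooth_at_diff sX) (smooth_at_diff sY).
  by rewrite tx !D !mulr0 addr0.
have [r r0 onto] := chart_onto Ac' cx' (filterI (filterI fg fg') ct).
have sB : smooth_at (cmap c' x) (fun q => g' q - (g \o t) q) by exact: smoothB sg' sgt.
have : 'D_v (fun q => g' q - (g \o t) q) (cmap c' x) = 0.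
  apply: half_zero => //; first exact: cmap_ge0.
  apply/near_norm; exists r => // q qr q0; have [y [[[e1 e2] e3] cy <-]] := onto q qr q0.
  by rewrite /= -e3 -e1 -e2 subrr.
have E := @deriveB _ _ _ g' (g \o t) (cmap c' x) v.
rewrite [X in X = 0 -> _]E ?Dt ?subr0//; by apply: diff_derivable; exact: smooth_at_diff.
Qed.

Lemma increasing_ball (u : pt -> R) p (r : R) : 
  (forall q, `|q - p| < r -> smooth_at q u /\ 0 < 'D_e0 u q) ->
  forall q q', `|q - p| < r -> `|q' - p| < r -> cY q = cY q' -> cX q < cX q' -> u q < u q'.
Proof.
move=> H q q' qr qr' EY EX; have qE : q' = q + (q' - q) by rewrite addrC subrK.
have inr t : 0 <= t <= 1 -> `|q + t *: (q' - q) - p| < r.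
  move=> /andP[t0 t1].
  have -> : q + t *: (q' - q) - p = (1 - t) *: (q - p) + t *: (q' - p).
    by apply: ptP; rewrite !cE; ring.
  apply: le_lt_trans (ler_normD _ _) _; rewrite !normrZ (ger0_norm t0) ger0_norm ?subr_ge0//.
  have a1 : `|q - p| <= Num.max `|q - p| `|q' - p| by rewrite le_max lexx.
  have a2 : `|q' - p| <= Num.max `|q - p| `|q' - p| by rewrite le_max lexx orbT.
  have a3 : Num.max `|q - p| `|q' - p| < r by rewrite gt_max qr.
  have t1' : 0 <= 1 - t by rewrite subr_ge0.
  by have := ler_wpM2l t0 a2; have := ler_wpM2l t1' a1; lra.
have [t t01 E] := @line_mvt _ u q (q' - q) (fun t h => diff_derivable (smooth_at_diff (H _ (inr t h)).1)).
have [st pt0] := H _ (inr t t01).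
rewrite -subr_gt0 {1}qE E smooth_deriveE// !cE EY subrr mul0r addr0 mulr_gt0// subr_gt0 //.
Qed.

(** In the coordinates u = a (g - f x) and y the surface is locally the half plane u >= 0 and the
    levels of [f] are the lines u = const. The factor [a], the normal derivative itself, makes u
    increase inwards whatever the sign of [a]. *)
Lemma boundary_box x : boundary x ->
  flow_box x /\ \forall y \near x, f y = f x -> boundary y.
Proof.
move=> [c [Ac cx x0]]; rewrite -/(cX _) in x0.
have [g G] := classF_smooth hf Ac cx; have [sg fg] := G.
have g0 := boundary_gradient Ac cx x0 G; set a := 'D_e0 g _ in g0.
have [k [r [r0 kP kE kc]]] := chart_inverse Ac cx fg.
pose u q := a * (g q - f x); pose F q := mk (u q) (cY q).
have su q : smooth_at q g -> smooth_at q u.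
  by move=> h; apply: (smoothM (smooth_cst q a)); apply: (smoothB h); exact: smooth_cst.
have Du q v : smooth_at q g -> 'D_v u q = a * 'D_v g q.
  move=> h; have d : derivable g q v by apply: diff_derivable; exact: smooth_at_diff.
  have := @deriveM _ _ (cst a) (g \+ cst (- f x)) q v (derivable_cst _ _ _) (derivableD d (derivable_cst _ _ _)).
  rewrite derive_cst scaler0 addr0 => ->; rewrite (deriveD d (derivable_cst _ _ _)) derive_cst addr0.
  by [].
have sF q : smooth_at q g -> smooth_at q F by move=> h; apply: smooth_mk (su q h) (smooth_Y q).
have EX : cX \o F = u by apply/funext => q /=; rewrite cE.
have EY : cY \o F = @cY R by apply/funext => q /=; rewrite cE.
have JF : jac F (cmap c x) != 0.
  by rewrite /jac EX EY !derive_Y !Du// !cE mulr0 subr0 mulr1 mulf_neq0.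
have [r1 [H [r10 inj cH HF nH]]] := inverse_function (sF _ sg) JF.
have N1 : \forall q \near cmap c x, smooth_at q u /\ 0 < 'D_e0 u q.
  apply: filterI; first exact: smooth_at_near (su _ sg).
  have p0 : 0 < 'D_e0 u (cmap c x) by rewrite Du// -expr2 lt_def sqr_ge0 sqrf_eq0 g0.
  have cD := smooth_at_continuous (smooth_at_derive e0 (su _ sg)).
  by move/cvgr_gt : cD; apply.
have N2 : \forall q \near cmap c x, cX q = 0 -> g q = f x by exact: boundary_const Ac cx x0 G.
have /near_norm[r2' r2'0 h2'] : \forall q \near cmap c x,
    ((smooth_at q u /\ 0 < 'D_e0 u q) /\ (cX q = 0 -> g q = f x)) /\ smooth_at q g.
  exact: filterI (filterI N1 N2) (smooth_at_near sg).
pose r2 := Num.min r (Num.min r1 r2'); have r20 : 0 < r2 by rewrite !lt_min r0 r10.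
have lt2 q : `|q - cmap c x| < r2 -> [/\ `|q - cmap c x| < r, `|q - cmap c x| < r1 &
    [/\ smooth_at q u, 0 < 'D_e0 u q, cX q = 0 -> g q = f x & smooth_at q g]].
  by rewrite !lt_min => /and3P[h1 h2 /h2'[[[? ?] ?] ?]].
have inc q q' : `|q - cmap c x| < r2 -> `|q' - cmap c x| < r2 -> cY q = cY q' -> cX q < cX q' -> u q < u q'.
  by apply: increasing_ball => w /lt2[_ _ [? ? _ _]].
have proj q : `|q - cmap c x| < r2 -> `|mk 0 (cY q) - cmap c x| < r2 /\ u (mk 0 (cY q)) = 0.
  move=> qr; have h : `|mk 0 (cY q) - cmap c x| < r2.
    apply/norm_ltP; rewrite !cE x0 subrr normr0; split=> //; apply: le_lt_trans qr.
    by rewrite -cYN -cYD; exact: cY_le.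
  split=> //; have [_ _ [_ _ + _]] := lt2 _ h; rewrite cE => /(_ erefl) E.
  by rewrite /u E subrr mulr0.
have sgn q : `|q - cmap c x| < r2 -> (0 <= cX q -> 0 <= u q) /\ (0 <= u q -> 0 <= cX q) /\ (u q = 0 -> cX q = 0).
  move=> qr; have [h E] := proj q qr; have [X|X|X] := ltgtP (cX q) 0.
  - have := inc _ _ qr h; rewrite !cE E => /(_ erefl X) lt; split; [|split]; move: X lt; lra.
  - have := inc _ _ h qr; rewrite !cE E => /(_ erefl X) lt; split; [|split]; move: X lt; lra.
  - have qE : q = mk 0 (cY q) by rewrite -[LHS]mkK X.
    by have -> : u q = 0; [rewrite qE|rewrite lexx].
have w0E : F (cmap c x) = mk 0 (cY (cmap c x)).
  by rewrite /F; have [|_ E] := proj (cmap c x); [rewrite subrr normr0|rewrite -[in X in mk X _](mkK (cmap c x)) x0 E].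
have nH2 : \forall w \near F (cmap c x), `|H w - cmap c x| < r2.
  by have := cH; move/cvgr_distC_lt => /(_ _ r20); rewrite HF.
have /near_norm[dl dl0 hd] : \forall w \near F (cmap c x),
    (F (H w) = w /\ smooth_at w H) /\ `|H w - cmap c x| < r2 by exact: filterI nH nH2.
have FH w : `|w - F (cmap c x)| < dl -> [/\ F (H w) = w, smooth_at w H & `|H w - cmap c x| < r2].
  by move=> /hd[[? ?] ?].
have HFq q : `|q - cmap c x| < r2 -> `|F q - F (cmap c x)| < dl -> H (F q) = q.
  move=> qr /FH[E _ h]; have [_ q1 _] := lt2 _ qr; have [_ q2 _] := lt2 _ h.
  exact: inj q2 q1 E.
pose U := [set y | [/\ cdom c y, `|cmap c y - cmap c x| < r2 & `|F (cmap c y) - F (cmap c x)| < dl]].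
have Uopen y : U y -> \forall z \near y, U z.
  move=> [cy yr yd].
  have /near_norm[e1 e10 he1] := near_norm_lt yr; have /near_norm[e2 e20 he2] := near_norm_lt yd.
  have [_ _ [_ _ _ sgy]] := lt2 _ yr.
  have c1 : {for y, continuous (cmap c)} := cmap_continuous Ac cy.
  have c2 : {for y, continuous (F \o cmap c)}.
    by apply: continuous_comp c1 _; exact: smooth_at_continuous (sF _ sgy).
  have n1 : \forall z \near y, `|cmap c z - cmap c y| < e1 by move/cvgr_distC_lt : c1; apply.
  have n2 : \forall z \near y, `|F (cmap c z) - F (cmap c y)| < e2 by move/cvgr_distC_lt : c2; apply.
  apply: filterS3 (cdom_near Ac cy) n1 n2 => z cz z1 z2; split=> //.
    by have := he1 (cmap c z - cmap c x); rewrite opprB addrA subrK; apply.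
  by have := he2 (F (cmap c z) - F (cmap c x)); rewrite opprB addrA subrK; apply.
have Ux : U x by split=> //; rewrite subrr normr0.
have fE y : U y -> f y = g (cmap c y).
  move=> [cy yr _]; have [r' _ _] := lt2 _ yr.
  by have := kE y cy r'; have [] := kP _ r' (cmap_ge0 Ac cy) => fk _ _ E; rewrite -{1}E fk E.
have U0 y : U y -> f y = f x -> cX (cmap c y) = 0.
  move=> Uy fy; have [cy yr _] := Uy; apply: (sgn _ yr).2.2.
  by rewrite /u -fE// fy subrr mulr0.
split; last by apply: filterS (Uopen x Ux) => y Uy /(U0 y Uy) y0; exists c; split=> //; have [] := Uy.
have path z y' : U z -> U y' -> z ~~ k (H (mk (cX (F (cmap c z))) (cY (cmap c y')))) /\
    `|mk (cX (F (cmap c z))) (cY (cmap c y')) - F (cmap c x)| < dl /\ 0 <= cX (F (cmap c z)).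
  move=> Uz Uy'; have [cz zr zd] := Uz; set s := cX (F (cmap c z)).
  have s0 : 0 <= s by rewrite /s cE; apply: (sgn _ zr).1; exact: cmap_ge0.
  have sd : `|s| < dl by move/norm_ltP : zd => [+ _]; rewrite w0E !cE subr0 /s cE.
  have Yd w : U w -> `|cY (cmap c w) - cY (cmap c x)| < dl.
    by move=> [_ _ /norm_ltP[_]]; rewrite !cE.
  pose gam (t : R) := mk s ((1 - t) * cY (cmap c z) + t * cY (cmap c y')).
  have gd t : 0 <= t <= 1 -> `|gam t - F (cmap c x)| < dl.
    move=> /andP[t0 t1]; rewrite w0E; apply/norm_ltP; rewrite !cE subr0; split; first exact: sd.
    have -> : (1 - t) * cY (cmap c z) + t * cY (cmap c y') - cY (cmap c x) =
      (1 - t) * (cY (cmap c z) - cY (cmap c x)) + t * (cY (cmap c y') - cY (cmap c x)) by ring.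
    apply: le_lt_trans (ler_normD _ _) _; rewrite !normrM (ger0_norm t0) ger0_norm ?subr_ge0//.
    have := Yd _ Uz; have := Yd _ Uy'.
    set a1 := `|_|; set a2 := `|_|; set a3 := Num.max a1 a2 => h1 h2.
    have h3 : a3 < dl by rewrite gt_max h1.
    have h4 : a1 <= a3 by rewrite le_max lexx.
    have h5 : a2 <= a3 by rewrite le_max lexx orbT.
    have t1' : 0 <= 1 - t by rewrite subr_ge0.
    by have := ler_wpM2l t0 h4; have := ler_wpM2l t1' h5; lra.
  have cg (t : R) : {for t, continuous gam}.
    apply: mk_continuous; first exact: cvg_cst.
    apply: cvgD; apply: cvgM; try exact: cvg_cst; last exact: cvg_id.
    by apply: cvgB; [exact: cvg_cst|exact: cvg_id].
  have H0 w : `|w - F (cmap c x)| < dl -> 0 <= cX w -> [/\ 0 <= cX (H w), `|H w - cmap c x| < r & u (H w) = cX w].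
    move=> /FH[FHw _ Hr] w0; have uE : u (H w) = cX w by rewrite -EX /= FHw.
    by split=> //; [apply: (sgn _ Hr).2.1; rewrite uE|have [] := lt2 _ Hr].
  have G0 : k (H (gam 0)) = z.
    have -> : gam 0 = F (cmap c z) by apply: ptP; rewrite /gam /s !cE; ring.
    by rewrite HFq// kE//; have [] := lt2 _ zr.
  have G1 : gam 1 = mk s (cY (cmap c y')) by rewrite /gam subrr mul0r mul1r add0r.
  rewrite -G1; split; last by split; [apply: gd; rewrite lexx ler01|exact: s0].
  rewrite -{1}G0; apply: (@lc_path (k \o (H \o gam))); first exact: ler01.
    move=> t t01; have [_ sH _] := FH _ (gd t t01).
    have cHg : {for t, continuous (H \o gam)}.
      by apply: continuous_comp (cg t) _; exact: smooth_at_continuous sH.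
    apply: kc => //.
    have /near_norm[e1 e10 he1] := near_norm_lt (gd t t01).
    have : \forall t' \near t, `|gam t' - gam t| < e1 by have := cg t; move/cvgr_distC_lt; apply.
    apply: filterS => t' h; have [||h1 h2 _] := H0 (gam t'); [|by rewrite cE|by []].
    by have := he1 (gam t' - F (cmap c x)); rewrite opprB addrA subrK; apply.
  move=> t t01; have t00 : (0 <= (0 : R) <= 1). by rewrite lexx ler01.
  have X0 t' : 0 <= cX (gam t') by rewrite cE.
  have [h1 h2 h3] := H0 _ (gd t t01) (X0 t); have [h4 h5 h6] := H0 _ (gd 0 t00) (X0 0).
  have [fk _ kk] := kP _ h2 h1; have [fk' _ kk'] := kP _ h5 h4.
  rewrite /= fk fk' kk kk'; move: h6; rewrite -[RHS]/(cX (gam 0)) cE -(cX_mk s ((1 - t) * cY (cmap c z) + t * cY (cmap c y'))).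
  by rewrite -h3 /u => /(mulfI g0)/addIr.
have same z z' : U z -> U z' -> f z = f z' -> z ~~ z'.
  move=> Uz Uz' fz; have [h _] := path z z' Uz Uz'; have [cz zr _] := Uz'; have [_ _ zd] := Uz'.
  have E : mk (cX (F (cmap c z))) (cY (cmap c z')) = F (cmap c z').
    by apply: ptP; rewrite !cE // /u -!fE// fz.
  by move: h; rewrite E HFq// kE//; have [] := lt2 _ zr.
exists U; split; [exact: Uopen| |exact: same].
move=> y y' Uy Uy' /(U0 y Uy) y0 /(U0 y' Uy') y0' W Wy'.
have [cy yr yd] := Uy; have [cy' yr' yd'] := Uy'.
have F0 z : U z -> cX (cmap c z) = 0 -> F (cmap c z) = mk 0 (cY (cmap c z)).
  move=> [_ zr _] z0; have [_ E] := proj _ zr.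
  by rewrite /F; congr mk; rewrite -E -[in LHS](mkK (cmap c z)) z0.
have Fy' := F0 y' Uy' y0'.
have [e e0' he] : exists2 e : R, 0 < e & forall w, `|w - F (cmap c y')| < e -> `|w - F (cmap c x)| < dl ->
    0 <= cX w -> W (k (H w)).
  have [_ sH _] := FH _ yd'; have cH' : {for F (cmap c y'), continuous H} := smooth_at_continuous sH.
  have HFy := HFq _ yr' yd'.
  have [e1 e10 onto] := chart_onto Ac cy' Wy'.
  have : \forall w \near F (cmap c y'), `|H w - cmap c y'| < e1.
    by move/cvgr_distC_lt : cH'; rewrite HFy; apply.
  move=> /near_norm[e e0' he]; exists e => // w /he h /FH[FHw _ Hr] w0.
  have X0 : 0 <= cX (H w) by apply: (sgn _ Hr).2.1; rewrite -EX /= FHw.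
  have [r' _ _] := lt2 _ Hr; have [z [Wz cz zE]] := onto _ h X0.
  by rewrite -zE kE// zE.
have N3 : \forall z \near y, `|cX (F (cmap c z))| < e.
  have [_ _ [_ _ _ sgy]] := lt2 _ yr.
  have c2 : {for y, continuous (F \o cmap c)}.
    apply: continuous_comp (cmap_continuous Ac cy) _; exact: smooth_at_continuous (sF _ sgy).
  have : \forall z \near y, `|F (cmap c z) - F (cmap c y)| < e by move/cvgr_distC_lt : c2; apply.
  apply: filterS => z /norm_ltP[+ _]; rewrite !cE.
  by have /(congr1 cX) := F0 y Uy y0; rewrite !cE => ->; rewrite subr0.
apply: filterS2 N3 (Uopen y Uy) => z ze Uz; have [cz zr zd] := Uz.
have [h1 [h2 h3]] := path z y' Uz Uy'.
exists (k (H (mk (cX (F (cmap c z))) (cY (cmap c y'))))); last exact: lc_sym.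
apply: he; [|exact: h2|by rewrite cX_mk].
rewrite Fy'; move: (cX (F (cmap c z))) ze => s' ze.
by apply/norm_ltP; rewrite !cE subrr normr0 subr0.
Qed.

(** Degree 0 is excluded because P 0 = 0, degree 1 because the differential of [P] at 0 vanishes: in
    both cases [P] would be 0, which has multiple factors. *)
Lemma vertex_disk x : critical f x -> exists m j r n P,
  [/\ disk m j r, j 0 = x, homogeneous n.+2 P, no_multiple_linear_factor P &
      forall p, `|p| < r -> f (j p) = f x + P p].
Proof.
move=> cr; have ix := classF_interior hf cr.
have [c [n [P [Ac cx hP nP fP]]]] := classF_germ hf cr.
have [j [r [D j0]]] := disk_at Ac cx ix; set m := fun y => _ in D; have r0 := disk_gt0 D.
have n0 : `|0 : pt| < r by rewrite normr0.
have cj := disk_j_continuous D n0.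
have /near_norm[r' r'0 fj] : \forall p \near (0 : pt), f (j p) = f x + P (m (j p)).
  by apply: (cj [set y | f y = f x + P (m y)]); rewrite j0.
pose r1 := Num.min r r'; have r10 : 0 < r1 by rewrite lt_min r0.
have r1r : r1 <= r by rewrite ge_min lexx.
have D1 := disk_shrink D r10 r1r.
have fE p : `|p| < r1 -> f (j p) = f x + P p.
  rewrite lt_min => /andP[h1 h2]; by rewrite fj ?subr0// (disk_mK D).
have P0 : P 0 = 0.
  by have := fE 0; rewrite normr0 j0 => /(_ r10)/eqP; rewrite -subr_eq0 opprD addrA subrr sub0r oppr_eq0 => /eqP.
have DP v : 'D_v P 0 = 0.
  have := cr; rewrite -j0 => /(disk_critical D (classF_smooth hf) n0)/(_ v) <-.
  have E : \forall p \near (0 : pt), (f \o j) p = (P \+ cst (f x)) p.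
    by apply/near_norm; exists r1 => // p; rewrite subr0 => /fE /= ->; rewrite addrC.
  rewrite (eq_near_derive v E) deriveD; first by rewrite derive_cst addr0.
    by apply: diff_derivable; apply: smooth_at_diff; exact: hom_smooth hP.
  exact: derivable_cst.
have nz : ~ forall p, P p = 0.
  move=> z; have [] := nP 1 0 0%N (fun=> 0).
  - by exists (fun=> 0) => w; rewrite big1// => i _; rewrite !mul0r.
  - by move=> w; rewrite z mulr0.
  by move=> /eqP; rewrite oner_eq0.
case: n hP => [|[|n]] hP; last by exists m, j, r1, n, P.
  by exfalso; apply: nz => p; rewrite -(mul1r (P p)) -(expr0 0) -(hom_scale _ _ hP) scale0r.
exfalso; apply: nz => p; have [a aP] := hP.
have E : P = lin2 (a 1%N) (a 0%N).
  apply/funext => q; rewrite aP big_ord_recr big_ord1 /= !expr0 !expr1 !mulr1 -!/(cX _) -!/(cY _) /lin2.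
  by rewrite addrC mulrC [a 0%N * _]mulrC.
by rewrite E -(derive_lin2 (a 1%N) (a 0%N) 0 p) -E.
Qed.

Section VertexDisk.
Context (x : M) (m : M -> pt) (j : pt -> M) (r : R) (n : nat) (P : pt -> R).
Context (D : disk m j r) (j0 : j 0 = x) (hP : homogeneous n.+2 P).
Context (nP : no_multiple_linear_factor P) (fP : forall p, `|p| < r -> f (j p) = f x + P p).

Lemma vertex_derive p v : `|p| < r -> 'D_v (f \o j) p = 'D_v P p.
Proof.
move=> pr; have E : \forall q \near p, (f \o j) q = (P \+ cst (f x)) q.
  by apply: filterS (near_norm_lt pr) => q /fP /= ->; rewrite addrC.
rewrite (eq_near_derive v E) deriveD; first by rewrite derive_cst addr0.
  by apply: diff_derivable; apply: smooth_at_diff; exact: hom_smooth hP.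
exact: derivable_cst.
Qed.

Lemma vertex_regular p : `|p| < r -> p != 0 -> P p = 0 -> ~ critical f (j p).
Proof.
move=> pr p0 Pp /(disk_critical D (classF_smooth hf) pr) H.
have [v] := hom_regular hP nP p0 Pp.
by rewrite -vertex_derive// H eqxx.
Qed.

Lemma vertex_level p : `|p| < r -> (f (j p) = f x) <-> P p = 0.
Proof.
by move=> /fP ->; split=> [/eqP|->]; rewrite ?addr0// -subr_eq0 addrAC subrr add0r => /eqP.
Qed.

Lemma vertex_cone p : `|p| < r -> P p = 0 -> x ~~ j p.
Proof.
move=> pr Pp; have tr t : 0 <= t <= 1 -> `|t *: p| < r.
  by move=> /andP[t0 t1]; rewrite normrZ ger0_norm//; apply: le_lt_trans pr; rewrite ler_piMl.
have := @lc_path (fun t => j (t *: p)) 0 1 ler01; rewrite scale0r scale1r j0; apply.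
  move=> t t01; apply: continuous_comp; last exact: (disk_j_continuous D (tr t t01)).
  by apply: cvgZr_tmp; exact: cvg_id.
by move=> t t01; apply/vertex_level; [exact: tr|rewrite (hom_scale _ _ hP) Pp mulr0].
Qed.

End VertexDisk.

Lemma regular_box x : ~ critical f x -> flow_box x.
Proof.
by move=> rx; have [/boundary_box[]//|ix] := pselect (boundary x); exact: flow_box_inner.
Qed.

(** Levels are locally connected: a cone over the zeros of [P] at a vertex, a single component in a
    flow box elsewhere. *)
Lemma level_near x : \forall y \near x, f y = f x -> x ~~ y.
Proof.
have [cr|rx] := pselect (critical f x).
  have [m [j [r [n [P [D j0 hP nP fP]]]]]] := vertex_disk cr.
  have n0 : `|0 : pt| < r by rewrite normr0; exact: disk_gt0 D.
  have := region_near D (disk_region j n0); rewrite j0; apply: filterS => _ [p pr <-] fp.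
  exact: (vertex_cone D j0 hP fP pr) ((vertex_level fP pr).1 fp).
have [U [Ux H _]] := regular_box rx; apply: filterS (Ux) => y Uy fy.
by apply: Rel_lc; apply: H => //; exact: nbhs_singleton Ux.
Qed.

Lemma lc_near x y : x ~~ y -> \forall z \near y, f z = f x -> x ~~ z.
Proof.
move=> xy; have fxy := lc_f xy.
by apply: filterS (level_near y) => z yz fz; apply: lc_trans xy (yz _); rewrite fz.
Qed.

(** By [lc_near] the component is open in its level, so disjoint open sets [U] and [V] separate it
    from the rest of the level and from the complement of [F]. By compactness, levels close to that
    of [x] stay inside the union of [U] and [V], and a connected set that meets [U] then remains in
    it. *)
Lemma fiber_usc x (F : set M) : open F -> level_component f x `<=` F ->
  \forall z \near x, level_component f z `<=` F.
Proof.
move=> oF CF; set C := level_component f x.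
have nM : normal_space M := compact_normal (@surface_hausdorff _ M) (@surface_compact _ M).
have clL : closed [set y | f y = f x].
  apply: (@preimage_closed _ _ f [set t | t = f x]); last exact: closed_eq.
  by move=> y _; exact: classF_continuous.
have clB : closed ([set y | f y = f x] `\` C `|` ~` F).
  apply: closedU; last exact: open_closedC.
  rewrite -[X in closed X]setCK; apply: open_closedC; apply: open_of_near => y ny.
  have [fy|fy] := eqVneq (f y) (f x); last first.
    have : \forall z \near y, f z != f x.
      apply: (@classF_continuous y [set t | t != f x]).
      by apply: open_nbhs_nbhs; split; [exact: open_neq|exact: fy].
    by apply: filterS => z /eqP fz [].
  have Cy : C y by apply: contrapT => nC; apply: ny.
  by apply: filterS (lc_near Cy) => z h [fz nC]; apply: nC; exact: h.
have dis : C `&` ([set y | f y = f x] `\` C `|` ~` F) = set0.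
  by rewrite -subset0 => y [Cy [[_]//|]]; apply; exact: CF.
have [U [V [oU oV CU BV UV]]] := (@normal_openP R M).1 nM C _ (@lc_closed x) clB dis.
have UF : U `<=` F.
  move=> y Uy; apply: contrapT => nF; have : (U `&` V) y by split=> //; apply: BV; right.
  by rewrite UV.
have cl : closed (f @` (~` (U `|` V))).
  apply: compact_closed; first exact: norm_hausdorff.
  apply: continuous_compact; first by apply: continuous_subspaceT; exact: classF_continuous.
  apply: (subclosed_compact _ (@surface_compact _ M)) => //; apply: open_closedC; exact: openU.
have nfx : ~ (f @` (~` (U `|` V))) (f x).
  move=> [y nUV fy]; apply: nUV; have [Cy|nC] := pselect (C y); first by left; exact: CU.
  by right; apply: BV; left.
have N : \forall z \near x, ~ (f @` (~` (U `|` V))) (f z).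
  apply: (@classF_continuous x (~` (f @` (~` (U `|` V))))).
  by apply: open_nbhs_nbhs; split; [exact: closed_openC|exact: nfx].
have Ux : \forall z \near x, U z.
  by apply: open_nbhs_nbhs; split=> //; apply: CU; exact: lc_refl.
apply: filterS2 N Ux => z nz Uz y zy; apply: UF.
have sub w : z ~~ w -> (U `|` V) w.
  by move=> zw; apply: contrapT => nUV; apply: nz; exists w => //; rewrite (lc_f zw).
apply: (@connected_near_ind _ _ U z y (@lc_connected z)) => // [|w zw]; first exact: lc_refl.
have [Uw|Vw] := sub w zw.
  by apply: filterS (open_nbhs_nbhs (conj oU Uw)) => u Uu _.
apply: filterS (open_nbhs_nbhs (conj oV Vw)) => u Vu _; split=> [Uw|Uu].
  by have : (U `&` V) w by []; rewrite UV.
by have : (U `&` V) u by []; rewrite UV.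
Qed.

Lemma lc_not x y : ~ x ~~ y -> exists W, [/\ nbhs y W &
  \forall z \near x, forall w, W w -> ~ z ~~ w].
Proof.
move=> nxy; have nM : normal_space M := compact_normal (@surface_hausdorff _ M) (@surface_compact _ M).
have dis : level_component f x `&` level_component f y = set0.
  by rewrite -subset0 => z [xz yz]; apply: nxy; apply: lc_trans xz (lc_sym yz).
have [U [V [oU oV CU CV UV]]] := (@normal_openP R M).1 nM _ _ (@lc_closed x) (@lc_closed y) dis.
exists V; split; first by apply: open_nbhs_nbhs; split=> //; apply: CV; exact: lc_refl.
apply: filterS (fiber_usc oU CU) => z zU w Vw zw.
by have : (U `&` V) w; [split=> //; exact: zU|rewrite UV].
Qed.

Lemma propagate (A : set M) y y' : connected A -> A y -> A y' ->
  (forall z, A z -> f z = f y /\ ~ critical f z) -> Rel y y'.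
Proof.
move=> cA Ay Ay' H; apply: (@connected_near_ind _ A (Rel y) y y') => //; first exact: Rel_refl.
move=> a Aa; have [fa ra] := H a Aa; have [U [Ua HU _]] := regular_box ra.
apply: filterS (Ua) => b Ub Ab; have [fb _] := H b Ab; have Uaa := nbhs_singleton Ua.
have fab : f b = f a by rewrite fa.
split=> h; apply: Rel_trans h _; exact: HU.
Qed.

End Reeb.
(** Compactness as induction over subsets: if [P A] failed, the sets whose complement in [A]
    satisfies [P] would form a proper filter without cluster point in [A]. *)
Lemma compact_ind (T : topologicalType) (A : set T) (P : set T -> Prop) : compact A -> P set0 ->
  (forall B C, P B -> P C -> P (B `|` C)) -> (forall B C, B `<=` C -> P C -> P B) ->
  (forall x, A x -> exists2 U, nbhs x U & P U) -> P A.
Proof.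
move=> cA P0 PU PS PL; apply: contrapT => nPA.
pose F : set (set T) := [set B | P (A `\` B)].
have FF : ProperFilter F.
  split; first by rewrite /F /= setD0.
  split.
  - by rewrite /F /= setDT.
  - move=> B C /= PB PC; apply: PS (PU _ _ PB PC) => x [Ax nBC].
    by have [Bx|nB] := pselect (B x); [right; split=> // Cx; exact: nBC|left].
  - by move=> B C BC /=; apply: PS => x [Ax nC]; split=> // /BC.
have FA : F A by rewrite /F /= setDv.
have [x [Ax clx]] := cA F FF FA; have [U Ux PUU] := PL x Ax.
have FU : F (~` U) by apply: PS PUU => y [_ /contrapT].
by have [y []] := clx _ _ FU Ux.
Qed.

Section RealLine.
Context {R : realType}.

Lemma no_zero_sign (u : R -> R) (b : R) : 0 <= b -> continuous u ->
  (forall t, 0 <= t <= b -> u t != 0) -> 0 < u 0 * u b.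
Proof.
move=> b0 cu nz; rewrite lt_def mulf_neq0 ?nz ?lexx ?b0//= leNgt; apply/negP => neg.
have [||c /=] := @IVT R u 0 b 0 b0; [exact: continuous_subspaceT| |].
  have [ub|ub] := ltP 0 (u b).
    by rewrite ge_min le_max (ltW ub) orbT andbT; move: neg; rewrite pmulr_llt0// => /ltW ->.
  rewrite ge_min le_max ub orbT/=; have ubn : u b < 0.
    by rewrite lt_def ub andbT eq_sym nz// b0 lexx.
  by move: neg; rewrite nmulr_llt0// => /ltW ->.
by rewrite in_itv => /nz /eqP.
Qed.

Lemma first_time (g : R -> R) : continuous g -> g 0 < 0 ->
  (forall t, 0 <= t <= 1 -> g t < 0) \/
  exists t, [/\ 0 < t, t <= 1, g t = 0 & forall s, 0 <= s -> s < t -> g s < 0].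
Proof.
move=> cg g0; pose A := [set t : R | 0 <= t <= 1 /\ 0 <= g t].
have [[a Aa]|nA] := pselect (A !=set0); last first.
  by left=> t t01; rewrite ltNge; apply/negP => h; apply: nA; exists t.
right; have lA : has_lbound A by exists 0 => t [/andP[]].
have t0 : 0 <= inf A by apply: lb_le_inf; [exists a|move=> t [/andP[]]].
have ta : inf A <= a by exact: ge_inf.
have [/andP[a0 a1] _] := Aa.
have lt s : 0 <= s -> s < inf A -> g s < 0.
  move=> s0 sA; rewrite ltNge; apply/negP => h.
  have As : A s by split=> //; rewrite s0 (ltW (lt_le_trans sA (le_trans ta a1))).
  by have := ge_inf lA As; rewrite leNgt sA.
have N (P : set R) : nbhs (inf A) P -> exists2 e : R, 0 < e & forall t, `|inf A - t| < e -> P t.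
  by move=> /nbhs_normP[e e0 h]; exists e.
have gA : g (inf A) = 0.
  have [h|h|//] := ltgtP (g (inf A)) 0.
    have /N[e e0 he] : \forall t \near inf A, g t < 0 by have := cg (inf A); move/cvgr_lt; apply.
    have [b Ab be] := inf_adherent e0 (conj (ex_intro _ a Aa) lA).
    have := ge_inf lA Ab => h2; have [_] := Ab; rewrite leNgt he//.
    by rewrite distrC ger0_norm; lra.
  have /N[e e0 he] : \forall t \near inf A, 0 < g t by have := cg (inf A); move/cvgr_gt; apply.
  have tp : 0 < inf A by rewrite lt_def t0 andbT; apply: contraTneq h => ->; rewrite -leNgt ltW.
  pose s := Num.max 0 (inf A - e / 2).
  have s1 : 0 <= s by rewrite le_max lexx.
  have s2 : s < inf A by rewrite gt_max tp; lra.
  have s3 : inf A - e / 2 <= s by rewrite le_max lexx orbT.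
  have := lt s s1 s2; rewrite ltNge ltW// he//.
  by rewrite ger0_norm; lra.
exists (inf A); split=> //; last by lra.
rewrite lt_def t0 andbT; apply/eqP => h; move: g0; rewrite -h gA; lra.
Qed.

End RealLine.

(** * Leaving a vertex along a level *)

Section Exit.
Context {R : realType} {M : compact_surface R} {f : M -> R} (hf : classF f).
Local Notation pt := 'rV[R]_2.
Context (x : M) (m : M -> pt) (j : pt -> M) (r : R) (n : nat) (P : pt -> R).
Context (D : disk m j r) (j0 : j 0 = x) (hP : homogeneous n.+2 P).
Context (nP : no_multiple_linear_factor P) (fP : forall p : pt, `|p| < r -> f (j p) = f x + P p).
Implicit Types (p q u w : pt).

(* The segment from [w] to [w1] is pushed radially onto the level [P w] until
   it leaves the ball of radius [r0]. *)
Lemma exit_path (r0 : R) w w1 : 0 < r0 -> r0 < r -> `|w| < r0 -> P w != 0 -> independent w w1 ->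
  exists q, [/\ level_component f (j w) (j q), P q = P w, `|q| <= r0 &
    `|q| = r0 \/ P w1 != 0 /\ exists2 l : R, 0 < l & q = l *: w1].
Proof.
move=> r00 r0r wr Pw ww1; set N := n.+2.
pose W (t : R) : pt := w + t *: (w1 - w).
have W0 : W 0 = w by rewrite /W scale0r addr0.
have W1 : W 1 = w1 by rewrite /W scale1r addrC subrK.
have Wn t : W t != 0.
  move: ww1; rewrite /independent; apply: contra => /eqP E; apply/eqP.
  have EX : cX w + t * (cX w1 - cX w) = 0 by have /(congr1 cX) := E; rewrite /W !cE.
  have EY : cY w + t * (cY w1 - cY w) = 0 by have /(congr1 cY) := E; rewrite /W !cE.
  have [t0|t0] := eqVneq t 0.
    by move: Pw; rewrite (_ : w = 0) ?(hom0 hP) ?eqxx//; rewrite -W0 -t0.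
  apply: (mulfI t0); rewrite mulr0.
  transitivity (cX w * (cY w + t * (cY w1 - cY w)) - cY w * (cX w + t * (cX w1 - cX w))); first by ring.
  by rewrite EX EY !mulr0 subr0.
have cW : continuous W by move=> t; apply: cvgD; [exact: cvg_cst|apply: cvgZr_tmp; exact: cvg_id].
have cP : continuous (P \o W).
  by move=> t; apply: continuous_comp; [exact: cW|exact: smooth_at_continuous (hom_smooth _ hP)].
(* The multiple l W(t) on the level of [w] has l^N |P(W t)| = |P w|, so [g t <= 0] says that it lies
   in the closed ball. Written without division, [g] is continuous also at zeros of [P], where it is
   positive. *)
pose g t := `|W t| ^+ N * `|P w| - r0 ^+ N * `|P (W t)|.
have cg : continuous g.
  move=> t; apply: cvgB; apply: cvgM; try exact: cvg_cst.
    apply: (@continuous_comp _ _ _ (fun t => `|W t|) (fun x => x ^+ N)).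
      by apply: continuous_comp; [exact: cW|exact: norm_continuous].
    exact: exprn_continuous.
  by apply: (@continuous_comp _ _ _ (P \o W) (fun s : R => `|s|)); [exact: cP|exact: norm_continuous].
have pw : 0 < `|P w| by rewrite normr_gt0.
have g0 : g 0 < 0.
  by rewrite /g W0 -mulrBl pmulr_llt0// subr_lt0 ltrXn2r// ltW.
pose l t : R := expR (ln (`|P w| / `|P (W t)|) / N%:R).
have lN t : P (W t) != 0 -> l t ^+ N = `|P w| / `|P (W t)|.
  move=> h; rewrite /l -expRM_natl mulrC divfK ?pnatr_eq0// lnK//.
  by rewrite posrE divr_gt0 ?normr_gt0.
have key b : 0 <= b <= 1 -> (forall t, 0 <= t <= b -> P (W t) != 0 /\ g t <= 0) ->
    [/\ level_component f (j w) (j (l b *: W b)), P (l b *: W b) = P w, `|l b *: W b| <= r0 &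
        (`|l b *: W b| ^+ N) * `|P (W b)| = `|W b| ^+ N * `|P w|].
  move=> /andP[b0 b1] H.
  have sg t : 0 <= t <= b -> 0 < P w * P (W t).
    move=> /andP[t0 tb]; have := @no_zero_sign R (P \o W) t t0 cP; rewrite /= W0; apply.
    by move=> s /andP[s0 st]; have [] := H s _; rewrite ?s0 ?(le_trans st).
  have Pl t : 0 <= t <= b -> P (l t *: W t) = P w.
    move=> tb; have [nz _] := H t tb; rewrite (hom_scale _ _ hP) lN//.
    have [h|h] := ltP 0 (P w).
      by move: (sg t tb); rewrite pmulr_rgt0// => h'; rewrite !gtr0_norm// divfK ?gt_eqF.
    have {}h : P w < 0 by rewrite lt_def h andbT eq_sym.
    by move: (sg t tb); rewrite nmulr_rgt0// => h'; rewrite !ltr0_norm// invrN mulrNN divfK ?lt_eqF.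
  have nl t : 0 <= t <= b -> `|l t *: W t| ^+ N * `|P (W t)| = `|W t| ^+ N * `|P w|.
    move=> tb; have [nz _] := H t tb; rewrite normrZ exprMn ger0_norm ?expR_ge0// lN//.
    by rewrite mulrAC divfK ?normr_eq0// mulrC.
  have rl0 t : 0 <= t <= b -> `|l t *: W t| <= r0.
    move=> tb; have [nz gt] := H t tb.
    rewrite -(@ler_pXn2r _ N)// ?nnegrE ?normr_ge0 ?(ltW r00)//.
    have h : 0 < `|P (W t)| by rewrite normr_gt0.
    by rewrite -(ler_pM2r h) nl//; move: gt; rewrite /g subr_le0.
  have rl t : 0 <= t <= b -> `|l t *: W t| < r by move=> /rl0 h; exact: le_lt_trans r0r.
  have l0 : l 0 *: W 0 = w by rewrite /l W0 divff ?normr_eq0// ln1 mul0r expR0 scale1r.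
  split; [|by apply: Pl; rewrite b0 lexx|by apply: rl0; rewrite b0 lexx|by apply: nl; rewrite b0 lexx].
  have := @lc_path _ M f (fun t => j (l t *: W t)) 0 b b0; rewrite l0; apply.
    move=> t tb; have [nz _] := H t tb; apply: continuous_comp; last exact: (disk_j_continuous D (rl t tb)).
    apply: cvgZ; last exact: cW.
    apply: (@continuous_comp _ _ _ (fun t => ln (`|P w| / `|P (W t)|) / N%:R) expR); last exact: continuous_expR.
    apply: cvgM; last exact: cvg_cst.
    have c1 : {for t, continuous (fun t => `|P w| / `|P (W t)|)}.
      apply: cvgM; first exact: cvg_cst.
      apply: cvgV; first by rewrite normr_eq0.
      by apply: (@continuous_comp _ _ _ (P \o W) (fun s : R => `|s|)); [exact: cP|exact: norm_continuous].
    have c2 : {for `|P w| / `|P (W t)|, continuous (@ln R)} by apply: continuous_ln; rewrite divr_gt0 ?normr_gt0.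
    exact: (continuous_comp c1 c2).
  by move=> t tb; rewrite !fP ?Pl ?(lt_trans wr)//; exact: rl.
have gz t : g t < 0 -> P (W t) != 0.
  by apply: contraTneq => E; rewrite /g E normr0 mulr0 subr0 -leNgt mulr_ge0.
have [H|[t [t0 t1 gt H]]] := first_time cg g0.
  have [|t /andP[t0 t1]|h1 h2 h4 _] := key 1; first by rewrite ler01 lexx.
    by have h := H t; rewrite t0 t1 in h; split; [exact: gz (h isT)|exact: ltW (h isT)].
  exists (l 1 *: W 1); split=> //; right; rewrite -W1; split; last by exists (l 1) => //; exact: expR_gt0.
  by apply: gz; apply: H; rewrite ler01 lexx.
have nz : P (W t) != 0.
  apply/eqP => E; move: gt; rewrite /g E normr0 mulr0 subr0 => /eqP.
  by rewrite mulf_eq0 expf_eq0 /= !normr_eq0 (negbTE (Wn t)) (negbTE Pw).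
have [|s /andP[s0 st]|h1 h2 h4 h3] := key t; first by rewrite ltW.
  have [E|st'] := eqVneq s t; first by rewrite E nz gt lexx.
  by have h := H s s0; rewrite lt_neqAle st' st in h; split; [exact: gz (h isT)|exact: ltW (h isT)].
exists (l t *: W t); split=> //; left; apply/eqP; rewrite -(@eqrXn2 _ N)// ?(ltW r00)//.
have h : 0 < `|P (W t)| by rewrite normr_gt0.
by rewrite -(inj_eq (mulIf (lt0r_neq0 h))) h3 -subr_eq0 -/(g t) gt.
Qed.

End Exit.

(** * Stabilizers of a critical component *)

Section Component.
Context {R : realType} {M : compact_surface R} {f : M -> R} (hf : classF f).
Local Notation pt := 'rV[R]_2.
Notation "x ~~ y" := (level_component f x y) (at level 70).
Implicit Types (x y z : M) (p q u w : pt) (h k : M -> M).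

Lemma stab_f h x : stabilizer f h -> f (h x) = f x.
Proof. by move=> [_ E]; rewrite -[in RHS]E. Qed.

Lemma stab_continuous h : stabilizer f h -> continuous h.
Proof. by move=> [[[]]]. Qed.

Lemma stab_comp h k : stabilizer f h -> stabilizer f k -> stabilizer f (h \o k).
Proof.
move=> sh sk; split; first by apply: diffeo_comp; [case: sh|case: sk].
by apply/funext => x /=; rewrite !stab_f.
Qed.

Lemma stab_id : stabilizer f id.
Proof.
by split=> //; apply: (@diffeo_of _ _ id id) => //; exact: smooth_map_id.
Qed.

Lemma stab_inv h : stabilizer f h -> exists k, [/\ stabilizer f k, cancel h k & cancel k h].
Proof.
move=> sh; have [[sm [k [sk hk kh]]] _] := sh; exists k; split=> //; split.
  exact: diffeo_of sk sm kh hk.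
by apply/funext => x /=; rewrite -{2}(kh x) (stab_f _ sh).
Qed.

Lemma stab_lc h x y : stabilizer f h -> x ~~ y -> h x ~~ h y.
Proof.
move=> sh xy; apply: (@lc_max _ _ _ (h @` level_component f x)).
- apply: connected_continuous_connected; first exact: lc_connected.
  by apply: continuous_subspaceT; exact: stab_continuous.
- by exists x => //; exact: lc_refl.
- by exists y.
- by move=> _ [z xz <-]; rewrite !stab_f// (lc_f xz).
Qed.

Lemma stab_lc_iff h x y : stabilizer f h -> (h x ~~ h y) <-> (x ~~ y).
Proof.
move=> sh; split; last exact: stab_lc.
by have [k [sk hk _]] := stab_inv sh => /(stab_lc sk); rewrite !hk.
Qed.

Lemma rho_proj h x : stabilizer f h -> rho (f := f) h (reeb_proj f x) = reeb_proj f (h x).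
Proof.
move=> sh; have [_ fh] := sh.
by have := rhoE (stab_continuous sh) fh => /(congr1 (fun g => g x)) /= <-.
Qed.

Lemma rho_comp h k (w : reeb f) : stabilizer f h -> stabilizer f k ->
  rho (f := f) (h \o k) w = rho (f := f) h (rho (f := f) k w).
Proof.
move=> sh sk; rewrite -(reeb_reprK w) !rho_proj//; exact: stab_comp.
Qed.

(** A set of components is open in the quotient when its union is open; by [fiber_usc] this holds
    for the components contained in the open set [F]. *)
Lemma reeb_near (Q : set (reeb f)) (w : reeb f) :
  (forall y, reeb_proj f y = w -> \forall z \near y, Q (reeb_proj f z)) -> nbhs w Q.
Proof.
move=> H; pose F : set M := interior [set y | Q (reeb_proj f y)].
pose A := [set u : reeb f | forall y, reeb_proj f y = u -> F y].
have oF : open F := open_interior _.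
have oA : open A.
  change (open (reeb_proj f @^-1` A)); apply: open_of_near => y Ay.
  have CF : level_component f y `<=` F by move=> z /reeb_projP/esym; exact: Ay.
  apply: filterS (fiber_usc hf oF CF) => z zF u /esym/reeb_projP; exact: zF.
have Aw : A w by move=> y /H.
apply: filterS (open_nbhs_nbhs (conj oA Aw)) => u Au.
have /(interior_subset) := Au _ (reeb_reprK u).
by rewrite /= reeb_reprK.
Qed.

Lemma compact_M (A : set M) : closed A -> compact A.
Proof. by move=> cA; apply: (subclosed_compact cA (@surface_compact _ M)). Qed.

Context {v : reeb f} (hv : vertex v).
Let V := component v.

Lemma compP x y : V x -> V y <-> x ~~ y.
Proof.
by rewrite /V /component /= => <-; split=> [/esym/reeb_projP|/reeb_projP].
Qed.

Lemma compE x : V x -> V = level_component f x.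
Proof. by move=> Vx; apply/seteqP; split=> y /(compP y Vx). Qed.

Lemma comp_critical : exists2 x, critical f x & V x.
Proof. by have [x cx E] := hv; exists x. Qed.

Lemma comp_f x y : V x -> V y -> f x = f y.
Proof. by move=> Vx /(compP y Vx); exact: lc_f. Qed.

Lemma comp_closed : closed V.
Proof. by have [x _ Vx] := comp_critical; rewrite (compE Vx); exact: lc_closed. Qed.

Lemma comp_connected : connected V.
Proof. by have [x _ Vx] := comp_critical; rewrite (compE Vx); exact: lc_connected. Qed.

Lemma comp_near x : V x -> \forall y \near x, f y = f x -> V y.
Proof.
by move=> Vx; apply: filterS (level_near hf x) => y h /h /(compP y Vx).
Qed.

Lemma inner_near x : ~ boundary x -> \forall y \near x, ~ boundary y.
Proof.
move=> ix; have [c Ac cx] := chart_at x; have [j [r [D j0]]] := disk_at Ac cx ix.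
have n0 : `|0 : pt| < r by rewrite normr0; exact: disk_gt0 D.
have := region_near D (disk_region j n0); rewrite j0; apply: filterS => _ [p pr <-].
exact: disk_inner D p pr.
Qed.

(** By [boundary_box] a level that touches the boundary runs inside it, so being a boundary point is
    locally constant on [V]; a critical point of [V] is interior. *)
Lemma comp_inner x : V x -> ~ boundary x.
Proof.
move=> Vx; have [x0 cx0 Vx0] := comp_critical.
apply: (@connected_near_ind _ V (fun y => ~ boundary y) x0 x) => //; first exact: comp_connected.
  exact: (classF_interior hf).
move=> a Va; have [ba|ia] := pselect (boundary a).
  by have [_] := boundary_box hf ba; apply: filterS => b H Vb; have := H (comp_f Vb Va); tauto.
by apply: filterS (inner_near ia) => b ib _; tauto.
Qed.

Lemma critical_isolated x : critical f x -> \forall y \near x, f y = f x -> y <> x -> ~ critical f y.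
Proof.
move=> cr; have [m [j [r [n [P [D j0 hP nP fP]]]]]] := vertex_disk hf cr.
have n0 : `|0 : pt| < r by rewrite normr0; exact: disk_gt0 D.
have := region_near D (disk_region j n0); rewrite j0; apply: filterS => _ [p pr <-] fp px.
apply: (vertex_regular hf D hP nP fP pr); last exact: (vertex_level fP pr).1.
by apply/eqP => p0; apply: px; rewrite p0.
Qed.

Lemma regular_near x : ~ boundary x -> ~ critical f x -> \forall y \near x, ~ critical f y.
Proof.
move=> ix rx; have [m [j [r [D j0 fj]]]] := regular_disk hf ix rx.
have n0 : `|0 : pt| < r by rewrite normr0; exact: disk_gt0 D.
have := region_near D (disk_region j n0); rewrite j0; apply: filterS => _ [p pr <-].
move=> /(disk_critical D (classF_smooth hf) pr)/(_ e1) /eqP; apply/negP.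
have E : \forall q \near p, (f \o j) q = (cst (f x) \+ @cY R) q.
  by apply: filterS (near_norm_lt pr) => q /fj /= ->.
rewrite (eq_near_derive e1 E) deriveD; last 2 first.
- exact: derivable_cst.
- by apply: diff_derivable; apply: smooth_at_diff; exact: smooth_Y.
by rewrite derive_cst add0r derive_Y !cE oner_neq0.
Qed.

Lemma finite_vertices : finite_set (V `&` critical f).
Proof.
have cV := compact_M comp_closed.
suff : finite_set (V `&` (V `&` critical f)) by rewrite setIA setIid.
apply: (@compact_ind _ V (fun A => finite_set (A `&` (V `&` critical f))) cV).
- by rewrite set0I.
- by move=> B C fB fC; rewrite setIUl finite_setU.
- by move=> B C BC; apply: sub_finite_set; exact: setSI.
- move=> x Vx; have [cx|rx] := pselect (critical f x).
    have N := critical_isolated cx; eexists; first exact: N.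
    apply: (@sub_finite_set _ _ [set x]) => // y [H [Vy cy]].
    by apply: contrapT => /= yx; exact: H (comp_f Vy Vx) yx cy.
  have N := regular_near (comp_inner Vx) rx; eexists; first exact: N.
  by apply: (@sub_finite_set _ _ set0) => // y [H [_ /H]].
Qed.

Lemma path_connected (A : set M) (phi' : R -> M) : (forall t, 0 <= t <= 1 -> {for t, continuous phi'}) ->
  (forall t, 0 <= t <= 1 -> A (phi' t)) -> connected_component A (phi' 0) (phi' 1).
Proof.
move=> cp Ap; exists (phi' @` `[0, 1]); last by exists 1; rewrite //= in_itv /= ler01 lexx.
split; first by exists 0; rewrite //= in_itv /= ler01 lexx.
  by move=> ? [t /=]; rewrite in_itv => h <-; exact: Ap.
apply: connected_continuous_connected; first exact: segment_connected.
by apply: continuous_in_subspaceT => t /set_mem /=; rewrite in_itv; exact: cp.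
Qed.

Lemma ray_component (A : set M) (m : M -> pt) (j : pt -> M) (r a b : R) p : disk m j r ->
  0 <= a <= b -> `|b *: p| < r -> (forall t, a <= t <= b -> A (j (t *: p))) ->
  connected_component A (j (a *: p)) (j (b *: p)).
Proof.
move=> D /andP[a0 ab] pr H.
have := @path_connected A (fun t => j ((a + t * (b - a)) *: p)).
rewrite mul0r addr0 mul1r (_ : a + (b - a) = b); last by rewrite addrC subrK.
apply=> t /andP[t0 t1].
  have h : 0 <= a + t * (b - a) <= b.
    have : 0 <= t * (b - a) by rewrite mulr_ge0// subr_ge0.
    have : t * (b - a) <= b - a by rewrite ler_piMl// subr_ge0.
    by lra.
  apply: continuous_comp.
    apply: cvgZr_tmp.
    by apply: cvgD; [exact: cvg_cst|apply: cvgM; [exact: cvg_id|exact: cvg_cst]].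
  apply: (disk_j_continuous D); apply: le_lt_trans pr; rewrite !normrZ ler_wpM2r//.
  by have /andP[h1 h2] := h; rewrite !ger0_norm// (le_trans a0 ab).
apply: H; have : 0 <= t * (b - a) by rewrite mulr_ge0// subr_ge0.
have : t * (b - a) <= b - a by rewrite ler_piMl// subr_ge0.
by lra.
Qed.

Let E := V `\` critical f.

Lemma edge_at x : E x -> Xi1 v (connected_component E x).
Proof. by move=> Ex; exists x. Qed.

Lemma edge_eq e x : Xi1 v e -> e x -> E x /\ e = connected_component E x.
Proof.
move=> [y Ey ->] ex; split; first exact: connected_component_sub ex.
apply/seteqP; split=> z; last by apply: connected_component_trans.
by apply: connected_component_trans; exact: connected_component_sym.
Qed.

Lemma edge_sub e x : Xi1 v e -> e x -> V x /\ ~ critical f x.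
Proof. by move=> he /(edge_eq he)[[]]. Qed.

Lemma edge_connected e : Xi1 v e -> connected e.
Proof. by move=> [y _ ->]; exact: component_connected. Qed.

Lemma edge_near e x : Xi1 v e -> e x -> \forall y \near x, V y -> e y.
Proof.
move=> he ex; have [[Vx rx] ->] := edge_eq he ex; have ix := comp_inner Vx.
have [m [j [r [D j0 fj]]]] := regular_disk hf ix rx.
have n0 : `|0 : pt| < r by rewrite normr0; exact: disk_gt0 D.
have fVx y : V y -> f y = f x by move=> Vy; exact: comp_f.
have N : \forall y \near x, (f y = f x -> V y) /\ ~ critical f y.
  exact: filterI (comp_near Vx) (regular_near ix rx).
have N' : \forall p \near (0 : pt), (f (j p) = f x -> V (j p)) /\ ~ critical f (j p).
  by rewrite -j0 in N *; exact: (disk_j_continuous D n0 N).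
have /near_norm[r' r'0 h] : \forall p \near (0 : pt), ((f (j p) = f x -> V (j p)) /\ ~ critical f (j p)) /\ `|p| < r.
  by apply: filterI N' _; exact: near_norm_lt.
have Q : \forall p \near (0 : pt), `|p| < r' by apply: near_norm_lt; rewrite normr0.
have := disk_near D n0 Q; rewrite j0; apply: filterS => y [Ry yr] Vy.
have [jy yrr] := disk_jm D Ry; have Y0 : cY (m y) = 0.
  by have := fVx y Vy; rewrite -{1}jy fj// => /eqP; rewrite -subr_eq0 addrAC subrr add0r => /eqP.
have := @ray_component E m j r 0 1 (m y) D; rewrite scale0r scale1r j0 jy; apply=> //.
  by rewrite lexx ler01.
move=> t /andP[t0 t1]; have tr : `|t *: m y| < r'.
  by rewrite normrZ ger0_norm//; apply: le_lt_trans yr; rewrite ler_piMl.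
have [|[h1 h2] h3] := h (t *: m y); first by rewrite subr0.
by split=> //; apply: h1; rewrite fj// cE Y0 mulr0 addr0.
Qed.

(* Box at [y] gives [h z ~ z] near [y] as soon as [Rel y (h y)]. *)
Lemma fixed_near h y : stabilizer f h -> ~ critical f y -> ~ critical f (h y) ->
  Rel (f := f) y (h y) -> \forall z \near y, h z ~~ z.
Proof.
move=> sh ry rhy yhy; have [U [Uhy _ HU]] := regular_box hf rhy.
have N : \forall z \near y, U (h z) := stab_continuous sh Uhy.
apply: filterS2 N (yhy U Uhy) => z Uhz [z' Uz' zz].
apply: (lc_trans _ zz); apply: HU => //; by rewrite stab_f// (lc_f zz).
Qed.

Lemma stab_comp_comp h x : stabilizer_comp v h -> V x -> V (h x).
Proof. by move=> [_ E'] Vx; rewrite /V -E'; exists x. Qed.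

Section FixedEdges.
Context (h : M -> M) (hh : stabilizer_comp v h) (he : forall e, Xi1 v e -> h @` e = e).

Let sh : stabilizer f h. Proof. by case: hh. Qed.

Lemma fixed_near_edge y : V y -> ~ critical f y -> \forall z \near y, h z ~~ z.
Proof.
move=> Vy ry; have Ey : E y by [].
have ehy : connected_component E y (h y).
  by rewrite -{1}(he (edge_at Ey)); exists y => //; exact: connected_component_refl.
have [[Vhy rhy] _] := edge_eq (edge_at Ey) ehy.
apply: fixed_near => //; apply: (propagate hf (edge_connected (edge_at Ey))) => //.
  exact: connected_component_refl.
by move=> z /(edge_sub (edge_at Ey))[Vz rz]; split=> //; exact: comp_f.
Qed.

(** A point near [x] off [V] is joined within its level component to the sphere of radius [r0].
    There the points without a fixed neighbourhood form a compact set [S] on which [P] does not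
    vanish, so a level close to that of [x] avoids it. If [P] has a zero direction, the path is
    steered towards it and has to reach the sphere. If [P] is definite, [h] fixes [x], and the path
    is steered from [w] to its image [w'] on the same level. *)
Lemma fixed_near_vertex x : V x -> critical f x -> \forall z \near x, h z ~~ z.
Proof.
move=> Vx cx; have [m [j [r [n [P [D j0 hP nP fP]]]]]] := vertex_disk hf cx.
have rr := disk_gt0 D; have n0 : `|0 : pt| < r by rewrite normr0.
pose r0 := r / 2; have r00 : 0 < r0 by rewrite divr_gt0.
have r0r : r0 < r by rewrite /r0; lra.
have Vj p : `|p| < r -> P p = 0 -> V (j p).
  by move=> pr Pp; apply/(compP _ Vx); exact: (vertex_cone D j0 hP fP pr Pp).
pose S := [set p : pt | `|p| = r0 /\ ~ \forall q \near p, h (j q) ~~ j q].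
have S0 p : S p -> P p != 0.
  move=> [pr np]; apply/eqP => Pp; apply: np; have pr' : `|p| < r by rewrite pr.
  have p0 : p != 0 by rewrite -normr_gt0 pr.
  exact: (disk_j_continuous D pr' (fixed_near_edge (Vj p pr' Pp) (vertex_regular hf D hP nP fP pr' p0 Pp))).
have cS : compact S.
  apply: (@subclosed_compact _ _ [set p : pt | `|p| <= r0]); last by move=> p [/= ->].
    rewrite (_ : S = [set p : pt | `|p| = r0] `&` ~` interior [set q | h (j q) ~~ j q])//.
    apply: closedI; last exact: open_closedC (open_interior _).
    by apply: (@preimage_closed _ _ (fun p : pt => `|p|) [set s | s = r0]) => [p _|]; [exact: norm_continuous|exact: closed_eq].
  exact: ball_compact.
have cl : closed ((fun p => P p) @` S).
  apply: compact_closed; first exact: norm_hausdorff.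
  by apply: continuous_compact => //; apply: continuous_in_subspaceT => p _; exact: smooth_at_continuous (hom_smooth p hP).
have P0 := hom0 hP.
have NS : \forall p \near (0 : pt), ~ (P @` S) (P p).
  apply: (@smooth_at_continuous _ _ P 0 (hom_smooth 0 hP) (~` (P @` S))); rewrite P0.
  apply: open_nbhs_nbhs; split; first exact: closed_openC.
  by move=> [p /S0 /eqP h' /h'].
have exit w q : ~ (P @` S) (P w) -> P q = P w -> `|q| = r0 -> j w ~~ j q -> h (j w) ~~ j w.
  move=> nw Pq qr wq; have : h (j q) ~~ j q.
    apply: contrapT => nq; apply: nw; exists q => //; split=> //.
    by move=> /nbhs_singleton.
  by move=> hq; apply: lc_trans (stab_lc sh wq) (lc_trans hq (lc_sym wq)).
have base w : V (j w) -> h (j w) ~~ j w.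
  by move=> Vw; apply/(compP _ (stab_comp_comp hh Vw)).
have Q0 : \forall p \near (0 : pt), `|p| < r0 by apply: near_norm_lt; rewrite normr0.
have main : \forall w \near (0 : pt), h (j w) ~~ j w.
  have [[u [u0 Pu]]|def] := pselect (exists u, u != 0 /\ P u = 0).
    apply: filterS2 NS Q0 => w nw wr; have wr' : `|w| < r by exact: lt_trans wr r0r.
    have [Pw|Pw] := eqVneq (P w) 0; first by apply: base; exact: Vj.
    have D' : independent w u.
      rewrite -[independent _ _]negbK; apply: contra Pw => dep; apply/eqP.
      have dep' : ~~ independent u w by apply: contra dep; exact: independent_sym.
      by have [c ->] := dependent_scale u0 dep'; rewrite (hom_scale _ _ hP) Pu mulr0.
    have [q [wq Pq _ [qr|[]]]] := exit_path D hP fP r00 r0r wr Pw D'; last by rewrite Pu eqxx.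
    exact: exit qr wq.
  have hx : h x = x.
    have Vhx := stab_comp_comp hh Vx; apply/esym.
    apply: (@connected_near_ind _ V (fun y => x = y) x (h x)) => //; first exact: comp_connected.
    move=> a Va; have [<-|xa] := pselect (x = a).
      have := region_near D (disk_region j n0); rewrite j0; apply: filterS => _ [p pr <-] Vp; split=> // _.
      have [->|p0] := eqVneq p 0; first by rewrite j0.
      exfalso; apply: def; exists p; split=> //; apply/(vertex_level fP pr); exact: comp_f.
    have N : \forall b \near a, x <> b.
      apply: open_nbhs_nbhs; split; last exact: xa.
      rewrite (_ : (fun b => x <> b) = ~` [set x]).
        by apply: closed_openC; apply: compact_closed; [exact: surface_hausdorff|exact: compact_set1].
      by apply/seteqP; split=> b /= h' bx; apply: h'.
    by apply: filterS N => b xb _; split.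
  have Nh : \forall w \near (0 : pt), region j r (h (j w)) /\ `|m (h (j w))| < r0.
    have c1 : {for (0 : pt), continuous (h \o j)}.
      by apply: continuous_comp; [exact: (disk_j_continuous D n0)|exact: stab_continuous].
    have N1 : \forall y \near (h \o j) 0, region j r y /\ `|m y| < r0.
      by have := disk_near D n0 Q0; rewrite /= j0 hx.
    exact: c1 _ N1.
  have nz u : u != 0 -> P u != 0 by move=> u0; apply/eqP => Pu; apply: def; exists u.
  apply: filterS3 NS Q0 Nh => w nw wr [Rh hr].
  have [jh mr] := disk_jm D Rh; set w' := m (h (j w)) in jh mr hr.
  have wr' : `|w| < r by exact: lt_trans wr r0r.
  have Pw' : P w' = P w.
    by have := stab_f (j w) sh; rewrite -jh !fP// => /addrI.
  have [w0|w0] := eqVneq w 0; first by rewrite w0 j0 hx; exact: lc_refl.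
  have finish u : j w ~~ j u -> P u = P w -> `|u| < r0 -> independent u w' -> h (j w) ~~ j w.
    move=> wu Pu ur ind; have Pu0 : P u != 0 by rewrite Pu nz.
    have [q [uq Pq _ [qr|[_ [l l0 ql]]]]] := exit_path D hP fP r00 r0r ur Pu0 ind.
      by apply: (exit w q) => //; [rewrite Pq|exact: lc_trans wu uq].
    have l1 : l = 1.
      apply: (@exprn_eq1 _ _ n.+1) => //; apply: (mulIf Pu0).
      by rewrite mul1r -{2}Pq ql (hom_scale _ _ hP) Pw' Pu.
    by apply: lc_sym; apply: lc_trans wu _; rewrite -jh (_ : w' = q)// ql l1 scale1r.
  have [ind|] := boolP (independent w w'); first by apply: finish => //; exact: lc_refl.
  move=> /(dependent_scale w0)[c wc].
  have N2 := norm2_gt0 w0.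
  (* [exit_path] needs independent directions; when [w'] is a multiple of [w], the path goes through
     the quarter turn of [w]. *)
  have ind : independent w (mk (- cY w) (cX w)) by rewrite /independent !cE mulrN opprK gt_eqF.
  have [q [wq Pq qr' [qr|[_ [l l0 ql]]]]] := exit_path D hP fP r00 r0r wr (nz w w0) ind.
    by apply: (exit w q).
  move: qr'; rewrite le_eqVlt => /orP[/eqP qr|qr]; first exact: (exit w q).
  apply: (finish q) => //; rewrite wc ql /independent !cE.
  have c0 : c != 0.
    by apply/eqP => c0; move: Pw'; rewrite wc c0 scale0r P0 => /esym/eqP; rewrite (negbTE (nz w w0)).
  have -> : l * - cY w * (c * cY w) - l * cX w * (c * cX w) = - (l * c) * (cX w * cX w + cY w * cY w) by ring.
  by rewrite mulf_neq0 ?oppr_eq0 ?mulf_neq0// gt_eqF.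
have := disk_near D n0 main; rewrite j0; apply: filterS => z [Rz].
by have [-> _] := disk_jm D Rz.
Qed.

End FixedEdges.

Context {st : set (reeb f)} (hst : star v st).

Lemma rho_stab h : stabilizer_comp v h -> reeb_stab v (rho (f := f) h).
Proof.
move=> hh; have [sh _] := hh; split; first by exists h.
have [x _ Vx] := comp_critical; have Vhx := stab_comp_comp hh Vx.
by rewrite -{1}Vx rho_proj.
Qed.

Lemma val_phi h (w : st) : stabilizer_comp v h -> val (phi st h w) = rho (f := f) h (val w).
Proof.
move=> hh; rewrite /phi /restr insubdK//; apply: mem_set.
have sw : st (val w) := set_mem (valP w); move: (val w) sw => u su.
by rewrite -(star_invariant hst (rho_stab hh)); exists u.
Qed.

Lemma stabc_comp h k : stabilizer_comp v h -> stabilizer_comp v k -> stabilizer_comp v (h \o k).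
Proof. by move=> [sh eh] [sk ek]; split; [exact: stab_comp|rewrite -image_comp ek eh]. Qed.

Lemma stabc_id : stabilizer_comp v id.
Proof. by split; [exact: stab_id|rewrite image_id]. Qed.

Lemma stabc_inv h : stabilizer_comp v h -> exists k, [/\ stabilizer_comp v k, cancel h k & cancel k h].
Proof.
move=> [sh eh]; have [k [sk hk kh]] := stab_inv sh; exists k; split=> //; split=> //.
by rewrite -{1}eh image_comp (_ : k \o h = id) ?image_id//; apply/funext.
Qed.

Lemma phi_comp h k : stabilizer_comp v h -> stabilizer_comp v k ->
  phi st (h \o k) = phi st h \o phi st k.
Proof.
move=> hh hk; apply/funext => w; apply: val_inj.
rewrite /comp !val_phi//; last exact: stabc_comp.
by rewrite rho_comp//; [case: hh|case: hk].
Qed.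

Lemma phi_id : phi st id = id.
Proof.
apply/funext => w; apply: val_inj; rewrite val_phi; last exact: stabc_id.
by rewrite -{1}(reeb_reprK (val w)) rho_proj ?reeb_reprK//; exact: stab_id.
Qed.

Lemma phi_idP h : stabilizer_comp v h -> (phi st h = id) <->
  forall x, st (reeb_proj f x) -> h x ~~ x.
Proof.
move=> hh; have [sh _] := hh; split=> [E' x sx|H].
  apply/reeb_projP; rewrite -rho_proj//.
  pose w : st := SigSub (mem_set sx); have := val_phi w hh.
  by rewrite E' /= => <-.
apply/funext => w; apply: val_inj; rewrite val_phi//.
have := H (reeb_repr (val w)); rewrite reeb_reprK => /(_ (set_mem (valP w))) /reeb_projP.
by rewrite -rho_proj// reeb_reprK.
Qed.

(** The set of points of the star fixed by [rho h] is closed because lying on one level component is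
    a closed relation. It is open at [v] by [fixed_near_vertex] and [fixed_near_edge], and elsewhere
    because a component without critical points can be followed by flow boxes. *)
Lemma star_fixed h : stabilizer_comp v h -> (forall e, Xi1 v e -> h @` e = e) -> phi st h = id.
Proof.
move=> hh he; have [sh _] := hh; apply/(phi_idP hh) => x sx; apply/reeb_projP; rewrite -rho_proj//.
have stv : st v := nbhs_singleton (star_nbhs hst).
apply: (@connected_near_ind (reeb f) st (fun w : reeb f => rho (f := f) h w = w) v (reeb_proj f x)) => //.
- exact: star_connected hst.
- by have [] := rho_stab hh.
move=> w sw; have [fw|nw] := pselect (rho (f := f) h w = w); last first.
  apply: reeb_near => y yw.
  have ny : ~ y ~~ h y by move=> /reeb_projP; rewrite -rho_proj// yw => /esym.
  have [W [Wy N]] := lc_not hf ny; have N2 : \forall z \near y, W (h z) := stab_continuous sh Wy.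
  apply: filterS2 N N2 => z H Wz _; split=> // fz; exfalso.
  by apply: (H _ Wz); apply/reeb_projP; rewrite -rho_proj// fz.
apply: reeb_near => y yw.
have yhy : y ~~ h y by apply/reeb_projP; rewrite -rho_proj// yw fw.
suff : \forall z \near y, h z ~~ z.
  by apply: filterS => z zz _; split=> // _; rewrite rho_proj//; apply/reeb_projP.
have [wv|wv] := pselect (w = v).
  have Vy : V y by rewrite /V /component /= yw.
  have [cy|ry] := pselect (critical f y); first exact: fixed_near_vertex.
  exact: fixed_near_edge.
have reg z : y ~~ z -> ~ critical f z.
  move=> yz cz; apply: wv; apply: (star_vertex hst) => //; exists z => //.
  by rewrite -yw; apply/esym/reeb_projP.
apply: fixed_near => //; [exact: reg (lc_refl y)|exact: reg|].
apply: (propagate hf (@lc_connected _ M f y)) => //; first exact: lc_refl.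
by move=> z yz; split; [rewrite (lc_f yz)|exact: reg].
Qed.

End Component.
(** * Edges *)

Section Arcs.
Context {R : realType} {T : topologicalType} (V : set T).
Implicit Types (al be : R -> T) (s t : R).

(** By the last clause [al] is open onto its image in [V]: an arc is a line embedded as an open
    subset of [V]. *)
Definition arc al := [/\ continuous al, injective al, (forall t, V (al t)) &
  forall t (e : R), 0 < e -> \forall y \near al t, V y -> exists2 s, `|s - t| < e & al s = y].

Lemma arc_rev al : arc al -> arc (al \o -%R).
Proof.
move=> [ca ia Va oa]; split=> [t|s t /ia /oppr_inj //|t|t e e0]; first 1 last.
- exact: Va.
- apply: filterS (oa (- t) e e0) => y H Vy; have [s st sy] := H Vy.
  exists (- s); last by rewrite /= opprK.
  by rewrite -normrN opprB opprK addrC -[t]opprK.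
by apply: continuous_comp; [exact: opp_continuous|exact: ca].
Qed.

Lemma range_rev al y : range al y -> range (al \o -%R) y.
Proof. by move=> [t _ <-]; exists (- t) => //=; rewrite opprK. Qed.

Lemma near_R (P : set R) (t : R) : nbhs t P -> exists2 e : R, 0 < e & forall s, `|s - t| < e -> P s.
Proof. by move=> /nbhs_normP[e e0 h]; exists e => // s hs; apply: h; rewrite /ball_ /= distrC. Qed.

Context (hT : hausdorff_space T).

(** The piece ]a, s] of [al] is a closed half line of [be] ending at [t]: the lower one if [l]
    holds, the upper one otherwise. *)
Definition onto_left al be (a s t : R) (l : bool) :=
  (forall t', (if l then t' <= t else t <= t') -> exists s', [/\ a < s', s' <= s & al s' = be t']) /\
  (forall s', a < s' -> s' <= s -> exists2 t', (if l then t' <= t else t <= t') & al s' = be t').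

Definition squash (b c t : R) : R := (b + c) / 2 + (c - b) / 2 * (t / (1 + `|t|)).

Lemma squash_den t : 0 < 1 + `|t|. Proof. by rewrite ltr_wpDr. Qed.

Lemma squash_mono b c s t : b < c -> s < t -> squash b c s < squash b c t.
Proof.
move=> bc st; rewrite /squash ltrD2l ltr_pM2l; last by lra.
rewrite ltr_pdivrMr ?squash_den// mulrAC ltr_pdivlMr ?squash_den//.
have [s0|s0] := leP 0 s.
  by rewrite !ger0_norm//; [|lra]; rewrite !mulrDr !mulr1 [t * s]mulrC; lra.
have [t0|t0] := leP 0 t.
  have : 0 <= t * (1 + `|s|) by rewrite mulr_ge0// ltW ?squash_den.
  have : s * (1 + `|t|) < 0 by rewrite nmulr_rlt0// squash_den.
  by lra.
by rewrite !ltr0_norm// !mulrDr !mulr1 !mulrN [t * s]mulrC; lra.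
Qed.

Lemma squash_bound b c t : b < c -> b < squash b c t < c.
Proof.
move=> bc; have : - 1 < t / (1 + `|t|) < 1.
  by rewrite ltr_pdivlMr ?squash_den// ltr_pdivrMr ?squash_den//; have := ler_norm t; have := ler_norm (- t); rewrite normrN; lra.
move=> /andP[h1 h2]; have d0 : 0 < (c - b) / 2 by lra.
have h3 : (c - b) / 2 * - 1 < (c - b) / 2 * (t / (1 + `|t|)) by rewrite ltr_pM2l.
have h4 : (c - b) / 2 * (t / (1 + `|t|)) < (c - b) / 2 * 1 by rewrite ltr_pM2l.
by move: h3 h4; rewrite /squash; move: (_ * (t / _)) => z; lra.
Qed.

Lemma squash_continuous b c : continuous (squash b c).
Proof.
move=> t; apply: cvgD; first exact: cvg_cst; apply: cvgM; first exact: cvg_cst.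
apply: cvgM; first exact: cvg_id; apply: cvgV; first by rewrite gt_eqF ?squash_den.
by apply: cvgD; [exact: cvg_cst|exact: norm_continuous].
Qed.

Lemma squash_onto b c u : b < u < c -> exists t, squash b c t = u.
Proof.
move=> /andP[bu uc]; have bc : b < c by lra.
pose w := (u - (b + c) / 2) / ((c - b) / 2).
have d0 : (c - b) / 2 != 0 by rewrite gt_eqF//; lra.
have w1 : `|w| < 1.
  by rewrite ltr_norml ltr_pdivlMr ?ltr_pdivrMr; lra.
have w2 : 0 < 1 - `|w| by lra.
have uE : u = (b + c) / 2 + (c - b) / 2 * w by rewrite /w [X in _ + X]mulrC divfK// addrC subrK.
clearbody w; exists (w / (1 - `|w|)); rewrite /squash.
have -> : `|w / (1 - `|w|)| = `|w| / (1 - `|w|) by rewrite normf_div [X in _ / X]ger0_norm// ltW.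
have -> : w / (1 - `|w|) / (1 + `|w| / (1 - `|w|)) = w.
  have h : 1 - `|w| != 0 by rewrite gt_eqF.
  have -> : 1 + `|w| / (1 - `|w|) = (1 - `|w|)^-1 by field.
  by rewrite invrK divfK.
by rewrite uE.
Qed.

(* A parametrization by a bounded interval becomes an arc. *)
Lemma interval_arc (k : R -> T) b c : b < c ->
  (forall t, b < t < c -> {for t, continuous k}) ->
  (forall s t, b < s < c -> b < t < c -> k s = k t -> s = t) ->
  (forall t, b < t < c -> V (k t)) ->
  (forall t (e : R), b < t < c -> 0 < e ->
     \forall y \near k t, V y -> exists s, [/\ b < s < c, `|s - t| < e & k s = y]) ->
  arc (k \o squash b c) /\ forall y, range (k \o squash b c) y <-> exists2 t, b < t < c & k t = y.
Proof.
move=> bc ck ik Vk ok; split; last first.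
  move=> y; split=> [[t _ <-]|[u /squash_onto[t <-] <-]]; last by exists t.
  by exists (squash b c t) => //; exact: squash_bound.
have mono s t := @squash_mono b c s t bc.
split=> [t|s t /= /(ik _ _ (squash_bound s bc) (squash_bound t bc)) E|t|t e e0] /=.
- by apply: continuous_comp; [exact: squash_continuous|apply: ck; exact: squash_bound].
- by have [/mono|/mono|//] := ltgtP s t; rewrite E ltxx.
- by apply: Vk; exact: squash_bound.
pose d := Num.min (squash b c (t + e) - squash b c t) (squash b c t - squash b c (t - e)).
have d0 : 0 < d by rewrite lt_min !subr_gt0 !mono//; lra.
apply: filterS (ok _ d (squash_bound t bc) d0) => y H /H[s [sbc + <-]].
have [s' <-] := squash_onto sbc; rewrite lt_min !ltr_distl => /andP[/andP[_ h1] /andP[h2 _]].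
exists s' => //; rewrite ltr_distl; apply/andP; split; rewrite ltNge; apply/negP => h.
  have : squash b c s' <= squash b c (t - e).
    by move: h; rewrite le_eqVlt => /orP[/eqP ->//|/mono/ltW].
  by move: h2; lra.
have : squash b c (t + e) <= squash b c s'.
  by move: h; rewrite le_eqVlt => /orP[/eqP ->//|/mono/ltW].
by move: h1; lra.
Qed.

Definition cont_at_left (ph : R -> R) (a s : R) := forall u (e : R), a < u -> u <= s -> 0 < e ->
  \forall u' \near u, a < u' -> u' <= s -> `|ph u' - ph u| < e.

Lemma cont_within ph a s u : cont_at_left ph a s -> a < u -> {within `[u, s], continuous ph}.
Proof.
move=> cph au; apply/subspace_continuousP => x; rewrite /= in_itv => /andP[ux xs].
apply/cvgrPdist_lt => e e0; rewrite near_withinE.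
apply: filterS (cph x e (lt_le_trans au ux) xs e0) => u' h; rewrite /= in_itv => /andP[h1 h2].
by rewrite distrC; apply: h => //; exact: lt_le_trans au h1.
Qed.

(** The parameters [ph u] go to minus infinity as u decreases to [a]: if they had a finite infimum
    c, the points [al a] and [be c] could not be separated, and [al a] would lie on [be]. *)
Lemma left_end_inc al be ph a s : continuous al -> continuous be -> a < s ->
  ~ range be (al a) -> (forall u, a < u -> u <= s -> be (ph u) = al u) -> cont_at_left ph a s ->
  (forall u u', a < u -> u < u' -> u' <= s -> ph u < ph u') -> onto_left al be a s (ph s) true.
Proof.
move=> ca cb as_ na phE cph inc; split; last first.
  move=> u au us; exists (ph u); last by rewrite phE.
  by move: us; rewrite le_eqVlt => /orP[/eqP ->//|us]; apply: ltW; exact: inc.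
move=> t' t's; have [u [au us ut]] : exists u, [/\ a < u, u <= s & ph u <= t'].
  apply: contrapT => no; have lb u : a < u -> u <= s -> t' < ph u.
    by move=> au us; rewrite ltNge; apply/negP => h; apply: no; exists u.
  pose B := [set ph u | u in [set u | a < u /\ u <= s]].
  have Bs : B (ph s) by exists s.
  have lB : has_lbound B by exists t' => _ [u [au us] <-]; apply: ltW; exact: lb.
  have neq : al a != be (inf B) by apply/eqP => E; apply: na; exists (inf B).
  have [[U W] /= [Ua Wb] [oU oW UW]] : exists2 AB, (al a \in AB.1 /\ be (inf B) \in AB.2) &
      [/\ open AB.1, open AB.2 & AB.1 `&` AB.2 == set0].
    by move: hT; rewrite open_hausdorff; apply.
  have /near_R[d d0 hd] : \forall u \near a, U (al u).
    by apply: ca; apply: open_nbhs_nbhs; split=> //; exact: set_mem.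
  have /near_R[d' d'0 hd'] : \forall t \near inf B, W (be t).
    by apply: cb; apply: open_nbhs_nbhs; split=> //; exact: set_mem.
  have [_ [u [au us] <-] ub] := inf_adherent d'0 (conj (ex_intro _ _ Bs) lB).
  pose u' := Num.min u (a + d / 2).
  have h1 : a < u' by rewrite lt_min au /=; lra.
  have h2 : u' <= u by rewrite ge_min lexx.
  have h3 : u' <= a + d / 2 by rewrite ge_min lexx orbT.
  have h4 : u' <= s by exact: le_trans h2 us.
  have h5 : inf B <= ph u' by apply: ge_inf => //; exists u'.
  have h6 : ph u' <= ph u.
    by move: h2; rewrite le_eqVlt => /orP[/eqP ->//|h2]; apply: ltW; exact: inc.
  have : (U `&` W) (al u').
    split; first by apply: hd; rewrite ger0_norm; lra.
    by rewrite -phE//; apply: hd'; rewrite ger0_norm; lra.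
  by move/eqP : UW => ->.
have us' : ph u <= ph s.
  by move: us; rewrite le_eqVlt => /orP[/eqP ->//|us]; apply: ltW; exact: inc.
have [||c] := @IVT R ph u s t' us; first exact: cont_within cph au.
  by rewrite min_l// max_r// ut.
rewrite in_itv => /andP[uc cs] E; exists c; split=> //; first exact: lt_le_trans au uc.
by rewrite -E phE//; exact: lt_le_trans au uc.
Qed.

(** [a] is the last parameter before [s] at which [al] is off [be]. On ]a, s] the change of
    parameter is injective and continuous, hence monotone; reversing [be] turns a decreasing one
    into an increasing one. *)
Lemma left_end al be s t s1 : continuous al -> injective al -> (forall t, V (al t)) ->
  arc be -> al s = be t -> s1 < s -> ~ range be (al s1) ->
  exists a l, [/\ s1 <= a, a < s, ~ range be (al a) & onto_left al be a s t l].
Proof.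
move=> ca ia Va [cb ib Vb ob] st s1s n1.
pose A := [set u | u <= s /\ ~ range be (al u)].
have A1 : A s1 by split=> //; exact: ltW.
have uA : has_ubound A by exists s => u [].
have Jopen u : range be (al u) -> \forall u' \near u, range be (al u').
  move=> [t' _ E]; have N := ob t' 1 ltr01; rewrite E in N.
  have N' : \forall u' \near u, V (al u') -> exists2 s0, `|s0 - t'| < 1 & be s0 = al u' := ca u _ N.
  by apply: filterS N' => u' /(_ (Va u'))[s' _ s'E]; exists s'.
pose a := sup A.
have s1a : s1 <= a by exact: ub_le_sup.
have as_ : a <= s by apply: ge_sup; [exists s1|move=> u []].
have na : ~ range be (al a).
  move=> /Jopen/near_R[e e0 he]; have [u Au ua] := sup_adherent e0 (conj (ex_intro _ s1 A1) uA).
  have [us nu] := Au; apply: nu; apply: he; have : u <= a by exact: ub_le_sup.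
  by rewrite -/a in ua => h; rewrite ler0_norm ?subr_le0//; lra.
have {}as_ : a < s.
  by rewrite lt_neqAle as_ andbT; apply/eqP => E; apply: na; rewrite E st; exists t.
have Jin u : a < u -> u <= s -> exists t', be t' = al u.
  move=> au us; apply: contrapT => n; have : u <= a.
    by apply: ub_le_sup => //; split=> // -[t' _ h]; apply: n; exists t'.
  by rewrite leNgt au.
pose ph u : R := xget t [set t' | be t' = al u].
have phE u : a < u -> u <= s -> be (ph u) = al u.
  by move=> au us; exact: (@xgetPex _ t [set t' | be t' = al u]) (Jin u au us).
have phs : ph s = t by apply: ib; rewrite phE.
have phc : cont_at_left ph a s.
  move=> u e au us e0; have N := ob (ph u) e e0; rewrite phE// in N.
  have N' : \forall u' \near u, V (al u') -> exists2 s0, `|s0 - ph u| < e & be s0 = al u' := ca u _ N.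
  apply: filterS N' => u' /(_ (Va u'))[s' s'e E] au' us'.
  by rewrite (_ : ph u' = s')//; apply: ib; rewrite phE.
have phi_inj u u' : a < u -> u <= s -> a < u' -> u' <= s -> ph u = ph u' -> u = u'.
  by move=> ? ? ? ? E; apply: ia; rewrite -!phE// E.
have [inc|dec] : (forall u u', a < u -> u < u' -> u' <= s -> ph u < ph u') \/
                 (forall u u', a < u -> u < u' -> u' <= s -> ph u' < ph u).
  have : {within [set` `]a, s]], continuous ph}.
    apply/subspace_continuousP => x; rewrite /= in_itv => /andP[ux xs].
    apply/cvgrPdist_lt => e e0; rewrite near_withinE.
    apply: filterS (phc x e ux xs e0) => u' h; rewrite /= in_itv => /andP[h1 h2].
    by rewrite distrC; exact: h.
  move=> /itv_continuous_inj_mono[|H|H].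
  - by move=> u u'; rewrite !in_itv => /andP[? ?] /andP[? ?]; exact: phi_inj.
  - left=> u u' au uu us; apply: H => //; rewrite in_itv /= ?us ?au ?(lt_trans au)//=.
    by rewrite ?andbT; exact: le_trans (ltW uu) us.
  - right=> u u' au uu us; apply: H => //; rewrite in_itv /= ?us ?au ?(lt_trans au)//=.
    by rewrite ?andbT; exact: le_trans (ltW uu) us.
- by exists a, true; split=> //; rewrite -phs; exact: left_end_inc.
have [H1 H2] : onto_left al (be \o -%R) a s (- ph s) true.
  apply: (@left_end_inc al (be \o -%R) (fun u => - ph u)) => //.
  - by move=> x; apply: continuous_comp; [exact: opp_continuous|exact: cb].
  - by move=> [t' _ E]; apply: na; exists (- t').
  - by move=> u au us /=; rewrite opprK phE.
  - move=> u e au us e0; apply: filterS (phc u e au us e0) => u' h h1 h2.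
    by rewrite -opprD normrN; exact: h.
  - by move=> u u' au uu us; rewrite ltrN2; exact: dec.
exists a, false; split=> //; split=> [t' tt'|s' as' ss'].
  have [|s' [? ? E]] := H1 (- t'); first by rewrite lerN2 phs.
  by exists s'; split=> //; rewrite E /= opprK.
by have [t' tt' E] := H2 s' as' ss'; exists (- t') => //; rewrite lerNr -phs.
Qed.

Definition onto_right al be (b s t : R) (l : bool) :=
  (forall t', (if l then t' <= t else t <= t') -> exists s', [/\ s' < b, s <= s' & al s' = be t']) /\
  (forall s', s' < b -> s <= s' -> exists2 t', (if l then t' <= t else t <= t') & al s' = be t').

Lemma right_end al be s t s1 : arc al -> arc be -> al s = be t -> s < s1 -> ~ range be (al s1) ->
  exists b l, [/\ b <= s1, s < b, ~ range be (al b) & onto_right al be b s t l].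
Proof.
move=> aal abe st ss1 n1; have [ca ia Va _] := arc_rev aal.
have [a [l [h1 h2 h3 [h4 h5]]]] : exists a l,
    [/\ - s1 <= a, a < - s, ~ range be ((al \o -%R) a) & onto_left (al \o -%R) be a (- s) t l].
  by apply: left_end; [exact: ca|exact: ia|exact: Va|exact: abe|rewrite /= opprK|rewrite ltrN2|rewrite /= opprK].
exists (- a), l; split=> //; [by rewrite lerNl|by rewrite ltrNr|split].
  move=> t' /h4[s' [? ? E]]; exists (- s'); split=> //; [by rewrite ltrN2|by rewrite lerNr].
move=> s' sb ss; have [||t' tt' E] := h5 (- s'); [by rewrite ltrNr|by rewrite lerN2|].
by exists t' => //; rewrite -E /= opprK.
Qed.

Context (cV : connected V).

Lemma arc_near al t : arc al -> \forall y \near al t, V y -> range al y.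
Proof.
move=> [_ _ _ oa]; apply: filterS (oa t 1 ltr01) => y H /H[s _ <-]; by exists s.
Qed.

(* Two overlapping ends at both sides would close up to a compact subset that
   is open in [V]. *)
Lemma no_circle al be a b s0 s1 t0 t1 x : V x -> ~ range al x -> ~ range be x ->
  arc al -> arc be -> s1 < s0 -> a < s0 -> s1 < b -> b <= a -> al s0 = be t0 -> al s1 = be t1 ->
  (forall t, t <= t0 -> exists s, [/\ a < s, s <= s0 & al s = be t]) ->
  (forall t, t1 <= t -> exists s, [/\ s < b, s1 <= s & al s = be t]) -> False.
Proof.
move=> Vx nax nbx aal abe s10 as0 s1b ba E0 E1 H0 H1; have [ca ia Va oa] := aal; have [cb ib Vb ob] := abe.
pose K := (al @` `[s1, s0]) `|` (be @` `[t0, t1]).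
have cK : compact K.
  by apply: compactU; (apply: continuous_compact; [exact: continuous_subspaceT|exact: segment_compact]).
have bK t : K (be t).
  have [h|h] := leP t t0.
    by have [s [? ? <-]] := H0 t h; left; exists s => //=; rewrite in_itv /=; lra.
  have [h'|h'] := leP t1 t.
    by have [s [? ? <-]] := H1 t h'; left; exists s => //=; rewrite in_itv /=; lra.
  by right; exists t => //=; rewrite in_itv /= !ltW.
have bN t : \forall y \near be t, V y -> K y.
  by apply: filterS (arc_near t abe) => y H /H[t' _ <-].
have Kopen y : K y -> \forall z \near y, V z -> K z.
  move=> [[s /=]|[t _ <-]]; last exact: bN.
  rewrite in_itv /= => /andP[h1 h2] <-.
  have [->|n1] := eqVneq s s1; first by rewrite E1; exact: bN.
  have [->|n0] := eqVneq s s0; first by rewrite E0; exact: bN.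
  pose e := Num.min (s - s1) (s0 - s).
  have e0 : 0 < e by rewrite lt_min !subr_gt0 !lt_neqAle h1 h2 n0 eq_sym n1.
  apply: filterS (oa s e e0) => z H /H[s' + <-]; rewrite lt_min !ltr_distl => /andP[/andP[h3 _] /andP[_ h4]].
  by left; exists s' => //=; rewrite in_itv /=; lra.
have KV y : K y -> V y by move=> [[s _ <-]|[t _ <-]].
have clK : closed K by exact: compact_closed.
have : K x.
  apply: (@connected_near_ind _ V K (al s1) x cV) => //.
    by left; exists s1 => //=; rewrite in_itv /= lexx ltW.
  move=> y Vy; have [Ky|nK] := pselect (K y).
    by apply: filterS (Kopen y Ky) => z H Vz; split=> // _; exact: H.
  have : \forall z \near y, ~ K z by apply: open_nbhs_nbhs; split=> //; exact: closed_openC.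
  by apply: filterS => z nz _; split.
by move=> [[s _ E]|[t _ E]]; [apply: nax|apply: nbx]; [exists s|exists t].
Qed.

(** The new arc follows [al] up to [s0] and then [be] from [t0]. What it drops is not lost: [al]
    after [s0] lies on [be], and [be] before [t0] lies on [al]. *)
Lemma arc_join al be s0 t0 a : arc al -> arc be -> al s0 = be t0 -> a < s0 ->
  (forall s, s <= a -> ~ range be (al s)) -> (forall s, a < s -> range be (al s)) ->
  (forall t, t <= t0 -> exists s, [/\ a < s, s <= s0 & al s = be t]) ->
  (forall s, a < s -> s <= s0 -> exists2 t, t <= t0 & al s = be t) ->
  exists ga, arc ga /\ range ga = range al `|` range be.
Proof.
move=> aal abe E0 as0 Jn Jy H1 H2; have [ca ia Va oa] := aal; have [cb ib Vb ob] := abe.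
pose ga s := if s <= s0 then al s else be (t0 + (s - s0)).
have gaL s : s <= s0 -> ga s = al s by rewrite /ga => ->.
have gaR s : s0 <= s -> ga s = be (t0 + (s - s0)).
  rewrite le_eqVlt => /orP[/eqP <-|h]; first by rewrite gaL// subrr addr0.
  by rewrite /ga leNgt h.
have cross s t : s <= s0 -> t0 <= t -> al s = be t -> s = s0 /\ t = t0.
  move=> ss tt E; have [sa|sa] := leP s a; first by case: (Jn s sa); exists t.
  have [t' tt' E'] := H2 s sa ss; have tE : t = t' by apply: ib; rewrite -E.
  have tt0 : t = t0 by apply/eqP; rewrite eq_le tt andbT tE.
  by split=> //; apply: ia; rewrite E tt0.
have cbs s : {for s, continuous (fun s => be (t0 + (s - s0)))}.
  apply: continuous_comp; last exact: cb.
  by apply: cvgD; [exact: cvg_cst|apply: cvgB; [exact: cvg_id|exact: cvg_cst]].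
exists ga; split; first split.
- move=> s W gW; have [ss|ss|ss] := ltgtP s s0.
  + rewrite gaL ?ltW// in gW; have /near_R[e e0 he] : \forall s' \near s, s' < s0.
      by apply: open_nbhs_nbhs; split=> //; exact: open_lt.
    have N : \forall s' \near s, W (al s') := ca s _ gW.
    have N2 : \forall s' \near s, s' < s0 by apply: open_nbhs_nbhs; split=> //; exact: open_lt.
    by apply: filterS2 N N2 => s' Ws' h /=; rewrite gaL// ltW.
  + rewrite gaR ?ltW// in gW; have N : \forall s' \near s, W (be (t0 + (s' - s0))) := cbs s _ gW.
    have N2 : \forall s' \near s, s0 < s' by apply: open_nbhs_nbhs; split=> //; exact: open_gt.
    by apply: filterS2 N N2 => s' Ws' h /=; rewrite gaR// ltW.
  + have gWR := gW; rewrite gaR ?ss// in gWR; rewrite gaL ?ss// in gW.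
    have N : \forall s' \near s, W (al s') by rewrite ss; exact: ca s0 _ gW.
    have N2 : \forall s' \near s, W (be (t0 + (s' - s0))) by apply: cbs; rewrite ss.
    apply: filterS2 N N2 => s' h1 h2 /=; have [h|h] := leP s' s0; first by rewrite gaL.
    by rewrite gaR// ltW.
- move=> s s'; have [h|h] := leP s s0; have [h'|h'] := leP s' s0.
  + by rewrite !gaL// => /ia.
  + rewrite gaL// gaR ?ltW// => E; have [|-> E'] := cross _ _ h _ E; first by lra.
    by lra.
  + rewrite gaR ?ltW// gaL// => /esym E; have [|-> E'] := cross _ _ h' _ E; first by lra.
    by lra.
  + by rewrite !gaR ?ltW// => /ib; lra.
- by move=> s; rewrite /ga; case: ifP.
- move=> s e e0; have [ss|ss|ss] := ltgtP s s0.
  + rewrite gaL ?ltW//; pose e' := Num.min e (s0 - s).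
    have e'0 : 0 < e' by rewrite lt_min e0 subr_gt0.
    apply: filterS (oa s e' e'0) => y H /H[s' + <-]; rewrite lt_min => /andP[h1 h2].
    exists s' => //; rewrite gaL//; move: h2; rewrite ltr_distl; lra.
  + rewrite gaR ?ltW//; pose e' := Num.min e (s - s0).
    have e'0 : 0 < e' by rewrite lt_min e0 subr_gt0.
    apply: filterS (ob (t0 + (s - s0)) e' e'0) => y H /H[t' + <-]; rewrite lt_min => /andP[h1 h2].
    exists (t' - t0 + s0); first by rewrite (_ : _ - s = t' - (t0 + (s - s0)))//; ring.
    rewrite gaR; first by congr be; ring.
    by move: h2; rewrite ltr_distl; lra.
  + rewrite gaL ?ss//; have N2 := ob t0 e e0; rewrite -E0 in N2.
    apply: filterS2 (oa s0 e e0) N2 => y H H' Vy; have [s' s'e E] := H Vy; have [t' t'e E'] := H' Vy.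
    have [h|h] := leP s' s0; first by exists s' => //; rewrite gaL.
    have tt : t0 < t'.
      rewrite ltNge; apply/negP => /H1[s'' [_ h2 h3]].
      have q : s' = s'' by apply: ia; rewrite E -E' h3.
      by move: h; rewrite q ltNge h2.
    exists (t' - t0 + s0); first by rewrite (_ : _ - s0 = t' - t0)//; ring.
    by rewrite gaR; [rewrite -E'; congr be; ring|lra].
apply/seteqP; split=> y.
  by move=> [s _ <-]; rewrite /ga; case: ifP => _; [left; exists s|right; exists (t0 + (s - s0))].
have bR t : t0 <= t -> range ga (be t).
  by move=> h; exists (t - t0 + s0) => //; rewrite gaR; [congr be; ring|lra].
move=> [[s _ <-]|[t _ <-]].
  have [h|h] := leP s s0; first by exists s => //; rewrite gaL.
  have [|t _ E] := Jy s; first exact: lt_trans as0 h.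
  rewrite -E; apply: bR; rewrite leNgt; apply/negP => /ltW /H1[s' [_ h2 h3]].
  have q : s = s' by apply: ia; rewrite -E.
  by move: h; rewrite q ltNge h2.
have [/H1[s [_ h2 <-]]|h] := leP t t0; first by exists s => //; rewrite gaL.
by apply: bR; exact: ltW.
Qed.

(** After reversing [be] if necessary, ]a, s0] carries the lower half of [be]. A contact with [be]
    before [a] would cover this half twice or close up a circle. If [al] left [be] after [s0], it
    would cover the lower half twice or contain all of [be]. So [arc_join] applies. *)
Lemma arc_glue_left al be x s0 t0 s1 : V x -> ~ range al x -> ~ range be x ->
  arc al -> arc be -> al s0 = be t0 -> s1 < s0 -> ~ range be (al s1) -> ~ range be `<=` range al ->
  exists ga, arc ga /\ range ga = range al `|` range be.
Proof.
move=> Vx nax; move: be t0.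
suff main be t0 : ~ range be x -> arc be -> al s0 = be t0 -> ~ range be `<=` range al -> arc al ->
    forall a, a < s0 -> ~ range be (al a) -> onto_left al be a s0 t0 true ->
    exists ga, arc ga /\ range ga = range al `|` range be.
  move=> be t0 nbx aal abe E0 s10 n1 nba; have [ca ia Va _] := aal.
  have [a [l [h1 h2 h3 h4]]] := left_end ca ia Va abe E0 s10 n1.
  case: l h4 => h4; first exact: (main be t0 nbx abe E0 nba aal a).
  have rr y : range (be \o -%R) y -> range be y by move=> [t _ <-]; exists (- t).
  have nbx' : ~ range (be \o -%R) x by move=> /rr.
  have E0' : al s0 = (be \o -%R) (- t0) by rewrite /= opprK.
  have nba' : ~ (range (be \o -%R) `<=` range al) by move=> h; apply: nba => y /range_rev; exact: h.
  have na' : ~ range (be \o -%R) (al a) by move=> /rr.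
  have H' : onto_left al (be \o -%R) a s0 (- t0) true.
    have [h5 h6] := h4; split=> [t' tt|s' as' ss].
      by have [|s' ?] := h5 (- t'); [rewrite lerNr|exists s'].
    by have [t' tt' E] := h6 s' as' ss; exists (- t'); rewrite /= ?opprK// lerN2.
  have [ga [aga E]] := main (be \o -%R) (- t0) nbx' (arc_rev abe) E0' nba' aal a h2 na' H'.
  exists ga; split=> //; rewrite E; congr (_ `|` _).
  by apply/seteqP; split=> y; [exact: rr|exact: range_rev].
move=> nbx abe E0 nba aal a as0 na [H1 H2]; have [_ ia _ _] := aal.
have Jlow s : s < a -> ~ range be (al s).
  move=> sa [t _ E]; have sE : al s = be t by [].
  have [b [l [h1 h2 h3 [H3 H4]]]] := right_end aal abe sE sa na.
  case: l H3 H4 => H3 H4.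
    pose t' := Num.min t t0 - 1.
    have m1 : Num.min t t0 <= t by rewrite ge_min lexx.
    have m2 : Num.min t t0 <= t0 by rewrite ge_min lexx orbT.
    have [|s' [as1 _ E1]] := H1 t'; first by rewrite /t'; lra.
    have [|s'' [sb2 _ E2]] := H3 t'; first by rewrite /t'; lra.
    have q : s' = s'' by apply: ia; rewrite E1.
    by move: (lt_le_trans (lt_le_trans sb2 h1) (ltW as1)); rewrite q ltxx.
  apply: (@no_circle al be a b s0 s t0 t x) => //; lra.
have Jn s : s <= a -> ~ range be (al s).
  by rewrite le_eqVlt => /orP[/eqP ->//|]; exact: Jlow.
have Jy s : a < s -> range be (al s).
  move=> sa; have [h|h] := leP s s0; first by have [t _ ->] := H2 s sa h; exists t.
  apply: contrapT => n; have [b [l [h1 h2 h3 [H3 H4]]]] := right_end aal abe E0 h n.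
  case: l H3 H4 => H3 H4.
    have [|s' [_ ss1 E1]] := H1 (t0 - 1); first by lra.
    have [|s'' [_ ss2 E2]] := H3 (t0 - 1); first by lra.
    have q : s' = s'' by apply: ia; rewrite E1.
    have e1 : s' = s0 by apply/eqP; rewrite eq_le ss1 q ss2.
    by move: E1; rewrite e1 E0; have [_ ib _ _] := abe => /ib; lra.
  apply: nba => _ [t _ <-]; have [/H1[s' [_ _ <-]]|/ltW/H3[s' [_ _ <-]]] := leP t t0; by exists s'.
exact: (arc_join aal abe E0 as0).
Qed.

(** Two overlapping arcs might close up to a circle; the point [x] of the connected [V] off both of
    them excludes this. *)
Lemma arc_glue al be x s0 t0 : V x -> ~ range al x -> ~ range be x ->
  arc al -> arc be -> al s0 = be t0 ->
  exists ga, arc ga /\ range ga = range al `|` range be.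
Proof.
move=> Vx nax nbx aal abe E0.
have [ab|ab] := pselect (range al `<=` range be).
  by exists be; split=> //; apply/esym/setUidPr.
have [ba|ba] := pselect (range be `<=` range al).
  by exists al; split=> //; apply/esym/setUidPl.
have [s1 n1] : exists s1, ~ range be (al s1).
  by apply: contrapT => no; apply: ab => _ [s _ <-]; apply: contrapT => h; apply: no; exists s.
have [h|h|h] := ltgtP s1 s0; last by case: n1; rewrite h E0; exists t0.
  exact: (arc_glue_left Vx nax nbx aal abe E0 h).
have rr y : range (al \o -%R) y -> range al y by move=> [t _ <-]; exists (- t).
have nax' : ~ range (al \o -%R) x by move=> /rr.
have E0' : (al \o -%R) (- s0) = be t0 by rewrite /= opprK.
have h' : - s1 < - s0 by rewrite ltrN2.
have n1' : ~ range be ((al \o -%R) (- s1)) by rewrite /= opprK.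
have ba' : ~ (range be `<=` range (al \o -%R)) by move=> H; apply: ba => y /H /rr.
have [ga [aga E]] := arc_glue_left Vx nax' nbx (arc_rev aal) abe E0' h' n1' ba'.
exists ga; split=> //; rewrite E; congr (_ `|` _).
by apply/seteqP; split=> y; [exact: rr|exact: range_rev].
Qed.

End Arcs.
Lemma dmap_inj (R : realType) (F : 'rV[R]_2 -> 'rV[R]_2) p u : smooth_at p F -> jac F p != 0 ->
  dmap F p u = 0 -> u = 0.
Proof.
move=> /smooth_at_pt[/gradP[a [b gX]] /gradP[c [d gY]]].
rewrite /jac !gX !gY !cE !mul0r !mul1r !addr0 !add0r => J E.
have EX : cX u * a + cY u * b = 0 by rewrite -gX -[LHS](cX_mk _ ('D_u (cY \o F) p)) -/(dmap F p u) E cE.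
have EY : cX u * c + cY u * d = 0 by rewrite -gY -[LHS](cY_mk ('D_u (cX \o F) p)) -/(dmap F p u) E cE.
apply: ptP; rewrite !cE; apply: (mulIf J); rewrite mul0r.
  transitivity ((cX u * a + cY u * b) * d - (cX u * c + cY u * d) * b); first by ring.
  by rewrite EX EY !mul0r subr0.
transitivity ((cX u * c + cY u * d) * a - (cX u * a + cY u * b) * c); first by ring.
by rewrite EX EY !mul0r subr0.
Qed.

(** * Rays at a vertex and parametrization of the edges *)

Section Edges.
Context {R : realType} {M : compact_surface R} {f : M -> R} (hf : classF f).
Local Notation pt := 'rV[R]_2.
Notation "x ~~ y" := (level_component f x y) (at level 70).
Implicit Types (x y z : M) (p q u w : pt) (h k : M -> M).
Context {v : reeb f} (hv : vertex v).
Let V := component v.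
Let E := V `\` critical f.

Section Box.
Context (x : M) (m : M -> pt) (j : pt -> M) (r : R) (Vx : V x) (D : disk m j r) (j0 : j 0 = x).
Context (fj : forall p : pt, `|p| < r -> f (j p) = f x + cY p).

Lemma box_level p : `|p| < r -> V (j p) <-> cY p = 0.
Proof.
move=> pr; have n0 : `|0 : pt| < r by rewrite normr0; exact: disk_gt0 D.
split=> [Vj|Y0].
  by have := comp_f Vj Vx; rewrite fj// => /eqP; rewrite -subr_eq0 addrAC subrr add0r => /eqP.
by apply/(compP _ Vx); rewrite -j0; apply: (disk_level_path D fj) => //; rewrite cE Y0.
Qed.

Lemma box_regular p : `|p| < r -> ~ critical f (j p).
Proof.
move=> pr /(disk_critical D (classF_smooth hf) pr)/(_ e1) /eqP; apply/negP.
have N : \forall q \near p, (f \o j) q = (cst (f x) \+ @cY R) q.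
  by apply: filterS (near_norm_lt pr) => q /fj /= ->.
rewrite (eq_near_derive e1 N) deriveD; last 2 first.
- exact: derivable_cst.
- by apply: diff_derivable; apply: smooth_at_diff; exact: smooth_Y.
by rewrite derive_cst add0r derive_Y !cE oner_neq0.
Qed.

Lemma box_arc : let al := (fun s => j (mk s 0)) \o squash (- r) r in
  arc V al /\ forall y, range al y <-> region j r y /\ V y.
Proof.
have rr := disk_gt0 D; have mr (t : R) : - r < t < r -> `|mk t 0 : pt| < r.
  by move=> h; apply/norm_ltP; rewrite !cE normr0 ltr_norml.
have [||||| aal rg] := @interval_arc R M V (fun s => j (mk s 0)) (- r) r.
- by rewrite gtrN.
- move=> t /mr h; apply: continuous_comp; last exact: (disk_j_continuous D h).
  by apply: mk_continuous; [exact: cvg_id|exact: cvg_cst].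
- move=> s t /mr hs /mr ht /(congr1 m); rewrite !(disk_mK D)// => /(congr1 cX).
  by rewrite !cE.
- by move=> t /mr h; apply/box_level => //; rewrite cE.
- move=> t e /mr h e0.
  have N : \forall q \near (mk t 0 : pt), `|q - mk t 0| < e.
    by apply/near_norm; exists e.
  apply: filterS (disk_near D h N) => y [Ry ye] Vy; have [jy yr] := disk_jm D Ry.
  have Y0 : cY (m y) = 0 by apply/box_level => //; rewrite jy.
  exists (cX (m y)); split.
  + by have /norm_ltP[+ _] := yr; rewrite ltr_norml.
  + by have /norm_ltP[+ _] := ye; rewrite !cE.
  + by rewrite -[in RHS]jy; congr j; rewrite -[RHS]mkK Y0.
split=> // y; rewrite rg; split=> [[t /mr h <-]|[Ry Vy]].
  by split; [exists (mk t 0)|apply/box_level => //; rewrite cE].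
have [jy yr] := disk_jm D Ry; exists (cX (m y)).
  by have /norm_ltP[+ _] := yr; rewrite ltr_norml.
have Y0 : cY (m y) = 0 by apply/box_level => //; rewrite jy.
by rewrite -[in RHS]jy; congr j; rewrite -[RHS]mkK Y0.
Qed.

End Box.

(** Up to a factor w = u + s u' with u' the quarter turn of [u]. As the derivative of [P] at [u]
    along u' is not 0, P(u + s u') is of order s, and P w = 0 forces s = 0. *)
Lemma zero_isolated n P u : homogeneous n.+2 P -> no_multiple_linear_factor P -> u != 0 -> P u = 0 ->
  \forall w \near u, P w = 0 -> exists c : R, w = c *: u.
Proof.
move=> hP nP u0 Pu; have N0 := norm2_gt0 u0; set N := _ + _ in N0.
pose u' := mk (- cY u) (cX u).
have ind : independent u u' by rewrite /independent !cE mulrN opprK gt_eqF.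
have g := zero_gradient hP nP u0 Pu ind.
have gp : 0 < `|'D_u' P u| by rewrite normr_gt0.
have u'1 : 0 < 2 * (`|u'| + 1) by rewrite mulr_gt0// ltr_wpDl.
have ep : 0 < `|'D_u' P u| / (2 * (`|u'| + 1)) by exact: divr_gt0.
have [r r0 hr] := strict_diff (hom_smooth u hP) ep.
pose a w := (cX w * cX u + cY w * cY u) / N; pose b w := (cY w * cX u - cX w * cY u) / N.
have wE w : w = a w *: u + b w *: u'.
  by apply: ptP; rewrite /a /b !cE /N; field; rewrite -/N gt_eqF.
have ca : {for u, continuous a}.
  apply: smooth_at_continuous; rewrite (_ : a = lin2 (cX u / N) (cY u / N)); first exact: smooth_lin2.
  by apply/funext => w; rewrite /a /lin2; ring.
have cb : {for u, continuous b}.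
  apply: smooth_at_continuous; rewrite (_ : b = lin2 (- cY u / N) (cX u / N)); first exact: smooth_lin2.
  by apply/funext => w; rewrite /b /lin2; ring.
have au : a u = 1 by rewrite /a divff// gt_eqF.
have bu : b u = 0 by rewrite /b [cY u * _]mulrC subrr mul0r.
have cba : {for u, continuous (fun w => b w / a w)}.
  by apply: cvgM cb _; apply: cvgV => //; rewrite au oner_neq0.
have dl : 0 < r / (`|u'| + 1) by rewrite divr_gt0// ltr_wpDl.
have N1 : \forall w \near u, a w != 0 by move/cvgr_neq0 : ca; apply; rewrite au oner_neq0.
have N2 : \forall w \near u, `|b w / a w| < r / (`|u'| + 1).
  move/cvgr_distC_lt : cba => /(_ _ dl); rewrite bu mul0r.
  by apply: filterS => w; rewrite subr0.
apply: filterS2 N1 N2 => w aw bw Pw; exists (a w); rewrite [LHS]wE.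
suff -> : b w = 0 by rewrite scale0r addr0.
set s := b w / a w in bw; suff s0 : s = 0 by rewrite -[b w](divfK aw) -/s s0 mul0r.
have sr : `|u + s *: u' - u| < r.
  rewrite addrAC subrr add0r normrZ; apply: le_lt_trans (_ : `|s| * (`|u'| + 1) < r).
    by rewrite ler_wpM2l// lerDl.
  by move: bw; rewrite ltr_pdivlMr// ltr_wpDl.
have := hr _ u sr; rewrite subrr normr0 => /(_ r0); rewrite Pu subr0.
have -> : P (u + s *: u') = 0.
  have -> : u + s *: u' = (a w)^-1 *: w.
    by rewrite {2}[w]wE scalerDr !scalerA mulVf// scale1r /s mulrC.
  by rewrite (hom_scale _ _ hP) Pw mulr0.
rewrite sub0r normrN addrAC subrr add0r; clearbody s.
have -> : lin2 ('D_e0 P u) ('D_e1 P u) (s *: u') = s * 'D_u' P u.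
  by have [x' [y' G]] := gradP (hom_smooth u hP); rewrite !G /lin2 !cE; ring.
rewrite normrM normrZ; have : `|u'| / (2 * (`|u'| + 1)) < 1.
  by rewrite ltr_pdivrMr//; have := normr_ge0 u'; lra.
have [//|s0] := eqVneq s 0; have sp : 0 < `|s| by rewrite normr_gt0.
move: gp sp; move: `|u'| `|'D_u' P u| `|s| => U G S G0 S0 UI.
rewrite (_ : _ * (S * U) = S * G * (U / (2 * (U + 1)))); last by move: (_^-1) => I; ring.
rewrite -[X in X <= _]mulr1 ler_pM2l ?mulr_gt0// => h; exfalso; lra.
Qed.

Section Rays.
Context (x : M) (m : M -> pt) (j : pt -> M) (r : R) (n : nat) (P : pt -> R) (Vx : V x) (cx : critical f x).
Context (D : disk m j r) (j0 : j 0 = x) (hP : homogeneous n.+2 P).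
Context (nP : no_multiple_linear_factor P) (fP : forall p : pt, `|p| < r -> f (j p) = f x + P p).

Lemma vertex_V p : `|p| < r -> V (j p) <-> P p = 0.
Proof.
move=> pr; split=> [Vj|Pp]; first exact: (vertex_level fP pr).1 (comp_f Vj Vx).
by apply/(compP _ Vx); exact: (vertex_cone D j0 hP fP pr Pp).
Qed.

Lemma vertex_E p : `|p| < r -> E (j p) <-> P p = 0 /\ p != 0.
Proof.
move=> pr; split=> [[Vj nc]|[Pp p0]].
  split; first by apply/vertex_V.
  by apply/eqP => p0; apply: nc; rewrite p0 j0.
by split; [apply/vertex_V|exact: (vertex_regular hf D hP nP fP pr p0 Pp)].
Qed.

Lemma ray_arc u : `|u| = 1 -> P u = 0 -> let al := (fun s => j (s *: u)) \o squash 0 r in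
  arc V al /\ forall y, range al y <-> exists2 s, 0 < s < r & j (s *: u) = y.
Proof.
move=> u1 Pu /=; have rr := disk_gt0 D.
have u0 : u != 0 by rewrite -normr_gt0 u1.
have ur (s : R) : 0 < s < r -> `|s *: u| < r by move=> /andP[s0 sr]; rewrite normrZ u1 mulr1 gtr0_norm.
apply: interval_arc => //.
- move=> t /ur h; apply: continuous_comp; last exact: (disk_j_continuous D h).
  by apply: cvgZr_tmp; exact: cvg_id.
- move=> s t /ur hs /ur ht /(congr1 m); rewrite !(disk_mK D)// => /eqP.
  by rewrite -subr_eq0 -scalerBl scaler_eq0 (negbTE u0) orbF subr_eq0 => /eqP.
- by move=> t /ur h; apply/vertex_V => //; rewrite (hom_scale _ _ hP) Pu mulr0.
move=> t e tr e0; have h := ur t tr; have /andP[t0 _] := tr.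
have Z := zero_isolated hP nP u0 Pu.
have Z' : \forall q \near t *: u, P q = 0 -> exists c : R, q = c *: u.
  have ct : {for t *: u, continuous (fun q : pt => t^-1 *: q)}.
    by apply: smooth_at_continuous; exact: smooth_scale.
  have Z2 : \forall w \near t^-1 *: (t *: u), P w = 0 -> exists c : R, w = c *: u.
    by rewrite scalerA mulVf ?gt_eqF// scale1r.
  have Z3 : \forall q \near t *: u, P (t^-1 *: q) = 0 -> exists c : R, t^-1 *: q = c *: u := ct _ Z2.
  apply: filterS Z3 => q + Pq; rewrite (hom_scale _ _ hP) Pq mulr0 => /(_ erefl)[c E'].
  by exists (t * c); rewrite -scalerA -E' scalerA divff ?gt_eqF// scale1r.
have N : \forall q \near t *: u, `|q - t *: u| < Num.min e t.
  by apply/near_norm; exists (Num.min e t) => //; rewrite lt_min e0.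
apply: filterS (disk_near D h (filterI Z' N)) => y [Ry [yc]] + Vy.
have [jy yr] := disk_jm D Ry.
have [|c yE] := yc; first by apply/vertex_V => //; rewrite jy.
rewrite yE -scalerBl normrZ u1 mulr1 lt_min => /andP[ce ct]; exists c; split=> //.
  move: yr; rewrite yE normrZ u1 mulr1 => cr; have c0 : 0 < c by move: ct; rewrite ltr_distl; lra.
  by rewrite c0; apply: le_lt_trans cr; exact: ler_norm.
by rewrite -yE.
Qed.

End Rays.

Definition arc_cover (S : set M) := exists (n : nat) (A : nat -> R -> M),
  (forall i, (i < n)%N -> arc V (A i) /\ range (A i) `<=` E) /\
  forall y, S y -> exists2 i, (i < n)%N & range (A i) y.

Lemma arc_coverU (S S' : set M) : arc_cover S -> arc_cover S' -> arc_cover (S `|` S').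
Proof.
move=> [n [A [hA cA]]] [n' [A' [hA' cA']]].
exists (n + n')%N, (fun i => if (i < n)%N then A i else A' (i - n)%N); split=> [i h|y [/cA|/cA'] [i h iy]].
- by case: ltnP => hi; [exact: hA|apply: hA'; rewrite ltn_subLR// -ltnS].
- by exists i; [exact: ltn_addr|rewrite h].
- by exists (n + i)%N; [rewrite ltn_add2l|rewrite ltnNge leq_addr/= addKn].
Qed.

Lemma arc_coverS (S S' : set M) : S `<=` S' -> arc_cover S' -> arc_cover S.
Proof. by move=> SS [n [A [hA cA]]]; exists n, A; split=> // y /SS /cA. Qed.

Lemma arc_cover1 (S : set M) (al : R -> M) : arc V al -> range al `<=` E -> S `<=` range al -> arc_cover S.
Proof. by move=> aal alE Sal; exists 1%N, (fun=> al); split=> // y /Sal aly; exists 0%N. Qed.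

(** By compactness of [V]. A box at a regular point contributes one arc. At a vertex the zero
    directions of norm 1 are isolated by [zero_isolated], so compactness of the unit ball leaves
    finitely many rays. *)
Lemma arc_coverE : arc_cover E.
Proof.
have [x0 cx0 Vx0] := comp_critical hv.
have c0 : arc_cover set0 by exists 0%N, (fun _ _ => x0); split.
suff : arc_cover (V `&` E) by apply: arc_coverS => y Ey; split=> //; case: Ey.
apply: (@compact_ind _ V (fun S => arc_cover (S `&` E)) (compact_M (comp_closed hf hv))).
- by rewrite set0I.
- by move=> B C hB hC; rewrite setIUl; exact: arc_coverU.
- by move=> B C BC; apply: arc_coverS; exact: setSI.
move=> x Vx; have [cx|rx] := pselect (critical f x); last first.
  have [m [j [r [D j0 fj]]]] := regular_disk hf (comp_inner hf hv Vx) rx.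
  have n0 : `|0 : pt| < r by rewrite normr0; exact: disk_gt0 D.
  have R0 := region_near D (disk_region j n0); rewrite j0 in R0; exists (region j r) => //.
  have [aal rg] := box_arc Vx D j0 fj; apply: (arc_cover1 aal).
    move=> y /rg[[p pr <-] Vy]; split=> //; exact: (box_regular D fj pr).
  by move=> y [Ry [Vy _]]; apply/rg.
have [m [j [r [n [P [D j0 hP nP fP]]]]]] := vertex_disk hf cx.
have n0 : `|0 : pt| < r by rewrite normr0; exact: disk_gt0 D.
have R0 := region_near D (disk_region j n0); rewrite j0 in R0; exists (region j r) => //.
pose ray (B : set pt) := [set y | exists u s, [/\ B u, `|u| = 1, P u = 0 & 0 < s < r /\ j (s *: u) = y]].
have rays : arc_cover (ray [set u | `|u| <= 1]).
  have H := @compact_ind pt _ (fun B : set pt => arc_cover (ray B)) (@ball_compact R 1); apply: H.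
  - by apply: arc_coverS c0 => y [u [s []]].
  - move=> B C hB hC; apply: arc_coverS (arc_coverU hB hC) => y [u [s [[Bu|Cu] h1 h2 h3]]].
      by left; exists u, s.
    by right; exists u, s.
  - by move=> B C BC; apply: arc_coverS => y [u [s [/BC Cu h1 h2 h3]]]; exists u, s.
  move=> u _; have [[u1 Pu]|nu] := pselect (`|u| = 1 /\ P u = 0); last first.
    have : \forall w \near u, `|w| <> 1 \/ P w <> 0.
      have [u1|u1] := eqVneq `|u| 1.
        have Pu : P u != 0 by apply/eqP => Pu; apply: nu.
        have := smooth_at_continuous (hom_smooth u hP); move/cvgr_neq0 => /(_ Pu).
        by apply: filterS => w /eqP; right.
      have N1 : \forall w \near u, `|w| != 1.
        have /nbhs_normP[d d0 hd] : \forall t \near `|u|, t != 1.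
          by apply: open_nbhs_nbhs; split=> //; exact: open_neq.
        apply/near_norm; exists d => // w wd; apply: hd; rewrite /ball_ /=.
        by apply: le_lt_trans (ler_dist_dist _ _) _; rewrite distrC.
      by apply: filterS N1 => w /eqP; left.
    move=> N; eexists; first exact: N.
    by apply: arc_coverS c0 => y [w [s [[]]]].
  have u0 : u != 0 by rewrite -normr_gt0 u1.
  have Z := zero_isolated hP nP u0 Pu.
  have N : \forall w \near u, `|w - u| < 1 by apply/near_norm; exists 1.
  have [aal rg] := ray_arc Vx D j0 hP nP fP u1 Pu.
  eexists; first exact: filterI Z N.
  apply: (arc_cover1 aal) => y.
    move=> /rg[s sr <-]; have sr' : `|s *: u| < r.
      by move: sr => /andP[s0 sr]; rewrite normrZ u1 mulr1 gtr0_norm.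
    apply/(vertex_E Vx cx D j0 hP nP fP sr').
    rewrite (hom_scale _ _ hP) Pu mulr0 scaler_eq0 negb_or u0 andbT; split=> //.
    by move: sr => /andP[s0 _]; rewrite gt_eqF.
  move=> [w [s [[Zw wu] w1 Pw [sr <-]]]]; apply/rg; exists s => //.
  have [c wc] := Zw Pw; have c1 : c = 1.
    have wcu : w - u = (c - 1) *: u by rewrite scalerBl scale1r wc.
    move: w1 wu; rewrite wcu wc !normrZ u1 !mulr1 => c1 c2.
    have [c0'|c0'] := leP 0 c; first by rewrite -c1 ger0_norm.
    by move: c1 c2; rewrite !ltr0_norm//; lra.
  by rewrite wc c1 scale1r.
apply: arc_coverS rays => _ [[p pr <-] Ejp].
have [Pp p0] := (vertex_E Vx cx D j0 hP nP fP pr).1 Ejp.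
have pp : 0 < `|p| by rewrite normr_gt0.
have E1 : `| `|p|^-1 *: p| = 1 by rewrite normrZ normfV normr_id mulVf ?gt_eqF.
exists (`|p|^-1 *: p), `|p|; split=> //=; first by rewrite E1.
  by rewrite (hom_scale _ _ hP) Pp mulr0.
by rewrite pp scalerA divff ?gt_eqF// scale1r.
Qed.

Lemma edge_nonempty e : Xi1 v e -> exists y, e y.
Proof. by move=> [y Ey ->]; exists y; exact: connected_component_refl. Qed.

Lemma arc_connected (al : R -> M) : arc V al -> connected (range al).
Proof.
move=> [ca _ _ _]; apply: connected_continuous_connected; last exact: continuous_subspaceT.
have -> : [set: R] = [set` `]-oo, +oo[%R] by apply/seteqP; split=> t.
exact/connected_intervalP/interval_is_interval.
Qed.

Lemma arc_in_edge e (al : R -> M) t : Xi1 v e -> arc V al -> range al `<=` E -> e (al t) -> range al `<=` e.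
Proof.
move=> he aal alE et; have [_ ->] := edge_eq he et.
move=> y [s _ <-]; exists (range al); last by exists s.
by split; [exists t|exact: alE|exact: arc_connected].
Qed.

Lemma finite_edges : finite_set (@Xi1 R M f v).
Proof.
have [n [A [hA cA]]] := arc_coverE.
apply: (@sub_finite_set _ _ ((fun i => connected_component E (A i 0)) @` `I_n)); last first.
  by apply: finite_image; exact: finite_II.
move=> e he; have [y ey] := edge_nonempty he; have [Ey eE] := edge_eq he ey.
have [i ni [t _ ty]] := cA y Ey; have [aA AE] := hA i ni; exists i => //.
rewrite -ty in ey; have [_ ->] := edge_eq he (arc_in_edge he aA AE ey (ex_intro2 _ _ 0 I erefl)).
by [].
Qed.

(** Among the arcs inside [e] take one that contains the largest number of arcs of a finite cover.
    If it missed a point, connectedness of [e] would provide a covering arc that overlaps it without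
    being contained in it, and gluing would give a better one. A vertex of [V] is the point off both
    arcs that gluing requires. *)
Lemma edge_parametrization e : Xi1 v e -> exists2 ga : R -> M, arc V ga & range ga = e.
Proof.
move=> he; have [n [A [hA cA]]] := arc_coverE.
have [y0 ey0] := edge_nonempty he; have [Ey0 _] := edge_eq he ey0.
pose cnt (al : R -> M) := #|[pred i : 'I_n | `[< range (A i) `<=` range al >]]|.
pose good (k : nat) := `[< exists al, [/\ arc V al, range al `<=` e & cnt al = k] >].
have [i0 ni0 [t0 _ ty0]] := cA y0 Ey0; have [aA0 AE0] := hA i0 ni0.
have ex : exists k : nat, good k.
  exists (cnt (A i0)); apply/asboolP; exists (A i0); split=> //.
  by apply: (arc_in_edge he aA0 AE0 (t := t0)); rewrite ty0.
have bd (k : nat) : good k -> (k <= n)%N.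
  by move=> /asboolP[al [_ _ <-]]; rewrite -[X in (_ <= X)%N]card_ord; exact: max_card.
case: (ex_maxnP ex bd) => k /asboolP[al [aal ale ck]] mx; exists al => //.
apply/seteqP; split=> // y ey.
have [x0 cx0 Vx0] := comp_critical hv.
have nx0 (be : R -> M) : range be `<=` e -> ~ range be x0.
  by move=> bee /bee ex0; have [_] := edge_sub he ex0.
have key i : (i < n)%N -> range (A i) `<=` e -> (exists y, range (A i) y /\ range al y) -> range (A i) `<=` range al.
  move=> ni Ae [z [[t _ tz] [s _ sz]]]; apply: contrapT => nA; have [aA AE] := hA i ni.
  have E1 : al s = A i t by rewrite sz tz.
  have [ga [aga gE]] := arc_glue (@surface_hausdorff _ M) (comp_connected hv) Vx0 (nx0 _ ale) (nx0 _ Ae) aal aA E1.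
  have ge : range ga `<=` e by rewrite gE => w [/ale|/Ae].
  have /mx : good (cnt ga) by apply/asboolP; exists ga.
  rewrite leqNgt -ck => /negP; apply; apply: proper_card; apply/properP; split.
    apply/fintype.subsetP => i'; rewrite !inE => /asboolP h w; move/asboolP : h => h /h alw.
    by rewrite gE; left.
  exists (Ordinal ni); first by apply/asboolP => w Aw; rewrite gE; right.
  exact/asboolP.
apply: (@connected_near_ind _ e (range al) (al 0) y (edge_connected he)) => //.
  by apply: ale; exists 0.
move=> a ea; have [[s _ sa]|na] := pselect (range al a).
  have N := arc_near s aal; rewrite sa in N.
  apply: filterS N => b H eb; split=> _; last by exists s.
  by have [Vb _] := edge_sub he eb; exact: H.
have [Ea _] := edge_eq he ea; have [i ni [t _ ta]] := cA a Ea; have [aA AE] := hA i ni.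
have Ae : range (A i) `<=` e by apply: (arc_in_edge he aA AE (t := t)); rewrite ta.
have N := arc_near t aA; rewrite ta in N; apply: filterS N => b H eb; split=> // alb.
have Ab : range (A i) b by apply: H; have [] := edge_sub he eb.
by apply: (key i ni Ae); [exists b|exists t].
Qed.

Section RayPreserved.
Context (x : M) (m : M -> pt) (j : pt -> M) (r : R) (n : nat) (P : pt -> R) (Vx : V x) (cx : critical f x).
Context (D : disk m j r) (j0 : j 0 = x) (hP : homogeneous n.+2 P).
Context (nP : no_multiple_linear_factor P) (fP : forall p : pt, `|p| < r -> f (j p) = f x + P p).

Lemma ray_in_edge u : `|u| = 1 -> P u = 0 -> exists2 e, Xi1 v e &
  forall s, 0 < s < r -> e (j (s *: u)).
Proof.
move=> u1 Pu; have rr := disk_gt0 D; have [aal rg] := ray_arc Vx D j0 hP nP fP u1 Pu.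
set al := _ \o _ in aal rg; have u0 : u != 0 by rewrite -normr_gt0 u1.
have alE : range al `<=` E.
  move=> _ /rg[s sr <-]; have /andP[s0 sr'] := sr.
  have h : `|s *: u| < r by rewrite normrZ u1 mulr1 gtr0_norm.
  apply/(vertex_E Vx cx D j0 hP nP fP h).
  by rewrite (hom_scale _ _ hP) Pu mulr0 scaler_eq0 negb_or u0 andbT gt_eqF.
have E0 : E (al 0) by apply: alE; exists 0.
exists (connected_component E (al 0)); first exact: edge_at.
move=> s sr; apply: (arc_in_edge (edge_at E0) aal alE (t := 0)); first exact: connected_component_refl.
by apply/rg; exists s.
Qed.

(* Near [x] the ray [s |-> j (s u)] runs into one end of the edge, and an
   increasing self-map of the edge preserves that end. *)
Lemma ray_preserved h u : stabilizer_comp v h -> h x = x ->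
  (forall e, Xi1 v e -> h @` e = e) -> (forall e, Xi1 v e -> preserves_orientation1 h e) ->
  `|u| = 1 -> P u = 0 -> exists2 d : R, 0 < d & forall s, 0 < s < d ->
    exists2 s', 0 < s' < r & h (j (s *: u)) = j (s' *: u).
Proof.
move=> hh hx he ho u1 Pu; have rr := disk_gt0 D; have [e hXe ray] := ray_in_edge u1 Pu.
have u0 : u != 0 by rewrite -normr_gt0 u1.
have [ga0 aga0 ga0e] := edge_parametrization hXe.
have sr t : `|squash (- r) r t *: u| < r.
  by rewrite normrZ u1 mulr1 ltr_norml; apply: squash_bound; rewrite gtrN.
have rN : - r < r by rewrite gtrN.
pose sg := squash (- r) r; pose al t := j (sg t *: u).
have sgm s t : s < t -> sg s < sg t by exact: squash_mono.
have ca : continuous al.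
  move=> t; apply: continuous_comp; last exact: (disk_j_continuous D (sr t)).
  by apply: cvgZr_tmp; exact: squash_continuous.
have ia : injective al.
  move=> s t /(congr1 m); rewrite !(disk_mK D)// => /eqP.
  rewrite -subr_eq0 -scalerBl scaler_eq0 (negbTE u0) orbF subr_eq0 => /eqP E1.
  by have [/sgm|/sgm|//] := ltgtP s t; rewrite E1 ltxx.
have Va t : V (al t) by apply/(vertex_V Vx D j0 hP fP (sr t)); rewrite (hom_scale _ _ hP) Pu mulr0.
have sg0 : sg 0 = 0 by rewrite /sg /squash mul0r mulr0 addr0 addNr mul0r.
have al0 : al 0 = x by rewrite /al sg0 scale0r.
have nex : ~ e x by move=> /(edge_sub hXe)[].
have ale t : 0 < t -> e (al t).
  move=> t0; apply: ray; rewrite -[X in X < _]sg0 sgm//=.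
  by have /andP[] := squash_bound t rN.
have [t1 alt1] : exists t1, al 1 = ga0 t1.
  have : range ga0 (al 1) by rewrite ga0e; apply: ale.
  by move=> [t _ <-]; exists t.
have nga (ga : R -> M) : range ga = e -> ~ range ga (al 0) by move=> ->; rewrite al0.
have lend (ga : R -> M) s t : arc V ga -> range ga = e -> 0 < s -> al s = ga t ->
    exists l, onto_left al ga 0 s t l.
  move=> aga gae s0 E1.
  have [a [l [h1 h2 h3 h4]]] := left_end (@surface_hausdorff _ M) ca ia Va aga E1 s0 (nga ga gae).
  exists l; rewrite (_ : 0 = a)//; apply/eqP; rewrite eq_le h1 leNgt; apply/negP => /ale.
  by rewrite -gae.
(* The parametrization is reversed if necessary, so that the ray runs into the lower end of the
   edge. *)
have [ga [t0 [aga gae alt0 [H1 H2]]]] : exists ga t0, [/\ arc V ga, range ga = e, al 1 = ga t0 & onto_left al ga 0 1 t0 true].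
  have [[] h4] := lend ga0 1 t1 aga0 ga0e ltr01 alt1; first by exists ga0, t1.
  exists (ga0 \o -%R), (- t1); split.
  - exact: arc_rev.
  - rewrite -ga0e; apply/seteqP; split=> y; last exact: range_rev.
    by move=> [t _ <-]; exists (- t).
  - by rewrite /= opprK.
  have [h5 h6] := h4; split=> [t' tt|s' as' ss].
    by have [|s' ?] := h5 (- t'); [rewrite lerNr|exists s'].
  by have [t' tt' E1] := h6 s' as' ss; exists (- t'); rewrite /= ?opprK// lerN2.
have [cga iga Vga _] := aga.
have hga t : exists t', h (ga t) = ga t'.
  have : range ga (h (ga t)) by rewrite gae -(he _ hXe); exists (ga t) => //; rewrite -gae; exists t.
  by move=> [t' _ <-]; exists t'.
have [T1 hT1] : exists T1, h (ga T1) = ga t0.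
  have : e (ga t0) by rewrite -gae; exists t0.
  by rewrite -{1}(he _ hXe) -gae => -[_ [T1 _ <-] E1]; exists T1.
have inc s t s' t' : h (ga s) = ga s' -> h (ga t) = ga t' -> s < t -> s' < t'.
  exact: (ho _ hXe ga cga iga gae).
(* [h] sends parameters at most [T1] to parameters at most [t0], and points of the edge with
   parameter at most [t0] lie on the ray. *)
pose ts := Num.min T1 t0; have tsT : ts <= T1 by rewrite ge_min lexx.
have tst : ts <= t0 by rewrite ge_min lexx orbT.
have [s1 [s10 s11 E1]] := H1 ts tst.
have [l [H3 H4]] := lend ga s1 ts aga gae s10 E1.
have lt : l.
  case: l H3 H4 => // H3 _; have [|s' [h1 h2 h3]] := H3 (t0 + 1).
    by apply: le_trans tst _; rewrite lerDl.
  have [|t' h4] := H2 s' h1; first exact: le_trans h2 s11.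
  by rewrite h3 => /iga h5; move: h4; rewrite -h5 gerDl leNgt ltr01.
rewrite lt in H3 H4.
exists (sg s1); first by rewrite -[X in X < _]sg0 sgm.
move=> s /andP[s0 ss1]; have sr1 : sg s1 < r by have /andP[] := squash_bound s1 rN.
have [t tE] : exists t, sg t = s by apply: squash_onto; lra.
have t0' : 0 < t by rewrite ltNge; apply/negP => h'; move: s0; rewrite -tE ltNge -sg0 => /negP; apply; move: h'; rewrite le_eqVlt => /orP[/eqP ->//|/sgm/ltW].
have ts1 : t <= s1 by rewrite leNgt; apply/negP => /sgm; rewrite tE ltNge ltW.
have [t' tt' E2] := H4 t t0' ts1; have [t'' E3] := hga t'.
have t''0 : t'' <= t0.
  have : t' <= T1 by exact: le_trans tt' tsT.
  rewrite le_eqVlt => /orP[/eqP h'|h']; last by apply: ltW; exact: inc E3 hT1 h'.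
  by move: E3; rewrite h' hT1 => /iga ->.
have [s' [s'0 s'1 E4]] := H1 t'' t''0.
exists (sg s').
  rewrite -[X in X < _ < _]sg0 sgm//=; by have /andP[] := squash_bound s' rN.
by rewrite -tE -/(al t) E2 E3 -E4.
Qed.

(** By [ray_preserved] the difference quotients along a ray are nonnegative multiples of [u], hence
    so is their limit. It is not 0 because the differential is injective. *)
Lemma ray_derivative h u : stabilizer_comp v h -> h x = x ->
  (forall e, Xi1 v e -> h @` e = e) -> (forall e, Xi1 v e -> preserves_orientation1 h e) ->
  P u = 0 -> exists2 a : R, 0 < a & dmap (m \o h \o j) 0 u = a *: u.
Proof.
move=> hh hx he ho; have n0 : `|0 : pt| < r by rewrite normr0; exact: disk_gt0 D.
have [sh _] := hh; have [dh _] := sh; have smh : smooth_map h by case: dh.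
have Rh : region j r (h (j 0)) by rewrite j0 hx -j0; exact: disk_region.
have sF := disk_map D D smh n0 Rh; have JF := disk_map_jac D D dh n0 Rh.
set F := m \o h \o j in sF JF *.
have F0 : F 0 = 0 by rewrite /F /= j0 hx -j0 (disk_mK D).
have lF := dmap_linear sF.
have unit u' : `|u'| = 1 -> P u' = 0 -> exists2 a : R, 0 < a & dmap F 0 u' = a *: u'.
  move=> u1 Pu; have [d d0 hd] := ray_preserved hh hx he ho u1 Pu.
  have u0 : u' != 0 by rewrite -normr_gt0 u1.
  set w := dmap F 0 u'.
  have app (e : R) : 0 < e -> exists2 c : R, 0 <= c & `|c *: u' - w| < e.
    move=> e0; have B := blowup_near u' sF F0 e0.
    have /nbhs_normP[e' e'0 he'] := B.
    pose t := Num.min (e' / 2) (d / 2).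
    have t0 : 0 < t by rewrite lt_min !divr_gt0.
    have te : t <= e' / 2 by rewrite ge_min lexx.
    have td : t <= d / 2 by rewrite ge_min lexx orbT.
    have [|s' /andP[s'0 s'r] E1] := hd t; first by rewrite t0; lra.
    exists (t^-1 * s'); first by rewrite mulr_ge0 ?invr_ge0 ?(ltW t0)// ltW.
    have := he' t; rewrite /ball_ /= sub0r normrN gtr0_norm// => /(_ _ _).
    rewrite /F /= E1 (disk_mK D) ?scalerA; first by apply; [lra|rewrite gt_eqF].
    by rewrite normrZ u1 mulr1 gtr0_norm.
  pose a (z : pt) := cX z * cX u' + cY z * cY u'; pose b (z : pt) := cY z * cX u' - cX z * cY u'.
  have bd (z z' : pt) : `|a z - a z'| <= 2 * `|z - z'| /\ `|b z - b z'| <= 2 * `|z - z'|.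
    have h1 := cX_le (z - z'); have h2 := cY_le (z - z').
    have h3 := cX_le u'; have h4 := cY_le u'; rewrite u1 in h3 h4.
    have tri (s t s' t' : R) : `|s| <= `|z - z'| -> `|t| <= `|z - z'| -> `|s'| <= 1 -> `|t'| <= 1 ->
        `|s * s' + t * t'| <= 2 * `|z - z'|.
      move=> g1 g2 g3 g4; apply: le_trans (ler_normD _ _) _; rewrite !normrM mulr_natl mulr2n.
      by apply: lerD; rewrite -[leRHS]mulr1 ler_pM.
    have -> : a z - a z' = cX (z - z') * cX u' + cY (z - z') * cY u' by rewrite /a !cE; ring.
    have -> : b z - b z' = cY (z - z') * cX u' + cX (z - z') * (- cY u') by rewrite /b !cE; ring.
    by split; apply: tri => //; rewrite normrN.
  have N0 := norm2_gt0 u0; set N := _ + _ in N0.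
  have b0 : b w = 0.
    apply: contrapT => /eqP bn; have bp : 0 < `|b w| / 4 by rewrite divr_gt0 ?normr_gt0.
    have [c c0 hc] := app _ bp; have [_] := bd w (c *: u').
    have -> : b (c *: u') = 0 by rewrite /b !cE; ring.
    by rewrite subr0 [`|w - _|]distrC; move: hc bp; move: `|b w| `|c *: u' - w| => B C; lra.
  have a0 : 0 <= a w.
    rewrite leNgt; apply/negP => an; have ap : 0 < - a w / 4 by lra.
    have [c c0 hc] := app _ ap; have [+ _] := bd w (c *: u').
    have -> : a (c *: u') = c * N by rewrite /a /N !cE; ring.
    have cN : 0 <= c * N by rewrite mulr_ge0// ltW.
    rewrite ler_norml distrC => /andP[h1 _].
    by move: h1 hc an cN; move: (c * N) (a w) `|c *: u' - w| => X Y Z; lra.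
  have wE : w = (a w / N) *: u'.
    transitivity ((a w / N) *: u' + (b w / N) *: mk (- cY u') (cX u')).
      by apply: ptP; rewrite /a /b !cE /N; field; rewrite -/N gt_eqF.
    by rewrite b0 mul0r scale0r addr0.
  exists (a w / N) => //; rewrite lt_def divr_ge0 ?(ltW N0)// andbT.
  apply/eqP => c0; have : w = 0 by rewrite wE c0 scale0r.
  by move=> /(dmap_inj sF JF)/eqP; rewrite (negbTE u0).
have [->|u0] := eqVneq u 0; first by move=> _; exists 1 => //; rewrite scaler0 (linear0' lF).
move=> Pu; have [||a a0 E1] := unit (`|u|^-1 *: u).
- by rewrite normrZ normfV normr_id mulVf// normr_eq0.
- by rewrite (hom_scale _ _ hP) Pu mulr0.
exists a => //; rewrite (linearZ' _ _ lF) scalerA mulrC -scalerA in E1.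
by apply: (scalerI (_ : `|u|^-1 != 0)); rewrite ?invr_eq0 ?normr_eq0.
Qed.

End RayPreserved.

End Edges.
(** * Linear models at the vertices *)

Section Models.
Context {R : realType}.
Local Notation pt := 'rV[R]_2.
Implicit Types (u w z : pt) (P q : pt -> R).

(* An auxiliary quadratic form whose isometries among the symmetries of a
   saddle are finitely many; in higher degree no condition is needed. *)
Definition balanced (n : nat) P q : Prop := if n is 0%N then
    exists C k : pt -> pt, [/\ linear C, linear k, cancel C k, cancel k C &
      forall z, P z = cX (C z) * cY (C z) /\ q z = cX (C z) ^+ 2 + cY (C z) ^+ 2]
  else forall z, q z = 0.

Lemma balanced_exists n P u : homogeneous n.+2 P -> no_multiple_linear_factor P -> u != 0 -> P u = 0 ->
  exists q, balanced n P q.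
Proof.
move=> hP nP u0 Pu; case: n hP => [|n] hP; last by exists (fun=> 0).
have [a [b [c [d [D PE]]]]] := two_lines hP nP u0 Pu.
have [C [k [lC lk Ck kC CE]]] := lin2_pair D.
exists (fun z => cX (C z) ^+ 2 + cY (C z) ^+ 2), C, k; split=> // z; split=> //.
by rewrite PE CE !cE.
Qed.

(** In degree at least 3 this is the rigidity of [P] itself. On a saddle [D] scales each axis by a
    positive factor, which the sum of squares [q] forces to be 1. *)
Lemma model_rigid n P q (D : pt -> pt) u : homogeneous n.+2 P -> no_multiple_linear_factor P ->
  u != 0 -> P u = 0 -> balanced n P q -> linear D -> (forall z, P (D z) = P z) ->
  (forall z, q (D z) = q z) -> (forall u, P u = 0 -> exists2 a : R, 0 < a & D u = a *: u) -> D = id.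
Proof.
move=> hP nP u0 Pu bq lD PD qD rays; case: n hP bq => [|n] hP bq; last first.
  have [[w [w0 Pw I]]|no] := pselect (exists w, [/\ w != 0, P w = 0 & independent u w]).
    by apply: (rigid_two hP nP lD PD u0 w0 Pu Pw I _ _ (ltn0Sn _)); exact: rays.
  apply: (rigid_one hP nP lD PD u0 Pu _ (rays u Pu)) => w Pw; apply/negP => I; apply: no; exists w.
  by split=> //; apply: contraTneq I => ->; rewrite /independent !cE !mulr0 subr0 eqxx.
have [C [k [lC lk Ck kC E]]] := bq.
have axis w : cX w * cY w = 0 -> cX w ^+ 2 + cY w ^+ 2 = 1 -> D (k w) = k w.
  move=> w0 w1; have Pk : P (k w) = 0 by rewrite (E _).1 kC.
  have [a a0 Da] := rays _ Pk.
  have := qD (k w); rewrite !(E _).2 Da (linearZ' _ _ lC) kC !cE !exprMn -mulrDr w1 mulr1 => a1.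
  have -> : a = 1 by apply: (@exprn_eq1 _ _ 1).
  by rewrite scale1r.
have D0 : D (k e0) = k e0 by apply: axis; rewrite !cE ?mulr0// expr1n expr0n addr0.
have D1 : D (k e1) = k e1 by apply: axis; rewrite !cE ?mul0r// expr1n expr0n add0r.
apply/funext => z; rewrite -(Ck z).
have -> : C z = cX (C z) *: e0 + cY (C z) *: e1 by apply: ptP; rewrite !cE; ring.
rewrite (linearD' _ _ lk) !(linearZ' _ _ lk) (linearD' _ _ lD) !(linearZ' _ _ lD).
by rewrite D0 D1.
Qed.

Lemma linear_inverse (A : pt -> pt) : linear A -> (forall u, A u = 0 -> u = 0) ->
  exists B : pt -> pt, [/\ linear B, cancel A B & cancel B A].
Proof.
move=> lA iA; have [eX eY] := linear_lin2 lA.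
set a := cX (A e0) in eX; set b := cX (A e1) in eX; set c := cY (A e0) in eY; set d := cY (A e1) in eY.
have AE z : A z = mk (lin2 a b z) (lin2 c d z).
  by rewrite -[LHS]mkK -[cX _]/((cX \o A) z) -[cY _]/((cY \o A) z) eX eY.
have D : a * d - b * c != 0.
  apply/eqP => D0.
  have z1 : mk d (- c) = 0 by apply: iA; rewrite AE; apply: ptP; rewrite /lin2 !cE;
    [transitivity (a * d - b * c); [ring|exact: D0]|ring].
  have z2 : mk b (- a) = 0 by apply: iA; rewrite AE; apply: ptP; rewrite /lin2 !cE;
    [ring|transitivity (- (a * d - b * c)); [ring|by rewrite D0 oppr0]].
  have d0 : d = 0 by have /(congr1 cX) := z1; rewrite !cE.
  have c0 : c = 0 by have /(congr1 cY)/eqP := z1; rewrite !cE oppr_eq0 => /eqP.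
  have b0 : b = 0 by have /(congr1 cX) := z2; rewrite !cE.
  have a0 : a = 0 by have /(congr1 cY)/eqP := z2; rewrite !cE oppr_eq0 => /eqP.
  have /iA/(congr1 cX)/eqP : A e0 = 0 by rewrite AE; apply: ptP; rewrite /lin2 a0 b0 c0 d0 !cE; ring.
  by rewrite !cE oner_eq0.
have [C [k [lC lk Ck kC CE]]] := lin2_pair D.
have AC : A = C by apply/funext => z; rewrite AE CE.
by exists k; rewrite AC.
Qed.

(** The differential [A] of a lift is replaced by an isometry [D] of the auxiliary forms that acts
    on the zero rays as [A] does, up to positive factors. On a saddle [A] keeps or exchanges the
    axes, and [D] retains only the permutation and the sign. *)
Lemma model_exists n P P' q q' (A : pt -> pt) : homogeneous n.+2 P -> homogeneous n.+2 P' ->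
  balanced n P q -> balanced n P' q' -> linear A -> (forall u, A u = 0 -> u = 0) ->
  (forall z, P' (A z) = P z) ->
  exists D D' : pt -> pt, [/\ linear D, linear D', cancel D D', cancel D' D &
    [/\ forall z, P' (D z) = P z, forall z, q' (D z) = q z &
        forall u, P u = 0 -> exists2 a : R, 0 < a & D' (A u) = a *: u]].
Proof.
move=> hP hP' bq bq' lA iA PA; case: n hP hP' bq bq' => [|n] hP hP' bq bq'; last first.
  have [B [lB AB BA]] := linear_inverse lA iA; exists A, B; split=> //; split=> // [z|u _].
    by rewrite bq bq'.
  by exists 1 => //; rewrite AB scale1r.
have [C [k [lC lk Ck kC E]]] := bq; have [C' [k' [lC' lk' Ck' kC' E']]] := bq'.
pose B w := C' (A (k w)).
have lB : linear B by move=> t u w; rewrite /B lk lA lC'.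
have BB w : cX (B w) * cY (B w) = cX w * cY w by rewrite /B -(E' _).1 PA (E _).1 kC.
have wE (w : pt) : w = cX w *: e0 + cY w *: e1 by apply: ptP; rewrite !cE; ring.
set a := cX (B e0); set c := cY (B e0); set b := cX (B e1); set d := cY (B e1).
have Bw w : B w = mk (cX w * a + cY w * b) (cX w * c + cY w * d).
  rewrite [in LHS](wE w) (linearD' _ _ lB) !(linearZ' _ _ lB).
  by apply: ptP; rewrite !cE.
have ac : a * c = 0 by have := BB e0; rewrite !cE mulr0.
have bd : b * d = 0 by have := BB e1; rewrite !cE mul0r.
have abcd : a * d + b * c = 1.
  have := BB (mk 1 1); rewrite Bw !cE !mul1r => h.
  by rewrite -[RHS]h -[LHS]addr0 -[X in _ + X](addr0 0) -{1}ac -bd; ring.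
have sgE (s : R) : s != 0 -> exists e : R, [/\ e * e = 1 & 0 < e * s].
  by move=> s0; have [h|h] := ltP 0 s; [exists 1|exists (-1)]; rewrite ?mul1r ?mulN1r ?opprK ?mulr1//; split=> //; rewrite oppr_gt0 lt_neqAle s0.
have zeros u : P u = 0 -> cX (C u) = 0 \/ cY (C u) = 0.
  by rewrite (E u).1 => /eqP; rewrite mulf_eq0 => /orP[/eqP|/eqP]; [left|right].
have [a0|a0] := eqVneq a 0.
  have bc : b * c = 1 by rewrite -abcd a0 mul0r add0r.
  have b0 : b != 0 by apply: contra_eq_neq bc => ->; rewrite mul0r eq_sym oner_neq0.
  have c0 : c != 0 by apply: contra_eq_neq bc => ->; rewrite mulr0 eq_sym oner_neq0.
  have d0 : d = 0 by move/eqP : bd; rewrite mulf_eq0 (negbTE b0) => /eqP.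
  have [e [ee eb]] := sgE b b0.
  have ec : 0 < e * c by rewrite -(pmulr_rgt0 _ eb) mulrACA ee mul1r bc.
  exists (fun z => k' (mk (e * cY (C z)) (e * cX (C z)))), (fun z => k (mk (e * cY (C' z)) (e * cX (C' z)))).
  split.
  - by move=> t u w; rewrite lC -lk'; congr k'; apply: ptP; rewrite !cE; ring.
  - by move=> t u w; rewrite lC' -lk; congr k; apply: ptP; rewrite !cE; ring.
  - by move=> z; rewrite kC' -[RHS]Ck; congr k; apply: ptP; rewrite !cE mulrA ee mul1r.
  - by move=> z; rewrite kC -[RHS]Ck'; congr k'; apply: ptP; rewrite !cE mulrA ee mul1r.
  split=> [z|z|u Pu].
  - by rewrite (E' _).1 kC' (E _).1 !cE mulrACA ee mul1r mulrC.
  - by rewrite (E' _).2 kC' (E _).2 !cE !exprMn expr2 ee !mul1r addrC.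
  have AE : C' (A u) = mk (cY (C u) * b) (cX (C u) * c).
    by have := Bw (C u); rewrite /B Ck => ->; rewrite a0 d0 !mulr0 add0r addr0.
  have [X0|Y0] := zeros u Pu.
    exists (e * b) => //; rewrite AE -[u in RHS]Ck -(linearZ' _ _ lk); congr k.
    by apply: ptP; rewrite !cE ?X0; ring.
  exists (e * c) => //; rewrite AE -[u in RHS]Ck -(linearZ' _ _ lk); congr k.
  by apply: ptP; rewrite !cE ?Y0; ring.
have c0 : c = 0 by move/eqP : ac; rewrite mulf_eq0 (negbTE a0) => /eqP.
have ad : a * d = 1 by rewrite -abcd c0 mulr0 addr0.
have d0 : d != 0 by apply: contra_eq_neq ad => ->; rewrite mulr0 eq_sym oner_neq0.
have b0 : b = 0 by move/eqP : bd; rewrite mulf_eq0 (negbTE d0) orbF => /eqP.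
have [e [ee ea]] := sgE a a0.
have ed : 0 < e * d by rewrite -(pmulr_rgt0 _ ea) mulrACA ee mul1r ad.
exists (fun z => k' (e *: C z)), (fun z => k (e *: C' z)); split.
- by move=> t u w; rewrite lC -lk'; congr k'; rewrite scalerDr !scalerA mulrC.
- by move=> t u w; rewrite lC' -lk; congr k; rewrite scalerDr !scalerA mulrC.
- by move=> z; rewrite kC' scalerA ee scale1r Ck.
- by move=> z; rewrite kC scalerA ee scale1r Ck'.
split=> [z|z|u Pu].
- by rewrite (E' _).1 kC' (E _).1 !cE mulrACA ee mul1r.
- by rewrite (E' _).2 kC' (E _).2 !cE !exprMn expr2 ee !mul1r.
have AE : C' (A u) = mk (cX (C u) * a) (cY (C u) * d).
  by have := Bw (C u); rewrite /B Ck => ->; rewrite b0 c0 !mulr0 add0r addr0.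
have [X0|Y0] := zeros u Pu.
  exists (e * d) => //; rewrite AE -[u in RHS]Ck -(linearZ' _ _ lk); congr k.
  by apply: ptP; rewrite !cE ?X0; ring.
exists (e * a) => //; rewrite AE -[u in RHS]Ck -(linearZ' _ _ lk); congr k.
by apply: ptP; rewrite !cE ?Y0; ring.
Qed.

(** Here P'(t^-1 g(t z)) = t^(n - n') P z, which tends to 0. For an invertible differential [P']
    would then be 0; this is how the degree is seen to be constant on orbits of vertices. *)
Lemma dmap_degree n n' P P' (g : pt -> pt) z : homogeneous n P -> homogeneous n' P' -> (n' < n)%N ->
  smooth_at 0 g -> g 0 = 0 -> (\forall z \near (0 : pt), P' (g z) = P z) -> P' (dmap g 0 z) = 0.
Proof.
move=> hP hP' nn sg g0 Pg; apply/eqP; rewrite -normr_le0 leNgt; apply/negP => ep.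
have e2 : 0 < `|P' (dmap g 0 z)| / 2 by rewrite divr_gt0.
have /cvgr_distC_lt/(_ _ e2)/near_norm[r r0 hr] := smooth_at_continuous (hom_smooth (dmap g 0 z) hP').
have /near_norm[d d0 hd] := Pg.
have F : ProperFilter (0 : R)^' by exact: Proper_dnbhs_numFieldType.
have small (c : R) (e : R) : 0 <= c -> 0 < e -> \forall t \near (0 : R)^', `|t| * c < e.
  move=> c0 e0; apply: cvg_within; have z1 : 0 < c + 1 by rewrite ltr_wpDl.
  exists (e / (c + 1)); first exact: divr_gt0.
  move=> t /=; rewrite sub0r normrN ltr_pdivlMr// => h; apply: le_lt_trans h.
  by rewrite ler_wpM2l// lerDl.
have n1 : \forall t \near (0 : R)^', t != 0 by exact: nbhs_dnbhs_neq.
have n2 := small _ _ (normr_ge0 z) d0; have n3 := small _ _ (normr_ge0 (P z)) e2.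
have n4 := small _ _ ler01 (ltr01 : (0 : R) < 1).
have [t [[[[t0 h2] h3] h4] h5]] := filter_ex (filterI (filterI (filterI (filterI n1 n2) n3) n4) (blowup_near z sg g0 r0)).
have := hr _ h5; rewrite (hom_scale _ _ hP') (hd (t *: z)) ?subr0 ?normrZ// (hom_scale _ _ hP).
have [k nk] : exists k, n = (n' + k.+1)%N by exists (n - n').-1; rewrite prednK ?subn_gt0// subnKC// ltnW.
rewrite nk exprD mulrA mulrA -exprMn mulVf// expr1n mul1r => h6.
have h7 : `|t ^+ k.+1 * P z| < `|P' (dmap g 0 z)| / 2.
  apply: le_lt_trans h3; rewrite normrM normrX exprS -mulrA ler_wpM2l// ler_piMl// exprn_ile1//.
  by move: h4; rewrite mulr1 => /ltW.
have := ler_distD (t ^+ k.+1 * P z) (P' (dmap g 0 z)) 0; rewrite !subr0 distrC.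
by move: h6 h7; move: `|P' _| `|_ - _| `|t ^+ k.+1 * _| => X Y Z; lra.
Qed.

End Models.
Lemma image_component (T : topologicalType) (A : set T) (h k : T -> T) x : continuous h -> continuous k ->
  cancel h k -> cancel k h -> (forall y, A (h y) <-> A y) -> A x ->
  h @` connected_component A x = connected_component A (h x).
Proof.
move=> ch ck hk kh Ah Ax.
have sub (g : T -> T) y : continuous g -> (forall z, A z -> A (g z)) -> A y ->
    g @` connected_component A y `<=` connected_component A (g y).
  move=> cg Ag Ay _ [z [C [Cy CA cC] Cz] <-]; exists (g @` C); last by exists z.
  split; [by exists y|by move=> _ [w Cw <-]; exact/Ag/CA|].
  by apply: connected_continuous_connected => //; exact: continuous_subspaceT.
apply/seteqP; split; first by apply: sub => // z /Ah.
move=> z Az; exists (k z); rewrite ?kh// -[x]hk; have Ak w : A w -> A (k w) by rewrite -{1}[w]kh => /Ah.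
exact: (sub k (h x) ck Ak ((Ah x).2 Ax) _ (ex_intro2 _ _ z Az erefl)).
Qed.

Lemma factor_neq0 (R : realType) (P : 'rV[R]_2 -> R) : no_multiple_linear_factor P -> ~ forall w, P w = 0.
Proof.
move=> nP P0; have [] := nP 1 0 0 (fun=> 0); last by move/eqP; rewrite oner_eq0.
  by exists (fun=> 0) => p; rewrite big1// => i _; rewrite !mul0r.
by move=> p; rewrite P0 mulr0.
Qed.

(** * Consequences of condition (C) *)

Section Condition.
Context {R : realType} {M : compact_surface R} {f : M -> R} (hf : classF f).
Local Notation pt := 'rV[R]_2.
Notation "x ~~ y" := (level_component f x y) (at level 70).
Implicit Types (x y z : M) (p q u w : pt) (h k : M -> M).
Context {v : reeb f} (hv : vertex v).
Let V := component v.
Let E := V `\` critical f.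

Lemma stabc_V h x : stabilizer_comp v h -> V (h x) <-> V x.
Proof.
move=> hh; split; last exact: stab_comp_comp.
have [k [hk hK _]] := stabc_inv hh; rewrite -{2}[x]hK; exact: stab_comp_comp.
Qed.

Lemma stab_critical h x : stabilizer f h -> ~ boundary x -> ~ boundary (h x) ->
  critical f (h x) -> critical f x.
Proof.
move=> sh bx bhx; have [[smh _] _] := sh.
have [c Ac cx] := chart_at x; have [j [r [D j0]]] := disk_at Ac cx bx.
have [d Ad dx] := chart_at (h x); have [j' [r' [D' j'0]]] := disk_at Ad dx bhx.
set m := (fun y => _) in D; set m' := (fun y => _) in D'.
have r0 := disk_gt0 D; have r'0 := disk_gt0 D'.
have n0 : `|0 : pt| < r by rewrite normr0.
have n'0 : `|0 : pt| < r' by rewrite normr0.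
rewrite -{2}j0 -j'0 => /(disk_critical D' (classF_smooth hf) n'0) cr.
apply/(disk_critical D (classF_smooth hf) n0) => w.
have hr : region j' r' (h (j 0)) by rewrite j0 -j'0; exists 0.
have sF := disk_map D D' smh n0 hr; have nF := disk_map_near D D' (stab_continuous sh) n0 hr.
set F := m' \o h \o j in sF nF.
have F0 : F 0 = 0 by rewrite /F /= j0 -j'0 (disk_mK D').
have eF : \forall z \near (0 : pt), (f \o j) z = ((f \o j') \o F) z.
  by apply: filterS nF => z [e _]; rewrite /= e stab_f.
rewrite (eq_near_derive _ eF).
have sf' := disk_fun_smooth D' (classF_smooth hf) n'0; rewrite -F0 in sf'.
have [_ ->] := derive_comp_pt (smooth_at_diff sf') (smooth_at_diff ((smooth_at_pt _ _).1 sF).1)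
  (smooth_at_diff ((smooth_at_pt _ _).1 sF).2).
by rewrite F0 !cr !mulr0 addr0.
Qed.

Lemma stabc_critical h x : stabilizer_comp v h -> V x -> critical f (h x) <-> critical f x.
Proof.
move=> hh Vx; have bV y : V y -> ~ boundary y by exact: (comp_inner hf hv).
have st_c k y : stabilizer_comp v k -> V y -> critical f (k y) -> critical f y.
  by move=> hk Vy; apply: stab_critical; [case: hk|exact: bV|apply: bV; exact/stabc_V].
split; first exact: st_c.
have [k [hk hK _]] := stabc_inv hh; rewrite -{1}[x]hK; apply: st_c => //; exact/stabc_V.
Qed.

Lemma stabc_E h x : stabilizer_comp v h -> E (h x) <-> E x.
Proof.
move=> hh; split=> -[Vx nx].
  by have Vx' := (stabc_V x hh).1 Vx; split=> // /(stabc_critical hh Vx').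
by split; [exact/stabc_V|rewrite (stabc_critical hh Vx)].
Qed.

Lemma stabc_edge h x : stabilizer_comp v h -> E x ->
  h @` connected_component E x = connected_component E (h x).
Proof.
move=> hh Ex; have [k [hk hK kh]] := stabc_inv hh.
by apply: (image_component (stab_continuous hh.1) (stab_continuous hk.1)) => // y; exact: stabc_E.
Qed.

Lemma stabc_face h z : stabilizer_comp v h -> ~ V z ->
  h @` connected_component (~` V) z = connected_component (~` V) (h z).
Proof.
move=> hh Vz; have [k [hk hK kh]] := stabc_inv hh.
apply: (image_component (stab_continuous hh.1) (stab_continuous hk.1)) => // y.
by have [a b] := stabc_V y hh; split=> nV /= ?; apply: nV; [exact: b|exact: a].
Qed.

Lemma stabc_Xi1 h e : stabilizer_comp v h -> Xi1 v e -> Xi1 v (h @` e).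
Proof. by move=> hh [x Ex ->]; rewrite (stabc_edge hh Ex); exists (h x) => //; exact/stabc_E. Qed.

Lemma edge_fixed h e y : stabilizer_comp v h -> Xi1 v e -> e y -> e (h y) -> h @` e = e.
Proof.
move=> hh he ey ehy; have [Ey ee] := edge_eq he ey.
by rewrite ee (stabc_edge hh Ey); have [_ <-] := edge_eq he ehy.
Qed.

Lemma face_of_lc z y : ~ V z -> z ~~ y -> connected_component (~` V) z = connected_component (~` V) y.
Proof.
move=> Vz zy; apply/same_connected_component; exists (level_component f z) => //.
split; [exact: lc_refl| |exact: lc_connected].
by move=> w zw Vw; apply: Vz; apply/(compP _ Vw); exact: lc_sym.
Qed.

Lemma face_fixed h z : stabilizer_comp v h -> ~ V z -> h z ~~ z ->
  h @` connected_component (~` V) z = connected_component (~` V) z.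
Proof.
move=> hh Vz hz; rewrite (stabc_face hh Vz); apply: face_of_lc => //.
by rewrite /setC /= (stabc_V z hh).
Qed.

(** [V] has empty interior: at a vertex [P] is not identically 0, at the other points [f] is a
    coordinate. *)
Lemma off_component x (Q : set M) : V x -> (\forall y \near x, Q y) -> exists2 z, Q z & ~ V z.
Proof.
move=> Vx nQ; apply: contrapT => no.
have QV z : Q z -> V z by move=> Qz; apply: contrapT => nz; apply: no; exists z.
have bx := comp_inner hf hv Vx.
have [cx|rx] := pselect (critical f x).
  have [m [j [r [n [P [D j0 hP nP fP]]]]]] := vertex_disk hf cx.
  have r0 := disk_gt0 D; have n0 : `|0 : pt| < r by rewrite normr0.
  have nP0 : \forall p \near (0 : pt), Q (j p).
    by apply: (disk_j_continuous D n0); rewrite j0.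
  have /near_norm[d d0 hd] : \forall p \near (0 : pt), Q (j p) /\ `|p| < r.
    by apply: filterI nP0 _; exact: near_norm_lt.
  have P0 w : P w = 0.
    have [t t0 tw] : exists2 t : R, 0 < t & `|t *: w| < d.
      exists (d / (`|w| + 1)); first by rewrite divr_gt0// ltr_wpDl.
      rewrite normrZ gtr0_norm ?divr_gt0 ?ltr_wpDl// mulrAC ltr_pdivrMr ?ltr_wpDl//.
      by rewrite ltr_pM2l// ltrDl.
    have [] := hd (t *: w); rewrite ?subr0// => /QV Vw wr.
    have := (vertex_V Vx D j0 hP fP wr).1 Vw; rewrite (hom_scale _ _ hP) => /eqP.
    by rewrite mulf_eq0 expf_eq0 (gt_eqF t0) andbF => /eqP.
  exact: (factor_neq0 nP P0).
have [m [j [r [D j0 fj]]]] := regular_disk hf bx rx.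
have r0 := disk_gt0 D; have n0 : `|0 : pt| < r by rewrite normr0.
have nP0 : \forall p \near (0 : pt), Q (j p).
  by apply: (disk_j_continuous D n0); rewrite j0.
have /near_norm[d d0 hd] : \forall p \near (0 : pt), Q (j p) /\ `|p| < r.
  by apply: filterI nP0 _; exact: near_norm_lt.
have [] := hd (mk 0 (d / 2)).
  by rewrite subr0; apply/norm_ltP; rewrite !cE normr0 gtr0_norm ?divr_gt0//; split=> //; lra.
move=> /QV Vw wr; have /(_ Vw)/eqP := (box_level Vx D j0 fj wr).1.
by rewrite !cE gt_eqF// divr_gt0.
Qed.

Context {st : set (reeb f)} (hst : star v st).
Context {H : set (st -> st)} (hH : subgroup_of (local_stab v st) H).
Context (hC : conditionC v (phi_preimage v H)).
Let Hs := phi_preimage v H.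

Definition star_trivial h := stabilizer_comp v h /\ phi st h = id.
Local Notation T := star_trivial.

Lemma trivial_Hs k : T k -> Hs k.
Proof. by move=> [hk pk]; split=> //; rewrite pk; case: hH. Qed.

Lemma trivial_comp h k : T h -> T k -> T (h \o k).
Proof.
move=> [hh ph] [hk pk]; split; first exact: stabc_comp.
by rewrite (phi_comp hv hst)// ph pk.
Qed.

Lemma trivial_id : T id.
Proof. by split; [exact: stabc_id|exact: (phi_id hv hst)]. Qed.

(** Condition (C) starts from a fixed face, so the other rigidity statements are reduced to this one
    by exhibiting a level component off [V] that is fixed. *)
Lemma face_rigid h z : Hs h -> ~ V z ->
  h @` connected_component (~` V) z = connected_component (~` V) z ->
  [/\ forall e, Xi1 v e -> h @` e = e, forall e, Xi1 v e -> preserves_orientation1 h e,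
      forall x, V x -> critical f x -> h x = x & T h].
Proof.
move=> hh Vz fz; have [A B _] := hC hh (ex_intro2 _ _ z Vz erefl) fz.
have eh : forall e, Xi1 v e -> h @` e = e by move=> e he; apply: A; left; right.
split=> //; last by split; [case: hh|apply: (star_fixed hf hv) => //; case: hh].
move=> x Vx cx; have /A : Xi v [set x] by left; left; exists x.
by move/seteqP => [+ _]; apply; exists x.
Qed.

(** A map that is trivial on the star fixes every level component over it. Some of these lie off
    [V], each inside a single face, which is then fixed. *)
Lemma trivial_point h : T h -> exists2 z, ~ V z &
  h @` connected_component (~` V) z = connected_component (~` V) z.
Proof.
move=> Th; have [hh ph] := Th; have [x cx Vx] := comp_critical hv.
have stx : \forall y \near x, st (reeb_proj f y).
  have pc : continuous (reeb_proj f : M -> reeb f) by exact: pi_continuous.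
  by apply: pc; rewrite Vx; exact: star_nbhs hst.
have [z sz nz] := off_component Vx stx.
by exists z => //; exact: (face_fixed hh nz ((phi_idP hv hst hh).1 ph z sz)).
Qed.

Lemma trivial_fixes h : T h ->
  [/\ forall e, Xi1 v e -> h @` e = e, forall e, Xi1 v e -> preserves_orientation1 h e &
      forall x, V x -> critical f x -> h x = x].
Proof. by move=> Th; have [z nz fz] := trivial_point Th; have [] := face_rigid (trivial_Hs Th) nz fz. Qed.

Lemma trivial_face h A : T h -> Xi2 v A -> h @` A = A.
Proof.
move=> Th hA; have [z nz fz] := trivial_point Th.
by have [+ _ _] := hC (trivial_Hs Th) (ex_intro2 _ _ z nz erefl) fz; apply; right.
Qed.

(** Flow boxes along the fixed edge show that the level components of points near it are fixed; one
    of these points lies off [V], so a face is fixed. *)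
Lemma edge_rigid h e : Hs h -> Xi1 v e -> h @` e = e -> T h.
Proof.
move=> hh he eh; have [y ey] := edge_nonempty he.
have ehy : e (h y) by rewrite -eh; exists y.
have [Vy ry] := edge_sub he ey; have [Vhy rhy] := edge_sub he ehy.
have N : \forall z \near y, h z ~~ z.
  apply: (fixed_near hf) => //; first by case: hh => -[].
  apply: (propagate hf (edge_connected he)) => // z ez; have [Vz rz] := edge_sub he ez.
  by split=> //; exact: (comp_f Vz Vy).
have [z zz nz] := off_component Vy N.
by have [] := face_rigid hh nz (face_fixed hh.1 nz zz).
Qed.

Lemma subgroup_Hs h k : Hs h -> Hs k -> Hs (h \o k).
Proof.
move=> [hh Hh] [hk Hk]; split; first exact: stabc_comp.
by rewrite (phi_comp hv hst)//; case: hH => _ _ + _; apply.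
Qed.

Lemma inverse_Hs h : Hs h -> exists k, [/\ Hs k, cancel h k & cancel k h].
Proof.
move=> [hh Hh]; have [k [hk hK kh]] := stabc_inv hh; exists k; split=> //; split=> //.
case: hH => _ _ _ /(_ _ Hh)[b [Hb _ cb]]; suff -> : phi st k = b by [].
have : phi st k \o phi st h = id.
  by rewrite -(phi_comp hv hst)// -(phi_id hv hst); congr phi; exact/funext.
by move=> e; apply/funext => w; rewrite -[b w]/(id (b w)) -e /= cb.
Qed.

(** Each [k A] is the identity near the other pieces, so the composite of all of them agrees with
    [k A] near [A]. The abstract [Y] and [S] allow its use for the vertices as well as for the
    edges. *)
Lemma fragments (Y : set (set M)) (S : set (M -> M)) (k : set M -> M -> M) : finite_set Y ->
  S id -> (forall h k, S h -> S k -> S (h \o k)) -> (forall h, S h -> continuous h) ->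
  (forall h A, S h -> Y A -> h @` A `<=` A) -> (forall A, Y A -> S (k A)) ->
  (forall A B, Y A -> Y B -> A <> B -> forall x, B x -> \forall y \near x, k A y = y) ->
  exists2 K, S K & forall A, Y A -> forall x, A x -> \forall y \near x, K y = k A y.
Proof.
move=> /finite_seqP[s ->] Sid SC Sc SY Sk kY.
suff HH : forall t : seq (set M), {subset t <= s} -> exists2 K, S K & forall A, A \in s ->
    forall x, A x -> \forall y \near x, K y = if A \in t then k A y else y.
  have [K SK HK] := HH s (fun _ => id).
  by exists K => // A As x Ax; apply: filterS (HK A As x Ax) => y; rewrite As.
elim=> [|B t IH] st'.
  by exists id => // A _ x _; near=> y.
have [K SK HK] : exists2 K, S K & forall A, A \in s -> forall x, A x ->
    \forall y \near x, K y = if A \in t then k A y else y.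
  by apply: IH => A At; apply: st'; rewrite inE At orbT.
have Bs : B \in s by apply: st'; rewrite mem_head.
have [Bt|Bt] := boolP (B \in t).
  exists K => // A As x Ax; apply: filterS (HK A As x Ax) => y; rewrite inE.
  by case: eqVneq => // ->; rewrite Bt.
exists (k B \o K); first by apply: SC => //; exact: Sk.
move=> A As x Ax; rewrite inE; have [AB|AB] := eqVneq A B.
  by subst A; apply: filterS (HK B Bs x Ax) => y /=; rewrite (negbTE Bt) => ->.
have AK : A (K x) by apply: (SY K A SK As); exists x.
have N0 : \forall y \near K x, k B y = y.
  by apply: (kY B A Bs As _ _ AK) => BA; rewrite BA eqxx in AB.
have N : \forall y \near x, k B (K y) = K y := Sc K SK x _ N0.
by apply: filterS2 N (HK A As x Ax) => y /= -> ->.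
Unshelve. all: by end_near.
Qed.

End Condition.

Record vmodel (R : realType) (M : compact_surface R) (f : M -> R) (x : M) (m : M -> 'rV[R]_2)
    (j : 'rV[R]_2 -> M) (r : R) (n : nat) (P q : 'rV[R]_2 -> R) : Prop := VModel {
  vm_disk : disk m j r; vm0 : j 0 = x; vm_hom : homogeneous n.+2 P;
  vm_factor : no_multiple_linear_factor P;
  vm_f : forall p, `|p| < r -> f (j p) = f x + P p;
  vm_ray : exists2 u, u != 0 & P u = 0;
  vm_balanced : balanced n P q }.

(** * Kernel elements supported in a disk *)

Section Vertices.
Context {R : realType} {M : compact_surface R} {f : M -> R} (hf : classF f).
Local Notation pt := 'rV[R]_2.
Implicit Types (x y z : M) (p q u w : pt) (h k : M -> M).
Context {v : reeb f} (hv : vertex v).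
Let V := component v.

(** If [P] had no zero besides 0, the vertex would be isolated in the connected [V], which would
    then have no edge. *)
Lemma vmodel_exists e x : Xi1 v e -> V x -> critical f x ->
  exists m j r n P (q : pt -> R), vmodel f x m j r n P q.
Proof.
move=> he Vx cx; have [m [j [r [n [P [D j0 hP nP fP]]]]]] := vertex_disk hf cx.
suff [u u0 Pu] : exists2 u, u != 0 & P u = 0.
  have [q bq] := balanced_exists hP nP u0 Pu.
  by exists m, j, r, n, P, q; split=> //; exists u.
apply: contrapT => no; have [y ey] := edge_nonempty he; have [Vy ry] := edge_sub he ey.
apply: ry; suff -> : y = x by [].
apply: (@connected_near_ind M V (fun y => y = x) x y) => //; first exact: comp_connected.
move=> a Va; have [->|nax] := pselect (a = x); last first.
  have : \forall b \near a, b <> x.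
    have := @hausdorff_accessible M (@surface_hausdorff R M) => /accessible_closed_set1 /(_ x).
    by rewrite -openC => /open_near/(_ nax).
  by apply: filterS => b nb _; split.
have r0 := disk_gt0 D; have n0 : `|0 : pt| < r by rewrite normr0.
have N1 : \forall q \near (0 : pt), True by exact: filterT.
rewrite -j0; have := disk_near D n0 N1.
apply: filterS => b [/(disk_jm D)[jb mb] _] Vb; split=> // _.
rewrite -[LHS]jb; congr j; apply: contrapT => /eqP mb0; apply: no; exists (m b) => //.
by apply/(vertex_V Vx D j0 hP fP mb); rewrite jb.
Qed.

(** The last hypothesis says that an edge entering the disk is not contained in the support. So
    every edge has a fixed point and is mapped to itself, and [star_fixed] applies. *)
Lemma supported_trivial (st : set (reeb f)) (m : M -> pt) (j : pt -> M) (r c rho : R) (K : pt -> pt) :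
  star v st -> disk m j r -> (forall p : pt, `|p| < r -> V (j p) <-> f (j p) = c) ->
  plane_diffeo K -> (forall p : pt, rho <= `|p| -> K p = p) -> rho < r ->
  (forall p : pt, `|p| < r -> f (j (K p)) = f (j p)) ->
  (forall e (p : pt), Xi1 v e -> `|p| < r -> e (j p) -> exists2 p' : pt, e (j p') & rho <= `|p'| < r) ->
  star_trivial (v := v) (st := st) (lift m j r K).
Proof.
move=> hst D VE pK K1 rr fK fe; have [k [Kk kK sk]] := plane_diffeo_inv pK.
have fl y : f (lift m j r K y) = f y.
  have [[p pr <-]|ny] := pselect (region j r y); last by rewrite lift_out.
  by rewrite (lift_in D K pr) fK.
have sl : stabilizer f (lift m j r K).
  by split; [exact: (lift_diffeo D pK K1 rr)|exact/funext].
have k1 (p : pt) : rho <= `|p| -> k p = p by move=> pr; rewrite -{1}(K1 p pr) Kk.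
have fk (p : pt) : `|p| < r -> f (j (k p)) = f (j p).
  move=> pr; rewrite -[in RHS](kK p) fK//; exact: (supported_lt k1 rr (can_inj kK) pr).
have lV g : (forall p : pt, rho <= `|p| -> g p = p) ->
    (forall p : pt, `|p| < r -> f (j (g p)) = f (j p)) -> injective g ->
    forall y, V y -> V (lift m j r g y).
  move=> g1 fg gi y Vy; have [[p pr yp]|ny] := pselect (region j r y); last by rewrite lift_out.
  rewrite -yp (lift_in D g pr); apply/VE; first exact: (supported_lt g1 rr gi).
  by rewrite fg//; apply/VE => //; rewrite yp.
have hs : stabilizer_comp v (lift m j r K).
  split=> //; apply/seteqP; split.
    by move=> _ [y Vy <-]; apply: (lV K) => //; exact: can_inj Kk.
  move=> y Vy; exists (lift m j r k y); last by rewrite (liftK D k1 rr kK).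
  by apply: (lV k) => //; exact: can_inj kK.
split=> //; apply: (star_fixed hf hv) => // e he.
suff [y ey ly] : exists2 y, e y & lift m j r K y = y.
  by apply: (edge_fixed hf hv hs he ey); rewrite ly.
have [y ey] := edge_nonempty he.
have [[p pr yp]|ny] := pselect (region j r y); last by exists y => //; rewrite lift_out.
rewrite -yp in ey; have [p' ep' /andP[rp' p'r]] := fe e p he pr ey.
by exists (j p') => //; rewrite (lift_in D K p'r) K1.
Qed.

Section Model.
Context (x : M) (m : M -> pt) (j : pt -> M) (r : R) (n : nat) (P q : pt -> R).
Context (Vx : V x) (cx : critical f x) (vm : vmodel f x m j r n P q).

Let D := vm_disk vm.

Lemma model_other y p : V y -> critical f y -> `|p| < r -> y = j p -> y = x.
Proof.
move=> Vy cy pr yp; have Pp : P p = 0.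
  by apply/(vertex_V Vx D (vm0 vm) (vm_hom vm) (vm_f vm) pr); rewrite -yp.
have [p0|p0] := eqVneq p 0; first by rewrite yp p0 (vm0 vm).
by case: (vertex_regular hf D (vm_hom vm) (vm_factor vm) (vm_f vm) pr p0 Pp); rewrite -yp.
Qed.

Context {st : set (reeb f)} (hst : star v st).

Lemma trivial_lift K (rho : R) : plane_diffeo K -> (forall z : pt, rho <= `|z| -> K z = z) ->
  0 < rho -> rho < r -> (forall z : pt, P (K z) = P z) -> star_trivial (v := v) (st := st) (lift m j r K).
Proof.
move=> pK K1 rho0 rr PK; have [k [Kk kK sk]] := plane_diffeo_inv pK.
apply: (supported_trivial hst D _ pK K1 rr) => [p pr|p pr|e p he pr ep].
- apply: (iff_trans (vertex_V Vx D (vm0 vm) (vm_hom vm) (vm_f vm) pr)).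
  exact: (iff_sym (vertex_level (vm_f vm) pr)).
- by rewrite !(vm_f vm)// ?PK//; apply: (supported_lt K1 rr) => //; exact: can_inj Kk.
have [Vy ry] := edge_sub he ep.
have p0 : p != 0 by apply/eqP => p0; apply: ry; rewrite p0 (vm0 vm).
have np : 0 < `|p| by rewrite normr_gt0.
have Pp : P p = 0 by apply/(vertex_V Vx D (vm0 vm) (vm_hom vm) (vm_f vm) pr).
pose u := `|p|^-1 *: p.
have u1 : `|u| = 1 by rewrite normrZ normfV normr_id mulVf// gt_eqF.
have Pu : P u = 0 by rewrite (hom_scale _ _ (vm_hom vm)) Pp mulr0.
have [e' he' ray] := ray_in_edge hf Vx cx D (vm0 vm) (vm_hom vm) (vm_factor vm) (vm_f vm) u1 Pu.
have pu : p = `|p| *: u by rewrite scalerA divff ?scale1r ?gt_eqF.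
have e'y : e' (j p) by rewrite pu; apply: ray; rewrite np pr.
have ee : e = e' by have [_ ->] := edge_eq he ep; have [_ ->] := edge_eq he' e'y.
exists (rho *: u); first by rewrite ee; apply: ray; rewrite rho0.
by rewrite normrZ u1 mulr1 gtr0_norm// lexx.
Qed.

End Model.

End Vertices.

(** * Lifts that are linear near the vertices *)

Section LinearGroup.
Context {R : realType} {M : compact_surface R} {f : M -> R} (hf : classF f).
Local Notation pt := 'rV[R]_2.
Implicit Types (x y : M) (z u w : pt) (h k : M -> M).
Context {v : reeb f} (hv : vertex v).
Let V := component v.
Context {st : set (reeb f)} (hst : star v st).
Context {H : set (st -> st)} (hH : subgroup_of (local_stab v st) H).
Context (hC : conditionC v (phi_preimage v H)).
Let Hs := phi_preimage v H.
Local Notation T := (star_trivial (v := v) (st := st)).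
Context (m : M -> M -> pt) (j : M -> pt -> M) (r : M -> R) (n : M -> nat) (P q : M -> pt -> R).
Context (vm : forall x, V x -> critical f x -> vmodel f x (m x) (j x) (r x) (n x) (P x) (q x)).

(** The condition on [q] excludes the maps diag(t, 1/t) with t different from 1 at a saddle; it is
    what makes [linear_rigid] true there. *)
Definition linear_at h x := exists D D' : pt -> pt,
  [/\ linear D, linear D', cancel D D', cancel D' D &
  [/\ forall z, P (h x) (D z) = P x z, forall z, q (h x) (D z) = q x z &
      \forall z \near (0 : pt), h (j x z) = j (h x) (D z)]].

Definition vertex_linear h := Hs h /\ forall x, V x -> critical f x -> linear_at h x.

Lemma near_linear (D : pt -> pt) (Q : set pt) : linear D -> (\forall z \near (0 : pt), Q z) ->
  \forall z \near (0 : pt), Q (D z).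
Proof.
move=> lD nQ; have := smooth_at_continuous (smooth_linear 0 lD).
by move=> c; apply: c; rewrite (linear0' lD).
Qed.

Lemma linear_at_comp h k x : linear_at k x -> linear_at h (k x) -> linear_at (h \o k) x.
Proof.
move=> [D [D' [lD lD' DD' D'D [PD qD ND]]]] [B [B' [lB lB' BB' B'B [PB qB NB]]]].
exists (B \o D), (D' \o B'); split; [exact: linear_comp|exact: linear_comp|exact: can_comp|exact: can_comp|].
split=> [z|z|] /=; [by rewrite PB|by rewrite qB|].
by apply: filterS2 ND (near_linear lD NB) => z -> ->.
Qed.

Lemma linear_at_inv h k x : cancel h k -> cancel k h -> linear_at h (k x) -> linear_at k x.
Proof.
move=> hk kh [D [D' [lD lD' DD' D'D]]]; rewrite kh => -[PD qD ND].
exists D', D; split=> //; split=> [z|z|]; [by rewrite -PD D'D|by rewrite -qD D'D|].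
by apply: filterS (near_linear lD' ND) => z; rewrite D'D => <-; rewrite hk.
Qed.

Lemma linear_at_eq h k x : V x -> critical f x -> (\forall y \near x, h y = k y) ->
  linear_at h x -> linear_at k x.
Proof.
move=> Vx cx hk [D [D' [lD lD' DD' D'D]]]; have := vm Vx cx => vx.
rewrite (nbhs_singleton hk) => -[PD qD ND]; exists D, D'; split=> //; split=> //.
have n0 : `|0 : pt| < r x by rewrite normr0; exact: disk_gt0 (vm_disk vx).
have cj := disk_j_continuous (vm_disk vx) n0; rewrite -(vm0 vx) in hk.
have N : \forall z \near (0 : pt), h (j x z) = k (j x z) := cj _ hk.
by apply: filterS2 ND N => z <- ->.
Qed.

Lemma vertex_linear_comp h k : vertex_linear h -> vertex_linear k -> vertex_linear (h \o k).
Proof.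
move=> [hh lh] [hk lk]; split; first exact: (subgroup_Hs hv hst hH).
move=> x Vx cx; apply: linear_at_comp; first exact: lk.
have skx := (stabc_V x hk.1).2 Vx.
by apply: lh => //; apply/(stabc_critical hf hv hk.1 Vx).
Qed.

Lemma vertex_linear_inv h : vertex_linear h -> exists k, [/\ vertex_linear k, cancel h k & cancel k h].
Proof.
move=> [hh lh]; have [k [hk hK kh]] := inverse_Hs hv hst hH hh; exists k; split=> //; split=> // x Vx cx.
have skx := (stabc_V x hk.1).2 Vx.
by apply: (linear_at_inv hK kh); apply: lh => //; apply/(stabc_critical hf hv hk.1 Vx).
Qed.

Lemma near_model x (Q : set M) : V x -> critical f x -> (\forall z \near (0 : pt), Q (j x z)) ->
  \forall y \near x, Q y.
Proof.
move=> Vx cx; have vx := vm Vx cx => NQ.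
have n0 : `|0 : pt| < r x by rewrite normr0; exact: disk_gt0 (vm_disk vx).
by have := disk_nbhs (vm_disk vx) n0 NQ; rewrite (vm0 vx).
Qed.

(** [D] is the differential of [h] in the model coordinates, and by [ray_derivative] it scales the
    zero rays by positive factors; so it is the identity by [model_rigid]. *)
Lemma linear_rigid h x : vertex_linear h -> T h -> V x -> critical f x -> \forall y \near x, h y = y.
Proof.
move=> [hh lh] Th Vx cx; have [eh oh xh] := trivial_fixes hf hv hst hH hC Th.
have hx := xh x Vx cx; have vx := vm Vx cx; have rx := disk_gt0 (vm_disk vx).
have [D [D' [lD lD' DD' D'D]]] := lh x Vx cx; rewrite hx => -[PD qD ND].
suff DE : D = id.
  by apply: near_model => //; apply: filterS ND => z; rewrite DE.
have [u u0 Pu] := vm_ray vx.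
apply: (model_rigid (vm_hom vx) (vm_factor vx) u0 Pu (vm_balanced vx) lD PD qD) => w Pw.
have [a a0 Da] := ray_derivative hf hv Vx cx (vm_disk vx) (vm0 vx) (vm_hom vx) (vm_factor vx)
  (vm_f vx) hh.1 hx eh oh Pw.
exists a => //; rewrite -Da -(dmap_of_linear 0 w lD); apply: dmap_near.
have N : \forall z \near (0 : pt), `|D z| < r x.
  by apply: (near_linear lD (Q := fun z => `|z| < r x)); apply: near_norm_lt; rewrite normr0.
by apply: filterS2 ND N => z /= -> Dr; rewrite (disk_mK (vm_disk vx) Dr).
Qed.

Section ModelMap.
Context (h : M -> M) (x : M) (hh : stabilizer_comp v h) (Vx : V x) (cx : critical f x).
Let F := m (h x) \o h \o j x.

Lemma model_map : [/\ smooth_at 0 F, F 0 = 0, jac F 0 != 0,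
  \forall z \near (0 : pt), P (h x) (F z) = P x z &
  \forall z \near (0 : pt), j (h x) (F z) = h (j x z)].
Proof.
have vx := vm Vx cx; have Vhx := (stabc_V x hh).2 Vx.
have chx : critical f (h x) by apply/(stabc_critical hf hv hh Vx).
have vhx := vm Vhx chx; have D := vm_disk vx; have D' := vm_disk vhx.
have n0 : `|0 : pt| < r x by rewrite normr0; exact: disk_gt0 D.
have n0' : `|0 : pt| < r (h x) by rewrite normr0; exact: disk_gt0 D'.
have hr : region (j (h x)) (r (h x)) (h (j x 0)) by exists 0 => //; rewrite (vm0 vx) (vm0 vhx).
have [[dh fh] _] := hh; have [smh _] := dh.
have N := disk_map_near D D' (stab_continuous hh.1) n0 hr.
split; [exact: (disk_map D D' smh n0 hr)| |exact: (disk_map_jac D D' dh n0 hr)| |].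
- by rewrite /F /= (vm0 vx) -{2}(vm0 vhx) (disk_mK D').
- apply: filterS2 N (near_norm_lt n0) => z [jF Fr] zr.
  apply: (addrI (f (h x))); rewrite -(vm_f vhx Fr) jF (stab_f _ hh.1) (vm_f vx zr).
  by rewrite (stab_f _ hh.1).
- by apply: filterS N => z [].
Qed.

Lemma degree_le : (n x <= n (h x))%N.
Proof.
rewrite leqNgt; apply/negP => lt; have [sF F0 jF PF _] := model_map.
have Vhx := (stabc_V x hh).2 Vx.
have chx : critical f (h x) by apply/(stabc_critical hf hv hh Vx).
apply: (factor_neq0 (vm_factor (vm Vhx chx))) => w.
have [B [_ _ BA]] := linear_inverse (dmap_linear sF) (fun u => dmap_inj sF jF).
by rewrite -(BA w); apply: (dmap_degree _ (vm_hom (vm Vx cx)) (vm_hom (vm Vhx chx))).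
Qed.

End ModelMap.

Lemma degree_eq h x : stabilizer_comp v h -> V x -> critical f x -> n x = n (h x).
Proof.
move=> hh Vx cx; apply/eqP; rewrite eqn_leq degree_le//=.
have [k [hk hK kh]] := stabc_inv hh.
rewrite -{2}[x]hK; apply: degree_le => //; first exact/stabc_V.
by apply/(stabc_critical hf hv hh Vx).
Qed.

(** Let [F] be [h] in model coordinates and [D] the isometry that replaces its differential. The
    germ g = F^-1 D preserves [P] and scales the zero rays positively, so [germ_extension] extends
    it to a map [k] supported in the disk, and [h \o k] is [D] near the vertex. *)
Lemma vertex_correction h x : stabilizer_comp v h -> V x -> critical f x ->
  exists k, [/\ T k, linear_at (h \o k) x &
    forall y, V y -> critical f y -> y <> x -> \forall z \near y, k z = z].
Proof.
move=> hh Vx cx; have [sF F0 jF PF jhF] := model_map hh Vx cx.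
set F := m (h x) \o h \o j x in sF F0 jF PF jhF.
have vx := vm Vx cx; have Vhx := (stabc_V x hh).2 Vx.
have chx : critical f (h x) by apply/(stabc_critical hf hv hh Vx).
have vhx := vm Vhx chx; have rx := disk_gt0 (vm_disk vx).
have hP' := vm_hom vhx; have bq' := vm_balanced vhx; rewrite -(degree_eq hh Vx cx) in hP' bq'.
have PA z := dmap_preserves z (vm_hom vx) hP' sF F0 PF.
have [D [D' [lD lD' DD' D'D [PD qD DA]]]] := model_exists (vm_hom vx) hP' (vm_balanced vx) bq'
  (dmap_linear sF) (fun u => dmap_inj sF jF) PA.
have [d [G [d0 Finj cG G0 NG]]] := inverse_function sF jF.
have sGF : smooth_at (F 0) G by have [] := nbhs_singleton NG.
have cGF := continuous_comp (smooth_at_continuous sF) cG.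
rewrite F0 in cG G0 NG.
have sG : smooth_at 0 G by have [] := nbhs_singleton NG.
have cF : {for 0, continuous F} := smooth_at_continuous sF.
pose g := G \o D.
have sg : smooth_at 0 g.
  by apply: (smooth_comp_pt (smooth_linear 0 lD)); rewrite (linear0' lD).
have g0 : g 0 = 0 by rewrite /g /= (linear0' lD).
have cg : {for 0, continuous g} := smooth_at_continuous sg.
have gnear (Q : set pt) : (\forall z \near (0 : pt), Q z) -> \forall z \near (0 : pt), Q (g z).
  by move=> NQ; apply: cg; rewrite g0.
have FgD : \forall z \near (0 : pt), F (g z) = D z.
  by apply: filterS (near_linear lD NG) => z [].
have Pg : \forall z \near (0 : pt), P x (g z) = P x z.
  by apply: filterS2 FgD (gnear _ PF) => z FD <-; rewrite FD PD.
have GF : \forall z \near (0 : pt), G (F z) = z.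
  have N1 : \forall z \near (0 : pt), F (G (F z)) = F z /\ smooth_at (F z) G.
    by apply: (cF (fun w => F (G w) = w /\ smooth_at w G)); rewrite F0.
  have nd : \forall z \near (0 : pt), `|z - 0| < d.
    by have := near_norm_lt (p := 0) (r := d); rewrite normr0 => /(_ d0); apply: filterS => z; rewrite subr0.
  have N2 : \forall z \near (0 : pt), `|G (F z) - 0| < d.
    by apply: (cGF (fun w => `|w - 0| < d)); rewrite /= F0 G0; move: nd; apply: filterS.
  by apply: filterS3 N1 N2 nd => z [e _] a b; exact: Finj.
have gray u : P x u = 0 -> exists2 a : R, 0 < a & dmap g 0 u = a *: u.
  move=> Pu; have [a a0 Da] := DA u Pu; exists a^-1; first by rewrite invr_gt0.
  have sGD : smooth_at (D 0) G := eq_ind_r (fun w => smooth_at w G) sG (linear0' lD).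
  rewrite (dmap_comp _ (smooth_linear 0 lD) sGD) (linear0' lD) (dmap_of_linear _ _ lD).
  have -> : D u = a^-1 *: dmap F 0 u.
    by rewrite -[dmap F 0 u]D'D Da (linearZ' _ _ lD) scalerA mulVf ?scale1r ?gt_eqF.
  rewrite (linearZ' _ _ (dmap_linear sG)); congr (_ *: _).
  by rewrite -{1}F0 -(dmap_comp _ sF sGF) (dmap_near _ GF) dmap_id.
have [u u0 Pu] := vm_ray vx.
have r2 : 0 < r x / 2 by rewrite divr_gt0.
have rr : r x / 2 < r x by lra.
have [K [pK Kg K1 PK]] := germ_extension (vm_hom vx) (vm_factor vx) u0 Pu sg g0 Pg gray r2.
have K0 : K 0 = 0 by rewrite (nbhs_singleton Kg).
have n0 : `|0 : pt| < r x by rewrite normr0.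
exists (lift (m x) (j x) (r x) K); split.
- exact: (trivial_lift hf hv Vx cx vx hst pK K1 r2 rr PK).
- have lx : lift (m x) (j x) (r x) K (j x 0) = j x 0 by rewrite (lift_in (vm_disk vx) K n0) K0.
  rewrite (vm0 vx) in lx.
  exists D, D'; split=> //; rewrite /comp lx; split=> //.
  have N : \forall z \near (0 : pt), [/\ K z = g z, F (g z) = D z & j (h x) (F (g z)) = h (j x (g z))].
    by apply: filterS3 Kg FgD (gnear _ jhF) => z.
  apply: filterS2 N (near_norm_lt n0) => z [e e1 e2] zr.
  by rewrite (lift_in (vm_disk vx) K zr) e -e2 e1.
move=> y Vy cy yx; apply: (lift_near_out (vm_disk vx) K1 rr) => -[p pr yp].
by apply: yx; apply: (model_other hf Vx vx Vy cy (le_lt_trans pr rr)).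
Qed.

Lemma linear_correction h : Hs h -> exists2 k, T k & vertex_linear (h \o k).
Proof.
move=> hh; have ex (A : set M) : exists k : M -> M, Xi0 v A -> [/\ T k,
    forall x, A x -> linear_at (h \o k) x &
    forall B, Xi0 v B -> A <> B -> forall y, B y -> \forall z \near y, k z = z].
  have [[x [Vx cx] <-]|no] := pselect (Xi0 v A); last by exists id.
  have [k [Tk lk ok]] := vertex_correction hh.1 Vx cx; exists k => _; split=> //.
    by move=> _ ->.
  move=> _ [y [Vy cy] <-] xy _ ->; apply: ok => // yx.
  by apply: xy; rewrite yx.
have [kk kkP] := choice ex.
have [K TK HK] : exists2 K, T K & forall A, Xi0 v A -> forall x, A x -> \forall y \near x, K y = kk A y.
  apply: (fragments (Y := Xi0 v) (S := T)) => //.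
  - by apply: finite_image; exact: finite_vertices.
  - exact: trivial_id.
  - by move=> k k'; exact: trivial_comp.
  - by move=> k [[/stab_continuous]].
  - move=> k _ Tk [x [Vx cx] <-] _ [_ -> <-].
    by have [_ _ ->] := trivial_fixes hf hv hst hH hC Tk.
  - by move=> A /kkP[].
  - by move=> A B /kkP[_ _ +] YB AB x Bx; apply; [exact: YB| |].
exists K => //; split; first exact: (subgroup_Hs hv hst hH hh (trivial_Hs hH TK)).
move=> x Vx cx; have Yx : Xi0 v [set x] by exists x.
have [_ /(_ x erefl) lx _] := kkP _ Yx.
apply: linear_at_eq lx => //; apply: filterS (HK _ Yx x erefl) => y /= -> //.
Qed.

End LinearGroup.
Lemma derive_mix (R : realType) (V : normedModType R) (a b g : V -> R) p v : derivable a p v ->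
  derivable b p v -> derivable g p v -> 'D_v b p = 0 ->
  'D_v (a + b * (g - a)) p = 'D_v a p + b p * ('D_v g p - 'D_v a p).
Proof.
move=> da db dg b0; have dga : derivable (g - a) p v by exact: derivableB.
rewrite (deriveD da (derivableM db dga)) (deriveM db dga) (deriveB dg da).
by rewrite b0 scaler0 addr0.
Qed.

(** * Diffeomorphisms preserving the horizontal lines *)

Section Shear.
Context {R : realType}.
Local Notation pt := 'rV[R]_2.
Implicit Types (p q z w : pt) (t s : R).

Lemma shear_increasing (g : pt -> R) z t : 0 < t ->
  (forall s, 0 <= s <= t -> smooth_at (z + s *: e0) g /\ 0 < 'D_e0 g (z + s *: e0)) -> g z < g (z + t *: e0).
Proof.
move=> t0 H.
have H' s : 0 <= s <= 1 -> smooth_at (z + s *: (t *: e0)) g /\ 0 < 'D_e0 g (z + s *: (t *: e0)).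
  move=> /andP[s0 s1]; rewrite scalerA; apply: H.
  by apply/andP; split; [apply: mulr_ge0 => //; exact: ltW|apply: ler_piMl => //; exact: ltW].
have [s s01 E] : exists2 s : R, 0 <= s <= 1 & g (z + t *: e0) - g z = 'D_(t *: e0) g (z + s *: (t *: e0)).
  by apply: line_mvt => s /H'[/smooth_at_diff/diff_derivable].
have [sg g0] := H' s s01; rewrite -subr_gt0 E (smooth_deriveE _ sg) !cE mulr0 mul0r addr0 mulr1.
exact: mulr_gt0.
Qed.

(** On each horizontal line the map is strictly increasing and equal to the identity far out, hence
    bijective by the intermediate value theorem; its Jacobian is the horizontal derivative of the
    first coordinate. *)
Lemma shear_diffeo (K : pt -> pt) (rho : R) : (forall p, smooth_at p K) ->
  (forall p, cY (K p) = cY p) -> (forall p, 0 < 'D_e0 (cX \o K) p) ->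
  (forall p, rho <= `|p| -> K p = p) -> plane_diffeo K.
Proof.
move=> sK KY K0 K1; pose g := cX \o K.
have sg p : smooth_at p g by have [] := (smooth_at_pt _ _).1 (sK p).
have mono z t : 0 < t -> g z < g (z + t *: e0) by move=> t0; apply: shear_increasing.
have wz z w : cY z = cY w -> w = z + (cX w - cX z) *: e0.
  by move=> e; apply: ptP; rewrite !cE; [ring|rewrite e; ring].
have iK : injective K.
  move=> z w e; have Y : cY z = cY w by rewrite -KY e KY.
  have gzw : g z = g w by rewrite /g /= e.
  have [h|h|h] := ltgtP (cX z) (cX w); last exact: ptP.
    by have := mono z (cX w - cX z); rewrite subr_gt0 -(wz _ _ Y) gzw ltxx => /(_ h).
  by have := mono w (cX z - cX w); rewrite subr_gt0 -(wz _ _ (esym Y)) gzw ltxx => /(_ h).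
have oK w : exists z, K z = w.
  pose B := Num.max `|w| rho; have wB : `|w| <= B by rewrite le_max lexx.
  have rB : rho <= B by rewrite le_max lexx orbT.
  have B0 : 0 <= B by exact: le_trans wB.
  have big t : B <= `|t| -> g (mk t (cY w)) = t.
    move=> Bt; rewrite /g /= K1 ?cE//; apply: le_trans rB (le_trans Bt _).
    by rewrite -[t in X in X <= _](cX_mk t (cY w)) cX_le.
  have cg : continuous (fun t => g (mk t (cY w))).
    move=> t; apply: (continuous_comp (f := fun t => mk t (cY w)) (g := g)).
      by apply: mk_continuous; [exact: cvg_id|exact: cvg_cst].
    exact: smooth_at_continuous.
  have /andP[w1 w2] : - B <= cX w <= B by rewrite -ler_norml; exact: le_trans (cX_le w) wB.
  have [|||c _ gc] := @IVT R (fun t => g (mk t (cY w))) (- B) B (cX w).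
  - by rewrite ge0_cp.
  - exact: continuous_subspaceT.
  - by rewrite !big ?normrN ?ger0_norm// ge_min w1/= le_max w2 orbT.
  by exists (mk c (cY w)); apply: ptP => //; rewrite KY cE.
have [k kP] := choice oK.
split=> // [|p]; first by exists k => [z|w]; [apply: iK; rewrite kP|exact: kP].
rewrite /jac (_ : cY \o K = @cY R); last exact/funext.
by rewrite !derive_Y !cE mulr1 mulr0 subr0 gt_eqF.
Qed.

(** [F] is controlled only near a segment of the horizontal axis. It is cut off by a function of the
    second coordinate alone, which is constant on horizontal lines; near the ends of the segment [F]
    is already the identity. *)
Lemma shear_extension (F : pt -> pt) (r rho : R) : 0 <= rho -> rho < r ->
  (forall t, `|t| < r -> \forall z \near mk t 0,
     [/\ smooth_at z F, cY (F z) = cY z & 0 < 'D_e0 (cX \o F) z]) ->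
  (forall t, rho < `|t| -> `|t| < r -> \forall z \near mk t 0, F z = z) ->
  exists K rho', [/\ plane_diffeo K, rho' < r, forall z, rho' <= `|z| -> K z = z,
    forall z, cY (K z) = cY z & forall t, `|t| < r -> \forall z \near mk t 0, K z = F z].
Proof.
move=> rho0 rr NF NI; pose r1 := (2 * rho + r) / 3; pose r2 := (rho + 2 * r) / 3.
have [h1 h2 h3] : [/\ rho < r1, r1 < r2 & r2 < r] by rewrite /r1 /r2; split; lra.
have r20 : 0 < r2 by lra.
pose good z := [/\ smooth_at z F, cY (F z) = cY z, 0 < 'D_e0 (cX \o F) z & r1 <= `|cX z| -> F z = z].
have Ng t : `|t| < r -> \forall z \near mk t 0, good z.
  move=> tr; have [t1|t1] := ltP `|t| r1; last first.
    by apply: filterS2 (NF t tr) (NI t (lt_le_trans h1 t1) tr) => z [a b c d].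
  have N : \forall z \near mk t 0, `|cX z| < r1.
    have c : {for mk t 0, continuous (fun z : pt => `|cX z|)}.
      by apply: continuous_comp; [exact: cX_continuous|exact: norm_continuous].
    by apply: (c (fun y => y < r1)); rewrite cE; exact: lt_nbhsl.
  by apply: filterS2 (NF t tr) N => z [a b c d]; split=> //; rewrite leNgt d.
(* Compactness of the segment gives one height [d] up to which [F] is under control over the whole
   of it. *)
have [d [d0 dr hd]] : exists d : R, [/\ 0 < d, d <= r2 & forall z, `|cX z| <= r2 -> `|cY z| < d -> good z].
  suff [d d0 hd] : exists2 d : R, 0 < d & forall t s, t \in `[- r2, r2] -> `|s| < d -> good (mk t s).
    exists (Num.min d r2); split; [by rewrite lt_min d0|by rewrite ge_min lexx orbT|].
    move=> z zx zy; rewrite -[z]mkK; apply: hd; first by rewrite in_itv /= -ler_norml.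
    by apply: lt_le_trans zy _; rewrite ge_min lexx.
  have := @compact_ind R `[- r2, r2]%classic (fun B => exists2 d : R, 0 < d &
    forall t s, t \in B -> `|s| < d -> good (mk t s)) (@segment_compact R _ _).
  case.
  - by exists 1 => // t s; rewrite inE.
  - move=> B C [d d0 hd] [d' d'0 hd']; exists (Num.min d d'); first by rewrite lt_min d0.
    move=> t s; rewrite inE lt_min => -[Bt|Ct] /andP[sd sd'].
      by apply: hd => //; exact: mem_set.
    by apply: hd' => //; exact: mem_set.
  - by move=> B C BC [d d0 hd]; exists d => // t s; rewrite inE => /BC Ct; apply: hd; exact: mem_set.
  - move=> t; rewrite /= in_itv /= -ler_norml => tr.
    have /near_norm[d d0 hd] := Ng t (le_lt_trans tr h3).
    exists (ball t d); first exact: nbhsx_ballx.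
    exists d => // t' s; rewrite inE => bt sd; apply: hd; apply/norm_ltP.
    by rewrite !cE subr0; split=> //; rewrite distrC.
  - move=> d d0 hd; exists d => // t s ts; apply: hd; rewrite inE /=; move: ts; by rewrite in_itv.
pose g := cX \o F; pose chi z := cutoff (d / 2) (mk 0 (cY z)).
have d2 : 0 < d / 2 by rewrite divr_gt0.
pose dom z := (`|cX z| < r2) && (`|cY z| < d).
(* Convex combination of two increasing functions of the first coordinate. *)
pose G z := mk (cX z + chi z * (g z - cX z)) (cY z).
pose K z := if dom z then G z else z.
have GX z : F z = z -> G z = z by move=> e; apply: ptP; rewrite !cE// /g /= e subrr mulr0 addr0.
have chi0 z : d / 2 <= `|cY z| -> chi z = 0.
  by move=> h; apply: cutoff0 => //; apply: le_trans h _; rewrite -{1}(cY_mk 0 (cY z)) cY_le.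
have chi1 z : `|cY z| <= d / 4 -> chi z = 1.
  move=> h; apply: cutoff1 => //; apply/norm_leP; rewrite !cE normr0.
  by split; [|apply: le_trans h _]; lra.
have chi01 z : 0 <= chi z <= 1 by exact: cutoff01.
have GY z : d / 2 <= `|cY z| -> G z = z.
  by move=> h; apply: ptP; rewrite !cE// chi0// mul0r addr0.
have open_lt (u : pt -> R) (a : R) z : continuous u -> `|u z| < a -> \forall w \near z, `|u w| < a.
  move=> cu h; have c : {for z, continuous (fun w => `|u w|)}.
    by apply: continuous_comp; [exact: cu|exact: norm_continuous].
  by apply: (c (fun y => y < a)); exact: lt_nbhsl.
have open_gt (u : pt -> R) (a : R) z : continuous u -> a < `|u z| -> \forall w \near z, a < `|u w|.
  move=> cu h; have c : {for z, continuous (fun w => `|u w|)}.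
    by apply: continuous_comp; [exact: cu|exact: norm_continuous].
  by apply: (c (fun y => a < y)); exact: lt_nbhsr.
have Kid w : r1 <= `|cX w| \/ d / 2 <= `|cY w| -> K w = w.
  rewrite /K; case: ifP => // /andP[wx wy] [h|h]; last exact: GY.
  by apply: GX; have [_ _ _] := hd w (ltW wx) wy; apply.
have Kin z : dom z -> \forall w \near z, K w = G w.
  move=> /andP[zx zy]; apply: filterS2 (open_lt _ _ z cX_continuous zx) (open_lt _ _ z cY_continuous zy).
  by move=> w wx wy; rewrite /K /dom wx wy.
have Kout z : ~~ dom z -> \forall w \near z, K w = w.
  rewrite negb_and -!leNgt => /orP[h|h].
    apply: filterS (open_gt _ _ z cX_continuous (lt_le_trans h2 h)) => w wx.
    by apply: Kid; left; exact: ltW.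
  have h' : d / 2 < `|cY z| by lra.
  by apply: filterS (open_gt _ _ z cY_continuous h') => w wy; apply: Kid; right; exact: ltW.
have goodd z : dom z -> good z by move=> /andP[zx zy]; apply: hd => //; exact: ltW.
have sL z : smooth_at z (fun z : pt => mk 0 (cY z)) by apply: smooth_mk; [exact: smooth_cst|exact: smooth_Y].
have schi z : smooth_at z chi.
  by apply: (smooth_comp (F := fun z : pt => mk 0 (cY z))); [exact: sL|exact: smooth_cutoff].
have sg z : dom z -> smooth_at z g by move=> /goodd[/smooth_at_pt[]].
have sH z : dom z -> smooth_at z (fun w => g w - cX w).
  by move=> /sg s; apply: smoothB; [exact: s|exact: smooth_X].
have sM z : dom z -> smooth_at z (fun w => chi w * (g w - cX w)).
  by move=> dz; have := smoothM (schi z) (sH z dz).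
have sG z : dom z -> smooth_at z G.
  move=> dz; apply: smooth_mk; last exact: smooth_Y.
  by have := smoothD (smooth_X z) (sM z dz).
have sK z : smooth_at z K.
  have [dz|ndz] := boolP (dom z).
    by apply: smooth_at_eq (sG z dz); apply: filterS (Kin z dz) => w ->.
  by apply: smooth_at_eq (smooth_id z); apply: filterS (Kout z ndz) => w ->.
have KY z : cY (K z) = cY z by rewrite /K; case: ifP => //; rewrite /G cE.
have dchi z : 'D_e0 chi z = 0.
  have sc := smooth_cutoff (d / 2) (mk 0 (cY z)).
  have [sX sY] := (smooth_at_pt _ _).1 (sL z).
  have [_ /(_ e0)] := derive_comp_pt (smooth_at_diff sc) (smooth_at_diff sX) (smooth_at_diff sY).
  rewrite -/chi => ->; move: ('D_e0 (cutoff _) _) ('D_e1 (cutoff _) _) => a b.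
  rewrite (_ : cX \o _ = cst 0); last by apply/funext => w /=; rewrite cE.
  rewrite derive_cst (_ : cY \o _ = @cY R); last by apply/funext => w /=; rewrite cE.
  by rewrite derive_Y !cE !mul0r addr0.
have K0 z : 0 < 'D_e0 (cX \o K) z.
  have [dz|ndz] := boolP (dom z); last first.
    rewrite (@eq_near_derive _ _ _ _ cX); last by apply: filterS (Kout z ndz) => w /= ->.
    by rewrite derive_X cE.
  rewrite (@eq_near_derive _ _ _ _ (@cX R + chi * (g - @cX R))); last first.
    by apply: filterS (Kin z dz) => w /= ->; rewrite /G cE.
  have dvX : derivable cX z e0 := diff_derivable (smooth_at_diff (smooth_X z)).
  have dvg : derivable g z e0 := diff_derivable (smooth_at_diff (sg z dz)).
  have dvc : derivable chi z e0 := diff_derivable (smooth_at_diff (schi z)).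
  rewrite (derive_mix dvX dvc dvg (dchi z)) derive_X cE.
  have [_ _ g0 _] := goodd z dz; move: g0 (chi01 z); rewrite -/g.
  move: ('D_e0 g z) (chi z) => X Y X0 /andP[Y0 Y1].
  have [->|Yn] := eqVneq Y 0; first by rewrite mul0r addr0.
  have YX : 0 < Y * X by rewrite mulr_gt0// lt_neqAle eq_sym Yn.
  rewrite mulrBr mulr1; lra.
have Kr z : r2 <= `|z| -> K z = z.
  move=> zr; apply: Kid; have [h|h] := leP r1 `|cX z|; [by left|right].
  rewrite leNgt; apply/negP => h'; move: zr; rewrite leNgt => /negP[]; apply/norm_ltP.
  by split; [exact: lt_trans h2|move: h' dr d0; move: `|cY z| => y; lra].
exists K, r2; split=> //; first exact: (shear_diffeo sK KY K0 Kr).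
move=> t tr; have [tr2|tr2] := ltP `|t| r2; last first.
  have N := NI t (lt_trans h1 (lt_le_trans h2 tr2)) tr.
  have nd : ~~ dom (mk t 0) by rewrite /dom cX_mk ltNge tr2.
  by apply: filterS2 N (Kout _ nd) => z -> ->.
have dt : dom (mk t 0) by rewrite /dom !cE tr2 normr0.
have N : \forall z \near mk t 0, `|cY z| < d / 4.
  by apply: open_lt; [exact: cY_continuous|rewrite cE normr0; lra].
apply: filterS3 (Kin _ dt) (NF t tr) N => z -> [_ Y _] zd.
rewrite /G (chi1 z (ltW zd)) mul1r [cX z + _]addrC subrK -Y; exact: mkK.
Qed.

(** A translation by t' - t along the axis, cut off at radius [rho]. The bound [eps] keeps [t] where
    the cut-off is 1 and makes the perturbation 1/2-Lipschitz, so that [near_identity] applies. *)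
Lemma push (rho : R) : 0 < rho -> exists2 eps : R, 0 < eps & forall t t', `|t| < eps -> `|t'| < eps ->
  exists K, [/\ plane_diffeo K, forall z, rho <= `|z| -> K z = z, forall z, cY (K z) = cY z &
    K (mk t 0) = mk t' 0].
Proof.
move=> rho0; have [Z Z0 hZ] := @cutoff_lip R.
pose c := rho / (4 * (Z + 1)); have Z1 : 0 < 4 * (Z + 1) by lra.
have c0 : 0 < c by exact: divr_gt0.
exists (Num.min (rho / 2) c); first by rewrite lt_min c0 divr_gt0.
move=> t t'; rewrite !lt_min => /andP[t1 t2] /andP[t3 t4].
pose K (z : pt) := z + mk ((t' - t) * cutoff rho z) 0.
have tt : `|t' - t| * (Z / rho) <= 2^-1.
  have h : `|t' - t| <= 2 * c by have := ler_normB t' t; move: t2 t4; move: `|_ - _| `|t| `|t'| => x y z; lra.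
  apply: le_trans (ler_wpM2r _ h) _; first by rewrite divr_ge0// ltW.
  rewrite /c (_ : 2 * (rho / (4 * (Z + 1))) * (Z / rho) = Z / (2 * (Z + 1))); last by field; rewrite !gt_eqF//; lra.
  by rewrite ler_pdivrMr; lra.
have pK : plane_diffeo K.
  apply: near_identity => [p|z w].
    apply: smooth_mk; last exact: smooth_cst.
    by have := smoothM (smooth_cst p (t' - t)) (smooth_cutoff rho p).
  apply/norm_leP; rewrite !cE subrr normr0 -mulrBr normrM; split; last by rewrite mulr_ge0.
  apply: le_trans (ler_wpM2l (normr_ge0 _) (hZ rho z w rho0)) _.
  by rewrite mulrA ler_wpM2r.
exists K; split=> // [z zr|z|].
- by apply: ptP; rewrite !cE ?addr0// cutoff0// mulr0 addr0.
- by rewrite !cE addr0.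
- rewrite /K cutoff1 ?mulr1 //; last by apply/norm_leP; rewrite !cE normr0 (ltW t1); split=> //; lra.
  by apply: ptP; rewrite !cE ?addr0// addrC subrK.
Qed.

End Shear.

(** * Extension along an edge *)

Section EdgeGroup.
Context {R : realType} {M : compact_surface R} {f : M -> R} (hf : classF f).
Local Notation pt := 'rV[R]_2.
Implicit Types (x y : M) (z w p : pt) (t s : R) (h k : M -> M).
Context {v : reeb f} (hv : vertex v).
Let V := component v.
Let E := V `\` critical f.
Context {st : set (reeb f)} (hst : star v st).
Context {H : set (st -> st)} (hH : subgroup_of (local_stab v st) H).
Context (hC : conditionC v (phi_preimage v H)).
Let Hs := phi_preimage v H.
Local Notation T := (star_trivial (v := v) (st := st)).

Definition vertex_trivial k := T k /\ forall x, V x -> critical f x -> \forall y \near x, k y = y.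
Local Notation T1 := vertex_trivial.

Lemma vertex_trivial_id : T1 id.
Proof. by split=> [|x _ _]; [exact: trivial_id|near=> y]. Unshelve. all: by end_near. Qed.

Lemma vertex_trivial_comp h k : T1 h -> T1 k -> T1 (h \o k).
Proof.
move=> [Th nh] [Tk nk]; split; first exact: (trivial_comp hv hst).
by move=> x Vx cx; apply: filterS2 (nh x Vx cx) (nk x Vx cx) => y hy /= ->.
Qed.

Lemma vertex_trivial_inv h : T1 h -> exists k, [/\ T1 k, cancel h k & cancel k h].
Proof.
move=> [[hh ph] nh]; have [k [hk hK kh]] := stabc_inv hh; exists k; split=> //; split.
  split=> //; have := phi_comp hv hst hk hh; rewrite (_ : k \o h = id); last exact/funext.
  by rewrite ph (phi_id hv hst).
by move=> x Vx cx; apply: filterS (nh x Vx cx) => y {1}<-; rewrite hK.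
Qed.

Section Box.
Context (x : M) (m : M -> pt) (j : pt -> M) (r : R) (Vx : V x) (D : disk m j r) (j0 : j 0 = x).
Context (fj : forall p : pt, `|p| < r -> f (j p) = f x + cY p).
Context (e : set M) (he : Xi1 v e) (ex : e x).

(** Inside a box [V] is a single arc without critical points, so it lies on one edge. *)
Lemma box_edge e' p p' : Xi1 v e' -> `|p| < r -> `|p'| < r -> e' (j p) -> cY p' = 0 -> e' (j p').
Proof.
move=> he' pr p'r ep Y; have [Al Ar] := box_arc Vx D j0 fj.
have Vp : V (j p) := (edge_sub he' ep).1.
have /(Ar _).2[s _ sp] : region j r (j p) /\ V (j p) by split=> //; exists p.
have [_ _ _ _] := Al.
apply: (arc_in_edge (t := s) he' Al); last 1 first.
- by apply/Ar; split; [exists p'|apply/(box_level Vx D j0 fj p'r)].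
- move=> y /Ar[[q qr <-] Vq]; split=> //; exact: (box_regular hf D fj).
- by rewrite sp.
Qed.

Lemma box_sub p : `|p| < r -> V (j p) <-> e (j p).
Proof.
move=> pr; split; last by move=> /(edge_sub he)[].
move=> /(box_level Vx D j0 fj pr); apply: (box_edge (p := 0)) => //; last by rewrite j0.
by rewrite normr0; exact: disk_gt0 D.
Qed.

Lemma box_trivial K (rho : R) : plane_diffeo K -> (forall z, rho <= `|z| -> K z = z) -> rho < r ->
  (forall z, cY (K z) = cY z) -> T1 (lift m j r K) /\
  forall y, V y -> ~ e y -> \forall z \near y, lift m j r K z = z.
Proof.
move=> pK K1 rr KY; have r0 := disk_gt0 D; have [k [Kk kK sk]] := plane_diffeo_inv pK.
have off y : V y -> ~ e y -> \forall z \near y, lift m j r K z = z.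
  move=> Vy ney; apply: (lift_near_out D K1 rr) => -[p pr yp].
  by apply: ney; rewrite -yp; apply/box_sub; [exact: le_lt_trans rr|rewrite yp].
split=> //; split; last first.
  by move=> y Vy cy; apply: off => // /(edge_sub he)[].
apply: (supported_trivial hf hv hst D (c := f x) _ pK K1 rr) => [p pr|p pr|e' p he' pr ep].
- rewrite (box_level Vx D j0 fj pr) fj//; split=> [->|]; first by rewrite addr0.
  by move=> /eqP; rewrite -subr_eq0 addrAC subrr add0r => /eqP.
- by rewrite !fj ?KY//; apply: (supported_lt K1 rr) => //; exact: can_inj Kk.
(* A point of the axis between the support and the rim of the box; the maximum with 0 takes care of
   a negative [rho]. *)
pose a := (Num.max rho 0 + r) / 2.
have [h1 h2] : rho <= Num.max rho 0 /\ 0 <= Num.max rho 0 by rewrite !le_max !lexx orbT.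
have h3 : Num.max rho 0 < r by rewrite gt_max rr.
have na : `|mk a 0 : pt| = a.
  apply/le_anti/andP; split; last first.
    by rewrite -[X in X <= _]ger0_norm -?[X in `|X| <= _](cX_mk a 0) ?cX_le// /a; lra.
  by apply/norm_leP; rewrite !cE normr0 ger0_norm /a; lra.
have ra : rho <= a < r by rewrite /a; apply/andP; split; lra.
exists (mk a 0); last by rewrite na.
by apply: (box_edge he' pr _ ep); rewrite ?cE// na; case/andP : ra.
Qed.

(** In the box [k] preserves the second coordinate because it preserves [f], so the horizontal
    derivative of its first coordinate does not vanish on the axis. Near the ends of the axis [k] is
    the identity, so this derivative is positive throughout by connectedness, and [shear_extension]
    applies. *)
Lemma strip k (S : set M) : T1 k -> compact S -> S `<=` e -> S `<=` region j r ->
  (forall y, e y -> ~ S y -> \forall z \near y, k z = z) ->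
  exists K, [/\ T1 K, forall y, e y -> \forall z \near y, K z = k z &
    forall y, V y -> ~ e y -> \forall z \near y, K z = z].
Proof.
move=> [Tk nk] cS Se Sr kS; have r0 := disk_gt0 D.
have [ke _ _] := trivial_fixes hf hv hst hH hC Tk; have [[sk _] _] := Tk; have [dk fk] := sk.
have ik : injective k by have [k' [_ /can_inj]] := stab_inv sk.
have [rho [rho0 rr hrho]] : exists rho : R, [/\ 0 <= rho, rho < r & forall y, S y -> `|m y| <= rho].
  apply: (@compact_ind _ S (fun B => exists rho : R, [/\ 0 <= rho, rho < r & forall y, B y -> `|m y| <= rho])) => //.
  - by exists 0.
  - move=> B C [a [a0 ar ha]] [b [b0 br hb]]; exists (Num.max a b).
    split; [by rewrite le_max a0|by rewrite gt_max ar|].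
    by move=> y [/ha|/hb] h; rewrite le_max h ?orbT.
  - by move=> B C BC [a [a0 ar ha]]; exists a; split=> // y /BC; exact: ha.
  - move=> y /Sr yr; have [_ my] := disk_jm D yr.
    exists [set y' | `|m y'| < (`|m y| + r) / 2].
      have c : {for y, continuous (fun y' => `|m y'|)}.
        by apply: continuous_comp; [exact: (disk_m_continuous D yr)|exact: norm_continuous].
      by apply: (c (fun a => a < (`|m y| + r) / 2)); apply: lt_nbhsl; lra.
    exists ((`|m y| + r) / 2); split; [by have := normr_ge0 (m y); lra|lra|by move=> z /ltW].
have nt t : `|t| < r -> `|mk t 0 : pt| < r by move=> tr; apply/norm_ltP; rewrite !cE normr0.
have et t : `|t| < r -> e (j (mk t 0)).
  by move=> tr; apply/(box_sub (nt t tr))/(box_level Vx D j0 fj (nt t tr)); rewrite cE.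
have kr t : `|t| < r -> region j r (k (j (mk t 0))).
  move=> tr; have eky : e (k (j (mk t 0))) by rewrite -(ke e he); exists (j (mk t 0)) => //; exact: et.
  have [/Sr//|nS] := pselect (S (k (j (mk t 0)))).
  by rewrite (ik _ _ (nbhs_singleton (kS _ eky nS))); exists (mk t 0) => //; exact: nt.
pose F := m \o k \o j.
have sF t : `|t| < r -> smooth_at (mk t 0) F.
  by move=> tr; apply: (disk_map D D) => //; [case: dk|exact: nt|exact: kr].
have NF t : `|t| < r -> \forall z \near mk t 0, [/\ j (F z) = k (j z), `|F z| < r & cY (F z) = cY z].
  move=> tr; have N := disk_map_near D D (stab_continuous sk) (nt t tr) (kr t tr).
  apply: filterS2 N (near_norm_lt (nt t tr)) => z [jF Fr] zr; split=> //.
  by apply: (addrI (f x)); rewrite -!fj// jF stab_f.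
have NI t : rho < `|t| -> `|t| < r -> \forall z \near mk t 0, F z = z.
  move=> tr tr'; have nS : ~ S (j (mk t 0)).
    move=> /hrho; rewrite (disk_mK D (nt t tr')) leNgt => /negP; apply.
    by apply: lt_le_trans tr _; rewrite -[t in X in X <= _](cX_mk t 0) cX_le.
  have N : \forall z \near mk t 0, k (j z) = j z.
    exact: (disk_j_continuous D (nt t tr') (kS _ (et t tr') nS)).
  by apply: filterS2 N (near_norm_lt (nt t tr')) => z kz zr; rewrite /F /= kz (disk_mK D).
pose u t := 'D_e0 (cX \o F) (mk t 0).
have sX t : `|t| < r -> smooth_at (mk t 0) (cX \o F) by move=> /sF/smooth_at_pt[].
have cu t : `|t| < r -> {for mk t 0, continuous ('D_e0 (cX \o F))}.
  by move=> tr; apply: smooth_at_continuous; apply: smooth_at_derive; exact: sX.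
have un t : `|t| < r -> u t != 0.
  move=> tr; have := disk_map_jac D D dk (nt t tr) (kr t tr); rewrite -/F /jac.
  have NY : \forall z \near mk t 0, (cY \o F) z = cY z by apply: filterS (NF t tr) => z [].
  by rewrite !(eq_near_derive _ NY) !derive_Y !cE mulr1 mulr0 subr0.
have u0 t : `|t| < r -> 0 < u t.
  move=> tr; pose a := (rho + r) / 2; have [a1 a2] : rho < a /\ a < r by rewrite /a; lra.
  have aa : `|a| = a by rewrite ger0_norm //; lra.
  apply: (@connected_near_ind R `]- r, r[ (fun t => 0 < u t) a t).
  - by apply/connected_intervalP; exact: interval_is_interval.
  - by rewrite /= in_itv /= -ltr_norml aa.
  - by rewrite /= in_itv /= -ltr_norml.
  - have NX : \forall z \near mk a 0, (cX \o F) z = cX z.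
      by apply: filterS (NI a _ _) => [z /= ->|//|]; rewrite ?aa.
    by rewrite /u (eq_near_derive _ NX) derive_X cE.
  move=> b; rewrite /= in_itv /= -ltr_norml => br.
  have cb : {for b, continuous u}.
    apply: (continuous_comp (f := fun t => mk t 0) (g := 'D_e0 (cX \o F))); last exact: cu.
    by apply: mk_continuous; [exact: cvg_id|exact: cvg_cst].
  have [h|h|h] := ltgtP 0 (u b); last by have := un b br; rewrite -h eqxx.
    have N : \forall c \near b, 0 < u c by apply: (cb (fun c => 0 < c)); exact: lt_nbhsr.
    by apply: filterS N => c uc _; split.
  have N : \forall c \near b, u c < 0 by apply: (cb (fun c => c < 0)); exact: lt_nbhsl.
  by apply: filterS N => c uc _; split=> // uc'; move: (lt_trans uc uc'); rewrite ltxx.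
have [|K [r' [pK r'r K1 KY KF]]] := shear_extension rho0 rr _ NI.
  move=> t tr; have N : \forall z \near mk t 0, 0 < 'D_e0 (cX \o F) z.
    by apply: (cu t tr (fun c => 0 < c)); apply: lt_nbhsr; exact: u0.
  by apply: filterS3 (smooth_at_near (sF t tr)) (NF t tr) N => z sz [].
have [TK oK] := box_trivial pK K1 r'r KY.
exists (lift m j r K); split=> // y ey; have Vy : V y := (edge_sub he ey).1.
have [[p pr yp]|ny] := pselect (region j r y).
  rewrite -yp in ey Vy *; have Y0 := (box_level Vx D j0 fj pr).1 Vy.
  have pE : p = mk (cX p) 0 by rewrite -Y0 mkK.
  have xr : `|cX p| < r by exact: le_lt_trans (cX_le p) pr.
  apply: (disk_nbhs D pr); rewrite pE; rewrite pE in pr.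
  apply: filterS3 (KF _ xr) (NF _ xr) (near_norm_lt pr) => z e1 [e2 _ _] zr.
  by rewrite (lift_in D K zr) e1.
have N : \forall z \near y, lift m j r K z = z.
  by apply: (lift_near_out D K1 r'r) => -[p pr yp]; apply: ny; exists p => //; exact: le_lt_trans r'r.
have nS : ~ S y by move=> /Sr.
by apply: filterS2 N (kS y ey nS) => z -> ->.
Qed.

End Box.

Lemma edge_box e x : Xi1 v e -> e x -> exists (m : M -> pt) j r,
  [/\ disk m j r, j 0 = x & forall p : pt, `|p| < r -> f (j p) = f x + cY p].
Proof.
by move=> he ex; have [Vx rx] := edge_sub he ex; exact: (regular_disk hf (comp_inner hf hv Vx) rx).
Qed.

Definition off_edge e k := forall y, V y -> ~ e y -> \forall z \near y, k z = z.

(** [strip] works in one box only, while the support of a kernel element on [e] may need several. A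
    map of [T1] that is the identity near the rest of [V] carries the compact piece of the edge into
    a single box. *)
Lemma compress e (ga : R -> M) (a b : R) : Xi1 v e -> arc V ga -> range ga = e ->
  exists si, [/\ T1 si, off_edge e si & exists x (m : M -> pt) j r, [/\ e x, disk m j r, j 0 = x,
    forall p : pt, `|p| < r -> f (j p) = f x + cY p &
    forall c, a <= c -> c <= b -> region j r (si (ga c))]].
Proof.
move=> he aga gE; have [cga iga Vga oga] := aga.
have ega t : e (ga t) by rewrite -gE; exists t.
pose Q b := exists si, [/\ T1 si, off_edge e si & exists x (m : M -> pt) j r, [/\ e x, disk m j r, j 0 = x,
    forall p : pt, `|p| < r -> f (j p) = f x + cY p &
    forall c, a <= c -> c <= b -> region j r (si (ga c))]].
have id_off : off_edge e id by move=> y _ _; near=> z.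
have Q1 b0 (m : M -> pt) j (r : R) d b1 : disk m j r -> j 0 = ga b0 ->
    (forall p : pt, `|p| < r -> f (j p) = f (ga b0) + cY p) ->
    (forall s, `|s - b0| < d -> region j r (ga s)) ->
    (forall c, a <= c -> c <= b1 -> `|c - b0| < d) -> Q b1.
  move=> D j0 fj hr hd; exists id; split=> //; first exact: vertex_trivial_id.
  by exists (ga b0), m, j, r; split=> // c ac cb; apply: hr; exact: hd.
have regd b0 (m : M -> pt) j (r : R) : disk m j r -> j 0 = ga b0 ->
    exists2 d : R, 0 < d & forall s, `|s - b0| < d -> region j r (ga s).
  move=> D j0; have rx : region j r (ga b0) by exists 0 => //=; rewrite normr0; exact: disk_gt0 D.
  by apply: near_R; apply: (cga b0); exact: (region_near D rx).
(* The end of the arc is pulled back within one box at a time. *)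
rewrite -/(Q b); apply: (@connected_near_ind R setT Q a b) => //.
- by apply/connected_intervalP.
- have [m [j [r [D j0 fj]]]] := edge_box he (ega a); have [d d0 hr] := regd a m j r D j0.
  apply: (Q1 a m j r d) => // c ac ca.
  by have -> : c = a; [apply/le_anti; rewrite ac ca|rewrite subrr normr0].
move=> b0 _; have [m [j [r [D j0 fj]]]] := edge_box he (ega b0).
have [d d0 hr] := regd b0 m j r D j0; have r0 := disk_gt0 D.
have n0 : `|0 : pt| < r by rewrite normr0.
(* Within radius [rho] all points of [V] are [ga s] with s close to [b0], so a map supported there
   fixes [ga a] when [a] is farther away. *)
have [rho [rho0 rr hrho]] : exists rho : R, [/\ 0 < rho, rho < r & forall p : pt, `|p| < rho -> V (j p) ->
    exists2 s, `|s - b0| < d & ga s = j p].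
  have N : \forall p \near (0 : pt), V (j p) -> exists2 s, `|s - b0| < d & ga s = j p.
    have N0 : \forall y \near j 0, V y -> exists2 s, `|s - b0| < d & ga s = y by rewrite j0; exact: oga.
    exact: (disk_j_continuous D n0 N0).
  have /near_norm[e' e0 he'] := N; exists (Num.min e' (r / 2)).
  rewrite lt_min e0 gt_min divr_gt0//; split=> //; first by rewrite [r / 2 < r](_ : _ = true) ?orbT//; lra.
  by move=> p; rewrite lt_min => /andP[pe _]; apply: he'; rewrite subr0.
have [eps eps0 heps] := push rho0.
have rx : region j r (ga b0) by exists 0.
have N : \forall b1 \near b0, `|b1 - b0| < d /\ `|m (ga b1)| < eps.
  apply: filterI.
    by apply/nbhs_normP; exists d => // s /=; rewrite distrC.
  have c : {for b0, continuous (fun b1 => `|m (ga b1)|)}.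
    apply: continuous_comp; last exact: norm_continuous.
    by apply: (continuous_comp (g := m)); [exact: cga|exact: disk_m_continuous D _ rx].
  apply: (c (fun a => a < eps)); apply: lt_nbhsl.
  by rewrite -j0 (disk_mK D n0) normr0.
suff step b1 b2 : `|b1 - b0| < d -> `|m (ga b1)| < eps -> `|b2 - b0| < d -> `|m (ga b2)| < eps ->
    Q b1 -> Q b2.
  have [N1 N2] := nbhs_singleton N.
  by apply: filterS N => b1 [h1 h2] _; split; exact: step.
move=> b1d b1e b2d b2e Qb1; have [b21|b12] := leP b2 b1.
  have [si [Tsi osi [x [m' [j' [r' [ex D' j'0 fj' hc]]]]]]] := Qb1.
  exists si; split=> //; exists x, m', j', r'; split=> // c ac cb; apply: hc => //; exact: le_trans b21.
(* If [a] is close to [b0], the whole piece lies in the box and the identity will do. Otherwise the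
   push fixes [ga a], moves [ga b2] to [ga b1] and, being increasing along the edge, sends the piece
   over [a, b2] into the one over [a, b1]. *)
have [ad|ad] := ltP `|a - b0| d.
  apply: (Q1 b0 m j r d) => // c ac cb; move: ad b2d; rewrite !ltr_norml => /andP[? ?] /andP[? ?].
  by apply/andP; split; lra.
have [ab2|ab2] := leP a b2; last first.
  by apply: (Q1 b0 m j r d) => // c ac cb; move: (lt_le_trans ab2 (le_trans ac cb)); rewrite ltxx.
have ab1 : a < b1.
  move: ad b1d b2d; rewrite !ltr_norml leNgt ltr_norml => h /andP[h1 h2] /andP[h3 h4].
  rewrite ltNge; apply/negP => h5; move/negP : h; apply; apply/andP; split; lra.
have [si [Tsi osi [x [m' [j' [r' [ex D' j'0 fj' hc]]]]]]] := Qb1.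
have axis s : `|s - b0| < d -> ga s = j (mk (cX (m (ga s))) 0) /\ `|mk (cX (m (ga s))) 0 : pt| < r.
  move=> sd; have [jm mr] := disk_jm D (hr s sd).
  have Y0 : cY (m (ga s)) = 0 by apply/(box_level (Vga b0) D j0 fj mr); rewrite jm; exact: Vga.
  by rewrite -Y0 mkK jm.
have [K [pK K1 KY Kt]] := heps (cX (m (ga b2))) (cX (m (ga b1))) (le_lt_trans (cX_le _) b2e) (le_lt_trans (cX_le _) b1e).
have [Tt ot] := box_trivial (Vga b0) D j0 fj he (ega b0) pK K1 rr KY.
set ta := lift m j r K in Tt ot.
have ta2 : ta (ga b2) = ga b1.
  have [e2 n2] := axis b2 b2d; have [e1 n1] := axis b1 b1d.
  by rewrite e2 /ta (lift_in D K n2) Kt -e1.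
have taa : ta (ga a) = ga a.
  apply: (lift_fix D K1) => -[p pr yp]; have Vp : V (j p) by rewrite yp.
  have [s sd] := hrho p pr Vp; rewrite yp => /iga sa.
  by move: ad; rewrite -sa leNgt sd.
have [te to _] := trivial_fixes hf hv hst hH hC Tt.1.
have tag c : exists c', ta (ga c) = ga c'.
  have : e (ta (ga c)) by rewrite -(te e he); exists (ga c).
  by rewrite -gE => -[c' _ <-]; exists c'.
exists (si \o ta); split; [exact: vertex_trivial_comp| |].
  by move=> y Vy ny; apply: filterS2 (osi y Vy ny) (ot y Vy ny) => z sz /= ->.
exists x, m', j', r'; split=> // c ac cb2 /=; have [c' cc'] := tag c; rewrite cc'.
have incr := to e he ga cga iga gE; apply: hc.
  have [<-|ca] := eqVneq a c'; first by [].
  have [ac'|ac'] := eqVneq a c; first by move: cc'; rewrite -ac' taa => /iga e'; rewrite e' lexx.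
  by apply/ltW/(incr a c a c' taa cc'); rewrite lt_neqAle ac'.
have [cb|cb] := eqVneq c b2; first by move: cc'; rewrite cb ta2 => /iga ->.
by apply/ltW/(incr c b2 c' b1 cc' ta2); rewrite lt_neqAle cb.
Unshelve. all: by end_near.
Qed.

(** The ends of the edge leave a neighbourhood of each of its points and can accumulate only at
    vertices, where elements of [T1] are the identity; compactness of [V] gives the bound. *)
Lemma trivial_support e (ga : R -> M) k : Xi1 v e -> arc V ga -> range ga = e -> T1 k ->
  exists N : R, forall t, N < `|t| -> \forall z \near ga t, k z = z.
Proof.
move=> he aga gE [_ nk]; have [_ iga Vga oga] := aga.
suff [N hN] : exists N : R, forall t, V (ga t) -> N < `|t| -> \forall z \near ga t, k z = z.
  by exists N => t; exact: hN.
apply: (@compact_ind _ V (fun B => exists N : R, forall t, B (ga t) -> N < `|t| -> \forall z \near ga t, k z = z)).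
- apply: compact_M; exact: comp_closed.
- by exists 0.
- move=> B C [N hN] [N' hN']; exists (Num.max N N') => t; rewrite gt_max => -[h|h] /andP[? ?].
    exact: hN.
  exact: hN'.
- by move=> B C BC [N hN]; exists N => t /BC; exact: hN.
move=> y Vy; have [cy|ry] := pselect (critical f y).
  have nky := nk y Vy cy.
  exists [set z | \forall w \near z, k w = w]; first exact: near_join nky.
  by exists 0.
have [ey|ney] := pselect (e y); last first.
  have Ey := edge_at (conj Vy ry); have ce : connected_component E y y by exact: connected_component_refl.
  exists [set z | V z -> connected_component E y z]; first exact: (edge_near hf hv Ey ce).
  exists 0 => t /(_ (Vga t)) cz; exfalso; apply: ney.
  have eg : e (ga t) by rewrite -gE; exists t.
  by have [_ ->] := edge_eq he eg; have [_ <-] := edge_eq Ey cz.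
move: ey; rewrite -gE => -[t0 _ ty].
exists [set z | V z -> exists2 s, `|s - t0| < 1 & ga s = z]; first by rewrite -ty; exact: oga.
exists (`|t0| + 1) => t /(_ (Vga t))[s st0 /iga st1]; rewrite -st1 => h.
by have := ler_normD (s - t0) t0; rewrite subrK; move: st0 h; move: `|s - t0| `|s| `|t0| => X Y Z; lra.
Qed.

Lemma edge_extension e k : Xi1 v e -> T1 k -> exists K, [/\ T1 K,
  forall y, e y -> \forall z \near y, K z = k z & off_edge e K].
Proof.
move=> he Tk; have [ga aga gE] := edge_parametrization hf hv he; have [cga _ _ _] := aga.
have ega t : e (ga t) by rewrite -gE; exists t.
have [N hN] := trivial_support he aga gE Tk.
have [si [Tsi osi [x [m [j [r [ex D j0 fj hc]]]]]]] := compress (- N) N he aga gE.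
have [so [Tso sK Ks]] := vertex_trivial_inv Tsi.
have cont h : T1 h -> continuous h by move=> [[[/stab_continuous]]].
have pres h y : T1 h -> e y -> e (h y).
  by move=> [Th _] ey; have [he' _ _] := trivial_fixes hf hv hst hH hC Th; rewrite -(he' e he); exists y.
(* Conjugation by [si] moves the support of [k] on the edge into a single box. *)
pose S := (si \o ga) @` `[- N, N].
have Tk2 : T1 (si \o k \o so) by apply: vertex_trivial_comp => //; exact: vertex_trivial_comp.
have [||||K [TK eK oK]] := strip (edge_sub he ex).1 D j0 fj he ex Tk2 (S := S).
- apply: continuous_compact; last exact: segment_compact.
  by apply: continuous_subspaceT => t; apply: continuous_comp; [exact: cga|exact: cont].
- by move=> _ [t _ <-]; apply: pres.
- by move=> _ [t + <-]; rewrite /= in_itv /= => /andP[]; exact: hc.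
- move=> y ey nS; have : e (so y) by exact: pres.
  rewrite -gE => -[t _ ty]; have tN : N < `|t|.
    rewrite ltNge ler_norml; apply/negP => tN; apply: nS; exists t; first by rewrite /= in_itv.
    by rewrite /= ty Ks.
  have n1 : \forall z \near so y, k z = z by rewrite -ty; exact: hN.
  have n2 : \forall z \near y, k (so z) = so z := cont so Tso y _ n1.
  by apply: filterS n2 => z /= ->; rewrite Ks.
exists (so \o K \o si); split.
- by apply: vertex_trivial_comp => //; exact: vertex_trivial_comp.
- move=> y ey; have n1 := eK (si y) (pres _ _ Tsi ey).
  have n2 : \forall z \near y, K (si z) = (si \o k \o so) (si z) := cont si Tsi y _ n1.
  by apply: filterS n2 => z /= ->; rewrite sK sK.
- move=> y Vy ny; apply: filterS2 (osi y Vy ny) (oK y Vy ny) => z s1 k1 /=.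
  by rewrite s1 k1 -{1}s1 sK.
Qed.

End EdgeGroup.
Lemma near_preimage (X Y : topologicalType) (k : X -> Y) (x : X) (y : Y) (Q : set Y) :
  continuous k -> k x = y -> (\forall z \near y, Q z) -> \forall w \near x, Q (k w).
Proof. by move=> ck <- nQ; exact: (ck x). Qed.

Lemma near_finite (X : topologicalType) (I : choiceType) (B : set I) (x : X) (Q : I -> set X) : finite_set B ->
  (forall i, B i -> \forall y \near x, Q i y) -> \forall y \near x, forall i, B i -> Q i y.
Proof.
move=> /finite_seqP[t ->]; elim: t => [|i t IH] nQ; first by near=> y.
have N1 := nQ i (mem_head i t).
have N2 : \forall y \near x, forall k, k \in t -> Q k y.
  by apply: IH => k kt; apply: nQ; rewrite /= inE kt orbT.
apply: filterS2 N1 N2 => y Qi Qt k; rewrite /= inE => /orP[/eqP->//|]; exact: Qt.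
Unshelve. all: by end_near.
Qed.

(** * Gluing over the faces *)

Section Gluing.
Context {R : realType} {M : compact_surface R} {f : M -> R} (hf : classF f).
Local Notation pt := 'rV[R]_2.
Implicit Types (x y z w : M) (h k : M -> M) (A e : set M).
Context {v : reeb f} (hv : vertex v).
Let V := component v.
Context {st : set (reeb f)} (hst : star v st).
Context {H : set (st -> st)} (hH : subgroup_of (local_stab v st) H).
Context (hC : conditionC v (phi_preimage v H)).
Implicit Types (a b : st -> st).
Let Hs := phi_preimage v H.
Local Notation T := (star_trivial (v := v) (st := st)).
Local Notation face := (connected_component (~` V)).

Lemma Hs_continuous h : Hs h -> continuous h.
Proof. by move=> [[/stab_continuous]]. Qed.

Lemma phi_cancel h k : Hs h -> Hs k -> cancel h k -> phi st k \o phi st h = id.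
Proof.
move=> [hh _] [hk _] hK; rewrite -(phi_comp hv hst hk hh) -(phi_id hv hst); congr phi; exact/funext.
Qed.

Lemma phi_compHs h k : Hs h -> Hs k -> phi st (h \o k) = phi st h \o phi st k.
Proof. by move=> [hh _] [hk _]; exact: (phi_comp hv hst). Qed.

Lemma same_phi h k : Hs h -> Hs k -> phi st h = phi st k -> exists2 t, T t & h = k \o t.
Proof.
move=> hh hk e; have [k' [hk' kK k'K]] := inverse_Hs hv hst hH hk.
exists (k' \o h); last by apply/funext => x /=; rewrite k'K.
split; first by apply: stabc_comp; [case: hk'|case: hh].
by rewrite phi_compHs// e; exact: phi_cancel.
Qed.

Lemma phi_Hs h : Hs h -> H (phi st h). Proof. by case. Qed.

Lemma subgroup_comp a b : H a -> H b -> H (a \o b).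
Proof. by case: hH => _ _ h _; exact: h. Qed.

Section Orbits.
Context (Y : set (set M)) (YH : forall h A, Hs h -> Y A -> Y (h @` A)).
Context (YT : forall h A, T h -> Y A -> h @` A = A).
Context (YR : forall h A, Hs h -> Y A -> h @` A = A -> T h).
Context (g : (st -> st) -> M -> M) (gH : forall a, H a -> Hs (g a)).
Context (gphi : forall a, H a -> phi st (g a) = a).

Lemma same_image h k A : Hs h -> Hs k -> phi st h = phi st k -> Y A -> h @` A = k @` A.
Proof. by move=> hh hk e YA; have [t Tt ->] := same_phi hh hk e; rewrite -image_comp (YT Tt YA). Qed.

Lemma image_phi h k A : Hs h -> Hs k -> Y A -> h @` A = k @` A -> phi st h = phi st k.
Proof.
move=> hh hk YA e; have [k' [hk' kK k'K]] := inverse_Hs hv hst hH hk.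
have : T (k' \o h).
  apply: (YR (A := A)) => //; first exact: (subgroup_Hs hv hst hH).
  by rewrite -image_comp e image_comp (_ : k' \o k = id) ?image_id//; exact/funext.
move=> [_ p]; rewrite (_ : h = k \o (k' \o h)); last by apply/funext => x /=; rewrite k'K.
rewrite phi_compHs ?p//; exact: (subgroup_Hs hv hst hH).
Qed.

Definition orbit A : set (set M) := [set h @` A | h in Hs].

Lemma orbit_image h A : Hs h -> orbit (h @` A) = orbit A.
Proof.
move=> hh; have [k [hk hK kh]] := inverse_Hs hv hst hH hh.
apply/seteqP; split=> [_ [h' hh' <-]|_ [h' hh' <-]].
  by exists (h' \o h); [exact: (subgroup_Hs hv hst hH)|rewrite image_comp].
exists (h' \o k); first exact: (subgroup_Hs hv hst hH).
by rewrite image_comp -compA (_ : k \o h = id)//; exact/funext.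
Qed.

Definition orbit_rep A : set M := xget set0 (orbit A).

Lemma orbit_repP A : Y A -> Y (orbit_rep A) /\ exists2 k, Hs k & k @` orbit_rep A = A.
Proof.
move=> YA; have : orbit A (orbit_rep A).
  apply: (@xgetPex _ set0); exists (id @` A); exists id => //.
  by apply: trivial_Hs => //; exact: trivial_id.
move=> [h hh <-]; split; first exact: YH.
have [k [hk hK kh]] := inverse_Hs hv hst hH hh; exists k => //.
by rewrite image_comp (_ : k \o h = id) ?image_id//; exact/funext.
Qed.

(** Since [H] acts freely on [Y], [al A] is the only element carrying [rep A] to [A]; this
    uniqueness gives the equivariance of [al]. *)
Lemma orbit_elements : exists (rep : set M -> set M) (al : set M -> st -> st),
  (forall A, Y A -> [/\ Y (rep A), H (al A) & g (al A) @` rep A = A]) /\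
  (forall h A, Hs h -> Y A -> rep (h @` A) = rep A /\ al (h @` A) = phi st h \o al A).
Proof.
have ex A : exists a, Y A -> H a /\ g a @` orbit_rep A = A.
  have [YA|] := pselect (Y A); last by exists id.
  have [Yr [k hk kr]] := orbit_repP YA; have Hk := phi_Hs hk.
  exists (phi st k) => _; split=> //; rewrite -[RHS]kr; apply: same_image => //; [exact: gH|exact: gphi].
have [al hal] := choice ex; exists orbit_rep, al; split=> [A YA|h A hh YA].
  by have [Yr _] := orbit_repP YA; have [] := hal A YA.
have e : orbit_rep (h @` A) = orbit_rep A by rewrite /orbit_rep orbit_image.
split=> //; have [Ha Ea] := hal A YA; have [Hb Eb] := hal _ (YH hh YA).
have [Yr _] := orbit_repP YA; rewrite e in Eb.
rewrite -[LHS](gphi Hb) -(gphi Ha) -(phi_compHs hh (gH Ha)).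
apply: (image_phi (A := orbit_rep A)) => //; first exact: gH.
  exact: (subgroup_Hs hv hst hH hh (gH Ha)).
by rewrite Eb -image_comp Ea.
Qed.

End Orbits.

Context (m : M -> M -> pt) (j : M -> pt -> M) (r : M -> R) (n : M -> nat) (P q : M -> pt -> R).
Context (vm : forall x, V x -> critical f x -> vmodel f x (m x) (j x) (r x) (n x) (P x) (q x)).
Local Notation vertex_linear := (vertex_linear (v := v) (H := H) j P q).

Lemma Hs_Xi1 h A : Hs h -> Xi1 v A -> Xi1 v (h @` A).
Proof. by move=> [hh _]; exact: stabc_Xi1. Qed.

Lemma Hs_Xi2 h A : Hs h -> Xi2 v A -> Xi2 v (h @` A).
Proof.
move=> [hh _] [z Vz ->]; rewrite (stabc_face hh Vz); exists (h z) => //.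
by move=> Vhz; apply: Vz; exact: (stabc_V z hh).1.
Qed.

Lemma T_Xi1 h A : T h -> Xi1 v A -> h @` A = A.
Proof. by move=> Th; have [+ _ _] := trivial_fixes hf hv hst hH hC Th; apply. Qed.

Lemma rigid_Xi2 h A : Hs h -> Xi2 v A -> h @` A = A -> T h.
Proof. by move=> hh [z Vz ->] e; have [] := face_rigid hf hv hst hC hh Vz e. Qed.

Section Edges.
Context (g : (st -> st) -> M -> M) (gL : forall a, H a -> vertex_linear (g a)).
Context (gphi : forall a, H a -> phi st (g a) = a).

Let gH a : H a -> Hs (g a). Proof. by case/gL. Qed.
Context (rep : set M -> set M) (al : set M -> st -> st).
Context (elt1 : forall A, Xi1 v A -> [/\ Xi1 v (rep A), H (al A) & g (al A) @` rep A = A]).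
Context (img1 : forall h A, Hs h -> Xi1 v A ->
  rep (h @` A) = rep A /\ al (h @` A) = phi st h \o al A).

(** When each edge e is identified with [rep e] through [g (al e)], such an [h] only changes the
    label [al e] into [phi st h \o al e]. So its germ along the edges is determined by [phi st h],
    and these germs compose. *)
Definition edge_linear h := vertex_linear h /\ forall e, Xi1 v e -> forall y, rep e y ->
  \forall z \near y, h (g (al e) z) = g (phi st h \o al e) z.

Lemma edge_linear_comp h k : edge_linear h -> edge_linear k -> edge_linear (h \o k).
Proof.
move=> [lh eh] [lk ek]; split; first exact: (vertex_linear_comp hf hv hst hH).
move=> e he y ey; have [re ae] := img1 lk.1 he.
have n1 : \forall z \near y, h (g (al (k @` e)) z) = g (phi st h \o al (k @` e)) z.
  by apply: eh; [exact: Hs_Xi1 lk.1 he|rewrite re].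
rewrite ae in n1; apply: filterS2 n1 (ek e he y ey) => z /= e1 ->.
by rewrite e1 phi_compHs//; [case: lh|case: lk].
Qed.

Lemma edge_linear_eq h k y : edge_linear h -> edge_linear k -> phi st h = phi st k -> V y ->
  \forall z \near y, h z = k z.
Proof.
move=> [lh eh] [lk ek] pe Vy; have [cy|ry] := pselect (critical f y).
  have [k' [lk' kK k'K]] := vertex_linear_inv hf hv hst hH lk.
  have lt : vertex_linear (k' \o h) by exact: (vertex_linear_comp hf hv hst hH).
  have Tt : T (k' \o h).
    have [t Tt ht] := same_phi lh.1 lk.1 pe; rewrite (_ : k' \o h = t)//.
    by apply/funext => x; rewrite ht /= kK.
  have := linear_rigid hf hv hst hH hC vm lt Tt Vy cy.
  by apply: filterS => z /= e; rewrite -[h z]k'K e.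
have Ee := edge_at (conj Vy ry); set e := connected_component _ y in Ee.
have ey : e y by apply: connected_component_refl.
have [_ Ha ga] := elt1 Ee; have hga := gH Ha.
have [G [hG gK Gg]] := inverse_Hs hv hst hH hga.
have : (g (al e) @` rep e) y by rewrite ga.
move=> [y0 ey0 gy0]; have Gy : G y = y0 by rewrite -gy0 gK.
have N : \forall z \near y0, h (g (al e) z) = k (g (al e) z).
  by apply: filterS2 (eh e Ee y0 ey0) (ek e Ee y0 ey0) => z -> ->; rewrite pe.
have N' : \forall z \near y, h (g (al e) (G z)) = k (g (al e) (G z)).
  exact: (near_preimage (Hs_continuous hG) Gy N).
by apply: filterS N' => z; rewrite Gg.
Qed.

Lemma edge_correction b : H b -> exists2 h, edge_linear h & phi st h = b.
Proof.
move=> Hb; have [gb' [lgb' gbK gb'K]] := vertex_linear_inv hf hv hst hH (gL Hb).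
have phi_inv : phi st gb' \o b = id.
  by rewrite -{1}(gphi Hb); apply: phi_cancel => //; [exact: gH|case: lgb'].
have ex A : exists K, Xi1 v A -> [/\ vertex_trivial (v := v) (st := st) K, off_edge (v := v) A K &
    forall y, rep A y -> \forall z \near y, g b (K (g (al A) z)) = g (b \o al A) z].
  have [hA|] := pselect (Xi1 v A); last by exists id.
  have [_ Ha ga] := elt1 hA.
  have [G [lG gK Gg]] := vertex_linear_inv hf hv hst hH (gL Ha).
  have Hba := subgroup_comp Hb Ha.
  have lc := vertex_linear_comp hf hv hst hH (vertex_linear_comp hf hv hst hH lgb' (gL Hba)) lG.
  (* On the edge [A] the lift [g b] is off by [k], which is g(b)^-1 g(b a) g(a)^-1 for a = [al A].
     It lies in the kernel and, being linear at the vertices, is the identity near them; so it can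
     be extended from [A] alone. *)
  set k := (gb' \o _) \o G in lc.
  have Tk : T k.
    have hk := lc.1; split; first by case: hk.
    have e : phi st k \o al A = al A.
      rewrite -{1}(gphi Ha) -phi_compHs//; last exact: gH.
      rewrite (_ : k \o _ = gb' \o g (b \o al A)); last by apply/funext => z; rewrite /k /= gK.
      by rewrite (phi_compHs lgb'.1 (gH Hba)) (gphi Hba) compA phi_inv.
    have aG : al A \o phi st G = id.
      by rewrite -{1}(gphi Ha); apply: phi_cancel => //; [case: lG|exact: gH].
    by rewrite -[LHS]/(phi st k \o id) -aG compA e.
  have T1k : vertex_trivial (v := v) (st := st) k.
    by split=> // x Vx cx; exact: (linear_rigid hf hv hst hH hC vm lc Tk Vx cx).
  have [K [TK eK oK]] := edge_extension hf hv hst hH hC hA T1k.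
  exists K => _; split=> // y ry.
  have egy : A (g (al A) y) by rewrite -[A in A _]ga; exists y.
  have N : \forall z \near y, K (g (al A) z) = k (g (al A) z).
    exact: (near_preimage (Hs_continuous (gH Ha)) erefl (eK _ egy)).
  by apply: filterS N => z ->; rewrite /k /= gb'K gK.
have [KK hKK] := choice ex.
have [K TK eK] : exists2 K, vertex_trivial (v := v) (st := st) K &
    forall A, Xi1 v A -> forall y, A y -> \forall z \near y, K z = KK A z.
  apply: (fragments (Y := Xi1 v)) => //.
  - exact: finite_edges.
  - exact: vertex_trivial_id.
  - by move=> h k; exact: (vertex_trivial_comp hv hst).
  - by move=> h [[[/stab_continuous]]].
  - by move=> h A [Th _] hA; rewrite T_Xi1.
  - by move=> A /hKK[].
  - move=> A B hA hB AB x Bx; have [_ oA _] := hKK A hA; apply: oA; first by have [] := edge_sub hB Bx.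
    move=> Ax; apply: AB; have [_ ->] := edge_eq hA Ax.
    by have [_ ->] := edge_eq hB Bx.
have [TK0 nK] := TK; have HK := trivial_Hs hH TK0.
have pK : phi st (g b \o K) = b.
  by rewrite phi_compHs ?gphi ?(proj2 TK0)//; exact: gH.
exists (g b \o K) => //; split; last first.
  move=> e he y ry; have [_ _ /(_ y ry) N] := hKK e he; rewrite pK.
  have [_ Ha ga] := elt1 he.
  have egy : e (g (al e) y) by rewrite -[e in e _]ga; exists y.
  have N' : \forall z \near y, K (g (al e) z) = KK e (g (al e) z).
    exact: (near_preimage (Hs_continuous (gH Ha)) erefl (eK e he _ egy)).
  apply: filterS2 N N' => z e1 e2; by rewrite /= e2 e1.
split; first exact: (subgroup_Hs hv hst hH (gH Hb) HK).
move=> x Vx cx; have [_ /(_ x Vx cx) lx] := gL Hb.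
by apply: (linear_at_eq vm Vx cx _ lx); apply: filterS (nK x Vx cx) => y /= ->.
Qed.

End Edges.

Lemma face_near z : ~ V z -> \forall w \near z, face w = face z.
Proof.
move=> Vz; have [c Ac cz] := chart_at z.
have nV : nbhs z (~` V) by apply: open_near => //; apply: closed_openC; exact: comp_closed.
have [k [d [d0 kP kK ck]]] := chart_inverse Ac cz nV.
have nz : \forall w \near z, `|cmap c w - cmap c z| < d.
  have nq : \forall p \near cmap c z, `|p - cmap c z| < d.
    by apply/nbhs_normP; exists d => // p /=; rewrite distrC.
  exact: (cmap_continuous Ac cz nq).
apply: filterS2 (cdom_near Ac cz) nz => w cw wd.
(* [chart_inverse] asks for control on both sides of each parameter; [cl] is t on [0, 1] and keeps
   the path inside the chart for all t. *)
pose cl (t : R) : R := `|clamp 1 t|.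
have cl0 t : 0 <= cl t by exact: normr_ge0.
have cl1 t : cl t <= 1 by exact: clamp_le.
have ccl : continuous cl.
  move=> t; apply: dist_continuous => e e0; near=> t'.
  rewrite /cl; apply: le_lt_trans (ler_dist_dist _ _) _; apply: le_lt_trans (clamp_lip 1 t t') _.
  by near: t'; apply/nbhs_normP; exists e.
pose gam t := cmap c z + cl t *: (cmap c w - cmap c z).
have gd t : `|gam t - cmap c z| < d /\ 0 <= cX (gam t).
  split.
    rewrite /gam addrAC subrr add0r normrZ ger0_norm//; apply: le_lt_trans wd.
    by rewrite ler_piMl.
  have z0 := cmap_ge0 Ac cz; have w0 := cmap_ge0 Ac cw; rewrite /gam !cE.
  have -> : cX (cmap c z) + cl t * (cX (cmap c w) - cX (cmap c z)) =
    (1 - cl t) * cX (cmap c z) + cl t * cX (cmap c w) by ring.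
  by rewrite addr_ge0// mulr_ge0// subr_ge0.
have cgam : continuous gam.
  move=> t; apply: cvgD; first exact: cvg_cst.
  by apply: cvgZr_tmp; exact: ccl.
have cl_in t : 0 <= t -> t <= 1 -> cl t = t.
  by move=> t0 t1; rewrite /cl clamp_id ger0_norm.
have := @path_connected R M (~` V) (k \o gam).
have -> : (k \o gam) 0 = z by rewrite /= /gam cl_in// scale0r addr0 kK// subrr normr0.
have -> : (k \o gam) 1 = w by rewrite /= /gam cl_in// scale1r addrC subrK kK.
move=> pc; apply/esym/same_connected_component; apply: pc => t _; last first.
  by have [gt1 gt2] := gd t; have [] := kP _ gt1 gt2.
by apply: ck; [exact: cgam|near=> t'; exact: gd].
Unshelve. all: by end_near.
Qed.

Section Faces.
Context (g G : (st -> st) -> M -> M) (gH : forall a, H a -> Hs (g a)).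
Context (GH : forall a, H a -> [/\ Hs (G a), cancel (g a) (G a) & cancel (G a) (g a)]).
Context (gphi : forall a, H a -> phi st (g a) = a) (B : set (set M)) (psi : set M -> st -> st).
Context (finB : finite_set B) (Bpsi : H `<=` psi @` B).
Context (gV : forall a b, H a -> H b -> forall y, V y -> \forall z \near y, g (a \o b) z = g a (g b z)).
Context (rep : set M -> set M) (al : set M -> st -> st).
Context (elt2 : forall A, Xi2 v A -> [/\ Xi2 v (rep A), H (al A) & g (al A) @` rep A = A]).
Context (img2 : forall h A, Hs h -> Xi2 v A ->
  rep (h @` A) = rep A /\ al (h @` A) = phi st h \o al A).

(** For a = [al A] the face A is the image of [rep A] under g(a), and g(b a) g(a)^-1 carries it to
    the face labelled b a. In a composite the inner factors therefore cancel exactly on the faces,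
    whatever the lifts; only on [V] is the multiplicativity of [g] used. *)
Definition glue b x := if `[< V x >] then g b x else g (b \o al (face x)) (G (al (face x)) x).

Lemma glueV b x : V x -> glue b x = g b x.
Proof. by rewrite /glue => Vx; case: asboolP. Qed.

Lemma glueF b x : ~ V x -> glue b x = g (b \o al (face x)) (G (al (face x)) x).
Proof. by rewrite /glue => Vx; case: asboolP. Qed.

Lemma Hs_V h x : Hs h -> V (h x) <-> V x.
Proof. by move=> [hh _]; exact: stabc_V. Qed.

Lemma face_Xi2 x : ~ V x -> Xi2 v (face x).
Proof. by exists x. Qed.

Lemma face_H x : ~ V x -> H (al (face x)).
Proof. by move=> /face_Xi2/elt2[]. Qed.

Let hb b x := g (b \o al (face x)) \o G (al (face x)).

Lemma hb_Hs b x : H b -> ~ V x -> Hs (hb b x).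
Proof.
move=> Hb /face_H Ha; have [GHa _ _] := GH Ha.
by apply: (subgroup_Hs hv hst hH) => //; apply: gH; exact: subgroup_comp.
Qed.

Lemma glue_face b x : H b -> ~ V x -> ~ V (glue b x) /\ al (face (glue b x)) = b \o al (face x).
Proof.
move=> Hb Vx; have hh := hb_Hs Hb Vx; rewrite glueF//.
have nV : ~ V (hb b x x) by move=> /(Hs_V x hh).
split=> //; have [_] := img2 hh (face_Xi2 Vx); rewrite (stabc_face hh.1 Vx) => ->.
have Ha := face_H Vx; have [GHa gK _] := GH Ha.
rewrite /hb phi_compHs//; last by apply: gH; exact: subgroup_comp.
rewrite gphi; last exact: subgroup_comp.
have e : phi st (G (al (face x))) \o al (face x) = id.
  by rewrite -{2}(gphi Ha); apply: phi_cancel => //; exact: gH.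
by apply/funext => w; have /(congr1 (fun s => s w)) /= -> := e.
Qed.

Lemma glue_comp a b : H a -> H b -> glue (a \o b) = glue a \o glue b.
Proof.
move=> Ha Hb; apply/funext => x /=; have [Vx|Vx] := pselect (V x).
  have Vgx : V (g b x) by apply/(Hs_V x (gH Hb)).
  by rewrite !glueV ?(nbhs_singleton (gV Ha Hb Vx))//; rewrite glueV.
have [Vy ay] := glue_face Hb Vx; rewrite [RHS]glueF// ay (glueF b Vx) glueF//.
have [_ gK _] := GH (subgroup_comp Hb (face_H Vx)).
by rewrite gK.
Qed.

Lemma glue_id : glue id = id.
Proof.
have Hid : H id by case: hH.
apply/funext => x; have [Vx|Vx] := pselect (V x).
  have [_ /can_inj ig _] := GH Hid; rewrite glueV//; apply: ig.
  by have := nbhs_singleton (gV Hid Hid Vx); rewrite -[id \o id]/id.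
rewrite glueF//; have [_ _ Gg] := GH (face_H Vx); exact: Gg.
Qed.

(** The identity g(b a) g(a)^-1 = g(b) holds near [x] on a neighbourhood that depends on a. The
    finite set [B], which enumerates [H] through [psi], gives one that serves all the faces
    accumulating at [x]. *)
Lemma glue_near b x : H b -> V x -> \forall z \near x, glue b z = g b z.
Proof.
move=> Hb Vx; have N : \forall z \near x, forall a, H a -> g (b \o a) (G a z) = g b z.
  have N : \forall z \near x, forall A, B A -> H (psi A) -> g (b \o psi A) (G (psi A) z) = g b z.
    apply: near_finite => // A _; have [Ha|nH] := pselect (H (psi A)); last by near=> z.
    have [hG gK Gg] := GH Ha; have VG : V (G (psi A) x) by apply/(Hs_V x hG).
    have N : \forall z \near x, g (b \o psi A) (G (psi A) z) = g b (g (psi A) (G (psi A) z)).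
      exact: (near_preimage (Hs_continuous hG) erefl (gV Hb Ha VG)).
    by apply: filterS N => z -> _; rewrite Gg.
  by apply: filterS N => z Nz a Ha; have [A BA Aa] := Bpsi Ha; rewrite -Aa in Ha *; exact: Nz.
apply: filterS N => z Nz; have [Vz|Vz] := pselect (V z); first exact: glueV.
by rewrite glueF// Nz//; exact: face_H.
Unshelve. all: by end_near.
Qed.

Lemma glue_smooth b : H b -> smooth_map (glue b).
Proof.
have sm h : Hs h -> smooth_map h by move=> [[[[]]]].
move=> Hb; apply: smooth_map_local => x; have [Vx|Vx] := pselect (V x).
  by exists (g b); [apply/sm/gH|exact: glue_near].
have nV : \forall z \near x, ~ V z by apply: open_near => //; apply: closed_openC; exact: comp_closed.
exists (hb b x); first exact/sm/hb_Hs.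
by apply: filterS2 nV (face_near Vx) => z Vz e; rewrite glueF// e.
Qed.

(** Multiplicativity provides the inverse [glue b'], smooth like [glue b] itself. The class of
    [glue b] is that of [g b] because the two maps agree on [V], hence on every edge, and
    [star_fixed] applies to their quotient. *)
Lemma glue_Hs b : H b -> Hs (glue b) /\ phi st (glue b) = b.
Proof.
move=> Hb; have [b' [Hb' bK b'K]] : exists b', [/\ H b', cancel b b' & cancel b' b].
  by case: hH => _ _ _; apply.
have eq1 a a' : H a -> H a' -> cancel a' a -> cancel (glue a') (glue a).
  move=> Ha Ha' aK x; have /(congr1 (fun s : M -> M => s x)) /= := glue_comp Ha Ha'.
  by rewrite (_ : a \o a' = id) ?glue_id//; exact/funext.
have fs x : f (glue b x) = f x.
  have fH h : Hs h -> f (h x) = f x by move=> [[sh _] _]; exact: (stab_f _ sh).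
  have [Vx|Vx] := pselect (V x); first by rewrite glueV//; exact/fH/gH.
  by rewrite glueF//; exact: (fH (hb b x) (hb_Hs Hb Vx)).
have hs : stabilizer_comp v (glue b).
  split; first split; [|exact/funext|].
    by apply: (diffeo_of (k := glue b')); [exact: glue_smooth|exact: glue_smooth|exact: eq1|exact: eq1].
  apply/seteqP; split=> [_ [x Vx <-]|x Vx]; first by rewrite glueV//; exact: (Hs_V x (gH Hb)).2.
  by exists (glue b' x); [rewrite glueV//; exact: (Hs_V x (gH Hb')).2|exact: eq1].
suff e : phi st (glue b) = b by split=> //; split=> //; rewrite e.
have [[hG HG] gK Gg] := GH Hb; have [hg _] := gH Hb.
have hc : stabilizer_comp v (G b \o glue b) by exact: stabc_comp.
have pc : phi st (G b \o glue b) = id.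
  apply: (star_fixed hf hv) => // e he; have [y ey] := edge_nonempty he.
  have [Vy _] := edge_sub he ey.
  by apply: (edge_fixed hf hv hc he ey); rewrite /= glueV// gK.
have -> : glue b = g b \o (G b \o glue b) by apply/funext => x /=; rewrite Gg.
by rewrite (phi_comp hv hst)// pc gphi.
Qed.

End Faces.

Lemma local_lift a : H a -> exists2 h, Hs h & phi st h = a.
Proof.
move=> Ha; have : local_stab v st a by case: hH => + _ _ _; apply.
move=> [_ [[h sh <-] hv'] ha]; have pa : phi st h = a by [].
exists h => //; split; last by rewrite pa.
have Vx0 : V (reeb_repr v) := reeb_reprK v.
have Vhx0 : V (h (reeb_repr v)) by rewrite /V /component /= -(rho_proj _ sh) reeb_reprK.
have Vh x : V (h x) <-> V x.
  have e := stab_lc_iff (reeb_repr v) x sh.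
  by split=> [/(compP _ Vhx0)/e/(compP _ Vx0)|/(compP _ Vx0)/e/(compP _ Vhx0)].
split=> //; have [k [_ hk kh]] := stab_inv sh.
apply/seteqP; split=> [_ [x Vx <-]|x Vx]; first exact/Vh.
by exists (k x) => //; apply/Vh; rewrite kh.
Qed.

Lemma section_of_edges e0 : Xi1 v e0 -> exists s : (st -> st) -> (M -> M),
  [/\ forall a, H a -> Hs (s a), forall a b, H a -> H b -> s (a \o b) = s a \o s b &
      forall a, H a -> phi st (s a) = a].
Proof.
move=> he0; have exg a : exists h, H a -> vertex_linear h /\ phi st h = a.
  have [Ha|] := pselect (H a); last by exists id.
  have [h hh ph] := local_lift Ha; have [k Tk lk] := linear_correction hf hv hst hH hC vm hh.
  exists (h \o k) => _; split=> //; rewrite phi_compHs//; last exact: trivial_Hs.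
  by rewrite ph (proj2 Tk).
have [g0 hg0] := choice exg.
have g0L a : H a -> vertex_linear (g0 a) by move=> /hg0[].
have g0H a : H a -> Hs (g0 a) by move=> /hg0[[]].
have g0phi a : H a -> phi st (g0 a) = a by move=> /hg0[].
have rig1 h A := @edge_rigid _ _ _ hf _ hv _ hst _ hC h A.
have [rep [al [elt1 img1]]] := orbit_elements Hs_Xi1 T_Xi1 rig1 g0H g0phi.
have exh a : exists h, H a -> edge_linear g0 rep al h /\ phi st h = a.
  have [Ha|] := pselect (H a); last by exists id.
  by have [h lh ph] := edge_correction g0L g0phi elt1 Ha; exists h.
have [g hg] := choice exh.
have gL a : H a -> edge_linear g0 rep al (g a) by move=> /hg[].
have gH a : H a -> Hs (g a) by move=> /gL[[]].
have gphi a : H a -> phi st (g a) = a by move=> /hg[].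
have exG a : exists k, H a -> [/\ Hs k, cancel (g a) k & cancel k (g a)].
  have [Ha|] := pselect (H a); last by exists id.
  by have [k hk] := inverse_Hs hv hst hH (gH a Ha); exists k.
have [G GH] := choice exG.
have gV a b : H a -> H b -> forall y, V y -> \forall z \near y, g (a \o b) z = g a (g b z).
  move=> Ha Hb y Vy; have Hab := subgroup_comp Ha Hb.
  have pe : phi st (g (a \o b)) = phi st (g a \o g b).
    by rewrite (phi_compHs (gH _ Ha) (gH _ Hb)) (gphi _ Hab) (gphi _ Ha) (gphi _ Hb).
  have lc := edge_linear_comp img1 (gL _ Ha) (gL _ Hb).
  exact: (edge_linear_eq g0L elt1 (gL _ Hab) lc pe Vy).
(* Since [H] acts freely on the edges, a |-> g(a)(e0) is injective into the finite set of edges, and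
   [psi] inverts it. *)
have [B [psi [fB Bpsi]]] : exists (B : set (set M)) (psi : set M -> st -> st), finite_set B /\ H `<=` psi @` B.
  have expsi A : exists a, (exists2 b, H b & g b @` e0 = A) -> H a /\ g a @` e0 = A.
    have [[b Hb bA]|no] := pselect (exists2 b, H b & g b @` e0 = A); first by exists b.
    by exists id => /no.
  have [psi hpsi] := choice expsi.
  exists (Xi1 v), psi; split; first exact: finite_edges.
  move=> a Ha; exists (g a @` e0); first exact: Hs_Xi1 (gH _ Ha) he0.
  have [Hb eb] := hpsi _ (ex_intro2 _ _ a Ha erefl).
  rewrite -(gphi _ Hb) -{2}(gphi _ Ha).
  exact: (image_phi rig1 (gH _ Hb) (gH _ Ha) he0 eb).
have T_Xi2 h A : T h -> Xi2 v A -> h @` A = A.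
  by move=> Th; exact: (trivial_face hf hv hst hH hC Th).
have [rep2 [al2 [elt2 img2]]] := orbit_elements Hs_Xi2 T_Xi2 rigid_Xi2 gH gphi.
have gl := glue_Hs gH GH gphi fB Bpsi gV elt2 img2.
exists (glue g G al2); split=> [a|a b Ha Hb|a]; [by case/gl|exact: (glue_comp gH GH gphi gV elt2 img2)|by case/gl].
Qed.

End Gluing.

Theorem theorem2p2 (R : realType) (M : compact_surface R) (f : M -> R)
    (hf : classF f)
    (v : reeb f) (hv : vertex v)
    (st : set (reeb f)) (hst : star v st) (hspecial : special v st)
    (H : set (st -> st)) (hH : subgroup_of (local_stab v st) H)
    (hC : conditionC v (phi_preimage v H)) :
  exists s : (st -> st) -> (M -> M),
    [/\ forall a, H a -> phi_preimage v H (s a),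
        forall a b, H a -> H b -> s (a \o b) = s a \o s b &
        forall a, H a -> phi st (s a) = a].
Proof.
have [[e he]|no] := pselect (exists e, Xi1 v e); last first.
  (* Without edges the hypothesis of [star_fixed] is void, so every lift is trivial on the star and
     [H] consists of the identity. *)
  exists (fun _ => id); have idE a : H a -> a = id.
    move=> Ha; have [h [hh _] <-] := local_lift hH Ha.
    by apply: (star_fixed hf hv hst hh) => e he; case: no; exists e.
  split=> [a Ha|//|a Ha]; last by rewrite (idE a Ha); exact: (phi_id hv hst).
  by split; [exact: stabc_id|rewrite (phi_id hv hst) -(idE a Ha)].
have ex x : exists d : (M -> 'rV[R]_2) * ('rV[R]_2 -> M) * R * nat * ('rV[R]_2 -> R) * ('rV[R]_2 -> R),
    component v x -> critical f x -> vmodel f x d.1.1.1.1.1 d.1.1.1.1.2 d.1.1.1.2 d.1.1.2 d.1.2 d.2.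
  have [[Vx cx]|nx] := pselect (component v x /\ critical f x).
    have [m [j [r [n [P [q vm]]]]]] := vmodel_exists hf hv he Vx cx.
    by exists (m, j, r, n, P, q).
  (* An arbitrary tuple for points that are not vertices of [V]; the models are only ever used at
     vertices. *)
  by exists (fun=> 0, fun=> x, 0, 0%N, fun=> 0, fun=> 0) => Vx cx; case: nx.
have [d vm] := choice ex.
exact: (section_of_edges hf hv hst hH hC (m := fun x => (d x).1.1.1.1.1) (j := fun x => (d x).1.1.1.1.2)
  (r := fun x => (d x).1.1.1.2) (n := fun x => (d x).1.1.2) (P := fun x => (d x).1.2) (q := fun x => (d x).2) vm he).
Qed.
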